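(* Let $\beta\in(0,1)$, $a\in\mathbf R$. Let two Banach triples $B_2\subset B_1\subset B$ and $B_{2b}\subset B_{1b}\subset B_b$, generated by the operators $D=(D_1,\dots,D_n)$, be dual. Let the operators $A\in\mathcal L(B_2,B)$, $A^b\in\mathcal L(B_{2b},B_b)$ be dual, $A^b=A^*$, in the sense that $(Ab,f)=(b,A^*f)$ for $b\in B_2$, $f\in B_{2b}$, and let $A$ and $A^*$ generate strongly continuous semigroups $e^{At}$ in $B$ and $e^{A^*t}$ in $B_b$, having cores contained in $B_1$ and $B_{1b}$ respectively. Moreover, let $e^{At}$ be smoothing in the 1st order from the right or from the left, and let the operators $[e^{At},D_j]$ extend to uniformly bounded operators $B\to B$ (in $t\in[0,T']$ for any $T'$). Let $B^{con}$ be a Banach space with norm $\|\cdot\|_{con}$, and assume: (1) $H:\mathbf R\times B\times B^n\times B^{con}\to B$ is continuous and, for some constants $L_H,L_H',L_H^{par}$ and all arguments, $$\|H(t,b_0,\dots,b_n,u)-H(t,\tilde b_0,\dots,\tilde b_n,u)\|\le L_H\sum_{j=0}^n\|b_j-\tilde b_j\|\Big(1+L_H'\sum_{j=1}^n\|b_j\|\Big),$$ $$\|H(t,b_0,\dots,b_n,u)-H(t,b_0,\dots,b_n,\tilde u)\|\le L_H^{par}\|u-\tilde u\|_{con}\Big(1+\sum_{j=1}^n\|b_j\|\Big),$$ $$\|H(t,b_0,\dots,b_n,u)\|\le L_H\sum_{j=1}^n\|b_j\|.$$ (2) For $T>a$, $H^b:\mathbf R\times B_b\times(B_b)^n\times C([a,T],B)\to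 B_b$ is continuous, $H^b(t,f_0,\dots,f_n,b(\cdot))$ depends on the curve $b(\cdot)$ only through its future values $b_{\ge t}=\{b(s):s\in[t,T]\}$, and, for some constants $L_H^b,(L_H^b)'$ not depending on $T$ and all arguments, $$\|H^b(t,f_0,\dots,f_n,b(\cdot))-H^b(t,\tilde f_0,\dots,\tilde f_n,b(\cdot))\|_b\le L^b_H\sum_{j=0}^n\|f_j-\tilde f_j\|_b\Big(1+(L_H^b)'\sum_{j=1}^n\|f_j\|_b\Big),$$ $$\|H^b(t,f_0,\dots,f_n,b(\cdot))-H^b(t,f_0,\dots,f_n,\tilde b(\cdot))\|_b\le L^b_H\|b-\tilde b\|_{C([a,T],B)}\Big(1+\sum_{j=0}^n\|f_j\|_b\Big),$$ $$\|H^b(t,f_0,\dots,f_n,b(\cdot))\|_b\le L^b_H\sum_{j=1}^n\|f_j\|_b.$$ (3) $u:\mathbf R\times B_b\times(B_b)^n\to B^{con}$ is continuous and, for some constant $L_u$, $$\|u(t,f_0,\dots,f_n)-u(t,\tilde f_0,\dots,\tilde f_n)\|_{con}\le L_u\sum_{j=0}^n\|f_j-\tilde f_j\|_b.$$ Then for any $Y\in B_1$, $Z\in B_{1b}$ there exists $T_0>a$ such that for all $T\in(a,T_0)$ each of the forward-backward systems (for $t\in[a,T]$) $$\begin{cases}\dot b(t)=Ab(t)+H(t,b(t),Db(t),u(t,f(t),Df(t))),& b(a)=Y,\\ \dot f(t)=-A^*f(t)+H^b(t,f(t),Df(t),b_{\ge t}),& f(T)=Z,\end{cases}$$ $$\begin{cases}D^\beta_{a+*}b(t)=Ab(t)+H(t,b(t),Db(t),u(t,f(t),Df(t))),&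 b(a)=Y,\\ -D^\beta_{T-*}f(t)=-A^*f(t)+H^b(t,f(t),Df(t),b_{\ge t}),& f(T)=Z,\end{cases}$$ has a unique mild solution.
   Context: $\mathcal L(B,C)$ is the Banach space of bounded linear operators $B\to C$ with operator norm $\|\cdot\|_{B\to C}$; $C([a,T],B)$ is the Banach space of continuous functions $[a,T]\to B$ with the sup-norm. A Banach triple is a sequence of embedded Banach spaces $B_2\subset B_1\subset B$ with norms $\|\cdot\|_2\ge\|\cdot\|_1\ge\|\cdot\|$, such that $B_2$ is dense in $B_1$ (topology of $B_1$) and $B_1$ is dense in $B$ (topology of $B$). It is generated by $D=(D_1,\dots,D_n)$, $D_i\in\mathcal L(B_1,B)\cap\mathcal L(B_2,B_1)$, if $$\|b\|_1=\|b\|+\sum_{j=1}^n\|D_jb\|,\qquad \|b\|_2=\|b\|_1+\sum_{i\le j}\|D_iD_jb\|.$$ A pair of Banach spaces $(B,C)$ is a dual pair if each of them is a closed subset of the dual of the other that separates the points of the latter; the duality is a bilinear form $(b,c)$, and being a subset of the dual means $\|b\|_B=\sup_{\|c\|\le1}|(b,c)|$ (and symmetrically for $C$). Two Banach triples $B_2\subset B_1\subset B$ and $B_{2b}\subset B_{1b}\subset B_b$ (norms $\|\cdot\|_{2b},\|\cdot\|_{1b},\|\cdot\|_b$), generated by $D$ and $D^b=(D_1^b,\dots,D_n^b)$ respectively, are dual if $(B,B_b)$ is a dual pair and $(D_jb,f)=-(b,D_j^bf)$ for $b\in B_1$, $f\in B_{1b}$, $j=1,\dots,n$. By abuse of notation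 $D_j$ is written also for $D_j^b$, and $D$ for $D^b$. The semigroup $e^{At}$ is smoothing from the right in the 1st order if for $t>0$ it takes $B$ to $B_1$ and $\|e^{At}\|_{B\to B_1}\le\varkappa t^{-\omega}$, $t\in(0,1]$; it is smoothing from the left in the 1st order if the operators $e^{At}D_j$ defined on $B_1$ extend to bounded operators in $B$ for any $t>0$ and $\|e^{At}D_jb\|\le\varkappa t^{-\omega}\|b\|$ for all $b\in B$, $j=1,\dots,n$, $t\in(0,1]$; here $\varkappa>0$, $\omega\in(0,1)$ are some constants. $[e^{At},D_j]=e^{At}D_j-D_je^{At}$. The Caputo–Dzherbashyan derivatives of order $\beta$ are $$D^{\beta}_{a+*}b(t)=\frac1{\Gamma(-\beta)}\int_0^{t-a}\frac{b(t-z)-b(t)}{z^{1+\beta}}dz+\frac{b(t)-b(a)}{\Gamma(1-\beta)(t-a)^\beta},$$ $$D^{\beta}_{T-*}b(t)=\frac1{\Gamma(-\beta)}\int_0^{T-t}\frac{b(t+z)-b(t)}{z^{1+\beta}}dz+\frac{b(t)-b(T)}{\Gamma(1-\beta)(T-t)^\beta}.$$ For a generator $A$ of a semigroup and $\tau\ge0$, $$E_\beta(A\tau)=\frac1\beta\int_0^\infty e^{A\tau x}x^{-1-1/\beta}G_\beta(1,x^{-1/\beta})\,dx,\qquad E'_\beta(A\tau)=\frac1\beta\int_0^\infty e^{A\tau x}x^{-1/\beta}G_\beta(1,x^{-1/\beta})\,dx,$$ where $G_\beta(t,x)=\frac1\pi\,\mathrm{Re}\int_0^\infty\exp\{ipx-tp^\beta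 e^{i\pi\beta/2}\}\,dp$ ($E_\beta$ being the Mittag-Leffler function). Write $\mathcal H(s)=H(s,b(s),Db(s),u(s,f(s),Df(s)))$ and $\mathcal H^b(s)=H^b(s,f(s),Df(s),b_{\ge s})$. A mild solution is a pair $(b,f)\in C([a,T],B_1)\times C([a,T],B_{1b})$ satisfying for $t\in[a,T]$, for the first system, $$b(t)=e^{A(t-a)}Y+\int_a^te^{A(t-s)}\mathcal H(s)\,ds,\qquad f(t)=e^{A^*(T-t)}Z-\int_t^Te^{A^*(s-t)}\mathcal H^b(s)\,ds,$$ and for the second (fractional) system, $$b(t)=E_\beta(A(t-a)^\beta)Y+\beta\int_a^t(t-s)^{\beta-1}E'_\beta(A(t-s)^\beta)\mathcal H(s)\,ds,$$ $$f(t)=E_\beta(A^*(T-t)^\beta)Z-\beta\int_t^T(s-t)^{\beta-1}E'_\beta(A^*(s-t)^\beta)\mathcal H^b(s)\,ds.$$ *)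

(* Defs.v *)
(* Stdlib reals with Coquelicot; ordinals and finite sums from MathComp.
   A real Banach space is a [CompleteNormedModule R_AbsRing], and an inclusion
   of Banach spaces is an embedding map between them. *)
From Stdlib Require Export Reals.
From mathcomp Require Export ssreflect ssrfun ssrbool eqtype ssrnat fintype bigop.
From Coquelicot Require Export Coquelicot.

Set Implicit Arguments.
Unset Strict Implicit.
Unset Printing Implicit Defensive.

Open Scope R_scope.

Notation Banach := (CompleteNormedModule R_AbsRing).

Definition sum_ord (n : nat) (F : 'I_n -> R) : R :=
  \big[Rplus/0]_(j < n) F j.

Definition dense_embedding (U V : Banach) (i : U -> V) : Prop :=
  is_linear i /\
  (forall x y, i x = i y -> x = y) /\
  (forall x, norm (i x) <= norm x) /\
  (forall (y : V) (eps : R), 0 < eps -> exists x, norm (minus (i x) y) < eps).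

Definition banach_triple (B B1 B2 : Banach) (i1 : B1 -> B) (i2 : B2 -> B1) : Prop :=
  dense_embedding i1 /\ dense_embedding i2.

(* [D' j] is [D j] restricted to [B2], seen as an operator into [B1]. *)
Definition generated_by (n : nat) (B B1 B2 : Banach) (i1 : B1 -> B) (i2 : B2 -> B1)
    (D : 'I_n -> B1 -> B) : Prop :=
  (forall j, is_linear (D j)) /\
  exists D' : 'I_n -> B2 -> B1,
    (forall j, is_linear (D' j)) /\
    (forall j b, i1 (D' j b) = D j (i2 b)) /\
    (forall b : B1, norm b = norm (i1 b) + sum_ord (fun j => norm (D j b))) /\
    (forall b : B2, norm b = norm (i2 b) +
       \big[Rplus/0]_(i < n) \big[Rplus/0]_(j < n | (i <= j)%N) norm (D i (D' j b))).

(* The last two clauses say that [B] is a closed subset of the dual of [C]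
   separating the points of [C]. *)
Definition norming_half (B C : Banach) (p : B -> C -> R) : Prop :=
  (forall b : B, is_lub (fun r => exists c, norm c <= 1 /\ r = Rabs (p b c)) (norm b)) /\
  (forall phi : C -> R, is_linear (U := C) (V := R_NormedModule) phi ->
     (forall eps, 0 < eps -> exists b, forall c, norm c <= 1 -> Rabs (phi c - p b c) <= eps) ->
     exists b, forall c, phi c = p b c) /\
  (forall c : C, (forall b, p b c = 0) -> c = zero).

Definition dual_pair (B C : Banach) (p : B -> C -> R) : Prop :=
  (forall b b' c, p (plus b b') c = p b c + p b' c) /\
  (forall (k : R) b c, p (scal k b) c = k * p b c) /\
  (forall b c c', p b (plus c c') = p b c + p b c') /\
  (forall (k : R) b c, p b (scal k c) = k * p b c) /\
  norming_half p /\ norming_half (fun c b => p b c).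

Definition dual_triples (n : nat) (B B1 Bb B1b : Banach)
    (i1 : B1 -> B) (D : 'I_n -> B1 -> B) (i1b : B1b -> Bb) (Db : 'I_n -> B1b -> Bb)
    (p : B -> Bb -> R) : Prop :=
  dual_pair p /\
  (forall j b f, p (D j b) (i1b f) = - p (i1 b) (Db j f)).

Definition C0_semigroup (B : Banach) (S : R -> B -> B) : Prop :=
  (forall t, 0 <= t -> is_linear (S t)) /\
  (forall x, S 0 x = x) /\
  (forall t s x, 0 <= t -> 0 <= s -> S (t + s) x = S t (S s x)) /\
  (forall x, filterlim (fun t => S t x) (at_right 0) (locally x)).

(* [x] is in the domain of the infinitesimal generator, with value [g]. *)
Definition generator_at (B : Banach) (S : R -> B -> B) (x g : B) : Prop :=
  filterlim (fun h : R => scal (/ h) (minus (S h x) x)) (at_right 0) (locally g).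

Definition is_core (B : Banach) (S : R -> B -> B) (K : B -> Prop) : Prop :=
  K zero /\
  (forall x y, K x -> K y -> K (plus x y)) /\
  (forall (k : R) x, K x -> K (scal k x)) /\
  (forall x, K x -> exists g, generator_at S x g) /\
  (forall x g, generator_at S x g -> forall eps, 0 < eps ->
     exists y h, K y /\ generator_at S y h /\
                 norm (minus y x) < eps /\ norm (minus h g) < eps).

(* An operator [A] with domain [B2] (included in [B] by [e]) generates [S]:
   the infinitesimal generator of [S] is the closure of [A]. *)
Definition generates (B B2 : Banach) (e : B2 -> B) (A : B2 -> B) (S : R -> B -> B) : Prop :=
  C0_semigroup S /\
  (forall b, generator_at S (e b) (A b)) /\
  (forall x g, generator_at S x g -> forall eps, 0 < eps ->
     exists b, norm (minus (e b) x) < eps /\ norm (minus (A b) g) < eps).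

Definition core_in (B B1 : Banach) (i1 : B1 -> B) (S : R -> B -> B) : Prop :=
  exists K : B -> Prop, is_core S K /\ (forall x, K x -> exists b, i1 b = x).

Definition smoothing_right (B B1 : Banach) (i1 : B1 -> B) (S : R -> B -> B) : Prop :=
  exists kappa omega : R, 0 < kappa /\ 0 < omega < 1 /\
    (forall t x, 0 < t -> exists y, i1 y = S t x) /\
    (forall t x y, 0 < t <= 1 -> i1 y = S t x ->
       norm y <= kappa * Rpower t (- omega) * norm x).

Definition smoothing_left (n : nat) (B B1 : Banach) (i1 : B1 -> B)
    (D : 'I_n -> B1 -> B) (S : R -> B -> B) : Prop :=
  exists kappa omega : R, 0 < kappa /\ 0 < omega < 1 /\
    forall j t, 0 < t ->
      exists Q : B -> B, is_linear Q /\ (forall b, Q (i1 b) = S t (D j b)) /\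
        (t <= 1 -> forall x, norm (Q x) <= kappa * Rpower t (- omega) * norm x).

(* [S t D_j - D_j S t] is an operator on [B1], so [S t] must preserve [B1]. *)
Definition commutators_bounded (n : nat) (B B1 : Banach) (i1 : B1 -> B)
    (D : 'I_n -> B1 -> B) (S : R -> B -> B) : Prop :=
  (forall t b, 0 <= t -> exists b', i1 b' = S t (i1 b)) /\
  (forall T' : R, exists C : R, forall j t, 0 <= t <= T' ->
     exists Q : B -> B, is_linear Q /\
       (forall b b', i1 b' = S t (i1 b) -> Q (i1 b) = minus (S t (D j b)) (D j b')) /\
       (forall x, norm (Q x) <= C * norm x)).

(* A curve in [C([a,T],B)] is represented by a function on [R] that is continuous
   on [a,T]; its values outside [a,T] are irrelevant. *)
Definition Ccurve (B : Banach) (a T : R) (c : R -> B) : Prop :=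
  continuous_on (fun t : R => a <= t <= T) c.

Definition Cdist (B : Banach) (a T : R) (c c' : R -> B) : R :=
  real (Lub_Rbar (fun r => exists s, a <= s <= T /\ r = norm (minus (c s) (c' s)))).

(* Joint continuity on [R * Bb * Bb^n * C([a,T],B)]. *)
Definition continuous_with_curve (n : nat) (B Bb : Banach) (a T : R)
    (F : R -> Bb -> ('I_n -> Bb) -> (R -> B) -> Bb) : Prop :=
  forall t f0 fs c, Ccurve a T c -> forall eps, 0 < eps -> exists delta, 0 < delta /\
    forall t' f0' fs' c', Ccurve a T c' ->
      Rabs (t' - t) < delta -> norm (minus f0' f0) < delta ->
      (forall j, norm (minus (fs' j) (fs j)) < delta) -> Cdist a T c' c < delta ->
      norm (minus (F t' f0' fs' c') (F t f0 fs c)) < eps.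

Definition Cexp (z : C) : C := (exp (Re z) * cos (Im z), exp (Re z) * sin (Im z)).

Definition G_beta (beta t x : R) : R :=
  / PI * Re (RInt_gen (V := C_R_CompleteNormedModule)
    (fun p : R => Cexp (Cminus (Cmult Ci (RtoC (p * x)))
       (Cmult (RtoC (t * Rpower p beta)) (Cexp (Cmult Ci (RtoC (PI * beta / 2)))))))
    (at_right 0) (Rbar_locally p_infty)).

(* The operators E_beta(A tau) and E'_beta(A tau), with S = e^{A .}. *)
Definition ML (B : Banach) (beta : R) (S : R -> B -> B) (tau : R) (y : B) : B :=
  scal (/ beta) (RInt_gen
    (fun x : R => scal (Rpower x (- 1 - / beta) * G_beta beta 1 (Rpower x (- / beta)))
                       (S (tau * x) y))
    (at_right 0) (Rbar_locally p_infty)).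

Definition ML' (B : Banach) (beta : R) (S : R -> B -> B) (tau : R) (y : B) : B :=
  scal (/ beta) (RInt_gen
    (fun x : R => scal (Rpower x (- / beta) * G_beta beta 1 (Rpower x (- / beta)))
                       (S (tau * x) y))
    (at_right 0) (Rbar_locally p_infty)).

(* x^r for x >= 0 and r > 0 ([Rpower 0 r] is 1, not 0). *)
Definition pow0 (x r : R) : R := if Rlt_dec 0 x then Rpower x r else 0.

(* Integrals over [a,t] that are improper at [t], resp. over [t,T] at [t]. *)
Definition is_RInt_sing_right (B : Banach) (g : R -> B) (a t : R) (v : B) : Prop :=
  (a = t /\ v = zero) \/ (a < t /\ is_RInt_gen g (at_point a) (at_left t) v).

Definition is_RInt_sing_left (B : Banach) (g : R -> B) (t T : R) (v : B) : Prop :=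
  (t = T /\ v = zero) \/ (t < T /\ is_RInt_gen g (at_right t) (at_point T) v).

Definition H_along (n : nat) (B B1 Bb B1b Bcon : Banach)
    (i1 : B1 -> B) (D : 'I_n -> B1 -> B) (i1b : B1b -> Bb) (Db : 'I_n -> B1b -> Bb)
    (H : R -> B -> ('I_n -> B) -> Bcon -> B)
    (u : R -> Bb -> ('I_n -> Bb) -> Bcon)
    (b : R -> B1) (f : R -> B1b) (s : R) : B :=
  H s (i1 (b s)) (fun j => D j (b s)) (u s (i1b (f s)) (fun j => Db j (f s))).

Definition Hb_along (n : nat) (B B1 Bb B1b : Banach)
    (i1 : B1 -> B) (i1b : B1b -> Bb) (Db : 'I_n -> B1b -> Bb)
    (HbT : R -> Bb -> ('I_n -> Bb) -> (R -> B) -> Bb)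
    (b : R -> B1) (f : R -> B1b) (s : R) : Bb :=
  HbT s (i1b (f s)) (fun j => Db j (f s)) (fun r => i1 (b r)).

(* Mild solutions on [a,T] of
     b' = A b + h(b,f),  b(a) = Y,     f' = - A^* f + hb(b,f),  f(T) = Z,
   where S = e^{A .}, Sb = e^{A^* .}, and h, hb send curves to curves. *)
Definition mild_solution (B B1 Bb B1b : Banach) (i1 : B1 -> B) (i1b : B1b -> Bb)
    (S : R -> B -> B) (Sb : R -> Bb -> Bb)
    (h : (R -> B1) -> (R -> B1b) -> R -> B) (hb : (R -> B1) -> (R -> B1b) -> R -> Bb)
    (a T : R) (Y : B1) (Z : B1b) (b : R -> B1) (f : R -> B1b) : Prop :=
  Ccurve a T b /\ Ccurve a T f /\
  forall t, a <= t <= T ->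
    (exists v, is_RInt (fun s => S (t - s) (h b f s)) a t v /\
       i1 (b t) = plus (S (t - a) (i1 Y)) v) /\
    (exists v, is_RInt (fun s => Sb (s - t) (hb b f s)) t T v /\
       i1b (f t) = minus (Sb (T - t) (i1b Z)) v).

(* The same for D^beta_{a+*} b = A b + h(b,f),  - D^beta_{T-*} f = - A^* f + hb(b,f). *)
Definition fractional_mild_solution (beta : R)
    (B B1 Bb B1b : Banach) (i1 : B1 -> B) (i1b : B1b -> Bb)
    (S : R -> B -> B) (Sb : R -> Bb -> Bb)
    (h : (R -> B1) -> (R -> B1b) -> R -> B) (hb : (R -> B1) -> (R -> B1b) -> R -> Bb)
    (a T : R) (Y : B1) (Z : B1b) (b : R -> B1) (f : R -> B1b) : Prop :=
  Ccurve a T b /\ Ccurve a T f /\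
  forall t, a <= t <= T ->
    (exists v, is_RInt_sing_right
         (fun s => scal (Rpower (t - s) (beta - 1))
                        (ML' beta S (pow0 (t - s) beta) (h b f s))) a t v /\
       i1 (b t) = plus (ML beta S (pow0 (t - a) beta) (i1 Y)) (scal beta v)) /\
    (exists v, is_RInt_sing_left
         (fun s => scal (Rpower (s - t) (beta - 1))
                        (ML' beta Sb (pow0 (s - t) beta) (hb b f s))) t T v /\
       i1b (f t) = minus (ML beta Sb (pow0 (T - t) beta) (i1b Z)) (scal beta v)).

Definition unique_on (B1 B1b : Banach) (a T : R)
    (P : (R -> B1) -> (R -> B1b) -> Prop) : Prop :=
  (exists b f, P b f) /\
  (forall b f b' f', P b f -> P b' f' ->
     forall t, a <= t <= T -> b t = b' t /\ f t = f' t).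

(* Main.v *)
(* On a short interval the system is a fixed point problem for a contraction: after
   the substitution b(t) = x(t - a), f(t) = y(T - t) both Duhamel formulas are
   convolutions with operators U(r) : B -> B1 of norm O(r^-om), om < 1, and the linear
   growth of H and H^b confines every solution to one ball, where they are Lipschitz.

   For U(r) = e^{Ar} the singular bound comes from duality: smoothing from the right or
   from the left both imply |(e^{At} x, D_j f)| <= C t^-om |x| |f|, and this estimate, like
   its analogue for the commutators, is symmetric in the two triples. The dyadic sum of
   e^{A 2^-k} x - e^{A 2^-k-1} x then shows that the domain of the generator lies in B1.

   For the fractional system U(r) = r^(beta-1) E'_beta(A r^beta), which is
   O(r^(beta-1-beta om)) provided that the weight x^(-1-1/beta) G_beta(1, x^(-1/beta)) is
   O(x^(-1/2) e^(-cx)): two integrations by parts give the behaviour of G_beta at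
   infinity, a contour shift that at 0. *)

(* Smoothing is assumed for e^{At} only, and from the left it does not by itself put e^{At} x into
   B1. The pairing with D_j f meets both difficulties: it makes sense for every x in B, and it
   transposes to the dual semigroup. It bounds the B1 norm of vectors already known to be in B1;
   membership comes by approximation, from the density of B2 and from the generator being the
   closure of A.

   The length of the time interval must be chosen before T. The radius of the ball depends only on
   the free evolutions over a fixed interval, the Lipschitz constants on this ball are uniform in T,
   and convolution over a length L has norm O(L^(1-om)).

   The true decay of G_beta at infinity is y^(-1-beta), which would make the weight bounded near 0.
   The weaker y^(-1-beta/2) already gives the integrable x^(-1/2), and follows from a cruder
   estimate.

   All integrals are Riemann integrals; dominated convergence takes the form of a majorant with an
   explicit primitive together with uniform convergence on compact intervals. *)
Require Import Defs.
From Stdlib Require Import Lra Lia Classical ClassicalEpsilon FunctionalExtensionality.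

Set Implicit Arguments.
Unset Strict Implicit.
Unset Printing Implicit Defensive.

(** * Norms, limits and completeness *)

(* Coquelicot reaches the group structure of a complete normed module along two
   convertible paths; [lra] only identifies atoms written along the same one. *)
Ltac one_path :=
  repeat match goal with
  | |- context [@minus (CompleteNormedModule.AbelianGroup ?K ?V)] =>
    change (@minus (CompleteNormedModule.AbelianGroup K V)) with
      (@minus (NormedModule.AbelianGroup K (CompleteNormedModule.NormedModule K V))) in *
  | H : context [@minus (CompleteNormedModule.AbelianGroup ?K ?V)] |- _ =>
    change (@minus (CompleteNormedModule.AbelianGroup K V)) with
      (@minus (NormedModule.AbelianGroup K (CompleteNormedModule.NormedModule K V))) in *
  | |- context [@plus (CompleteNormedModule.AbelianMonoid ?K ?V)] =>
    change (@plus (CompleteNormedModule.AbelianMonoid K V)) with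
      (@plus (NormedModule.AbelianMonoid K (CompleteNormedModule.NormedModule K V))) in *
  | H : context [@plus (CompleteNormedModule.AbelianMonoid ?K ?V)] |- _ =>
    change (@plus (CompleteNormedModule.AbelianMonoid K V)) with
      (@plus (NormedModule.AbelianMonoid K (CompleteNormedModule.NormedModule K V))) in *
  | |- context [@scal ?K (CompleteNormedModule.ModuleSpace ?K ?V)] =>
    change (@scal K (CompleteNormedModule.ModuleSpace K V)) with
      (@scal K (NormedModule.ModuleSpace K (CompleteNormedModule.NormedModule K V))) in *
  | H : context [@scal ?K (CompleteNormedModule.ModuleSpace ?K ?V)] |- _ =>
    change (@scal K (CompleteNormedModule.ModuleSpace K V)) with
      (@scal K (NormedModule.ModuleSpace K (CompleteNormedModule.NormedModule K V))) in *
  end.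
Ltac lran := intros; one_path; lra.

Lemma filterlim_normP (T : Type) (V : NormedModule R_AbsRing) (F : (T -> Prop) -> Prop)
    {FF : Filter F} (f : T -> V) (l : V) :
  filterlim f F (locally l) <->
  (forall eps, 0 < eps -> F (fun x => norm (minus (f x) l) < eps)).
Proof.
split.
- move=> hf eps he.
  have := proj1 (@filterlim_locally_ball_norm _ _ _ F FF f l) hf (mkposreal eps he).
  by apply: filter_imp => x.
- move=> h; apply: (proj2 (filterlim_locally_ball_norm f l)) => eps; exact: h (cond_pos eps).
Qed.

Lemma filter_mono (T : Type) (F : (T -> Prop) -> Prop) (FF : Filter F) (P Q : T -> Prop) :
  F P -> (forall x, P x -> Q x) -> F Q.
Proof. by move=> h1 h2; exact: (filter_imp P Q h2 h1). Qed.

Lemma norm_minusC (V : NormedModule R_AbsRing) (x y : V) : norm (minus x y) = norm (minus y x).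
Proof. by rewrite -norm_opp opp_minus. Qed.

Lemma norm_minus_trans (V : NormedModule R_AbsRing) (x y z : V) :
  norm (minus x z) <= norm (minus x y) + norm (minus y z).
Proof. rewrite (minus_trans y); exact: norm_triangle. Qed.

Lemma norm_minus_le (V : NormedModule R_AbsRing) (x y : V) : norm (minus x y) <= norm x + norm y.
Proof. by rewrite /minus -(norm_opp y); exact: norm_triangle. Qed.

Lemma norm_le_minus (V : NormedModule R_AbsRing) (x y : V) : norm x <= norm (minus x y) + norm y.
Proof.
have {1}-> : x = plus (minus x y) y by rewrite /minus -plus_assoc plus_opp_l plus_zero_r.
exact: norm_triangle.
Qed.

Lemma norm_minus_eq0 (V : NormedModule R_AbsRing) (x y : V) :
  norm (minus x y) <= 0 -> x = y.
Proof.
move=> h; have h0 : minus x y = zero.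
  by apply: norm_eq_zero; apply: Rle_antisym => //; exact: norm_ge_0.
have : plus (minus x y) y = plus zero y by rewrite h0.
by rewrite /minus -plus_assoc plus_opp_l plus_zero_r plus_zero_l.
Qed.

Lemma norm_minus_small (V : NormedModule R_AbsRing) (x y : V) :
  (forall eps, 0 < eps -> norm (minus x y) <= eps) -> x = y.
Proof.
move=> h; apply: norm_minus_eq0; apply: Rnot_lt_le => h0; have := h (norm (minus x y) / 2); lra.
Qed.

Lemma norm_scal_R (V : NormedModule R_AbsRing) (k : R) (x : V) :
  norm (scal k x) = Rabs k * norm x.
Proof.
apply: Rle_antisym; first exact: norm_scal.
case: (Req_dec k 0) => [->|hk].
  by rewrite Rabs_R0 Rmult_0_l; exact: norm_ge_0.
have h : norm x <= Rabs (/ k) * norm (scal k x).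
  have {1}-> : x = scal (/ k) (scal k x).
    by rewrite scal_assoc /mult /= Rinv_l // scal_one.
  exact: norm_scal.
rewrite Rabs_inv in h.
have hk0 := Rabs_pos_lt k hk.
apply: (Rmult_le_reg_l (/ Rabs k)); first exact: Rinv_0_lt_compat.
by rewrite -Rmult_assoc Rinv_l ?Rmult_1_l //; lra.
Qed.

Lemma minus_plus_l (V : NormedModule R_AbsRing) (z x y : V) : minus (plus z x) (plus z y) = minus x y.
Proof.
rewrite /minus opp_plus plus_assoc (plus_comm z x) -(plus_assoc x z) plus_opp_r plus_zero_r.
by [].
Qed.

Lemma minus_minus2 (V : NormedModule R_AbsRing) (a b c d : V) :
  minus (minus a b) (minus c d) = minus (minus a c) (minus b d).
Proof.
rewrite /minus !opp_plus !opp_opp -!plus_assoc; congr plus.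
by rewrite !plus_assoc; congr plus; rewrite plus_comm.
Qed.

Lemma scal_minus (V : NormedModule R_AbsRing) (k : R) (x y : V) :
  scal k (minus x y) = minus (scal k x) (scal k y).
Proof. by rewrite /minus scal_distr_l scal_opp_r. Qed.

Lemma scal_scal_inv (V : NormedModule R_AbsRing) (k : R) (x : V) : k <> 0 -> scal k (scal (/ k) x) = x.
Proof.
move=> hk; rewrite scal_assoc; have -> : mult k (/ k) = one :> R by rewrite /mult /one /=; field.
exact: scal_one.
Qed.

Lemma sum_ord_ge0 n (F : 'I_n -> R) : (forall j, 0 <= F j) -> 0 <= sum_ord F.
Proof. by move=> h; rewrite /sum_ord; apply: big_ind => // *; lra. Qed.

Lemma sum_ord_recl n (F : 'I_n.+1 -> R) :
  sum_ord F = F ord0 + sum_ord (fun j : 'I_n => F (lift ord0 j)).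
Proof. by rewrite /sum_ord big_ord_recl. Qed.

Lemma sum_ord_elem n (F : 'I_n -> R) j : (forall j, 0 <= F j) -> F j <= sum_ord F.
Proof.
elim: n F j => [|n IH] F j h; first by case: j.
rewrite sum_ord_recl; case: (unliftP ord0 j) => [k ->|->].
- have /= := IH (fun j => F (lift ord0 j)) k (fun j => h _); have := h ord0; lra.
- have := @sum_ord_ge0 n (fun j => F (lift ord0 j)) (fun j => h _); lra.
Qed.

Lemma sum_ord_const n (F : 'I_n -> R) c : (forall j, F j <= c) -> sum_ord F <= INR n * c.
Proof.
elim: n F => [|n IH] F h.
- rewrite /sum_ord big_ord0 /=; lra.
- rewrite sum_ord_recl S_INR; have := IH (fun j : 'I_n => F (lift ord0 j)) (fun j => h _); have := h ord0; lra.
Qed.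

Lemma seq_cauchy_lim (V : Banach) (x : nat -> V) :
  (forall eps, 0 < eps -> exists N, forall k l, (N <= k)%coq_nat -> (N <= l)%coq_nat ->
      norm (minus (x k) (x l)) < eps) ->
  exists y : V, forall eps, 0 < eps -> exists N, forall k, (N <= k)%coq_nat -> norm (minus (x k) y) < eps.
Proof.
move=> h.
have [y hy] : exists y, filterlim x eventually (locally y).
  apply: (proj1 (filterlim_locally_cauchy x)) => eps.
  have [N hN] := h eps (cond_pos eps).
  exists (fun k => (N <= k)%coq_nat); split; first by exists N.
  move=> k l hk hl; apply: norm_compat1; exact: hN.
exists y => eps he.
exact: (proj1 (filterlim_normP _ _) hy eps he).
Qed.

Lemma pow_half_small (c eps : R) : 0 <= c -> 0 < eps -> exists N, forall k, (N <= k)%coq_nat -> c * (/2)^k < eps.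
Proof.
move=> hc he.
have [N hN] := pow_lt_1_zero (/2) ltac:(rewrite Rabs_pos_eq; lra) (eps / (c + 1)) ltac:(apply: Rdiv_lt_0_compat; lra).
exists N => k hk; have := hN k hk; rewrite Rabs_pos_eq; last by apply: pow_le; lran.
move=> h.
apply: (Rle_lt_trans _ ((c+1) * (/2)^k)).
  apply: Rmult_le_compat_r; first by apply: pow_le; lran. lran.
apply: (Rlt_le_trans _ ((c+1) * (eps / (c+1)))); first by apply: Rmult_lt_compat_l => //; lran.
by right; field; lran.
Qed.

Lemma geometric_lim (V : Banach) (x : nat -> V) (d : R) :
  (forall k, norm (minus (x k.+1) (x k)) <= d * (/2)^k) ->
  exists y : V, forall k, norm (minus (x k) y) <= 2 * d * (/2)^k.
Proof.
move=> h.
have hd : 0 <= d by have := h 0%N; have := norm_ge_0 (minus (x 1%N) (x 0%N)); rewrite /=; lran.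
(* The subtracted tail of the geometric series is what lets the induction on [m] telescope. *)
have h2 : forall m k, norm (minus (x (k + m)%N) (x k)) <= 2 * d * (/2)^k - 2 * d * (/2)^(k+m)%N.
  elim=> [|m IH] k.
    rewrite addn0 minus_eq_zero norm_zero; lran.
  rewrite addnS.
  have h1 := norm_minus_trans (x (k+m).+1) (x (k+m)%N) (x k).
  have := h (k+m)%N; have := IH k; rewrite /=; lran.
have h3 : forall N k, (N <= k)%coq_nat -> norm (minus (x k) (x N)) <= 2 * d * (/2)^N.
  move=> N k hk; have := h2 (k - N)%coq_nat N.
  have -> : (N + (k - N)%coq_nat)%N = k by change (Nat.add N (Nat.sub k N) = k); lia.
  have := pow_le (/2) k ltac:(lra); nra.
have [y hy] : exists y : V, forall eps, 0 < eps -> exists N, forall k, (N <= k)%coq_nat -> norm (minus (x k) y) < eps.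
  apply: seq_cauchy_lim => eps he.
  have [N hN] := @pow_half_small (4 * d) eps ltac:(lra) he.
  exists N => k l hk hl.
  have := norm_minus_trans (x k) (x N) (x l); rewrite (norm_minusC (x N)).
  have := h3 _ _ hk; have := h3 _ _ hl; have := hN N (le_n _); lran.
exists y => k; apply: Rle_plus_epsilon => eps he.
have [N hN] := hy eps he.
have := norm_minus_trans (x k) (x (N + k)%coq_nat) y.
have := h3 k (N + k)%coq_nat ltac:(lia); rewrite (norm_minusC (x (N + k)%coq_nat) (x k)).
have := hN (N+k)%coq_nat ltac:(lia); lran.
Qed.

(** * Improper integrals *)

Lemma Riemann_sum_linear (U V : NormedModule R_AbsRing) (l : U -> V) (g : R -> U) (ptd : SF_seq.SF_seq) :
  is_linear l -> l (SF_seq.Riemann_sum g ptd) = SF_seq.Riemann_sum (fun x => l (g x)) ptd.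
Proof.
move=> hl; move: ptd; apply: SF_seq.SF_cons_ind => [x0|h ptd IH].
- exact: linear_zero.
- by rewrite !SF_seq.Riemann_sum_cons linear_plus // linear_scal // IH.
Qed.

Lemma is_RInt_linear (U V : NormedModule R_AbsRing) (l : U -> V) (g : R -> U) (a b : R) (v : U) :
  is_linear l -> is_RInt g a b v -> is_RInt (fun x => l (g x)) a b (l v).
Proof.
move=> hl hg; rewrite /is_RInt.
apply: (filterlim_ext (fun ptd => l (scal (sign (b - a)) (SF_seq.Riemann_sum g ptd)))) => [ptd|].
  by rewrite linear_scal // Riemann_sum_linear.
exact: filterlim_comp hg (linear_cont l v hl).
Qed.

Lemma is_RInt_gen_linear (U V : NormedModule R_AbsRing) (l : U -> V)
    (Fa Fb : (R -> Prop) -> Prop) {FFa : Filter Fa} {FFb : Filter Fb} (g : R -> U) (v : U) :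
  is_linear l -> is_RInt_gen g Fa Fb v -> is_RInt_gen (fun x => l (g x)) Fa Fb (l v).
Proof.
move=> hl hg P hP.
have hP' : locally v (fun y => P (l y)) by exact: (linear_cont l v hl P hP).
have := hg _ hP'; rewrite /filtermapi; apply: filter_imp => -[a b] [y [hy hPy]].
exists (l y); split => //.
exact: is_RInt_linear.
Qed.

(* The majorant [phi] comes with a primitive [Phi]: it is integrable up to the ends of [I] as soon as
   [Phi] has limits there. *)
Lemma integral_le_majorant (V : Banach) (I : R -> Prop) (g : R -> V) (Phi phi : R -> R) (c d : R) :
  (forall x y z, I x -> I z -> x <= y <= z -> I y) ->
  (forall x, I x -> continuous g x) ->
  (forall x, I x -> is_derive Phi x (phi x)) -> (forall x, I x -> continuous phi x) ->
  (forall x, I x -> norm (g x) <= phi x) -> I c -> I d ->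
  ex_RInt g c d /\ norm (RInt g c d) <= Rabs (Phi d - Phi c).
Proof.
move=> hI hg hPhi hphi hdom.
have main : forall c d, I c -> I d -> c <= d ->
    ex_RInt g c d /\ norm (RInt g c d) <= Rabs (Phi d - Phi c).
  move=> {}c {}d hc hd hcd.
  have hin : forall x, Rmin c d <= x <= Rmax c d -> I x.
    by move=> x; rewrite Rmin_left // Rmax_right //; exact: hI.
  have hex : ex_RInt g c d by apply: ex_RInt_continuous => x /hin /hg.
  split=> //.
  apply: Rle_trans (Rle_abs _).
  apply: (@norm_RInt_le _ g phi c d) => //.
  - by move=> x hx; apply: hdom; apply: hI hx.
  - exact: RInt_correct.
  - by apply: (@is_RInt_derive R_CompleteNormedModule Phi phi) => x /hin; [exact: hPhi | exact: hphi].
move=> hc hd; case: (Rle_dec c d) => hcd; first exact: main.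
have [h1 h2] := main d c hd hc ltac:(lra).
split; first exact: ex_RInt_swap.
by rewrite -(opp_RInt_swap g d c) // norm_opp Rabs_minus_sym.
Qed.

(** The two integrals differ by those from [c] to [c'] and from [d'] to [d], so the Cauchy criterion
    for the improper integral reduces to the one for [Phi]. *)
Lemma integral_diff_le_majorant (V : Banach) (I : R -> Prop) (g : R -> V) (Phi phi : R -> R) (c d c' d' : R) :
  (forall x y z, I x -> I z -> x <= y <= z -> I y) ->
  (forall x, I x -> continuous g x) ->
  (forall x, I x -> is_derive Phi x (phi x)) -> (forall x, I x -> continuous phi x) ->
  (forall x, I x -> norm (g x) <= phi x) -> I c -> I d -> I c' -> I d' ->
  norm (minus (RInt g c d) (RInt g c' d')) <= Rabs (Phi c - Phi c') + Rabs (Phi d - Phi d').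
Proof.
move=> hI hg hPhi hphi hdom hc hd hc' hd'.
have M : forall c d, I c -> I d -> ex_RInt g c d /\ norm (RInt g c d) <= Rabs (Phi d - Phi c).
  by move=> x y hx hy; exact: (integral_le_majorant (Phi := Phi) (phi := phi) hI).
have [e1 n1] := M c c' hc hc'; have [e2 n2] := M c' d' hc' hd'; have [e3 n3] := M d' d hd' hd.
have e4 := ex_RInt_Chasles _ _ _ _ e1 e2.
rewrite -(RInt_Chasles g c d' d) // -(RInt_Chasles g c c' d') //.
have -> : minus (plus (plus (RInt g c c') (RInt g c' d')) (RInt g d' d)) (RInt g c' d')
   = plus (RInt g c c') (RInt g d' d).
  rewrite /minus -!plus_assoc; congr plus.
  by rewrite plus_comm -plus_assoc plus_opp_l plus_zero_r.
apply: Rle_trans (norm_triangle _ _) _.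
by apply: Rplus_le_compat => //; rewrite Rabs_minus_sym.
Qed.

(** The filters stay general because 0+, a point, t- and infinity all occur as ends. The last clause
    controls the tails, as dominated convergence requires. *)
Lemma singular_integral (V : Banach) (I : R -> Prop) (Fa Fb : (R -> Prop) -> Prop)
    {FFa : ProperFilter Fa} {FFb : ProperFilter Fb}
    (g : R -> V) (Phi phi : R -> R) (la lb : R) :
  (forall x y z, I x -> I z -> x <= y <= z -> I y) -> Fa I -> Fb I ->
  (forall x, I x -> continuous g x) ->
  (forall x, I x -> is_derive Phi x (phi x)) -> (forall x, I x -> continuous phi x) ->
  (forall x, I x -> norm (g x) <= phi x) ->
  filterlim Phi Fa (locally la) -> filterlim Phi Fb (locally lb) ->
  exists v, is_RInt_gen g Fa Fb v /\ norm v <= Rabs (lb - la) /\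
   (forall c d, I c -> I d -> norm (minus v (RInt g c d)) <= Rabs (Phi c - la) + Rabs (Phi d - lb)).
Proof.
move=> hI hFa hFb hg hPhi hphi hdom hla hlb.
have hD c d c' d' := integral_diff_le_majorant (c := c) (d := d) (c' := c') (d' := d') hI hg hPhi hphi hdom.
have hM c d := integral_le_majorant (c := c) (d := d) hI hg hPhi hphi hdom.
have near F l (FF : ProperFilter F) : F I -> filterlim Phi F (locally l) -> forall eps, 0 < eps ->
    F (fun x => I x /\ Rabs (Phi x - l) < eps).
  move=> hFI hl eps he; apply: filter_and => //.
  exact: (proj1 (@filterlim_normP R R_NormedModule F _ Phi l) hl eps he).
pose f (ab : R * R) := RInt g ab.1 ab.2.
have hP eps (he : 0 < eps) : filter_prod Fa Fb (fun ab => (I ab.1 /\ Rabs (Phi ab.1 - la) < eps) /\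
      (I ab.2 /\ Rabs (Phi ab.2 - lb) < eps)).
  by apply: Filter_prod (near Fa la _ hFa hla eps he) (near Fb lb _ hFb hlb eps he) _ => x y hx hy.
have [v hv] : exists v : V, filterlim f (filter_prod Fa Fb) (locally v).
  apply: (proj1 (@filterlim_locally_cauchy _ V (filter_prod Fa Fb) _ f)) => eps.
  exists (fun ab => (I ab.1 /\ Rabs (Phi ab.1 - la) < eps / 4) /\
      (I ab.2 /\ Rabs (Phi ab.2 - lb) < eps / 4)); split.
    by apply: hP; have := cond_pos eps; lra.
  move=> [a b] [a' b'] /= [[h1 h2] [h3 h4]] [[h1' h2'] [h3' h4']].
  apply: (@norm_compat1 _ V); rewrite /f /=.
  apply: Rle_lt_trans (hD _ _ _ _ h1' h3' h1 h3) _.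
  move: h2 h4 h2' h4'; rewrite /Rabs; do 6 case: Rcase_abs; lra.
have hgen : is_RInt_gen g Fa Fb v.
  move=> P hP'; rewrite /filtermapi.
  have h1 : filter_prod Fa Fb (fun ab => P (f ab)) := hv P hP'; have h2 := hP 1 Rlt_0_1.
  refine (filter_mono _ (filter_and _ _ h1 h2) _) => -[a b] /= [h [[ha _] [hb _]]].
  exists (RInt g a b); split=> //; apply: RInt_correct; exact: (proj1 (hM _ _ ha hb)).
have hclose eps : 0 < eps -> exists a b, I a /\ I b /\ Rabs (Phi a - la) < eps /\ Rabs (Phi b - lb) < eps
    /\ norm (minus v (RInt g a b)) < eps.
  move=> he.
  have h1 : filter_prod Fa Fb (fun x => norm (minus (f x) v) < eps) by exact (proj1 (@filterlim_normP _ V _ _ f v) hv eps he).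
  have h2 := hP eps he.
  have [[a b] /= [h [[ha ha'] [hb hb']]]] := filter_ex _ (filter_and _ _ h1 h2).
  exists a, b; do 4 (split => //).
  by rewrite norm_minusC.
exists v; split=> //; split.
- apply: Rle_plus_epsilon => eps he.
  have [a [b [ha [hb [ha' [hb' hn]]]]]] := hclose (eps / 3) ltac:(lra).
  have h1 := norm_le_minus v (RInt g a b).
  have [_ h2] := hM a b ha hb.
  have : Rabs (Phi b - Phi a) <= Rabs (Phi b - lb) + Rabs (lb - la) + Rabs (Phi a - la).
    rewrite /Rabs; do 4 case: Rcase_abs; lra.
  lran.
- move=> c d hc hd; apply: Rle_plus_epsilon => eps he.
  have [a [b [ha [hb [ha' [hb' hn]]]]]] := hclose (eps / 3) ltac:(lra).
  have h1 := norm_minus_trans v (RInt g a b) (RInt g c d).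
  have h2 := hD _ _ _ _ ha hb hc hd.
  have h3 : Rabs (Phi a - Phi c) <= Rabs (Phi c - la) + eps / 3.
    move: ha'; rewrite /Rabs; do 3 case: Rcase_abs; lra.
  have h4 : Rabs (Phi b - Phi d) <= Rabs (Phi d - lb) + eps / 3.
    move: hb'; rewrite /Rabs; do 3 case: Rcase_abs; lra.
  lran.
Qed.

(** Dominated convergence: the common majorant makes the tails outside [c], [d] uniformly small, and
    between them the convergence is uniform. *)
Lemma singular_integral_lim (V : Banach) (T : Type) (FQ : (T -> Prop) -> Prop) {FFQ : Filter FQ}
    (I : R -> Prop) (Fa Fb : (R -> Prop) -> Prop)
    {FFa : ProperFilter Fa} {FFb : ProperFilter Fb}
    (gq : T -> R -> V) (g : R -> V) (Phi phi : R -> R) (la lb : R) (vq : T -> V) (v : V) :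
  (forall x y z, I x -> I z -> x <= y <= z -> I y) -> Fa I -> Fb I ->
  (forall x, I x -> continuous g x) ->
  FQ (fun q => forall x, I x -> continuous (gq q) x /\ norm (gq q x) <= phi x) ->
  (forall x, I x -> is_derive Phi x (phi x)) -> (forall x, I x -> continuous phi x) ->
  (forall x, I x -> norm (g x) <= phi x) ->
  filterlim Phi Fa (locally la) -> filterlim Phi Fb (locally lb) ->
  (forall c d eps, I c -> I d -> 0 < eps ->
     FQ (fun q => forall x, c <= x <= d -> norm (minus (gq q x) (g x)) <= eps)) ->
  FQ (fun q => is_RInt_gen (gq q) Fa Fb (vq q)) -> is_RInt_gen g Fa Fb v ->
  filterlim vq FQ (locally v).
Proof.
move=> hI hFa hFb hg hgq hPhi hphi hdom hla hlb hunif hvq hv.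
apply/filterlim_normP => eps he.
have near F l (FF : ProperFilter F) : F I -> filterlim Phi F (locally l) ->
    exists x, I x /\ Rabs (Phi x - l) < eps / 6.
  move=> hFI hl; apply: filter_ex; apply: filter_and => //.
  exact: (proj1 (@filterlim_normP R R_NormedModule F _ Phi l) hl (eps / 6) ltac:(lra)).
have [c [hc hc']] := near Fa la _ hFa hla; have [d [hd hd']] := near Fb lb _ hFb hlb.
have hmin : I (Rmin c d) by rewrite /Rmin; case: Rle_dec.
have hmax : I (Rmax c d) by rewrite /Rmax; case: Rle_dec.
have hle : Rmin c d <= Rmax c d by rewrite /Rmin /Rmax; case: Rle_dec; lra.
(* The [+ 1] keeps the denominator positive when [c = d]. The points come from two unrelated
   filters, so they need not be ordered. *)
pose eta := eps / (6 * (Rmax c d - Rmin c d + 1)).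
have heta : 0 < eta by apply: Rdiv_lt_0_compat; lra.
have hetaE : eta * (Rmax c d - Rmin c d) <= eps / 6.
  apply: (Rle_trans _ (eta * (Rmax c d - Rmin c d + 1))); first by nra.
  by right; rewrite /eta; field; lra.
refine (filter_mono _ (filter_and _ _ (hunif _ _ eta hmin hmax heta) (filter_and _ _ hgq hvq)) _).
move=> q [h1 [h2 h3]].
have tail (k : R -> V) w : (forall x, I x -> continuous k x) -> (forall x, I x -> norm (k x) <= phi x) ->
    is_RInt_gen k Fa Fb w -> ex_RInt k c d /\ norm (minus w (RInt k c d)) <= eps / 3.
  move=> hk1 hk2 hk3; split.
    exact: (proj1 (integral_le_majorant hI hk1 hPhi hphi hk2 hc hd)).
  have [w' [hw' [_ hw]]] := singular_integral hI hFa hFb hk1 hPhi hphi hk2 hla hlb.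
  have -> : w = w' by rewrite -(is_RInt_gen_unique _ _ hk3) -(is_RInt_gen_unique _ _ hw').
  apply: Rle_trans (hw _ _ hc hd) _; lra.
have [x1 x2] := tail _ _ (fun x hx => proj1 (h2 x hx)) (fun x hx => proj2 (h2 x hx)) h3.
have [y1 y2] := tail _ _ hg hdom hv.
have hd0 : norm (minus (RInt (gq q) c d) (RInt g c d)) <= eps / 6.
  have aux : forall c' d', c' <= d' -> Rmin c d = c' -> Rmax c d = d' -> ex_RInt (gq q) c' d' -> ex_RInt g c' d' ->
     norm (minus (RInt (gq q) c' d') (RInt g c' d')) <= eps / 6.
    move=> c' d' hcd' e1 e2 i1 i2; apply: Rle_trans hetaE.
    rewrite e1 e2.
    rewrite -RInt_minus // Rmult_comm.
    apply: (@norm_RInt_le_const _ (fun x => minus (gq q x) (g x)) c' d') => //.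
    - by move=> x hx; apply: h1; rewrite e1 e2.
    - by apply: RInt_correct; apply: ex_RInt_minus.
  case: (Rle_dec c d) => hcd.
    by apply: aux => //; [exact: Rmin_left | exact: Rmax_right].
  rewrite -(opp_RInt_swap (gq q) d c); last exact: ex_RInt_swap.
  rewrite -(opp_RInt_swap g d c); last exact: ex_RInt_swap.
  have -> : minus (opp (RInt (gq q) d c)) (opp (RInt g d c)) = opp (minus (RInt (gq q) d c) (RInt g d c)).
    by rewrite /minus opp_plus.
  rewrite norm_opp; apply: aux; [lra | | | exact: ex_RInt_swap | exact: ex_RInt_swap].
  - by apply: Rmin_right; lra.
  - by apply: Rmax_left; lra.
have t1 := norm_minus_trans (vq q) (RInt (gq q) c d) v.
have t2 := norm_minus_trans (RInt (gq q) c d) (RInt g c d) v.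
have := norm_minusC v (RInt g c d).
lran.
Qed.

(** A finite subcover turns local closeness into uniform closeness, since a filter is stable under
    finite intersections. *)
Lemma filterlim_uniform_compact (V : NormedModule R_AbsRing) (T : Type) (FQ : (T -> Prop) -> Prop) {FFQ : Filter FQ}
    (gq : T -> R -> V) (g : R -> V) (c d eps : R) :
  0 < eps ->
  (forall x, c <= x <= d -> exists delta, 0 < delta /\
     FQ (fun q => forall x', c <= x' <= d -> Rabs (x' - x) < delta -> norm (minus (gq q x') (g x')) <= eps)) ->
  FQ (fun q => forall x, c <= x <= d -> norm (minus (gq q x) (g x)) <= eps).
Proof.
move=> he h.
have [delta hdelta] : exists delta : R -> posreal, forall x, c <= x <= d ->
   FQ (fun q => forall x', c <= x' <= d -> Rabs (x' - x) < delta x -> norm (minus (gq q x') (g x')) <= eps).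
  have h' : forall x, exists delta : posreal, c <= x <= d ->
     FQ (fun q => forall x', c <= x' <= d -> Rabs (x' - x) < delta -> norm (minus (gq q x') (g x')) <= eps).
    move=> x; case: (classic (c <= x <= d)) => [/h [e [e0 hx]]|hx].
      by exists (mkposreal e e0).
    by exists (mkposreal 1 Rlt_0_1).
  exists (fun x => proj1_sig (constructive_indefinite_description _ (h' x))) => x.
  exact: (proj2_sig (constructive_indefinite_description _ (h' x))).
case: (Rle_lt_dec c d) => hcd; last first.
  by refine (filter_mono _ (filter_true) _) => q _ x [h1 h2]; exfalso; lra.
have [l hl] : exists l, forall x : R, c <= x <= d ->
    exists t, List.In t l /\ c <= t <= d /\ Rabs (x - t) < delta t.
  (* [compactness_list] yields only the double negation of a finite subcover. *)
  apply: NNPP => hn; apply: (compactness_list 1 (c, tt) (d, tt) (fun t => delta t.1)) => -[l hl].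
  apply: hn; exists (List.map fst l) => x hx.
  have [[t []] [h1 [[h2 _] [h3 _]]]] := hl (x, tt) (conj hx I).
  by exists t; split=> //; apply: (List.in_map fst _ _ h1).
have : FQ (fun q => forall t, List.In t l -> c <= t <= d -> forall x', c <= x' <= d -> Rabs (x' - t) < delta t ->
    norm (minus (gq q x') (g x')) <= eps).
  elim: l {hl} => [|t l IH]; first by refine (filter_mono _ (filter_true) _).
  case: (classic (c <= t <= d)) => ht.
  - refine (filter_mono _ (filter_and _ _ IH (hdelta t ht)) _) => q [h1 h2] t' /= [<-|]; first by [].
    exact: h1.
  - by refine (filter_mono _ IH _) => q h1 t' /= [<-|] //; exact: h1.
apply: filter_imp => q hq x hx.
have [t [h1 [h2 h3]]] := hl x hx.
exact: (hq t).
Qed.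

(** * Curves and Picard iteration *)

Lemma continuous_normP (V : NormedModule R_AbsRing) (f : R -> V) (t : R) :
  continuous f t <-> (forall eps, 0 < eps -> exists delta, 0 < delta /\
    forall t', Rabs (t' - t) < delta -> norm (minus (f t') (f t)) < eps).
Proof.
split.
- move=> h eps he.
  have [d hd] := proj1 (@filterlim_normP _ V (locally t) _ f (f t)) h eps he.
  by exists d; split=> [|t' ht']; [exact: cond_pos | exact: hd].
- move=> h; apply/filterlim_normP => eps he.
  have [d [hd0 hd]] := h eps he.
  by exists (mkposreal d hd0) => t' ht'; exact: hd.
Qed.

Lemma CcurveP (B : Banach) (a T : R) (c : R -> B) :
  Ccurve a T c <-> (forall t, a <= t <= T -> forall eps, 0 < eps -> exists delta, 0 < delta /\
    forall t', a <= t' <= T -> Rabs (t' - t) < delta -> norm (minus (c t') (c t)) < eps).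
Proof.
split.
- move=> h t ht eps he.
  have [d hd] := proj1 (@filterlim_normP _ B (within _ (locally t)) _ c (c t)) (h t ht) eps he.
  by exists d; split=> [|t' ht1 ht']; [exact: cond_pos | exact: hd].
- move=> h t ht; apply/filterlim_normP => eps he.
  have [d [hd0 hd]] := h t ht eps he.
  by exists (mkposreal d hd0) => t' ht' ht1; exact: hd.
Qed.

(** Composition with this retraction extends a curve on [a,T] to a function continuous on all of R,
    which the integration lemmas can take as it is. *)
Definition clamp (a T t : R) : R := Rmax a (Rmin T t).

Lemma clamp_in a T t : a <= T -> a <= clamp a T t <= T.
Proof. by move=> h; rewrite /clamp /Rmax /Rmin; do 2 case: Rle_dec; lra. Qed.

Lemma clamp_id a T t : a <= t <= T -> clamp a T t = t.
Proof. by move=> h; rewrite /clamp /Rmax /Rmin; do 2 case: Rle_dec; lra. Qed.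

Lemma clamp_lip a T s t : Rabs (clamp a T s - clamp a T t) <= Rabs (s - t).
Proof. by rewrite /clamp /Rmax /Rmin /Rabs; do 6 (try case: Rle_dec; try case: Rcase_abs); lra. Qed.

Lemma Ccurve_clamp (B : Banach) (a T : R) (c : R -> B) : a <= T ->
  Ccurve a T c -> forall t, continuous (fun s => c (clamp a T s)) t.
Proof.
move=> haT /CcurveP hc t; apply/continuous_normP => eps he.
have [d [hd0 hd]] := hc _ (clamp_in t haT) eps he.
exists d; split=> // t' ht'; apply: hd; first exact: clamp_in.
exact: Rle_lt_trans (clamp_lip _ _ _ _) ht'.
Qed.

Lemma Ccurve_of_continuous (B : Banach) (a T : R) (c : R -> B) :
  (forall t, a <= t <= T -> continuous c t) -> Ccurve a T c.
Proof.
move=> h; apply/CcurveP => t ht eps he.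
have [d [hd0 hd]] := proj1 (continuous_normP _ _) (h t ht) eps he.
by exists d; split=> // t' _; exact: hd.
Qed.

Lemma Ccurve_ext (B : Banach) (a T : R) (c c' : R -> B) :
  (forall t, a <= t <= T -> c t = c' t) -> Ccurve a T c -> Ccurve a T c'.
Proof.
move=> he /CcurveP h; apply/CcurveP => t ht eps hep.
have [d [hd0 hd]] := h t ht eps hep.
by exists d; split=> // t' ht' ht2; rewrite -!he //; exact: hd.
Qed.

Lemma Ccurve_max (B : Banach) (a T : R) (c : R -> B) : a <= T -> Ccurve a T c ->
  exists m, a <= m <= T /\ forall t, a <= t <= T -> norm (c t) <= norm (c m).
Proof.
move=> haT hc.
have hcont : forall t, continuity_pt (fun s => norm (c (clamp a T s))) t.
  move=> t; apply/continuity_pt_filterlim.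
  apply: (filterlim_comp _ _ _ (fun s => c (clamp a T s)) norm _ (locally (c (clamp a T t)))).
  - exact: Ccurve_clamp.
  - exact: filterlim_norm.
have [m [hm1 hm2]] := continuity_ab_maj (fun s => norm (c (clamp a T s))) a T haT (fun t _ => hcont t).
exists m; split=> // t ht; have := hm1 t ht; by rewrite !clamp_id.
Qed.

Lemma Ccurve_minus (B : Banach) (a T : R) (c c' : R -> B) :
  Ccurve a T c -> Ccurve a T c' -> Ccurve a T (fun t => minus (c t) (c' t)).
Proof.
move=> /CcurveP h /CcurveP h'; apply/CcurveP => t ht eps he.
have [d [hd0 hd]] := h t ht (eps/2) ltac:(lra).
have [d' [hd0' hd']] := h' t ht (eps/2) ltac:(lra).
exists (Rmin d d'); split=> [|t' ht' hlt]; first exact: Rmin_pos.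
have h1 := hd t' ht' (Rlt_le_trans _ _ _ hlt (Rmin_l _ _)).
have h2 := hd' t' ht' (Rlt_le_trans _ _ _ hlt (Rmin_r _ _)).
rewrite minus_minus2.
have := norm_minus_le (minus (c t') (c t)) (minus (c' t') (c' t)); lran.
Qed.

(** Uniform continuity, as the uniform convergence on [a,T] of the curve shifted by [q] when [q]
    tends to 0. *)
Lemma Ccurve_unif (B : Banach) (a T : R) (c : R -> B) : a <= T -> Ccurve a T c ->
  forall eps, 0 < eps -> exists delta, 0 < delta /\ forall s t, a <= s <= T -> a <= t <= T ->
    Rabs (t - s) < delta -> norm (minus (c t) (c s)) <= eps.
Proof.
move=> haT hc eps he.
have hcc := Ccurve_clamp haT hc.
have h : locally 0 (fun q => forall x, a <= x <= T ->
     norm (minus (c (clamp a T (x + q))) (c (clamp a T x))) <= eps).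
  apply: (@filterlim_uniform_compact _ R (locally 0) _ (fun q x => c (clamp a T (x+q))) _ a T eps he) => x hx.
  have [d [hd0 hd]] := proj1 (continuous_normP _ _) (hcc x) (eps/2) ltac:(lra).
  exists (d/2); split; first lra.
  exists (mkposreal (d/2) ltac:(lra)) => q hq x' hx' hxx.
  have hq' : Rabs (q - 0) < d / 2 := hq.
  have h1 : Rabs (x' + q - x) < d.
    by move: hq' hxx; rewrite /Rabs; do 3 case: Rcase_abs; lra.
  have h2 := hd _ h1; have h3 := hd x' ltac:(lra).
  have := norm_minus_trans (c (clamp a T (x' + q))) (c (clamp a T x)) (c (clamp a T x')).
  have := norm_minusC (c (clamp a T x)) (c (clamp a T x')).
  lran.
have [d hd] := h.
exists d; split=> [|s t hs ht hst]; first exact: cond_pos.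
have hb : ball 0 d (t - s).
  by rewrite /ball /= /AbsRing_ball /abs /minus /plus /opp /= Ropp_0 Rplus_0_r.
have := hd _ hb s hs.
have -> : s + (t - s) = t by ring.
by rewrite !clamp_id.
Qed.

Lemma Rpower_pos x y : 0 < Rpower x y.
Proof. exact: exp_pos. Qed.

Lemma exp_le_compat x y : x <= y -> exp x <= exp y.
Proof. by move=> [h|->]; [left; exact: exp_increasing | right]. Qed.

Lemma Rpower_small (s eps : R) : 0 < s -> 0 < eps ->
  exists delta, 0 < delta /\ forall t, 0 < t < delta -> Rpower t s < eps.
Proof.
move=> hs he; exists (Rpower eps (/ s)); split; first exact: Rpower_pos.
move=> t ht.
have -> : eps = Rpower (Rpower eps (/ s)) s by rewrite Rpower_mult Rinv_l ?Rpower_1 //; lra.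
by apply: Rlt_Rpower_l.
Qed.

Lemma filterlim_Rpower_0 (s c : R) : 0 < s ->
  filterlim (fun t => c * Rpower t s) (at_right 0) (locally 0).
Proof.
move=> hs; apply/(@filterlim_normP R R_NormedModule) => eps he.
have [d [hd0 hd]] := @Rpower_small s (eps / (Rabs c + 1)) hs
   ltac:(apply: Rdiv_lt_0_compat => //; have := Rabs_pos c; lra).
exists (mkposreal d hd0) => t ht ht0.
have ht' : Rabs (t - 0) < d := ht.
rewrite Rminus_0_r Rabs_pos_eq in ht'; last lra.
have h := hd t (conj ht0 ht').
change (Rabs (c * Rpower t s - 0) < eps).
rewrite Rminus_0_r Rabs_mult (Rabs_pos_eq (Rpower _ _)); last by left; exact: Rpower_pos.
have hc := Rabs_pos c.
apply: (Rle_lt_trans _ ((Rabs c + 1) * Rpower t s)).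
  by have := Rpower_pos t s; nra.
apply: (Rlt_le_trans _ ((Rabs c + 1) * (eps / (Rabs c + 1)))).
  by apply: Rmult_lt_compat_l => //; lra.
by right; field; lra.
Qed.

Lemma is_derive_Rpower (s x : R) : 0 < x -> is_derive (fun t => Rpower t s) x (s * Rpower x (s - 1)).
Proof. by move=> hx; apply/is_derive_Reals; exact: derivable_pt_lim_power. Qed.

Lemma continuous_Rpower (s x : R) : 0 < x -> continuous (fun t => Rpower t s) x.
Proof.
move=> hx; apply: (@ex_derive_continuous R_AbsRing R_NormedModule).
by eexists; exact: is_derive_Rpower.
Qed.

(** Banach's fixed point theorem. The contraction is stated for every common bound [d] of the
    differences, which avoids a sup norm on functions that matter only on [0,L]. Closedness of [P]
    is asked only for sequences converging at the geometric rate of the iteration. *)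
Lemma picard_pair (V W : Banach) (L : R) (P : (R -> V) -> (R -> W) -> Prop)
    (Fx : (R -> V) -> (R -> W) -> R -> V) (Fy : (R -> V) -> (R -> W) -> R -> W)
    (x0 : R -> V) (y0 : R -> W) (d0 : R) :
  P x0 y0 -> (forall x y, P x y -> P (Fx x y) (Fy x y)) ->
  (forall x y x' y' d, P x y -> P x' y' ->
     (forall t, 0 <= t <= L -> norm (minus (x t) (x' t)) <= d /\ norm (minus (y t) (y' t)) <= d) ->
     forall t, 0 <= t <= L -> norm (minus (Fx x y t) (Fx x' y' t)) <= d / 2 /\
                               norm (minus (Fy x y t) (Fy x' y' t)) <= d / 2) ->
  (forall t, 0 <= t <= L -> norm (minus (Fx x0 y0 t) (x0 t)) <= d0 /\ norm (minus (Fy x0 y0 t) (y0 t)) <= d0) ->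
  (forall xs ys x y d, (forall k : nat, P (xs k) (ys k)) ->
     (forall k t, 0 <= t <= L -> norm (minus (xs k t) (x t)) <= d * (/2)^k /\
                                 norm (minus (ys k t) (y t)) <= d * (/2)^k) -> P x y) ->
  exists x y, P x y /\ forall t, 0 <= t <= L -> x t = Fx x y t /\ y t = Fy x y t.
Proof.
move=> hP0 hPF hcontr hd0 hclosed.
pose z := fix z (k : nat) : (R -> V) * (R -> W) :=
  match k with 0%N => (x0, y0) | S k => (Fx (z k).1 (z k).2, Fy (z k).1 (z k).2) end.
have hPz : forall k, P (z k).1 (z k).2 by elim=> [//|k IH]; exact: hPF.
have hz : forall k t, 0 <= t <= L -> norm (minus ((z k.+1).1 t) ((z k).1 t)) <= d0 * (/2)^k /\
     norm (minus ((z k.+1).2 t) ((z k).2 t)) <= d0 * (/2)^k.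
  elim=> [|k IH] t ht.
    by rewrite Rmult_1_r; exact: hd0.
  have := hcontr _ _ _ _ _ (hPz k.+1) (hPz k) IH t ht.
  have -> : d0 * (/2)^k.+1 = d0 * (/2)^k / 2 by rewrite /=; field.
  by [].
have hx : forall t, exists x : V, 0 <= t <= L -> forall k, norm (minus ((z k).1 t) x) <= 2 * d0 * (/2)^k.
  move=> t; case: (classic (0 <= t <= L)) => ht; last by exists zero => /ht.
  have [x hx] := geometric_lim (fun k => proj1 (hz k t ht)).
  by exists x.
have hy : forall t, exists y : W, 0 <= t <= L -> forall k, norm (minus ((z k).2 t) y) <= 2 * d0 * (/2)^k.
  move=> t; case: (classic (0 <= t <= L)) => ht; last by exists zero => /ht.
  have [y hy] := geometric_lim (fun k => proj2 (hz k t ht)).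
  by exists y.
pose x t := proj1_sig (constructive_indefinite_description _ (hx t)).
pose y t := proj1_sig (constructive_indefinite_description _ (hy t)).
have hxE t : 0 <= t <= L -> forall k, norm (minus ((z k).1 t) (x t)) <= 2 * d0 * (/2)^k.
  exact: (proj2_sig (constructive_indefinite_description _ (hx t))).
have hyE t : 0 <= t <= L -> forall k, norm (minus ((z k).2 t) (y t)) <= 2 * d0 * (/2)^k.
  exact: (proj2_sig (constructive_indefinite_description _ (hy t))).
have hP : P x y.
  apply: (hclosed (fun k => (z k).1) (fun k => (z k).2) x y (2 * d0)) => // k t ht.
  by split; [exact: hxE | exact: hyE].
exists x, y; split=> // t ht.
have hd : 0 <= d0 by have := proj1 (hd0 t ht); have := norm_ge_0 (minus (Fx x0 y0 t) (x0 t)); lra.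
have small eps : 0 < eps -> exists k, 2 * d0 * (/2)^k <= eps / 2.
  move=> he; have [k hk] := @pow_half_small (2 * d0) (eps / 2) ltac:(lra) ltac:(lra).
  by exists k; left; exact: hk.
split; apply: norm_minus_small => eps he; have [k hk] := small eps he.
- have [h1 _] := hcontr _ _ _ _ _ (hPz k) hP (fun t ht => conj (hxE t ht k) (hyE t ht k)) t ht.
  have h2 := hxE t ht k.+1; rewrite /= in h2.
  have h3 := norm_minus_trans (x t) (Fx (z k).1 (z k).2 t) (Fx x y t).
  have h4 := norm_minusC (x t) (Fx (z k).1 (z k).2 t).
  have hp := pow_le (/2) k ltac:(lra).
  have : 2 * d0 * (/ 2 * (/ 2) ^ k) = 2 * d0 * (/2)^k / 2 by field.
  lran.
- have [_ h1] := hcontr _ _ _ _ _ (hPz k) hP (fun t ht => conj (hxE t ht k) (hyE t ht k)) t ht.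
  have h2 := hyE t ht k.+1; rewrite /= in h2.
  have h3 := norm_minus_trans (y t) (Fy (z k).1 (z k).2 t) (Fy x y t).
  have h4 := norm_minusC (y t) (Fy (z k).1 (z k).2 t).
  have : 2 * d0 * (/ 2 * (/ 2) ^ k) = 2 * d0 * (/2)^k / 2 by field.
  lran.
Qed.

(** * Convolution with singular kernels *)

Lemma is_RInt_gen_ext_0 (V : NormedModule R_AbsRing) (f g : R -> V) (tau : R) (v : V) : 0 < tau ->
  (forall r, 0 < r < tau -> f r = g r) ->
  is_RInt_gen f (at_right 0) (at_point tau) v -> is_RInt_gen g (at_right 0) (at_point tau) v.
Proof.
move=> h0 hfg h; refine (is_RInt_gen_ext _ _ _ _ h).
apply: (Filter_prod _ _ _ (fun r => 0 < r <= tau) (fun r => r = tau)).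
- exists (mkposreal tau h0) => y hy hy0.
  have : Rabs (y - 0) < tau := hy; rewrite Rminus_0_r Rabs_pos_eq; lra.
- by [].
- move=> x y hx -> z /=; rewrite Rmin_left ?Rmax_right; try lra.
  by move=> hz; apply: hfg; lra.
Qed.

(** [U1] is [U] seen as a map into [B1], with an integrable singularity at 0. Times are cut at [L0]
    because the fractional kernel is controlled for small times only. *)
Record smoothing_kernel (B B1 : Banach) (i1 : B1 -> B) (U : R -> B -> B) (U1 : R -> B -> B1)
    (K om L0 : R) : Prop := {
  sk_K : 0 < K;
  sk_om : 0 <= om < 1;
  sk_lift : forall t x, 0 < t < L0 -> i1 (U1 t x) = U t x;
  sk_minus : forall t (x y : B), 0 < t < L0 -> U1 t (minus x y) = minus (U1 t x) (U1 t y);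
  sk_bound : forall t x, 0 < t < L0 -> norm (U1 t x) <= K * Rpower t (- om) * norm x;
  sk_cont : forall t x, 0 < t < L0 -> continuous (fun s => U1 s x) t }.

Section Kernel.
Context (B B1 : Banach) (i1 : B1 -> B) (U : R -> B -> B) (U1 : R -> B -> B1) (K om L0 : R).
Context (hi1 : is_linear i1) (hinj : forall x y, i1 x = i1 y -> x = y).
Context (hk : smoothing_kernel i1 U U1 K om L0).

(** [kap] times t^(1-om) is the integral of K r^(-om) over [0,t]. *)
Let kap := K / (1 - om).

Lemma kernel_mass_gt0 : 0 < kap.
Proof. by have := sk_om hk; have := sk_K hk; move=> *; apply: Rdiv_lt_0_compat; lra. Qed.

Lemma kernel_continuous (e : R -> B) (r : R) : 0 < r < L0 -> continuous e r ->
  continuous (fun r => U1 r (e r)) r.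
Proof.
move=> hr /continuous_normP he; apply/continuous_normP => eps heps.
have [d1 [hd1 h1]] := proj1 (continuous_normP _ _) (sk_cont hk hr (x:=e r)) (eps/2) ltac:(lra).
have [d2 [hd2 h2]] := proj1 (continuous_normP _ _) (continuous_Rpower (s := - om) (proj1 hr)) 1 Rlt_0_1.
(* Bounds the operators [U1 r'] for all [r'] close enough to [r]; with it, strong continuity becomes
   joint continuity along [e]. *)
pose C := K * (Rpower r (- om) + 1).
have hC : 0 < C by apply: Rmult_lt_0_compat; [exact: sk_K hk | have := Rpower_pos r (-om); lra].
have [d3 [hd3 h3]] := he (eps / (2 * C)) ltac:(apply: Rdiv_lt_0_compat; lra).
exists (Rmin (Rmin d1 d2) (Rmin d3 (Rmin r (L0 - r)))); split.
  by do 3 (apply: Rmin_pos => //); lra.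
move=> r' hr'.
have l1 := Rmin_l d1 d2; have l2 := Rmin_r d1 d2; have l3 := Rmin_l r (L0 - r); have l4 := Rmin_r r (L0 - r).
have l5 := Rmin_l d3 (Rmin r (L0 - r)); have l6 := Rmin_r d3 (Rmin r (L0 - r)).
have l7 := Rmin_l (Rmin d1 d2) (Rmin d3 (Rmin r (L0 - r))).
have l8 := Rmin_r (Rmin d1 d2) (Rmin d3 (Rmin r (L0 - r))).
have hr2 : 0 < r' < L0 by move: hr'; rewrite /Rabs; case: Rcase_abs; lra.
have g1 := h1 r' ltac:(lra); have g2 : Rabs (Rpower r' (- om) - Rpower r (- om)) < 1 by exact: (h2 r' ltac:(lra)).
have g3 := h3 r' ltac:(lra).
have g4 := norm_minus_trans (U1 r' (e r')) (U1 r' (e r)) (U1 r (e r)).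
have g5 : norm (minus (U1 r' (e r')) (U1 r' (e r))) <= eps / 2.
  rewrite -(sk_minus hk) //.
  apply: Rle_trans (@sk_bound _ _ _ _ _ _ _ _ hk _ _ hr2) _.
  apply: (Rle_trans _ (C * (eps / (2 * C)))); last by right; field; lra.
  apply: Rmult_le_compat; last by left.
  - by apply: Rmult_le_pos; [left; exact: sk_K hk | left; exact: Rpower_pos].
  - exact: norm_ge_0.
  - apply: Rmult_le_compat_l; first by left; exact: sk_K hk.
    by have := Rle_abs (Rpower r' (- om) - Rpower r (- om)); lra.
lran.
Qed.

Lemma kernel_majorant_derive (M r : R) : 0 < r ->
  is_derive (fun r => kap * M * Rpower r (1 - om)) r (K * M * Rpower r (- om)).
Proof.
move=> hr.
have h := is_derive_scal (fun t => Rpower t (1 - om)) r (kap * M) _ (is_derive_Rpower (1 - om) hr).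
have -> : K * M * Rpower r (- om) = kap * M * ((1 - om) * Rpower r (1 - om - 1)) => //.
have -> : 1 - om - 1 = - om by ring.
by rewrite /kap; field; have := sk_om hk; lra.
Qed.

Lemma kernel_majorant_continuous (M r : R) : 0 < r ->
  continuous (fun r => K * M * Rpower r (- om)) r.
Proof.
move=> hr; apply: (@continuous_scal_r _ R_AbsRing R_NormedModule (K * M) (fun r => Rpower r (- om))).
exact: continuous_Rpower.
Qed.

Lemma kernel_dom (M r : R) (x : B) : 0 < r < L0 -> norm x <= M ->
  norm (U1 r x) <= K * M * Rpower r (- om).
Proof.
move=> hr hx; apply: Rle_trans (@sk_bound _ _ _ _ _ _ _ _ hk _ _ hr) _.
have h1 := sk_K hk; have h2 := Rpower_pos r (- om).
have : K * Rpower r (- om) * norm x <= K * Rpower r (- om) * M.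
  by apply: Rmult_le_compat_l => //; nra.
lra.
Qed.

Lemma kernel_integral (e : R -> B) (M tau : R) : 0 < tau < L0 -> (forall r, continuous e r) ->
  (forall r, 0 < r <= tau -> norm (e r) <= M) ->
  exists v, is_RInt_gen (fun r => U1 r (e r)) (at_right 0) (at_point tau) v /\
    norm v <= kap * M * Rpower tau (1 - om).
Proof.
move=> ht he hM.
have om_ := sk_om hk.
have hM0 : 0 <= M by apply: Rle_trans (norm_ge_0 (e tau)) (hM tau _); lra.
have [v [hv [hn _]]] := @singular_integral B1 (fun r => 0 < r <= tau) (at_right 0) (at_point tau) _ _
  (fun r => U1 r (e r)) (fun r => kap * M * Rpower r (1 - om)) (fun r => K * M * Rpower r (- om))
  0 (kap * M * Rpower tau (1 - om))
  ltac:(move=> x y z ? ? ?; lra)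
  ltac:(exists (mkposreal tau (proj1 ht)) => y hy hy0;
     have : Rabs (y - 0) < tau := hy; rewrite Rminus_0_r Rabs_pos_eq; lra)
  ltac:(rewrite /at_point; lra)
  ltac:(move=> x hx; apply: kernel_continuous => //; lra)
  ltac:(move=> x hx; apply: kernel_majorant_derive; lra)
  ltac:(move=> x hx; apply: kernel_majorant_continuous; lra)
  ltac:(move=> x hx; apply: kernel_dom; [lra | exact: hM])
  ltac:(apply: filterlim_Rpower_0; lra)
  ltac:(move=> P hP; exact: locally_singleton hP).
exists v; split=> //.
rewrite Rminus_0_r Rabs_pos_eq in hn => //.
have := kernel_mass_gt0; have := Rpower_pos tau (1 - om) => h1 h2.
by apply: Rmult_le_pos; [apply: Rmult_le_pos; lra | lra].
Qed.

(** Away from 0 the integral is proper, and this bound tends to 0 as [t] tends to [s]. *)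
Lemma kernel_integral_far (e : R -> B) (M s t : R) : 0 < s -> s <= t -> t < L0 ->
  (forall r, continuous e r) ->
  (forall r, s <= r <= t -> norm (e r) <= M) ->
  ex_RInt (fun r => U1 r (e r)) s t /\
  norm (RInt (fun r => U1 r (e r)) s t) <= kap * M * Rabs (Rpower t (1 - om) - Rpower s (1 - om)).
Proof.
move=> hs hst ht he hM.
have hM0 : 0 <= M by apply: Rle_trans (norm_ge_0 (e s)) (hM s _); lra.
have [h1 h2] := @integral_le_majorant B1 (fun r => s <= r <= t) (fun r => U1 r (e r))
  (fun r => kap * M * Rpower r (1 - om)) (fun r => K * M * Rpower r (- om)) s t
  ltac:(move=> x y z ? ? ?; lra)
  ltac:(move=> x hx; apply: kernel_continuous => //; lra)
  ltac:(move=> x hx; apply: kernel_majorant_derive; lra)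
  ltac:(move=> x hx; apply: kernel_majorant_continuous; lra)
  ltac:(move=> x hx; apply: kernel_dom; [lra | exact: hM])
  ltac:(lra) ltac:(lra).
split=> //; apply: Rle_trans h2 _; right.
rewrite -Rmult_minus_distr_l Rabs_mult (Rabs_pos_eq (kap * M)) //.
by apply: Rmult_le_pos => //; left; exact: kernel_mass_gt0.
Qed.

(** The variable is chosen so that the singularity sits at [r = 0] for every [tau]; one majorant
    then serves all of them. *)
Definition conv (c : R -> B) (tau : R) : B1 :=
  if Rlt_dec 0 tau then RInt_gen (fun r => U1 r (c (tau - r))) (at_right 0) (at_point tau) else zero.

Lemma continuous_reflect (c : R -> B) (tau : R) : (forall r, continuous c r) ->
  forall r, continuous (fun r => c (tau - r)) r.
Proof.
move=> hc r; apply: (continuous_comp (fun r => tau - r) c) => //.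
apply: (@continuous_minus _ R_AbsRing R_NormedModule); [exact: continuous_const | exact: continuous_id].
Qed.

Lemma conv_le0 (c : R -> B) (tau : R) : tau <= 0 -> conv c tau = zero.
Proof. by move=> h; rewrite /conv; case: Rlt_dec => // h0; lra. Qed.

Lemma conv_gt0 (c : R -> B) (tau : R) : 0 < tau ->
  conv c tau = RInt_gen (fun r => U1 r (c (tau - r))) (at_right 0) (at_point tau).
Proof. by move=> h; rewrite /conv; case: Rlt_dec. Qed.

Lemma conv_correct (c : R -> B) (tau : R) : 0 < tau < L0 -> (forall r, continuous c r) ->
  is_RInt_gen (fun r => U1 r (c (tau - r))) (at_right 0) (at_point tau) (conv c tau).
Proof.
move=> ht hc; rewrite /conv; case: Rlt_dec => h0; last lra.
have hm : exists M, forall r, 0 < r <= tau -> norm (c (tau - r)) <= M.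
  have hC : Ccurve 0 tau (fun r => c (tau - r)).
    by apply: Ccurve_of_continuous => r _; exact: continuous_reflect.
  have [m [_ hm]] := Ccurve_max (Rlt_le _ _ h0) hC.
  by exists (norm (c (tau - m))) => r hr; apply: hm; lra.
have [M hM] := hm.
have [v [hv _]] := kernel_integral ht (continuous_reflect (tau:=tau) hc) hM.
by rewrite (is_RInt_gen_unique _ _ hv).
Qed.

Lemma conv_bound (c : R -> B) (M tau : R) : 0 <= tau < L0 -> (forall r, continuous c r) ->
  0 <= M -> (forall r, 0 <= r <= tau -> norm (c r) <= M) ->
  norm (conv c tau) <= kap * M * Rpower tau (1 - om).
Proof.
move=> ht hc hM0 hM.
rewrite /conv; case: Rlt_dec => h0 /=; last first.
  rewrite norm_zero; have := kernel_mass_gt0; have := Rpower_pos tau (1 - om) => ? ?.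
  by apply: Rmult_le_pos; [apply: Rmult_le_pos; lra | lra].
have [v [hv hn]] := @kernel_integral (fun r => c (tau - r)) M tau ltac:(lra) (continuous_reflect (tau:=tau) hc)
   ltac:(move=> r hr; apply: hM; lra).
by rewrite (is_RInt_gen_unique _ _ hv).
Qed.

Lemma conv_minus (c c' : R -> B) (tau : R) : 0 <= tau < L0 -> (forall r, continuous c r) ->
  (forall r, continuous c' r) ->
  conv (fun s => minus (c s) (c' s)) tau = minus (conv c tau) (conv c' tau).
Proof.
move=> ht hc hc'.
case: (Rlt_dec 0 tau) => h0; last first.
  by rewrite !conv_le0 ?minus_eq_zero //; lra.
rewrite conv_gt0 //.
refine (is_RInt_gen_unique _ _ (is_RInt_gen_ext_0 (f := fun r => minus (U1 r (c (tau - r))) (U1 r (c' (tau - r)))) h0 _ _)).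
- by move=> r hr; rewrite (sk_minus hk) //; lra.
- by refine (is_RInt_gen_minus _ _ _ _ (conv_correct _ hc) (conv_correct _ hc')); lra.
Qed.

(** The increment is the integral over [0,s] of [U1 r] applied to c(t-r) - c(s-r), governed by the
    modulus of continuity of [c], plus the integral over [s,t], governed by the kernel. The case
    [s = 0] is separate because [Rpower 0 (1 - om)] is 1. *)
Lemma conv_increment (c : R -> B) (L M eta s t : R) : 0 <= s -> s <= t -> t <= L -> L < L0 ->
  (forall r, continuous c r) -> (forall r, norm (c r) <= M) ->
  (forall r, norm (minus (c (r + (t - s))) (c r)) <= eta) ->
  norm (minus (conv c t) (conv c s)) <=
    kap * eta * Rpower L (1 - om) +
    (if Rlt_dec 0 s then kap * M * Rabs (Rpower t (1 - om) - Rpower s (1 - om)) else kap * M * Rpower t (1 - om)).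
Proof.
move=> hs hst htL hL hc hM heta.
have om_ := sk_om hk.
have hM0 : 0 <= M by apply: Rle_trans (norm_ge_0 _) (hM 0).
have heta0 : 0 <= eta by apply: Rle_trans (norm_ge_0 _) (heta 0).
have hkap := kernel_mass_gt0.
have hpos : 0 <= kap * eta * Rpower L (1 - om).
  by have := Rpower_pos L (1-om) => ?; apply: Rmult_le_pos; [apply: Rmult_le_pos; lra | lra].
case: Rlt_dec => h0 /=; last first.
  rewrite (@conv_le0 c s); last lra.
  rewrite minus_zero_r.
  have := @conv_bound c M t ltac:(lra) hc hM0 (fun r _ => hM r); lran.
have hst' : 0 < s < L0 by lra.
have ht' : 0 < t < L0 by lra.
have i1' := conv_correct hst' hc; have i2 := conv_correct ht' hc.
have hd : forall r, continuous (fun r => minus (c (t - r)) (c (s - r))) r.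
  move=> r; apply: (@continuous_minus _ R_AbsRing B); exact: continuous_reflect.
have [v [hv hvn]] := @kernel_integral (fun r => minus (c (t - r)) (c (s - r))) eta s hst' hd
  ltac:(move=> r hr; have -> : t - r = s - r + (t - s) by [ring]; exact: heta).
have [ef nf] := @kernel_integral_far (fun r => c (t - r)) M s t h0 hst ltac:(lra) (continuous_reflect (tau:=t) hc)
  (fun r _ => hM _).
have [w [hw _]] := @kernel_integral (fun r => c (t - r)) M s hst' (continuous_reflect (tau:=t) hc) (fun r _ => hM _).
have e1 : conv c t = plus w (RInt (fun r => U1 r (c (t - r))) s t).
  rewrite -(is_RInt_gen_unique _ _ i2).
  refine (is_RInt_gen_unique _ _ (is_RInt_gen_Chasles _ s _ _ hw _)).
  by apply/is_RInt_gen_at_point; exact: RInt_correct.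
have e2 : v = minus w (conv c s).
  rewrite -(is_RInt_gen_unique _ _ hv).
  refine (is_RInt_gen_unique _ _ (is_RInt_gen_ext_0 (f := fun r => minus (U1 r (c (t - r))) (U1 r (c (s - r)))) h0 _ _)).
  - by move=> r hr; rewrite (sk_minus hk) //; lra.
  - exact (is_RInt_gen_minus _ _ _ _ hw i1').
have -> : minus (conv c t) (conv c s) = plus v (RInt (fun r => U1 r (c (t - r))) s t).
  by rewrite e1 e2 /minus -!plus_assoc; congr plus; exact: plus_comm.
apply: Rle_trans (norm_triangle _ _) _.
apply: Rplus_le_compat => //.
apply: Rle_trans hvn _.
apply: Rmult_le_compat_l; first by apply: Rmult_le_pos; lra.
apply: Rle_Rpower_l; lra.
Qed.

Lemma conv_Ccurve (c : R -> B) (L : R) : 0 <= L < L0 -> Ccurve 0 L c ->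
  Ccurve 0 L (conv (fun s => c (clamp 0 L s))).
Proof.
move=> hL hcc.
have hc := Ccurve_clamp (proj1 hL) hcc.
have om_ := sk_om hk.
have [m [hm hM]] := Ccurve_max (proj1 hL) hcc.
pose M := norm (c m).
have hM' : forall r, norm (c (clamp 0 L r)) <= M by move=> r; apply: hM; apply: clamp_in; lra.
have hM0 : 0 <= M by exact: norm_ge_0.
have hkap := kernel_mass_gt0.
apply/CcurveP => t ht eps he.
(* Chosen so that a modulus of continuity eps / (2A) makes the first term of [conv_increment] at
   most eps / 2; [C] below does the same for the second term. *)
pose A := kap * Rpower L (1 - om) + 1.
have hA : 0 < A by have := Rpower_pos L (1-om) => ?; rewrite /A; nra.
have [d1 [hd1 hu]] := Ccurve_unif (proj1 hL) hcc (eps := eps / (2 * A)) ltac:(apply: Rdiv_lt_0_compat; lra).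
have hu' : forall q, 0 <= q < d1 -> forall r, norm (minus (c (clamp 0 L (r + q))) (c (clamp 0 L r))) <= eps / (2 * A).
  move=> q hq r; apply: hu; try (apply: clamp_in; lra).
  apply: Rle_lt_trans (clamp_lip _ _ _ _) _.
  have -> : r + q - r = q by ring.
  rewrite Rabs_pos_eq; lra.
have hAe : kap * (eps / (2 * A)) * Rpower L (1 - om) <= eps / 2.
  have -> : eps / 2 = (eps / (2 * A)) * A by field; lra.
  have : 0 < eps / (2 * A) by apply: Rdiv_lt_0_compat; lra.
  by move: (eps / (2 * A)) => q hq; rewrite /A; nra.
have inc s' t' : 0 <= s' -> s' <= t' -> t' <= L -> t' - s' < d1 -> _ :=
  fun h1 h2 h3 h4 => @conv_increment (fun s => c (clamp 0 L s)) L M (eps / (2 * A)) s' t' h1 h2 h3 (proj2 hL) hc hM'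
     (hu' (t' - s') (conj (ltac:(lra) : 0 <= t' - s') h4)).
pose C := kap * M + 1.
have hC : 0 < C by rewrite /C; nra.
case: (Rlt_dec 0 t) => h0.
- have [d2 [hd2 hp]] := proj1 (continuous_normP _ _) (continuous_Rpower (s := 1 - om) h0) (eps / (2 * C)) ltac:(apply: Rdiv_lt_0_compat; lra).
  exists (Rmin (Rmin d1 d2) t); split; first by do 2 (apply: Rmin_pos => //).
  move=> t' ht' hlt.
  have l1 := Rmin_l d1 d2; have l2 := Rmin_r d1 d2; have l3 := Rmin_l (Rmin d1 d2) t; have l4 := Rmin_r (Rmin d1 d2) t.
  have hpp : kap * M * Rabs (Rpower t' (1 - om) - Rpower t (1 - om)) < eps / 2.
    have h1 : Rabs (Rpower t' (1 - om) - Rpower t (1 - om)) < eps / (2 * C) by apply: hp; lra.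
    have h2 := Rabs_pos (Rpower t' (1 - om) - Rpower t (1 - om)).
    have -> : eps / 2 = C * (eps / (2 * C)) by field; lra.
    apply: (Rle_lt_trans _ (C * Rabs (Rpower t' (1 - om) - Rpower t (1 - om)))).
      rewrite /C; nra.
    exact: Rmult_lt_compat_l.
  have t'0 : 0 < t' by move: hlt; rewrite /Rabs; case: Rcase_abs; lra.
  case: (Rle_dec t t') => hle.
    have := inc t t' ltac:(lra) hle ltac:(lra) ltac:(move: hlt; rewrite /Rabs; case: Rcase_abs; lra).
    case: Rlt_dec => //= _; lran.
  have := inc t' t ltac:(lra) ltac:(lra) ltac:(lra) ltac:(move: hlt; rewrite /Rabs; case: Rcase_abs; lra).
  case: Rlt_dec => //= _.
  rewrite Rabs_minus_sym norm_minusC; lran.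
- have t0 : t = 0 by lra.
  have [d2 [hd2 hp]] := @Rpower_small (1 - om) (eps / (2 * C)) ltac:(lra) ltac:(apply: Rdiv_lt_0_compat; lra).
  exists (Rmin d1 d2); split; first by apply: Rmin_pos.
  move=> t' ht' hlt; subst t.
  have l1 := Rmin_l d1 d2; have l2 := Rmin_r d1 d2.
  rewrite Rminus_0_r Rabs_pos_eq in hlt; last lra.
  case: (Req_dec t' 0) => ht0.
    by rewrite ht0 minus_eq_zero norm_zero.
  have := inc 0 t' ltac:(lra) ltac:(lra) ltac:(lra) ltac:(lra).
  case: Rlt_dec => //= _.
  have : kap * M * Rpower t' (1 - om) < eps / 2.
    have h1 := hp t' ltac:(lra); have h2 := Rpower_pos t' (1 - om).
    have -> : eps / 2 = C * (eps / (2 * C)) by field; lra.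
    apply: (Rle_lt_trans _ (C * Rpower t' (1 - om))); first by rewrite /C; nra.
    exact: Rmult_lt_compat_l.
  lran.
Qed.

End Kernel.

(** [gam] will be 1 or [beta], with a minus sign for the backward equation. Clamping makes the curve
    continuous on R and keeps its values on [0,L]. *)
Definition duhamel (B B1 : Banach) (U1 : R -> B -> B1) (V1 : R -> B1) (gam L : R) (c : R -> B) (tau : R) : B1 :=
  plus (V1 tau) (scal gam (conv U1 (fun s => c (clamp 0 L s)) tau)).

(** Stated in [B] and for the curve as given, like the definitions of mild solutions; the case
    [tau = 0] mirrors [is_RInt_sing_right]. *)
Definition duhamel_eqn (B B1 : Banach) (i1 : B1 -> B) (U : R -> B -> B) (V : R -> B) (gam : R)
    (c : R -> B) (x : R -> B1) (tau : R) : Prop :=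
  exists v, ((tau = 0 /\ v = zero) \/
      (0 < tau /\ is_RInt_gen (fun r => U r (c (tau - r))) (at_right 0) (at_point tau) v)) /\
    i1 (x tau) = plus (V tau) (scal gam v).

Section Duhamel.
Context (B B1 : Banach) (i1 : B1 -> B) (U : R -> B -> B) (U1 : R -> B -> B1) (K om L0 : R).
Context (hi1 : is_linear i1) (hinj : forall x y, i1 x = i1 y -> x = y).
Context (hk : smoothing_kernel i1 U U1 K om L0).
Context (V : R -> B) (V1 : R -> B1) (gam L : R).
Context (hL : 0 <= L < L0) (hV : forall t, 0 <= t <= L -> i1 (V1 t) = V t) (hVc : Ccurve 0 L V1).

(** Norm of the operator sending [c] to [gam] times its convolution, for sup norms on [0,L]. It
    tends to 0 with [L]. *)
Let th := Rabs gam * (K / (1 - om)) * Rpower L (1 - om).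

(** The convolution converges already in [B1], and [i1] is linear, continuous and injective; hence
    the equation in [B] is equivalent to one in [B1]. *)
Lemma duhamel_eqnP (c : R -> B) (x : R -> B1) (tau : R) : Ccurve 0 L c -> 0 <= tau <= L ->
  (duhamel_eqn i1 U V gam c x tau <-> x tau = duhamel U1 V1 gam L c tau).
Proof.
move=> hc ht.
have hcc := Ccurve_clamp (proj1 hL) hc.
have hconv : (tau = 0 /\ i1 (conv U1 (fun s => c (clamp 0 L s)) tau) = zero) \/
      (0 < tau /\ is_RInt_gen (fun r => U r (c (tau - r))) (at_right 0) (at_point tau)
           (i1 (conv U1 (fun s => c (clamp 0 L s)) tau))).
  case: (Rlt_dec 0 tau) => h0; [right | left]; split; try lra.
  - have h := conv_correct hk (conj h0 (ltac:(lra) : tau < L0)) hcc.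
    refine (is_RInt_gen_ext_0 h0 _ (is_RInt_gen_linear hi1 h)) => r hr /=.
    by rewrite (sk_lift hk) ?clamp_id //; lra.
  - by rewrite conv_le0 ?linear_zero //; lra.
split.
- move=> [v [hv hx]]; apply: hinj; rewrite hx /duhamel (linear_plus _ hi1) (linear_scal _ hi1) hV //.
  congr plus; congr scal.
  case: hv => -[h1 h2]; case: hconv => -[h3 h4]; try lra.
  + by rewrite h2 h4.
  + by rewrite -(is_RInt_gen_unique _ _ h2) -(is_RInt_gen_unique _ _ h4).
- move=> hx; exists (i1 (conv U1 (fun s => c (clamp 0 L s)) tau)); split=> //.
  by rewrite hx /duhamel (linear_plus _ hi1) (linear_scal _ hi1) hV.
Qed.

Lemma contraction_ge0 : 0 <= th.
Proof.
have h1 := kernel_mass_gt0 hk; have h2 := Rpower_pos L (1 - om); have h3 := Rabs_pos gam.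
rewrite /th; apply: Rmult_le_pos; last lra.
by apply: Rmult_le_pos; lra.
Qed.

Lemma scal_conv_bound (c : R -> B) (M tau : R) : (forall r, continuous c r) -> 0 <= M ->
  (forall r, 0 <= r <= L -> norm (c r) <= M) -> 0 <= tau <= L ->
  norm (scal gam (conv U1 c tau)) <= th * M.
Proof.
move=> hc hM0 hM ht.
have om_ := sk_om hk; have h1 := kernel_mass_gt0 hk; have h3 := Rabs_pos gam.
rewrite norm_scal_R.
have h4 : norm (conv U1 c tau) <= K / (1 - om) * M * Rpower L (1 - om).
  case: (Rlt_dec 0 tau) => h0; last first.
    rewrite conv_le0 ?norm_zero; last lra.
    have := Rpower_pos L (1 - om) => ?; apply: Rmult_le_pos; last lra.
    by apply: Rmult_le_pos; lra.
  apply: Rle_trans (@conv_bound _ _ _ _ _ _ _ _ hk c M tau _ hc hM0 _) _; [lra | move=> r hr; apply: hM; lra |].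
  apply: Rmult_le_compat_l; first by apply: Rmult_le_pos; lra.
  by apply: Rle_Rpower_l; lra.
apply: Rle_trans (Rmult_le_compat_l _ _ _ h3 h4) _.
by right; rewrite /th; ring.
Qed.

Lemma duhamel_bound (c : R -> B) (M CV tau : R) : Ccurve 0 L c -> 0 <= M ->
  (forall r, 0 <= r <= L -> norm (c r) <= M) -> 0 <= tau <= L -> norm (V1 tau) <= CV ->
  norm (duhamel U1 V1 gam L c tau) <= CV + th * M.
Proof.
move=> hc hM0 hM ht hCV.
apply: Rle_trans (norm_triangle _ _) _; apply: Rplus_le_compat => //.
apply: scal_conv_bound => //; first exact: Ccurve_clamp (proj1 hL) hc.
by move=> r hr; rewrite clamp_id //; exact: hM.
Qed.

Lemma duhamel_diff (c c' : R -> B) (d tau : R) : Ccurve 0 L c -> Ccurve 0 L c' -> 0 <= d ->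
  (forall r, 0 <= r <= L -> norm (minus (c r) (c' r)) <= d) -> 0 <= tau <= L ->
  norm (minus (duhamel U1 V1 gam L c tau) (duhamel U1 V1 gam L c' tau)) <= th * d.
Proof.
move=> hc hc' hd0 hd ht.
have h := Ccurve_clamp (proj1 hL) hc; have h' := Ccurve_clamp (proj1 hL) hc'.
rewrite /duhamel minus_plus_l.
have -> : minus (scal gam (conv U1 (fun s => c (clamp 0 L s)) tau)) (scal gam (conv U1 (fun s => c' (clamp 0 L s)) tau))
  = scal gam (conv U1 (fun s => minus (c (clamp 0 L s)) (c' (clamp 0 L s))) tau).
  rewrite (conv_minus hk _ h h'); last lra.
  by rewrite /minus scal_distr_l scal_opp_r.
apply: scal_conv_bound => //.
- by move=> r; apply: (@continuous_minus _ R_AbsRing B).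
- by move=> r hr; rewrite clamp_id //; exact: hd.
Qed.

Lemma duhamel_Ccurve (c : R -> B) : Ccurve 0 L c -> Ccurve 0 L (duhamel U1 V1 gam L c).
Proof.
move=> hc; have h := conv_Ccurve hk hL hc.
move=> t ht.
apply: (filterlim_comp_2 (H := locally (scal gam (conv U1 (fun s => c (clamp 0 L s)) t)))).
- exact: hVc.
- apply: (filterlim_comp _ _ _ _ (fun y => scal gam y) _ (locally (conv U1 (fun s => c (clamp 0 L s)) t))).
  + exact: h.
  + exact: (@filterlim_scal_r R_AbsRing B1).
- exact: (@filterlim_plus R_AbsRing B1).
Qed.

End Duhamel.

Definition ball_curves (V W : Banach) (a T Rad : R) (x : R -> V) (y : R -> W) : Prop :=
  Ccurve a T x /\ Ccurve a T y /\
  forall t, a <= t <= T -> norm (x t) <= Rad /\ norm (y t) <= Rad.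

Lemma Ccurve_unif_lim (V : Banach) (L d : R) (xs : nat -> R -> V) (x : R -> V) :
  (forall k, Ccurve 0 L (xs k)) ->
  (forall k t, 0 <= t <= L -> norm (minus (xs k t) (x t)) <= d * (/2)^k) -> Ccurve 0 L x.
Proof.
move=> hxs hd; apply/CcurveP => t ht eps he.
have hd0 : 0 <= d by have := hd 0%N t ht; have := norm_ge_0 (minus (xs 0%N t) (x t)); rewrite /=; lra.
have [k hk] := @pow_half_small d (eps / 3) hd0 ltac:(lra).
have hkk := hk k (le_n _).
have [del [hdel h]] := proj1 (CcurveP _ _ _) (hxs k) t ht (eps/3) ltac:(lra).
exists del; split=> // t' ht' hlt.
have h1 := h t' ht' hlt; have h2 := hd k t ht; have h3 := hd k t' ht'.
have := norm_minus_trans (x t') (xs k t') (x t).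
have := norm_minus_trans (xs k t') (xs k t) (x t).
have := norm_minusC (x t') (xs k t').
lran.
Qed.

Lemma ball_curves_closed (V W : Banach) (L Rad d : R) (xs : nat -> R -> V) (ys : nat -> R -> W)
    (x : R -> V) (y : R -> W) :
  (forall k, ball_curves 0 L Rad (xs k) (ys k)) ->
  (forall k t, 0 <= t <= L -> norm (minus (xs k t) (x t)) <= d * (/2)^k /\
                              norm (minus (ys k t) (y t)) <= d * (/2)^k) ->
  ball_curves 0 L Rad x y.
Proof.
move=> hb hd; split; [|split].
- by apply: (Ccurve_unif_lim (xs := xs) (d := d)) => k; [case: (hb k) | move=> t ht; case: (hd k t ht)].
- by apply: (Ccurve_unif_lim (xs := ys) (d := d)) => k; [case: (hb k) => _ [] | move=> t ht; case: (hd k t ht)].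
- move=> t ht.
  have hd0 : 0 <= d by have := proj1 (hd 0%N t ht); have := norm_ge_0 (minus (xs 0%N t) (x t)); rewrite /=; lra.
  split; apply: Rle_plus_epsilon => eps he; have [k hk] := pow_half_small hd0 he;
    have hkk := hk k (le_n _); have [h1 h2] := hd k t ht; have [_ [_ h]] := hb k; have [h3 h4] := h t ht.
  + have := norm_le_minus (x t) (xs k t); have := norm_minusC (x t) (xs k t); lran.
  + have := norm_le_minus (y t) (ys k t); have := norm_minusC (y t) (ys k t); lran.
Qed.

(** Linear growth sends curves bounded by M to curves bounded by CV + M/2, and 2 CV is the fixed
    point of this map. Growth holds for all curves and so confines every solution to the ball of
    radius 2 CV; the Lipschitz bound is required on that ball only. *)
Lemma duhamel_pair (B B1 Bb B1b : Banach) (i1 : B1 -> B) (i1b : B1b -> Bb)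
    (U : R -> B -> B) (U1 : R -> B -> B1) (K om L0 : R)
    (Ub : R -> Bb -> Bb) (U1b : R -> Bb -> B1b) (Kb omb L0b : R)
    (hi1 : is_linear i1) (hinj : forall x y, i1 x = i1 y -> x = y)
    (hi1b : is_linear i1b) (hinjb : forall x y, i1b x = i1b y -> x = y)
    (hk : smoothing_kernel i1 U U1 K om L0) (hkb : smoothing_kernel i1b Ub U1b Kb omb L0b)
    (V : R -> B) (V1 : R -> B1) (Vb : R -> Bb) (V1b : R -> B1b) (gam gamb L CV Lam LamR : R)
    (hL : 0 < L) (hLL : L < L0) (hLb : L < L0b)
    (hV : forall t, 0 <= t <= L -> i1 (V1 t) = V t) (hVc : Ccurve 0 L V1)
    (hVb : forall t, 0 <= t <= L -> i1b (V1b t) = Vb t) (hVcb : Ccurve 0 L V1b)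
    (hCV : forall t, 0 <= t <= L -> norm (V1 t) <= CV /\ norm (V1b t) <= CV)
    (N : (R -> B1) -> (R -> B1b) -> R -> B) (Nb : (R -> B1) -> (R -> B1b) -> R -> Bb) :
  (forall x y, Ccurve 0 L x -> Ccurve 0 L y -> Ccurve 0 L (N x y) /\ Ccurve 0 L (Nb x y)) ->
  0 <= Lam -> 0 <= LamR ->
  (forall x y s, Ccurve 0 L x -> Ccurve 0 L y -> 0 <= s <= L ->
     norm (N x y s) <= Lam * norm (x s) /\ norm (Nb x y s) <= Lam * norm (y s)) ->
  (forall x y x' y' d, ball_curves 0 L (2 * CV) x y -> ball_curves 0 L (2 * CV) x' y' ->
     (forall t, 0 <= t <= L -> norm (minus (x t) (x' t)) <= d /\ norm (minus (y t) (y' t)) <= d) ->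
     forall s, 0 <= s <= L -> norm (minus (N x y s) (N x' y' s)) <= LamR * d /\
                             norm (minus (Nb x y s) (Nb x' y' s)) <= LamR * d) ->
  Rabs gam * (K / (1 - om)) * Rpower L (1 - om) * (Lam + LamR) <= / 2 ->
  Rabs gamb * (Kb / (1 - omb)) * Rpower L (1 - omb) * (Lam + LamR) <= / 2 ->
  unique_on 0 L (fun x y => Ccurve 0 L x /\ Ccurve 0 L y /\ forall t, 0 <= t <= L ->
     duhamel_eqn i1 U V gam (N x y) x t /\ duhamel_eqn i1b Ub Vb gamb (Nb x y) y t).
Proof.
move=> hN hLam hLamR hgrow hlip hs hsb.
have hL0 : 0 <= L < L0 by lra.
have hL0b : 0 <= L < L0b by lra.
set th := Rabs gam * (K / (1 - om)) * Rpower L (1 - om) in hs.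
set thb := Rabs gamb * (Kb / (1 - omb)) * Rpower L (1 - omb) in hsb.
have hth : 0 <= th := contraction_ge0 hk gam L.
have hthb : 0 <= thb := contraction_ge0 hkb gamb L.
have hCV0 : 0 <= CV by have := proj1 (hCV 0 ltac:(lra)); have := norm_ge_0 (V1 0); lra.
pose Fx x y := duhamel U1 V1 gam L (N x y).
pose Fy x y := duhamel U1b V1b gamb L (Nb x y).
have hs1 : th * Lam <= / 2 by nra.
have hs2 : th * LamR <= / 2 by nra.
have hsb1 : thb * Lam <= / 2 by nra.
have hsb2 : thb * LamR <= / 2 by nra.
have bound x y M : Ccurve 0 L x -> Ccurve 0 L y -> (forall t, 0 <= t <= L -> norm (x t) <= M) ->
    forall t, 0 <= t <= L -> norm (Fx x y t) <= CV + M / 2.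
  move=> hx hy hM t ht.
  have hM0 : 0 <= M by apply: Rle_trans (norm_ge_0 _) (hM t ht).
  apply: Rle_trans (@duhamel_bound _ _ _ _ _ _ _ _ hk V1 gam L hL0 (N x y) (Lam * M) CV t _ _ _ ht _) _.
  - exact: (proj1 (hN x y hx hy)).
  - exact: Rmult_le_pos.
  - move=> r hr; apply: Rle_trans (proj1 (hgrow x y r hx hy hr)) _.
    by apply: Rmult_le_compat_l => //; exact: hM.
  - exact: (proj1 (hCV t ht)).
  - rewrite -/th; nra.
have boundb x y M : Ccurve 0 L x -> Ccurve 0 L y -> (forall t, 0 <= t <= L -> norm (y t) <= M) ->
    forall t, 0 <= t <= L -> norm (Fy x y t) <= CV + M / 2.
  move=> hx hy hM t ht.
  have hM0 : 0 <= M by apply: Rle_trans (norm_ge_0 _) (hM t ht).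
  apply: Rle_trans (@duhamel_bound _ _ _ _ _ _ _ _ hkb V1b gamb L hL0b (Nb x y) (Lam * M) CV t _ _ _ ht _) _.
  - exact: (proj2 (hN x y hx hy)).
  - exact: Rmult_le_pos.
  - move=> r hr; apply: Rle_trans (proj2 (hgrow x y r hx hy hr)) _.
    by apply: Rmult_le_compat_l => //; exact: hM.
  - exact: (proj2 (hCV t ht)).
  - rewrite -/thb; nra.
have hPF x y : ball_curves 0 L (2 * CV) x y -> ball_curves 0 L (2 * CV) (Fx x y) (Fy x y).
  move=> [hx [hy hxy]]; split; [|split].
  - exact: (duhamel_Ccurve hk hL0 hVc (proj1 (hN x y hx hy))).
  - exact: (duhamel_Ccurve hkb hL0b hVcb (proj2 (hN x y hx hy))).
  - move=> t ht; split.
    + apply: Rle_trans (bound x y (2 * CV) hx hy (fun t ht => proj1 (hxy t ht)) t ht) _; lra.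
    + apply: Rle_trans (boundb x y (2 * CV) hx hy (fun t ht => proj2 (hxy t ht)) t ht) _; lra.
have hcontr x y x' y' d : ball_curves 0 L (2 * CV) x y -> ball_curves 0 L (2 * CV) x' y' ->
     (forall t, 0 <= t <= L -> norm (minus (x t) (x' t)) <= d /\ norm (minus (y t) (y' t)) <= d) ->
     forall t, 0 <= t <= L -> norm (minus (Fx x y t) (Fx x' y' t)) <= d / 2 /\
                               norm (minus (Fy x y t) (Fy x' y' t)) <= d / 2.
  move=> hP hP' hd t ht.
  have hd0 : 0 <= d by apply: Rle_trans (norm_ge_0 _) (proj1 (hd t ht)).
  have [hx [hy _]] := hP; have [hx' [hy' _]] := hP'.
  have hl := hlip x y x' y' d hP hP' hd.
  split.
  - apply: Rle_trans (@duhamel_diff _ _ _ _ _ _ _ _ hk V1 gam L hL0 (N x y) (N x' y') (LamR * d) t _ _ _ _ ht) _.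
    + exact: (proj1 (hN x y hx hy)).
    + exact: (proj1 (hN x' y' hx' hy')).
    + exact: Rmult_le_pos.
    + by move=> r hr; case: (hl r hr).
    + rewrite -/th; nra.
  - apply: Rle_trans (@duhamel_diff _ _ _ _ _ _ _ _ hkb V1b gamb L hL0b (Nb x y) (Nb x' y') (LamR * d) t _ _ _ _ ht) _.
    + exact: (proj2 (hN x y hx hy)).
    + exact: (proj2 (hN x' y' hx' hy')).
    + exact: Rmult_le_pos.
    + by move=> r hr; case: (hl r hr).
    + rewrite -/thb; nra.
have hP0 : ball_curves 0 L (2 * CV) V1 V1b.
  by split; [|split] => // t ht; have := hCV t ht; lra.
have sol_fix x y : Ccurve 0 L x -> Ccurve 0 L y -> forall t, 0 <= t <= L ->
   (duhamel_eqn i1 U V gam (N x y) x t /\ duhamel_eqn i1b Ub Vb gamb (Nb x y) y t <->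
    x t = Fx x y t /\ y t = Fy x y t).
  move=> hx hy t ht; have [h1 h2] := hN x y hx hy.
  by rewrite (duhamel_eqnP hi1 hinj hk gam hL0 hV x h1 ht) (duhamel_eqnP hi1b hinjb hkb gamb hL0b hVb y h2 ht).
(* The growth bound applied at a maximum of [norm x] absorbs half of it. *)
have apriori x y : Ccurve 0 L x -> Ccurve 0 L y -> (forall t, 0 <= t <= L -> x t = Fx x y t /\ y t = Fy x y t) ->
   ball_curves 0 L (2 * CV) x y.
  move=> hx hy hxy; split; [|split] => // t ht; split.
  - have [m [hm hM]] := Ccurve_max (Rlt_le _ _ hL) hx.
    have := bound x y _ hx hy hM m hm; rewrite -(proj1 (hxy m hm)); have := hM t ht; lra.
  - have [m [hm hM]] := Ccurve_max (Rlt_le _ _ hL) hy.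
    have := boundb x y _ hx hy hM m hm; rewrite -(proj2 (hxy m hm)); have := hM t ht; lra.
split.
(* The iteration starts at the free evolution, bounded by CV, and its first iterate is bounded by 2
   CV: hence 3 CV. *)
- have [x [y [hP hxy]]] := @picard_pair B1 B1b L (ball_curves 0 L (2 * CV)) Fx Fy V1 V1b (3 * CV) hP0 hPF hcontr
    ltac:(move=> t ht; have [_ [_ h]] := hPF _ _ hP0; have [h1 h2] := h t ht; have [h3 h4] := hCV t ht;
       have h5 := norm_minus_le (Fx V1 V1b t) (V1 t); have h6 := norm_minus_le (Fy V1 V1b t) (V1b t); split; lran)
    (fun xs ys x y d => @ball_curves_closed B1 B1b L (2 * CV) d xs ys x y).
  have [hx [hy _]] := hP.
  exists x, y; split=> //; split=> // t ht.
  by apply/sol_fix => //; exact: hxy.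
- move=> x y x' y' [hx [hy hxy]] [hx' [hy' hxy']].
  have h t ht := proj1 (sol_fix x y hx hy t ht) (hxy t ht).
  have h' t ht := proj1 (sol_fix x' y' hx' hy' t ht) (hxy' t ht).
  have hP := apriori x y hx hy h; have hP' := apriori x' y' hx' hy' h'.
  have [m1 [hm1 hM1]] := Ccurve_max (Rlt_le _ _ hL) (Ccurve_minus hx hx').
  have [m2 [hm2 hM2]] := Ccurve_max (Rlt_le _ _ hL) (Ccurve_minus hy hy').
  (* Both differences attain their maximum, so [D] is the distance of the two solutions; the
     contraction gives D <= D/2. *)
  set D := Rmax (norm (minus (x m1) (x' m1))) (norm (minus (y m2) (y' m2))).
  have hD t : 0 <= t <= L -> norm (minus (x t) (x' t)) <= D /\ norm (minus (y t) (y' t)) <= D.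
    move=> ht; split; [apply: Rle_trans (hM1 t ht) (Rmax_l _ _) | apply: Rle_trans (hM2 t ht) (Rmax_r _ _)].
  have hD2 t : 0 <= t <= L -> norm (minus (x t) (x' t)) <= D / 2 /\ norm (minus (y t) (y' t)) <= D / 2.
    move=> ht; have := hcontr x y x' y' D hP hP' hD t ht.
    by rewrite -(proj1 (h t ht)) -(proj2 (h t ht)) -(proj1 (h' t ht)) -(proj2 (h' t ht)).
  have hD0 : D <= 0.
    have : D <= D / 2 by apply: Rmax_lub; [exact: (proj1 (hD2 m1 hm1)) | exact: (proj2 (hD2 m2 hm2))].
    lra.
  move=> t ht; have [d1 d2] := hD t ht.
  split; apply: norm_minus_eq0; lran.
Qed.

(** * Forward-backward systems *)

Lemma is_RInt_reflect (V : NormedModule R_AbsRing) (g : R -> V) (t x y : R) (l : V) :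
  is_RInt g x y l <-> is_RInt (fun r => g (t - r)) (t - y) (t - x) l.
Proof.
have main : forall g x y, is_RInt g x y l -> is_RInt (fun r => g (t - r)) (t - y) (t - x) l.
  move=> {}g {}x {}y h.
  have h1 : is_RInt g (-1 * (t - x) + t) (-1 * (t - y) + t) l.
    have -> : -1 * (t - x) + t = x by ring.
    by have -> : -1 * (t - y) + t = y by ring.
  have h2 := is_RInt_opp _ _ _ _ (is_RInt_swap _ _ _ _ (is_RInt_comp_lin _ _ _ _ _ _ h1)).
  rewrite opp_opp in h2.
  apply: is_RInt_ext h2 => r _.
  have -> : -1 * r + t = t - r by ring.
  have -> : (-1 : R) = opp (one : R_AbsRing) by [].
  by rewrite scal_opp_one opp_opp.
split; first exact: main.
move=> /main.
have -> : t - (t - x) = x by ring.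
have -> : t - (t - y) = y by ring.
apply: is_RInt_ext => r _; by have -> : t - (t - r) = r by ring.
Qed.

Lemma is_RInt_shift (V : NormedModule R_AbsRing) (g : R -> V) (t x y : R) (l : V) :
  is_RInt g x y l <-> is_RInt (fun r => g (t + r)) (x - t) (y - t) l.
Proof.
have main : forall g x y t, is_RInt g x y l -> is_RInt (fun r => g (t + r)) (x - t) (y - t) l.
  move=> {}g {}x {}y {}t h.
  have h1 : is_RInt g (1 * (x - t) + t) (1 * (y - t) + t) l.
    have -> : 1 * (x - t) + t = x by ring.
    by have -> : 1 * (y - t) + t = y by ring.
  have h2 := is_RInt_comp_lin _ _ _ _ _ _ h1.
  apply: is_RInt_ext h2 => r _.
  have -> : 1 * r + t = t + r by ring.
  exact: scal_one.
split; first exact: main.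
move=> h; have := main _ _ _ (- t) h.
have -> : x - t - - t = x by ring.
have -> : y - t - - t = y by ring.
apply: is_RInt_ext => r _; by have -> : t + (- t + r) = r by ring.
Qed.

Lemma at_left_reflect (t : R) (P : R -> Prop) : at_left t P <-> at_right 0 (fun r => P (t - r)).
Proof.
have e1 (r : R) : t - r - t = - (r - 0) by ring.
have e2 (r : R) : t - r - 0 = - (r - t) by ring.
have e3 (r : R) : t - (t - r) = r by ring.
split=> -[d hd]; exists d => r hr h0.
- have hr' : Rabs (r - 0) < d := hr.
  apply: hd; last by change (t - r < t); change (0 < r) in h0; lra.
  by change (Rabs (t - r - t) < d); rewrite e1 Rabs_Ropp.
- have hr' : Rabs (r - t) < d := hr.
  rewrite -(e3 r); apply: hd; last by change (0 < t - r); change (r < t) in h0; lra.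
  by change (Rabs (t - r - 0) < d); rewrite e2 Rabs_Ropp.
Qed.

Lemma at_right_shift (t : R) (P : R -> Prop) : at_right t P <-> at_right 0 (fun r => P (t + r)).
Proof.
have e1 (r : R) : t + r - t = r - 0 by ring.
have e2 (r : R) : r - t - 0 = r - t by ring.
have e3 (r : R) : t + (r - t) = r by ring.
split=> -[d hd]; exists d => r hr h0.
- have hr' : Rabs (r - 0) < d := hr.
  apply: hd; last by change (t < t + r); change (0 < r) in h0; lra.
  by change (Rabs (t + r - t) < d); rewrite e1.
- have hr' : Rabs (r - t) < d := hr.
  rewrite -(e3 r); apply: hd; last by change (0 < r - t); change (t < r) in h0; lra.
  by change (Rabs (r - t - 0) < d); rewrite e2.
Qed.

Lemma is_RInt_gen_reflect (V : NormedModule R_AbsRing) (g : R -> V) (a t : R) (v : V) :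
  is_RInt_gen g (at_point a) (at_left t) v <->
  is_RInt_gen (fun r => g (t - r)) (at_right 0) (at_point (t - a)) v.
Proof.
split=> h P hP; have [Q S hQ hS hQS] := h P hP.
- apply: (Filter_prod _ _ _ (fun r => S (t - r)) (fun r => r = t - a)); [exact (proj1 (at_left_reflect t S) hS) | by [] |].
  move=> r y hr ->; have [w [hw hPw]] := hQS a (t - r) hQ hr.
  exists w; split=> //=; move/(is_RInt_reflect _ t): hw.
  by have -> : t - (t - r) = r by ring.
- apply: (Filter_prod _ _ _ (fun x => x = a) (fun y => Q (t - y))); [by [] | |].
    apply/at_left_reflect; refine (filter_mono _ hQ _) => r.
    by have -> : t - (t - r) = r by ring.
  move=> x y -> hy; have [w [hw hPw]] := hQS (t - y) (t - a) hy hS.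
  by exists w; split=> //=; apply/(is_RInt_reflect _ t).
Qed.

Lemma is_RInt_gen_shift (V : NormedModule R_AbsRing) (g : R -> V) (t T : R) (v : V) :
  is_RInt_gen g (at_right t) (at_point T) v <->
  is_RInt_gen (fun r => g (t + r)) (at_right 0) (at_point (T - t)) v.
Proof.
split=> h P hP; have [Q S hQ hS hQS] := h P hP.
- apply: (Filter_prod _ _ _ (fun r => Q (t + r)) (fun r => r = T - t)); [exact (proj1 (at_right_shift t Q) hQ) | by [] |].
  move=> r y hr ->; have [w [hw hPw]] := hQS (t + r) T hr hS.
  exists w; split=> //=; move/(is_RInt_shift _ t): hw.
  by have -> : t + r - t = r by ring.
- apply: (Filter_prod _ _ _ (fun x => Q (x - t)) (fun y => y = T)); [| by [] |].
    apply/at_right_shift; refine (filter_mono _ hQ _) => r.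
    by have -> : t + r - t = r by ring.
  move=> x y hx ->; have [w [hw hPw]] := hQS (x - t) (T - t) hx hS.
  by exists w; split=> //=; apply/(is_RInt_shift _ t).
Qed.

Lemma Ccurve_isometry (B : Banach) (a T c d : R) (phi : R -> R) (x : R -> B) :
  (forall t, a <= t <= T -> c <= phi t <= d) -> (forall s t, Rabs (phi s - phi t) = Rabs (s - t)) ->
  Ccurve c d x -> Ccurve a T (fun t => x (phi t)).
Proof.
move=> h1 h2 /CcurveP hx; apply/CcurveP => t ht eps he.
have [del [hdel h]] := hx (phi t) (h1 t ht) eps he.
by exists del; split=> // t' ht' hlt; apply: h; [exact: h1 | rewrite h2].
Qed.

(** Common form of the two notions: [V] and [Vb] are the free evolutions, [U] and [Ub] the kernels.
    The fractional notion unfolds to it, while the first one needs its proper integrals read as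
    improper ones. *)
Definition kernel_solution (B B1 Bb B1b : Banach) (i1 : B1 -> B) (i1b : B1b -> Bb)
    (V : R -> B) (U : R -> B -> B) (Vb : R -> Bb) (Ub : R -> Bb -> Bb) (gam : R)
    (h : (R -> B1) -> (R -> B1b) -> R -> B) (hb : (R -> B1) -> (R -> B1b) -> R -> Bb)
    (a T : R) (b : R -> B1) (f : R -> B1b) : Prop :=
  Ccurve a T b /\ Ccurve a T f /\
  forall t, a <= t <= T ->
    (exists v, is_RInt_sing_right (fun s => U (t - s) (h b f s)) a t v /\
       i1 (b t) = plus (V (t - a)) (scal gam v)) /\
    (exists v, is_RInt_sing_left (fun s => Ub (s - t) (hb b f s)) t T v /\
       i1b (f t) = minus (Vb (T - t)) (scal gam v)).

(** In the new variables both equations start at [tau = 0], and the minus sign in front of the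
    backward integral becomes the factor [- gam]. *)
Lemma kernel_solution_duhamel (B B1 Bb B1b : Banach) (i1 : B1 -> B) (i1b : B1b -> Bb)
    (V : R -> B) (U : R -> B -> B) (Vb : R -> Bb) (Ub : R -> Bb -> Bb) (gam : R)
    (h : (R -> B1) -> (R -> B1b) -> R -> B) (hb : (R -> B1) -> (R -> B1b) -> R -> Bb)
    (a T : R) (x : R -> B1) (y : R -> B1b) :
  let b := fun t => x (t - a) in let f := fun t => y (T - t) in
  kernel_solution i1 i1b V U Vb Ub gam h hb a T b f <->
  (Ccurve 0 (T - a) x /\ Ccurve 0 (T - a) y /\ forall tau, 0 <= tau <= T - a ->
     duhamel_eqn i1 U V gam (fun s => h b f (a + s)) x tau /\
     duhamel_eqn i1b Ub Vb (- gam) (fun s => hb b f (T - s)) y tau).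
Proof.
move=> b f.
have hCx : Ccurve a T b <-> Ccurve 0 (T - a) x.
  split=> hc.
  - apply: (Ccurve_ext (c := fun t => b (a + t))).
      by move=> t _; rewrite /b; congr x; ring.
    apply: (Ccurve_isometry _ _ hc) => [t ht | s t]; first lra.
    by congr Rabs; ring.
  - apply: (Ccurve_isometry (phi := fun t => t - a) _ _ hc) => [t ht | s t]; first lra.
    by congr Rabs; ring.
have hCy : Ccurve a T f <-> Ccurve 0 (T - a) y.
  split=> hc.
  - apply: (Ccurve_ext (c := fun t => f (T - t))).
      by move=> t _; rewrite /f; congr y; ring.
    apply: (Ccurve_isometry (phi := fun t => T - t) _ _ hc) => [t ht | s t]; first lra.
    by have -> : T - s - (T - t) = - (s - t) by [ring]; rewrite Rabs_Ropp.
  - apply: (Ccurve_isometry (phi := fun t => T - t) _ _ hc) => [t ht | s t]; first lra.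
    by have -> : T - s - (T - t) = - (s - t) by [ring]; rewrite Rabs_Ropp.
have hr tau v : is_RInt_sing_right (fun s => U (a + tau - s) (h b f s)) a (a + tau) v <->
    (tau = 0 /\ v = zero) \/ (0 < tau /\ is_RInt_gen (fun r => U r (h b f (a + (tau - r)))) (at_right 0) (at_point tau) v).
  have e1 : a + tau - a = tau by ring.
  have e2 : (fun r => U (a + tau - (a + tau - r)) (h b f (a + tau - r))) = (fun r => U r (h b f (a + (tau - r)))).
    by apply: functional_extensionality => r; congr U; [ring | congr (h b f); ring].
  split; (move=> [[h1 h2]|[h1 h2]]; [left; split => //; lra | right; split; first lra]).
  - by move/is_RInt_gen_reflect: h2; rewrite e1 e2.
  - by apply/is_RInt_gen_reflect; rewrite e1 e2.
have hl tau v : is_RInt_sing_left (fun s => Ub (s - (T - tau)) (hb b f s)) (T - tau) T v <->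
    (tau = 0 /\ v = zero) \/ (0 < tau /\ is_RInt_gen (fun r => Ub r (hb b f (T - (tau - r)))) (at_right 0) (at_point tau) v).
  have e1 : T - (T - tau) = tau by ring.
  have e2 : (fun r => Ub (T - tau + r - (T - tau)) (hb b f (T - tau + r))) = (fun r => Ub r (hb b f (T - (tau - r)))).
    by apply: functional_extensionality => r; congr Ub; [ring | congr (hb b f); ring].
  split; (move=> [[h1 h2]|[h1 h2]]; [left; split => //; lra | right; split; first lra]).
  - by move/is_RInt_gen_shift: h2; rewrite e1 e2.
  - by apply/is_RInt_gen_shift; rewrite e1 e2.
have sgn (w : Bb) (v : Bb) : minus w (scal gam v) = plus w (scal (- gam) v).
  by rewrite /minus -scal_opp_l.
split.
- move=> [/hCx h1 [/hCy h2 h3]]; split=> //; split=> // tau ht; split.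
  + have [[v [hv hx]] _] := h3 (a + tau) ltac:(lra).
    exists v; split; first exact/hr.
    by move: hx; rewrite /b; have -> : a + tau - a = tau by ring.
  + have [_ [v [hv hx]]] := h3 (T - tau) ltac:(lra).
    exists v; split; first exact/hl.
    by move: hx; rewrite /f sgn; have -> : T - (T - tau) = tau by ring.
- move=> [/hCx h1 [/hCy h2 h3]]; split=> //; split=> // t ht; split.
  + have [[v [hv hx]] _] := h3 (t - a) ltac:(lra).
    exists v; split=> //.
    by move/hr: hv; have -> : a + (t - a) = t by ring.
  + have [_ [v [hv hx]]] := h3 (T - t) ltac:(lra).
    exists v; split; last by rewrite sgn.
    by move/hl: hv; have -> : T - (T - t) = t by ring.
Qed.

(** [h] and [hb] may depend on [T], but [Lam] and, for each radius, [LamR] may not: this is what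
    allows [T0] to be chosen before [T]. *)
Theorem kernel_wellposed (B B1 Bb B1b : Banach) (i1 : B1 -> B) (i1b : B1b -> Bb)
    (U : R -> B -> B) (U1 : R -> B -> B1) (K om : R)
    (Ub : R -> Bb -> Bb) (U1b : R -> Bb -> B1b) (Kb omb L0 L2 : R)
    (hi1 : is_linear i1) (hinj : forall x y, i1 x = i1 y -> x = y)
    (hi1b : is_linear i1b) (hinjb : forall x y, i1b x = i1b y -> x = y)
    (hk : smoothing_kernel i1 U U1 K om L0) (hkb : smoothing_kernel i1b Ub U1b Kb omb L0)
    (V : R -> B) (V1 : R -> B1) (Vb : R -> Bb) (V1b : R -> B1b) (gam : R)
    (hL2 : 0 < L2) (hL20 : L2 < L0)
    (hV : forall t, 0 <= t <= L2 -> i1 (V1 t) = V t) (hVc : Ccurve 0 L2 V1)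
    (hVb : forall t, 0 <= t <= L2 -> i1b (V1b t) = Vb t) (hVcb : Ccurve 0 L2 V1b)
    (a Lam : R)
    (h : R -> (R -> B1) -> (R -> B1b) -> R -> B) (hb : R -> (R -> B1) -> (R -> B1b) -> R -> Bb) :
  (forall T b f, a < T -> Ccurve a T b -> Ccurve a T f -> Ccurve a T (h T b f) /\ Ccurve a T (hb T b f)) ->
  0 <= Lam ->
  (forall T b f s, a < T -> Ccurve a T b -> Ccurve a T f -> a <= s <= T ->
     norm (h T b f s) <= Lam * norm (b s) /\ norm (hb T b f s) <= Lam * norm (f s)) ->
  (forall Rad, exists LamR, 0 <= LamR /\ forall T b f b' f' d, a < T ->
     ball_curves a T Rad b f -> ball_curves a T Rad b' f' ->
     (forall t, a <= t <= T -> norm (minus (b t) (b' t)) <= d /\ norm (minus (f t) (f' t)) <= d) ->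
     forall s, a <= s <= T -> norm (minus (h T b f s) (h T b' f' s)) <= LamR * d /\
                              norm (minus (hb T b f s) (hb T b' f' s)) <= LamR * d) ->
  exists T0, a < T0 /\ forall T, a < T < T0 ->
    unique_on a T (kernel_solution i1 i1b V U Vb Ub gam (h T) (hb T) a T).
Proof.
move=> hcont hLam hgrow hlip.
have [m [_ hm]] := Ccurve_max (Rlt_le _ _ hL2) hVc.
have [mb [_ hmb]] := Ccurve_max (Rlt_le _ _ hL2) hVcb.
(* Bound of the free evolutions over the whole of [0,L2], hence independent of [T]; it fixes the
   radius at which the Lipschitz constant is taken. *)
pose CV := Rmax (norm (V1 m)) (norm (V1b mb)).
have hCV t : 0 <= t <= L2 -> norm (V1 t) <= CV /\ norm (V1b t) <= CV.
  by move=> ht; split; [apply: Rle_trans (hm t ht) (Rmax_l _ _) | apply: Rle_trans (hmb t ht) (Rmax_r _ _)].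
have [LamR [hLamR hlipR]] := hlip (2 * CV).
have small (k o : R) : 0 < k -> 0 <= o < 1 -> exists d, 0 < d /\ forall L, 0 < L < d ->
    Rabs gam * (k / (1 - o)) * Rpower L (1 - o) * (Lam + LamR) <= / 2.
  move=> hk0 ho.
  pose C := Rabs gam * (k / (1 - o)) * (Lam + LamR).
  have hC : 0 <= C.
    have ? := Rabs_pos gam; have ? : 0 < k / (1 - o) by apply: Rdiv_lt_0_compat; lra.
    by apply: Rmult_le_pos; [apply: Rmult_le_pos; lra | lra].
  have [d [hd hs]] := @Rpower_small (1 - o) (/ (2 * (C + 1))) ltac:(lra) ltac:(apply: Rinv_0_lt_compat; lra).
  exists d; split=> // L hLd.
  have h1 := hs L hLd; have h2 := Rpower_pos L (1 - o).
  have -> : Rabs gam * (k / (1 - o)) * Rpower L (1 - o) * (Lam + LamR) = C * Rpower L (1 - o) by rewrite /C; ring.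
  have -> : / 2 = (C + 1) * / (2 * (C + 1)) by field; lra.
  apply: (Rle_trans _ ((C + 1) * Rpower L (1 - o))); first by nra.
  by apply: Rmult_le_compat_l; lra.
have [d1 [hd1 hs1]] := small K om (sk_K hk) (sk_om hk).
have [d2 [hd2 hs2]] := small Kb omb (sk_K hkb) (sk_om hkb).
exists (a + Rmin L2 (Rmin d1 d2)); split.
  by have : 0 < Rmin L2 (Rmin d1 d2) by [do 2 apply: Rmin_pos => //]; lra.
move=> T [haT hT].
have l1 := Rmin_l L2 (Rmin d1 d2); have l2 := Rmin_r L2 (Rmin d1 d2); have l3 := Rmin_l d1 d2; have l4 := Rmin_r d1 d2.
pose shB (x : R -> B1) := fun t => x (t - a); pose shF (y : R -> B1b) := fun t => y (T - t).
have cB x : Ccurve 0 (T - a) x -> Ccurve a T (shB x).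
  move=> hc; apply: (Ccurve_isometry (phi := fun t => t - a) _ _ hc) => [t ht | s t]; first lra.
  by congr Rabs; ring.
have cF y : Ccurve 0 (T - a) y -> Ccurve a T (shF y).
  move=> hc; apply: (Ccurve_isometry (phi := fun t => T - t) _ _ hc) => [t ht | s t]; first lra.
  by have -> : T - s - (T - t) = - (s - t) by [ring]; rewrite Rabs_Ropp.
have restr (W : Banach) (c : R -> W) : Ccurve 0 L2 c -> Ccurve 0 (T - a) c.
  by move=> hc; apply: (Ccurve_isometry (phi := id) _ _ hc) => [t ht | s t //]; lra.
have bc x y : ball_curves 0 (T - a) (2 * CV) x y -> ball_curves a T (2 * CV) (shB x) (shF y).
  move=> [h1 [h2 h3]]; split; [exact: cB | split; first exact: cF].
  move=> t ht; split; [exact: (proj1 (h3 (t - a) ltac:(lra))) | exact: (proj2 (h3 (T - t) ltac:(lra)))].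
have hsb : Rabs (- gam) * (Kb / (1 - omb)) * Rpower (T - a) (1 - omb) * (Lam + LamR) <= / 2.
  by rewrite Rabs_Ropp; apply: hs2; lra.
have [[x [y hxy]] huniq] := @duhamel_pair B B1 Bb B1b i1 i1b U U1 K om L0 Ub U1b Kb omb L0
  hi1 hinj hi1b hinjb hk hkb V V1 Vb V1b gam (- gam) (T - a) CV Lam LamR ltac:(lra) ltac:(lra) ltac:(lra)
  (fun t ht => hV t ltac:(lra)) (restr _ _ hVc) (fun t ht => hVb t ltac:(lra)) (restr _ _ hVcb)
  (fun t ht => hCV t ltac:(lra))
  (fun x y s => h T (shB x) (shF y) (a + s)) (fun x y s => hb T (shB x) (shF y) (T - s))
  ltac:(move=> x y hx hy; have [c1 c2] := hcont T _ _ haT (cB x hx) (cF y hy); split;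
     [apply: (Ccurve_isometry (phi := fun t => a + t) _ _ c1) => [t ht | s t]; [lra | congr Rabs; ring]
     |apply: (Ccurve_isometry (phi := fun t => T - t) _ _ c2) => [t ht | s t];
        [lra | have -> : T - s - (T - t) = - (s - t) by [ring]; by rewrite Rabs_Ropp]])
  hLam hLamR
  ltac:(move=> x y s hx hy hs; have g1 := hgrow T _ _ (a + s) haT (cB x hx) (cF y hy) ltac:(lra);
     have g2 := hgrow T _ _ (T - s) haT (cB x hx) (cF y hy) ltac:(lra); split;
     [move: (proj1 g1); rewrite /shB; have -> : a + s - a = s by [ring]; by []
     |move: (proj2 g2); rewrite /shF; have -> : T - (T - s) = s by [ring]; by []])
  ltac:(move=> x y x' y' d hP hP' hd s hs;
     have hh := hlipR T _ _ _ _ d haT (bc _ _ hP) (bc _ _ hP')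
      (fun t ht => conj (proj1 (hd (t - a) ltac:(lra))) (proj2 (hd (T - t) ltac:(lra)))); split;
     [exact: (proj1 (hh (a + s) ltac:(lra))) | exact: (proj2 (hh (T - s) ltac:(lra)))])
  (hs1 (T - a) ltac:(lra)) hsb.
split.
- by exists (shB x), (shF y); apply/kernel_solution_duhamel.
- move=> b f b' f' hs hs' t ht.
  (* The substitution is invertible on functions, so any solution has the form to which uniqueness
     applies. *)
  have eB b0 : b0 = shB (fun s => b0 (a + s)) by apply: functional_extensionality => s; rewrite /shB; congr b0; ring.
  have eF f0 : f0 = shF (fun s => f0 (T - s)) by apply: functional_extensionality => s; rewrite /shF; congr f0; ring.
  rewrite (eB b) (eF f) in hs; rewrite (eB b') (eF f') in hs'.
  have k1 := proj1 (kernel_solution_duhamel _ _ _ _ _ _ _ _ _ _ _ _ _) hs.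
  have k2 := proj1 (kernel_solution_duhamel _ _ _ _ _ _ _ _ _ _ _ _ _) hs'.
  (* At the same time [t] the two components are read at different values of [tau], so uniqueness is
     used twice. *)
  have u1 := huniq _ _ _ _ k1 k2 (t - a) ltac:(lra).
  have u2 := huniq _ _ _ _ k1 k2 (T - t) ltac:(lra).
  split.
  + by move: (proj1 u1); have -> : a + (t - a) = t by ring.
  + by move: (proj2 u2); have -> : T - (T - t) = t by ring.
Qed.

(** * Strongly continuous semigroups *)

Lemma minus_plus_id (V : NormedModule R_AbsRing) (x y : V) : minus (plus x y) x = y.
Proof. by rewrite /minus plus_comm plus_assoc plus_opp_l plus_zero_l. Qed.

(** Because 2y = (x+y) - (x-y). This is the step that replaces Baire's theorem in the proof of
    uniform boundedness below. *)
Lemma large_or_large (V : NormedModule R_AbsRing) (x y : V) :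
  norm y <= norm (plus x y) \/ norm y <= norm (minus x y).
Proof.
case: (Rle_dec (norm y) (norm (plus x y))) => h1; first by left.
right; apply: Rnot_lt_le => h2.
have e : scal 2 y = minus (plus x y) (minus x y).
  rewrite /minus opp_plus opp_opp -plus_assoc (plus_assoc y) (plus_comm y (opp x)) plus_assoc plus_assoc.
  rewrite plus_opp_r plus_zero_l.
  have -> : (2 : R) = plus (one : R_AbsRing) one by [].
  by rewrite scal_distr_r !scal_one.
have h3 := norm_minus_le (plus x y) (minus x y).
rewrite -e norm_scal_R Rabs_pos_eq in h3; lra.
Qed.

(* Nested balls: on the k-th ball some operator of the family has norm at least k. *)
Lemma uniform_boundedness (V : Banach) (W : NormedModule R_AbsRing) (T : nat -> V -> W) :
  (forall k, is_linear (T k)) -> (forall x, exists M, forall k, norm (T k x) <= M) ->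
  exists M, forall k x, norm (T k x) <= M * norm x.
Proof.
move=> hT hb; apply: NNPP => hn.
have big M : exists k x, M * norm x < norm (T k x).
  apply: NNPP => h; apply: hn; exists M => k x; apply: Rnot_lt_le => h'; apply: h; by exists k, x.
have step (s : V * R) (N : nat) : exists s' : V * R, 0 < s.2 ->
    0 < s'.2 <= s.2 / 2 /\ norm (minus s'.1 s.1) <= s.2 / 2 /\
    exists k, forall z, norm (minus z s'.1) <= s'.2 -> INR N <= norm (T k z).
  case: s => x r /=; case: (Rlt_dec 0 r) => hr; last by exists (x, r).
  (* With this factor, the multiple [xi] of [y] of norm r/2 has an image of norm at least N + 1, and
     one of [x + xi], [x - xi] inherits this. *)
  have [k [y hy]] := big (2 * (INR N + 1) / r).
  have hN := pos_INR N.
  have hM : 0 < 2 * (INR N + 1) / r by apply: Rdiv_lt_0_compat; lra.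
  have hy0 : 0 < norm y.
    case: (Rle_lt_or_eq_dec _ _ (norm_ge_0 y)) => // h0.
    have [m [_ hTm]] := linear_norm _ (hT k); have := hTm y.
    rewrite -h0 !Rmult_0_r in hy *; lra.
  pose xi := scal (r / (2 * norm y)) y.
  have hxi : norm xi = r / 2.
    rewrite norm_scal_R Rabs_pos_eq; first by field; lra.
    by left; apply: Rdiv_lt_0_compat; lra.
  have hTxi : INR N + 1 <= norm (T k xi).
    rewrite linear_scal // norm_scal_R Rabs_pos_eq; last by left; apply: Rdiv_lt_0_compat; lra.
    have -> : INR N + 1 = r / (2 * norm y) * (2 * (INR N + 1) / r * norm y) by field; lra.
    apply: Rmult_le_compat_l; last lra.
    by left; apply: Rdiv_lt_0_compat; lra.
  have [x' [hx' hTx']] : exists x', norm (minus x' x) <= r / 2 /\ INR N + 1 <= norm (T k x').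
    case: (large_or_large (T k x) (T k xi)) => h.
    - exists (plus x xi); rewrite (linear_plus _ (hT k)); split; last exact: Rle_trans hTxi h.
      by rewrite minus_plus_id hxi; lra.
    - exists (minus x xi); rewrite (linear_minus _ _ _ (hT k)); split; last exact: Rle_trans hTxi h.
      have -> : minus (minus x xi) x = opp xi by exact: (minus_plus_id x (opp xi)).
      by rewrite norm_opp hxi; lra.
  have [m [hm hTm]] := linear_norm _ (hT k).
  (* On a ball of radius 1/m the operator [T k], bounded by m, varies by at most 1, so its norm
     stays at least N there. *)
  exists (x', Rmin (r / 2) (/ m)) => _ /=.
  have hmi := Rinv_0_lt_compat _ hm.
  split; first by split; [apply: Rmin_pos; lra | exact: Rmin_l].
  split=> //; exists k => z hz.
  have h1 := norm_le_minus (T k x') (T k z).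
  rewrite -(linear_minus _ _ _ (hT k)) in h1.
  have h2 := hTm (minus x' z).
  have h3 : norm (minus x' z) <= / m by rewrite norm_minusC; apply: Rle_trans hz (Rmin_r _ _).
  have h4 : m * norm (minus x' z) <= m * / m by apply: Rmult_le_compat_l; lra.
  rewrite Rinv_r in h4; last lra.
  lran.
pose next s N := proj1_sig (constructive_indefinite_description _ (step s N)).
have hnext s N := proj2_sig (constructive_indefinite_description _ (step s N)).
pose z := fix z (k : nat) : V * R := match k with 0%N => (zero, 1) | S k => next (z k) k end.
have hr : forall k, 0 < (z k).2.
  by elim=> [|k IH] /=; [lra | case: (hnext (z k) k IH) => -[]].
(* The later ball is contained in the earlier one. *)
have hinv : forall j k, norm (minus (z (j + k)%N).1 (z k).1) + (z (j + k)%N).2 <= (z k).2.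
  elim=> [|j IH] k.
    rewrite add0n minus_eq_zero norm_zero; lra.
  have [[h1 h2] [h3 _]] := hnext (z (j + k)%N) (j + k)%N (hr _).
  have h4 := norm_minus_trans (z (j.+1 + k)%N).1 (z (j + k)%N).1 (z k).1.
  have h5 := IH k.
  change (z (j.+1 + k)%N) with (next (z (j + k)%N) (j + k)%N) in h4 |- *.
  rewrite -/(next (z (j + k)%N) (j + k)%N) in h1 h2 h3.
  lran.
have hhalf : forall k, (z k).2 <= (/2)^k.
  elim=> [|k IH]; first by rewrite /=; lra.
  have [[h1 h2] _] := hnext (z k) k (hr k).
  change (z k.+1) with (next (z k) k); rewrite -/(next (z k) k) in h2.
  have : (/2)^(k.+1) = (/2)^k / 2 by rewrite /=; field.
  lra.
have [y hy] := @geometric_lim V (fun k => (z k).1) 1 ltac:(move=> k; rewrite Rmult_1_l;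
   have h1 := hinv 1%N k; have h2 := hr (1 + k)%N; have h3 := hhalf k; rewrite add1n in h1 h2; lran).
have hin k : norm (minus y (z k).1) <= (z k).2.
  apply: Rle_plus_epsilon => eps he.
  have [N hN] := @pow_half_small 2 eps ltac:(lra) he.
  have h1 := hinv N k; have h2 := hr (N + k)%N; have h3 := hy (N + k)%N.
  have h4 := hN (N + k)%N ltac:(change (le N (Nat.add N k)); lia).
  have h5 := norm_minus_trans y (z (N + k)%N).1 (z k).1.
  have h6 := norm_minusC y (z (N + k)%N).1.
  lran.
have [M hM] := hb y.
have [N hN] := INR_unbounded M.
have [_ [_ [k hk]]] := hnext (z N) N (hr N).
have h1 := hk y (hin N.+1).
have := hM k; lra.
Qed.

Lemma finite_bound (F : nat -> R) (N : nat) : exists M, forall k, (k < N)%coq_nat -> F k <= M.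
Proof.
elim: N => [|N [M hM]]; first by exists 0 => k hk; lia.
exists (Rmax M (F N)) => k hk.
case: (PeanoNat.Nat.eq_dec k N) => [->|hkN]; first exact: Rmax_r.
by apply: Rle_trans (hM k _) (Rmax_l _ _); lia.
Qed.

Lemma at_right0_ext (V : NormedModule R_AbsRing) (f g : R -> V) (l : V) :
  (forall h, 0 < h -> f h = g h) -> filterlim f (at_right 0) (locally l) ->
  filterlim g (at_right 0) (locally l).
Proof. by move=> h; apply: filterlim_ext_loc; exists (mkposreal 1 Rlt_0_1) => r _ hr; exact: h. Qed.

Section Semigroup.
Context (B : Banach) (S : R -> B -> B) (hS : C0_semigroup S).

Lemma sg_linear t : 0 <= t -> is_linear (S t).
Proof. exact: (proj1 hS). Qed.

Lemma sg_0 x : S 0 x = x.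
Proof. exact: (proj1 (proj2 hS)). Qed.

Lemma sg_plus t s x : 0 <= t -> 0 <= s -> S (t + s) x = S t (S s x).
Proof. exact: (proj1 (proj2 (proj2 hS))). Qed.

Lemma sg_right_cont x eps : 0 < eps ->
  exists delta, 0 < delta /\ forall t, 0 <= t < delta -> norm (minus (S t x) x) < eps.
Proof.
move=> he.
have h := proj2 (proj2 (proj2 hS)) x.
have [d hd] := proj1 (@filterlim_normP _ B (at_right 0) _ (fun t => S t x) x) h eps he.
exists d; split=> [|t ht]; first exact: cond_pos.
case: (Req_dec t 0) => [->|h0]; first by rewrite sg_0 minus_eq_zero norm_zero.
apply: hd; last lra.
change (Rabs (t - 0) < d); rewrite Rminus_0_r Rabs_pos_eq; lra.
Qed.

(** Otherwise there are times tending to 0 at which the operator norms are unbounded. Strong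
    continuity at 0 bounds each orbit along these times, contradicting uniform boundedness. *)
Lemma sg_local_bound : exists delta M, 0 < delta /\ 1 <= M /\
  forall t x, 0 <= t <= delta -> norm (S t x) <= M * norm x.
Proof.
apply: NNPP => hn.
have h (n : nat) : exists tx : R * B, 0 <= tx.1 <= / (INR n + 1) /\ (INR n + 1) * norm tx.2 < norm (S tx.1 tx.2).
  apply: NNPP => h; apply: hn; exists (/ (INR n + 1)), (INR n + 1).
  have hn0 := pos_INR n.
  split; first by apply: Rinv_0_lt_compat; lra.
  split; first lra.
  move=> t x ht; apply: Rnot_lt_le => hlt; apply: h; by exists (t, x).
pose tx n := proj1_sig (constructive_indefinite_description _ (h n)).
have htx n : 0 <= (tx n).1 <= / (INR n + 1) /\ (INR n + 1) * norm (tx n).2 < norm (S (tx n).1 (tx n).2).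
  exact: (proj2_sig (constructive_indefinite_description _ (h n))).
have [M hM] := @uniform_boundedness B B (fun n => S (tx n).1) (fun n => sg_linear (proj1 (proj1 (htx n))))
  ltac:(move=> x; have [d [hd hx]] := sg_right_cont x Rlt_0_1;
    have [N hN] := INR_unbounded (/ d);
    have [M hM] := finite_bound (fun n => norm (S (tx n).1 x)) N;
    exists (Rmax M (norm x + 1)) => n; case: (PeanoNat.Nat.lt_ge_cases n N) => hnN;
    [apply: Rle_trans (hM n hnN) (Rmax_l _ _) |
     apply: Rle_trans _ (Rmax_r _ _);
     have h1 : (tx n).1 < d by [apply: Rle_lt_trans (proj2 (proj1 (htx n))) _;
        have h2 := le_INR _ _ hnN; rewrite -(Rinv_inv d); apply: Rinv_lt_contravar;
        [apply: Rmult_lt_0_compat; [exact: Rinv_0_lt_compat | have := Rinv_0_lt_compat _ hd; lra] | lra]];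
     have h3 := hx _ (conj (proj1 (proj1 (htx n))) h1);
     have := norm_le_minus (S (tx n).1 x) x; lran]).
have [N hN] := INR_unbounded M.
have [_ h1] := htx N; have h2 := hM N (tx N).2.
have h3 := norm_ge_0 (tx N).2.
have : M * norm (tx N).2 <= (INR N + 1) * norm (tx N).2 by apply: Rmult_le_compat_r; lra.
lran.
Qed.

(** The rate is chosen so that exp (w d) = M: every further step of length [d] costs one factor [M],
    which the exponential absorbs. *)
Lemma sg_growth : exists M w, 1 <= M /\ 0 <= w /\
  forall t x, 0 <= t -> norm (S t x) <= M * exp (w * t) * norm x.
Proof.
have [d [M [hd [hM h]]]] := sg_local_bound.
have hw : 0 <= ln M / d.
  apply: Rmult_le_pos; last by left; exact: Rinv_0_lt_compat.
  by rewrite -ln_1; apply: ln_le; lra.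
exists M, (ln M / d); split=> //; split=> //.
have exp1 t : 0 <= t -> 1 <= exp (ln M / d * t).
  move=> ht; rewrite -exp_0; apply: exp_le_compat; exact: Rmult_le_pos.
have main : forall (k : nat) t x, 0 <= t <= INR k * d -> norm (S t x) <= M * exp (ln M / d * t) * norm x.
  elim=> [|k IH] t x ht.
    apply: Rle_trans (h t x _) _; first by rewrite /= in ht; lra.
    apply: Rmult_le_compat_r; first exact: norm_ge_0.
    have := exp1 t (proj1 ht); nra.
  rewrite S_INR in ht.
  case: (Rle_dec t d) => htd.
    apply: Rle_trans (h t x _) _; first lra.
    apply: Rmult_le_compat_r; first exact: norm_ge_0.
    have := exp1 t (proj1 ht); nra.
  have -> : S t x = S d (S (t - d) x).
    by rewrite -sg_plus; [congr (S _ x); ring | lra | lra].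
  apply: Rle_trans (h d _ _) _; first lra.
  have h2 := IH (t - d) x ltac:(lra).
  have -> : exp (ln M / d * t) = M * exp (ln M / d * (t - d)).
    have -> : ln M / d * t = ln M + ln M / d * (t - d) by field; lra.
    by rewrite exp_plus exp_ln //; lra.
  have : M * norm (S (t - d) x) <= M * (M * exp (ln M / d * (t - d)) * norm x).
    by apply: Rmult_le_compat_l; lra.
  lra.
move=> t x ht; have [k hk] := INR_unbounded (t / d).
apply: (main k); split=> //.
have -> : t = t / d * d by field; lra.
apply: Rmult_le_compat_r; lra.
Qed.

Lemma sg_bound T : exists M, 1 <= M /\ forall t x, 0 <= t <= T -> norm (S t x) <= M * norm x.
Proof.
have [M [w [hM [hw h]]]] := sg_growth.
exists (M * exp (w * Rmax 0 T)).
have h0 := Rmax_l 0 T; have h1 := Rmax_r 0 T.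
split.
  have : 1 <= exp (w * Rmax 0 T) by rewrite -exp_0; apply: exp_le_compat; exact: Rmult_le_pos.
  nra.
move=> t x ht; apply: Rle_trans (h t x (proj1 ht)) _.
apply: Rmult_le_compat_r; first exact: norm_ge_0.
apply: Rmult_le_compat_l; first lra.
apply: exp_le_compat; apply: Rmult_le_compat_l; lra.
Qed.

Lemma sg_cont x t eps : 0 <= t -> 0 < eps ->
  exists delta, 0 < delta /\ forall t', 0 <= t' -> Rabs (t' - t) < delta -> norm (minus (S t' x) (S t x)) < eps.
Proof.
move=> ht he.
have [M [hM h]] := sg_bound t.
have [d [hd hx]] := @sg_right_cont x (eps / M) ltac:(apply: Rdiv_lt_0_compat; lra).
(* Left continuity also follows from right continuity at 0, by factoring out the smaller of the two
   times, where the operators are uniformly bounded. *)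
have key s s' : 0 <= s <= t -> 0 <= s' - s < d -> norm (minus (S s' x) (S s x)) < eps.
  move=> hs hs'.
  have -> : S s' x = S s (S (s' - s) x) by rewrite -sg_plus; [congr (S _ x); ring | lra | lra].
  rewrite -(linear_minus _ _ _ (sg_linear (proj1 hs))).
  apply: Rle_lt_trans (h s _ hs) _.
  have -> : eps = M * (eps / M) by field; lra.
  by apply: Rmult_lt_compat_l; [lra | exact: hx].
exists d; split=> // t' ht' hlt.
case: (Rle_dec t t') => hc.
  by apply: key; [lra | move: hlt; rewrite Rabs_pos_eq; lra].
by rewrite norm_minusC; apply: key; [lra | move: hlt; rewrite Rabs_left; lra].
Qed.

Lemma generator_norm x g eps : generator_at S x g -> 0 < eps ->
  exists delta, 0 < delta /\ forall h, 0 < h < delta -> norm (minus (minus (S h x) x) (scal h g)) <= eps * h.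
Proof.
move=> hg he.
have [d hd] := proj1 (@filterlim_normP _ B (at_right 0) _ _ g) hg eps he.
exists d; split=> [|h hh]; first exact: cond_pos.
have hb : norm (minus (scal (/ h) (minus (S h x) x)) g) < eps.
  apply: hd; last lra.
  change (Rabs (h - 0) < d); rewrite Rminus_0_r Rabs_pos_eq; lra.
have -> : minus (minus (S h x) x) (scal h g) = scal h (minus (scal (/ h) (minus (S h x) x)) g).
  by rewrite (scal_minus h) scal_scal_inv //; lra.
rewrite norm_scal_R Rabs_pos_eq; last lra.
by rewrite Rmult_comm; apply: Rmult_le_compat_r; lra.
Qed.

Lemma generator_orbit x g t : 0 <= t -> generator_at S x g -> generator_at S (S t x) (S t g).
Proof.
rewrite /generator_at => ht hg.
have hl := sg_linear ht.
apply: (at_right0_ext (f := fun h => S t (scal (/ h) (minus (S h x) x)))).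
  move=> h h0; rewrite linear_scal // linear_minus //.
  by rewrite -!sg_plus ?(Rplus_comm t) //; lra.
exact: filterlim_comp hg (linear_cont _ g hl).
Qed.

Lemma generator_minus x g y k : generator_at S x g -> generator_at S y k -> generator_at S (minus x y) (minus g k).
Proof.
rewrite /generator_at => hx hy.
apply: (at_right0_ext (f := fun h => plus (scal (/ h) (minus (S h x) x)) (opp (scal (/ h) (minus (S h y) y))))).
  move=> h h0.
  rewrite (linear_minus _ _ _ (sg_linear (Rlt_le _ _ h0))) (minus_minus2 _ _ x).
  by symmetry; exact: scal_minus.
eapply filterlim_comp_2; [exact hx | | exact (@filterlim_plus R_AbsRing B g (opp k))].
exact: filterlim_comp hy (@filterlim_opp R_AbsRing B k).
Qed.

End Semigroup.

(** * Duality *)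

(** Discrete form of S h x - x being the integral of S s g over [0,h]: the interval is cut into
    steps [et] so short that S et x - x is close to et g, and each step costs at most [M] times its
    norm. *)
Lemma generator_lipschitz (B : Banach) (S : R -> B -> B) (hS : C0_semigroup S) (M T : R) (x g : B) (h : R) :
  (forall t y, 0 <= t <= T -> norm (S t y) <= M * norm y) -> 0 <= M ->
  generator_at S x g -> 0 <= h <= T -> norm (minus (S h x) x) <= M * h * norm g.
Proof.
move=> hM hM0 hg hh.
case: (Req_dec h 0) => [->|h0].
  rewrite (sg_0 hS) minus_eq_zero norm_zero; lra.
apply: Rle_plus_epsilon => eps he.
have hMh : 0 < M * h + 1 by have := Rmult_le_pos M h hM0 (proj1 hh); lra.
have [d [hd hdg]] := generator_norm hg (eps := eps / (M * h + 1)) ltac:(apply: Rdiv_lt_0_compat; lra).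
have [N hN] := INR_unbounded (h / d).
have hN0 : 0 < INR N by apply: Rle_lt_trans hN; apply: Rmult_le_pos; [lra | left; exact: Rinv_0_lt_compat].
set et := h / INR N.
have het : 0 < et by apply: Rdiv_lt_0_compat; lra.
have hetd : et < d.
  apply: (Rmult_lt_reg_r (INR N)) => //; rewrite /et.
  have -> : h / INR N * INR N = h / d * d by field; lra.
  by rewrite Rmult_comm; apply: Rmult_lt_compat_l.
have h1 : norm (minus (S et x) x) <= et * (norm g + eps / (M * h + 1)).
  have h2 := hdg et (conj het hetd).
  have h3 := norm_le_minus (minus (S et x) x) (scal et g).
  rewrite norm_scal_R (Rabs_pos_eq et) in h3; last lra.
  lran.
have key : forall k : nat, (k <= N)%coq_nat ->
    norm (minus (S (INR k * et) x) x) <= INR k * (M * (et * (norm g + eps / (M * h + 1)))).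
  elim=> [|k IH] hk.
    rewrite /= !Rmult_0_l (sg_0 hS) minus_eq_zero norm_zero; lra.
  have hkN : INR k * et <= T.
    apply: Rle_trans (proj2 hh); have -> : h = INR N * et by rewrite /et; field; lra.
    by apply: Rmult_le_compat_r; [lra | apply: le_INR; lia].
  have hk0 : 0 <= INR k * et by apply: Rmult_le_pos; [exact: pos_INR | lra].
  rewrite S_INR.
  have -> : S ((INR k + 1) * et) x = S (INR k * et) (S et x).
    by rewrite -(sg_plus hS) //; [congr (S _ x); ring | lra].
  have h2 := norm_minus_trans (S (INR k * et) (S et x)) (S (INR k * et) x) x.
  have h3 := hM (INR k * et) (minus (S et x) x) (conj hk0 hkN).
  rewrite (linear_minus _ _ _ (sg_linear hS hk0)) in h3.
  have h4 : M * norm (minus (S et x) x) <= M * (et * (norm g + eps / (M * h + 1))) by apply: Rmult_le_compat_l.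
  have := IH ltac:(lia); lran.
have := key N (le_n _).
have -> : INR N * et = h by rewrite /et; field; lra.
have -> : INR N * (M * (et * (norm g + eps / (M * h + 1)))) = M * h * norm g + M * h * (eps / (M * h + 1)).
  by rewrite /et; field; lra.
have : M * h * (eps / (M * h + 1)) <= (M * h + 1) * (eps / (M * h + 1)).
  by apply: Rmult_le_compat_r; [left; apply: Rdiv_lt_0_compat; lra | lra].
have -> : (M * h + 1) * (eps / (M * h + 1)) = eps by field; lra.
lra.
Qed.

Section Pairing.
Context (B C : Banach) (p : B -> C -> R) (hp : dual_pair p).

Lemma dp_plus_l b b' c : p (plus b b') c = p b c + p b' c.
Proof. exact: (proj1 hp). Qed.
Lemma dp_scal_l (k : R) b c : p (scal k b) c = k * p b c.
Proof. exact: (proj1 (proj2 hp)). Qed.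
Lemma dp_plus_r b c c' : p b (plus c c') = p b c + p b c'.
Proof. exact: (proj1 (proj2 (proj2 hp))). Qed.
Lemma dp_scal_r (k : R) b c : p b (scal k c) = k * p b c.
Proof. exact: (proj1 (proj2 (proj2 (proj2 hp)))). Qed.

Lemma dp_opp_l b c : p (opp b) c = - p b c.
Proof. by rewrite -scal_opp_one dp_scal_l /opp /one /=; ring. Qed.
Lemma dp_opp_r b c : p b (opp c) = - p b c.
Proof. by rewrite -scal_opp_one dp_scal_r /opp /one /=; ring. Qed.
Lemma dp_minus_l b b' c : p (minus b b') c = p b c - p b' c.
Proof. by rewrite /minus dp_plus_l dp_opp_l. Qed.
Lemma dp_minus_r b c c' : p b (minus c c') = p b c - p b c'.
Proof. by rewrite /minus dp_plus_r dp_opp_r. Qed.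

Lemma dp_norm b c : Rabs (p b c) <= norm b * norm c.
Proof.
have hlub := proj1 (proj1 (proj2 (proj2 (proj2 (proj2 hp))))) b.
case: (Rle_lt_or_eq_dec _ _ (norm_ge_0 c)) => h0; last first.
  have -> : p b c = 0.
    apply: NNPP => hn.
    have h := proj1 hlub (Rabs (p b (scal ((norm b + 1) / p b c) c))).
    have : Rabs (p b (scal ((norm b + 1) / p b c) c)) <= norm b.
      apply: h; exists (scal ((norm b + 1) / p b c) c); split=> //.
      by rewrite norm_scal_R -h0; lra.
    rewrite dp_scal_r.
    have -> : (norm b + 1) / p b c * p b c = norm b + 1 by field.
    by rewrite Rabs_pos_eq; have := norm_ge_0 b; lra.
  by rewrite -h0 Rabs_R0; lra.
have h1 : Rabs (p b (scal (/ norm c) c)) <= norm b.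
  apply: (proj1 hlub); exists (scal (/ norm c) c); split=> //.
  rewrite norm_scal_R Rabs_pos_eq; last by left; exact: Rinv_0_lt_compat.
  by rewrite Rinv_l; lra.
rewrite dp_scal_r Rabs_mult Rabs_pos_eq in h1; last by left; exact: Rinv_0_lt_compat.
apply: (Rmult_le_reg_l (/ norm c)); first exact: Rinv_0_lt_compat.
by apply: Rle_trans h1 _; right; field; lra.
Qed.

End Pairing.

Lemma dual_pair_sym (B C : Banach) (p : B -> C -> R) : dual_pair p -> dual_pair (fun c b => p b c).
Proof.
move=> [h1 [h2 [h3 [h4 [h5 h6]]]]]; split; [|split; [|split; [|split; [|split]]]].
- by move=> c c' b; exact: h3.
- by move=> k c b; exact: h4.
- by move=> c b b'; exact: h1.
- by move=> k c b; exact: h2.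
- exact: h6.
- exact: h5.
Qed.

(** The norm is a supremum over the unit ball of [C]; density allows testing on [C1] alone, the
    space on which the operators of the dual triple act. *)
Lemma norm_by_dual (B C C1 : Banach) (p : B -> C -> R) (i : C1 -> C) (b : B) (M : R) : dual_pair p ->
  dense_embedding i -> 0 <= M -> (forall f, Rabs (p b (i f)) <= M * norm (i f)) -> norm b <= M.
Proof.
move=> hp [hil [_ [_ hdense]]] hM h.
have hlub := proj1 (proj1 (proj2 (proj2 (proj2 (proj2 hp))))) b.
apply: (proj2 hlub) => r [c [hc ->]].
apply: Rle_plus_epsilon => eps he.
have hb := norm_ge_0 b.
have [f hf] := hdense c (eps / (M + norm b + 1)) ltac:(apply: Rdiv_lt_0_compat; lra).
set e := eps / (M + norm b + 1) in hf.
have h1 : p b c = p b (i f) - p b (minus (i f) c) by rewrite (dp_minus_r hp); ring.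
have h2 := dp_norm hp b (minus (i f) c).
have h3 := h f.
have h4 := norm_le_minus (i f) c.
have h5 : Rabs (p b c) <= Rabs (p b (i f)) + Rabs (p b (minus (i f) c)).
  by rewrite h1; apply: Rle_trans (Rabs_triang _ _) _; rewrite Rabs_Ropp; lra.
have he0 : (M + norm b + 1) * e = eps by rewrite /e; field; lra.
have h6 : norm b * norm (minus (i f) c) <= norm b * e by apply: Rmult_le_compat_l; lran.
have h7 : M * norm (i f) <= M * (1 + e) by apply: Rmult_le_compat_l; lran.
have : 0 < e by apply: Rdiv_lt_0_compat; lra.
lran.
Qed.

(** Both orbits stay in the domains of the generators, so [hgen] applies at every intermediate
    time. *)
Lemma semigroup_dual_domain (B C : Banach) (p : B -> C -> R) (S : R -> B -> B) (Sb : R -> C -> C)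
    (x g : B) (y k : C) (t : R) :
  dual_pair p -> C0_semigroup S -> C0_semigroup Sb ->
  (forall x g y k, generator_at S x g -> generator_at Sb y k -> p g y = p x k) ->
  generator_at S x g -> generator_at Sb y k -> 0 <= t -> p (S t x) y = p x (Sb t y).
Proof.
move=> hp hS hSb hgen hx hy ht.
case: (Req_dec t 0) => [->|t0]; first by rewrite (sg_0 hS) (sg_0 hSb).
have [M [hM hMb]] := sg_bound hS t; have [M' [hM' hMb']] := sg_bound hSb t.
pose Q := M * M' * (norm x + norm y).
have hxn := norm_ge_0 x; have hyn := norm_ge_0 y.
have hMM : 0 < M * M' by apply: Rmult_lt_0_compat; lra.
have hQ : 0 <= Q by apply: Rmult_le_pos; lra.
suff h : forall eps, 0 < eps -> Rabs (p (S t x) y - p x (Sb t y)) <= t * (eps * Q).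
  have h0 : Rabs (p (S t x) y - p x (Sb t y)) <= 0.
    apply: Rle_plus_epsilon => eps he; rewrite Rplus_0_l.
    have hq : 0 < t * (Q + 1) by apply: Rmult_lt_0_compat; lra.
    apply: Rle_trans (h (eps / (t * (Q + 1))) _) _; first exact: Rdiv_lt_0_compat.
    apply: (Rle_trans _ (t * (eps / (t * (Q + 1)) * (Q + 1)))); last by right; field; lra.
    apply: Rmult_le_compat_l; first lra.
    by apply: Rmult_le_compat_l; [left; exact: Rdiv_lt_0_compat | lra].
  by move: h0; rewrite /Rabs; case: Rcase_abs; lra.
move=> eps he.
have [d1 [hd1 h1]] := generator_norm hx he; have [d2 [hd2 h2]] := generator_norm hy he.
have hd : 0 < Rmin d1 d2 by exact: Rmin_pos.
have [N hN] := INR_unbounded (t / Rmin d1 d2).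
have hN0 : 0 < INR N by apply: Rle_lt_trans hN; apply: Rmult_le_pos; [lra | left; exact: Rinv_0_lt_compat].
set et := t / INR N.
have het : 0 < et by apply: Rdiv_lt_0_compat; lra.
have hNet : INR N * et = t by rewrite /et; field; lra.
have hetd : et < Rmin d1 d2.
  apply: (Rmult_lt_reg_r (INR N)) => //; rewrite /et.
  have -> : t / INR N * INR N = t / Rmin d1 d2 * Rmin d1 d2 by field; lra.
  by rewrite Rmult_comm; apply: Rmult_lt_compat_l.
have l1 := Rmin_l d1 d2; have l2 := Rmin_r d1 d2.
have g1 := h1 et ltac:(lra); have g2 := h2 et ltac:(lra).
(* Along [k -> p (S (k et) x) (Sb (t - k et) y)] the first order terms cancel, by the pairing of the generators. *)
have main : forall k : nat, (k <= N)%coq_nat ->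
    Rabs (p (S (INR k * et) x) (Sb (t - INR k * et) y) - p x (Sb t y)) <= INR k * et * (eps * Q).
  elim=> [|m IH] hm.
    rewrite /= !Rmult_0_l Rminus_0_r (sg_0 hS) Rminus_diag_eq // Rabs_R0; lra.
  have hm0 := pos_INR m.
  have hmN : (INR m + 1) * et <= t.
    by rewrite -S_INR -hNet; apply: Rmult_le_compat_r; [lra | exact: le_INR].
  set s := INR m * et in IH *; set r := t - (INR m + 1) * et.
  have hs : 0 <= s by apply: Rmult_le_pos; lra.
  have hst : s <= t by rewrite /s; lra.
  have hr : 0 <= r <= t by rewrite /r; nra.
  rewrite S_INR.
  have -> : S ((INR m + 1) * et) x = S s (S et x).
    by rewrite -(sg_plus hS) //; [congr (S _ x); rewrite /s; ring | lra].
  rewrite -/r.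
  have eY : Sb (t - s) y = Sb r (Sb et y).
    by rewrite -(sg_plus hSb) //; [congr (Sb _ y); rewrite /s /r; ring | lra | lra].
  have IH' := IH ltac:(lia); rewrite eY in IH'.
  set e1 := minus (minus (S et x) x) (scal et g) in g1.
  set e2 := minus (minus (Sb et y) y) (scal et k) in g2.
  (* To first order S et x = x + et g and Sb et y = y + et k; [hgen] cancels these terms, and only
     the remainders [e1], [e2], of size eps et, are left. *)
  have E1 : p (S s (S et x)) (Sb r y) - p (S s x) (Sb r (Sb et y)) = p (S s e1) (Sb r y) - p (S s x) (Sb r e2).
    have hl := sg_linear hS hs; have hlb := sg_linear hSb (proj1 hr).
    rewrite /e1 /e2 !(linear_minus _ _ _ hl) !(linear_minus _ _ _ hlb) (linear_scal _ hl) (linear_scal _ hlb).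
    rewrite !(dp_minus_l hp) !(dp_minus_r hp) (dp_scal_l hp) (dp_scal_r hp).
    rewrite (hgen _ _ _ _ (generator_orbit hS hs hx) (generator_orbit hSb (proj1 hr) hy)); ring.
  have b1 := hMb s e1 (conj hs hst); have b2 := hMb s x (conj hs hst).
  have b3 := hMb' r y hr; have b4 := hMb' r e2 hr.
  have c1 := dp_norm hp (S s e1) (Sb r y); have c2 := dp_norm hp (S s x) (Sb r e2).
  have d1' : norm (S s e1) * norm (Sb r y) <= (M * (eps * et)) * (M' * norm y).
    apply: Rmult_le_compat; try exact: norm_ge_0.
    + by apply: Rle_trans b1 _; apply: Rmult_le_compat_l; lra.
    + exact: b3.
  have d2' : norm (S s x) * norm (Sb r e2) <= (M * norm x) * (M' * (eps * et)).
    apply: Rmult_le_compat; try exact: norm_ge_0.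
    + exact: b2.
    + by apply: Rle_trans b4 _; apply: Rmult_le_compat_l; lra.
  have tri (u v w z z' : R) : u - v = z - z' -> Rabs (u - w) <= Rabs (v - w) + Rabs z + Rabs z'.
    by move=> h; have -> : u - w = v - w + z - z' by [lra]; rewrite /Rabs; do 4 case: Rcase_abs; lra.
  have := tri _ _ (p x (Sb t y)) _ _ E1.
  have -> : (INR m + 1) * et * (eps * Q) = s * (eps * Q) + ((M * (eps * et)) * (M' * norm y) + (M * norm x) * (M' * (eps * et))).
    by rewrite /Q /s; ring.
  lra.
have := main N (le_n _); rewrite hNet.
have -> : t - t = 0 by ring.
by rewrite (sg_0 hSb).
Qed.

Lemma semigroup_dual (B C : Banach) (p : B -> C -> R) (S : R -> B -> B) (Sb : R -> C -> C) (x : B) (y : C) (t : R) :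
  dual_pair p -> C0_semigroup S -> C0_semigroup Sb ->
  (forall x g y k, generator_at S x g -> generator_at Sb y k -> p g y = p x k) ->
  (forall x eps, 0 < eps -> exists u g, generator_at S u g /\ norm (minus u x) < eps) ->
  (forall y eps, 0 < eps -> exists v k, generator_at Sb v k /\ norm (minus v y) < eps) ->
  0 <= t -> p (S t x) y = p x (Sb t y).
Proof.
move=> hp hS hSb hgen hd hdb ht.
have [M [hM hMb]] := sg_bound hS t; have [M' [hM' hMb']] := sg_bound hSb t.
have hl := sg_linear hS ht; have hlb := sg_linear hSb ht.
have hxn := norm_ge_0 x; have hyn := norm_ge_0 y.
(* The restriction eps <= 1 bounds the approximants by norm x + 1 and norm y + 1. *)
suff h : forall eps, 0 < eps <= 1 -> Rabs (p (S t x) y - p x (Sb t y)) <= eps * ((M + M') * (norm x + norm y + 2)).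
  apply: Rminus_diag_uniq; apply: NNPP => hn.
  have h0 := Rabs_pos_lt _ hn.
  set Q := (M + M') * (norm x + norm y + 2) in h.
  have hQ : 0 < Q by apply: Rmult_lt_0_compat; lra.
  set r := Rabs (p (S t x) y - p x (Sb t y)) in h h0.
  have hr : 0 < r / (2 * Q) by apply: Rdiv_lt_0_compat; lra.
  have h1 := h (Rmin 1 (r / (2 * Q))) (conj (Rmin_pos _ _ Rlt_0_1 hr) (Rmin_l _ _)).
  have h2 : Rmin 1 (r / (2 * Q)) * Q <= r / (2 * Q) * Q by apply: Rmult_le_compat_r; [lra | exact: Rmin_r].
  have h3 : r / (2 * Q) * Q = r / 2 by field; lra.
  lra.
move=> eps [he he1].
have [u [g [hg hu]]] := hd x eps he; have [v [k [hk hv]]] := hdb y eps he.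
have E := semigroup_dual_domain hp hS hSb hgen hg hk ht.
have E1 : p (S t x) y - p x (Sb t y) =
   - p (S t (minus u x)) y - p (S t u) (minus v y) + p (minus u x) (Sb t v) + p x (Sb t (minus v y)).
  rewrite (linear_minus _ _ _ hl) (linear_minus _ _ _ hlb) !(dp_minus_l hp) !(dp_minus_r hp) E; ring.
have b1 := dp_norm hp (S t (minus u x)) y; have b2 := dp_norm hp (S t u) (minus v y).
have b3 := dp_norm hp (minus u x) (Sb t v); have b4 := dp_norm hp x (Sb t (minus v y)).
have tt : 0 <= t <= t by lra.
have c1 := hMb t (minus u x) tt; have c2 := hMb t u tt; have c3 := hMb' t v tt; have c4 := hMb' t (minus v y) tt.
have nu := norm_le_minus u x; have nv := norm_le_minus v y.
have P := fun (V : NormedModule R_AbsRing) (z : V) => norm_ge_0 z.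
have d1 : norm (S t (minus u x)) * norm y <= (M * eps) * norm y.
  apply: Rmult_le_compat_r => //; apply: Rle_trans c1 _; apply: Rmult_le_compat_l; lran.
have d2 : norm (S t u) * norm (minus v y) <= (M * (norm x + 1)) * eps.
  apply: Rmult_le_compat; try exact: P; last by left.
  apply: Rle_trans c2 _; apply: Rmult_le_compat_l; lran.
have d3 : norm (minus u x) * norm (Sb t v) <= eps * (M' * (norm y + 1)).
  apply: Rmult_le_compat; try exact: P; first by left.
  apply: Rle_trans c3 _; apply: Rmult_le_compat_l; lran.
have d4 : norm x * norm (Sb t (minus v y)) <= norm x * (M' * eps).
  apply: Rmult_le_compat_l => //; apply: Rle_trans c4 _; apply: Rmult_le_compat_l; lran.
have tri (a b c d : R) : Rabs (- a - b + c + d) <= Rabs a + Rabs b + Rabs c + Rabs d.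
  by rewrite /Rabs; do 5 case: Rcase_abs; lra.
rewrite E1.
have := tri (p (S t (minus u x)) y) (p (S t u) (minus v y)) (p (minus u x) (Sb t v)) (p x (Sb t (minus v y))).
have := Rmult_le_pos eps (M * norm x) ltac:(lra) ltac:(apply: Rmult_le_pos; lra).
have := Rmult_le_pos eps (M' * norm y) ltac:(lra) ltac:(apply: Rmult_le_pos; lra).
have := Rmult_le_pos eps M ltac:(lra) ltac:(lra).
have := Rmult_le_pos eps M' ltac:(lra) ltac:(lra).
intros; one_path.
have -> : eps * ((M + M') * (norm x + norm y + 2)) = eps * (M * norm x) + (M * eps) * norm y + 2 * (eps * M)
   + norm x * (M' * eps) + eps * (M' * norm y) + 2 * (eps * M') by ring.
lra.
Qed.

(** * Smoothing *)

Lemma Rpower_pow_base (q s : R) (k : nat) : 0 < q -> Rpower (q ^ k) s = (Rpower q s) ^ k.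
Proof.
move=> hq; elim: k => [|k IH]; first by rewrite /= /Rpower ln_1 Rmult_0_r exp_0.
by rewrite /= -Rpower_mult_distr ?IH //; exact: pow_lt.
Qed.

Lemma Rpower_neg_ge1 (t s : R) : 0 < t <= 1 -> 0 <= s -> 1 <= Rpower t (- s).
Proof.
move=> ht hs; rewrite /Rpower -exp_0; apply: exp_le_compat.
have : ln t <= 0 by rewrite -ln_1; apply: ln_le; lra.
nra.
Qed.

(** How vectors of [B] are shown to belong to [B1]: approximate them in [B] by images of vectors of
    [B1] that are Cauchy in the stronger norm. *)
Lemma embedded_lim (B B1 : Banach) (i1 : B1 -> B) (ys : nat -> B1) (x : B) (d Q : R) :
  is_linear i1 -> (forall z, norm (i1 z) <= norm z) ->
  (forall k, norm (minus (ys k.+1) (ys k)) <= d * (/2)^k) ->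
  (forall k, norm (minus (i1 (ys k)) x) <= d * (/2)^k) ->
  (forall k, norm (ys k) <= Q + d * (/2)^k) -> exists y, i1 y = x /\ norm y <= Q.
Proof.
move=> hl hi hc hx hn.
have [y hy] := geometric_lim hc.
have hd : 0 <= d by have := hc 0%N; have := norm_ge_0 (minus (ys 1%N) (ys 0%N)); rewrite /=; lra.
exists y; split.
- apply: norm_minus_small => eps he.
  have [k hk] := @pow_half_small (3 * d) eps ltac:(lra) he.
  have := hk k (le_n _); have := hx k; have := hy k; have := hi (minus (ys k) y).
  rewrite (linear_minus _ _ _ hl).
  have := norm_minus_trans (i1 y) (i1 (ys k)) x; have := norm_minusC (i1 y) (i1 (ys k)).
  lran.
- apply: Rle_plus_epsilon => eps he.
  have [k hk] := @pow_half_small (3 * d) eps ltac:(lra) he.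
  have := hk k (le_n _); have := hn k; have := hy k.
  have := norm_le_minus y (ys k); have := norm_minusC y (ys k).
  lran.
Qed.

Section Smoothing.
Context (n : nat) (B B1 B2 Bb B1b : Banach) (i1 : B1 -> B) (i2 : B2 -> B1) (i1b : B1b -> Bb).
Context (D : 'I_n -> B1 -> B) (Db : 'I_n -> B1b -> Bb) (p : B -> Bb -> R).
Context (A : B2 -> B) (S : R -> B -> B).
Context (ht : banach_triple i1 i2) (hib : dense_embedding i1b).
Context (hDl : forall j, is_linear (D j)).
Context (hnorm : forall b, norm b = norm (i1 b) + sum_ord (fun j => norm (D j b))).
Context (hp : dual_pair p) (hdual : forall j b f, p (D j b) (i1b f) = - p (i1 b) (Db j f)).
Context (hAl : is_linear A) (hS : generates (fun b => i1 (i2 b)) A S).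
Context (kap om C : R) (hkap : 0 < kap) (hom : 0 < om < 1) (hC : 0 <= C).
(* Smoothing and the commutator bound, in a weak form that is invariant under exchanging the two triples. *)
Context (hW : forall j t x f, 0 < t <= 1 ->
  Rabs (p (S t x) (Db j f)) <= kap * Rpower t (- om) * norm x * norm (i1b f)).
Context (hWC : forall j t b f, 0 <= t <= 1 ->
  Rabs (p (S t (D j b)) (i1b f) + p (S t (i1 b)) (Db j f)) <= C * norm (i1 b) * norm (i1b f)).

Let hS0 : C0_semigroup S := proj1 hS.
Let li1 : is_linear i1 := proj1 (proj1 ht).
Let li2 : is_linear i2 := proj1 (proj2 ht).
Let inj1 : forall x y, i1 x = i1 y -> x = y := proj1 (proj2 (proj1 ht)).
Let ni1 : forall x, norm (i1 x) <= norm x := proj1 (proj2 (proj2 (proj1 ht))).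

Lemma dense_core x eps : 0 < eps -> exists u, norm (minus (i1 (i2 u)) x) < eps.
Proof.
move=> he.
have [b hb] := proj2 (proj2 (proj2 (proj1 ht))) x (eps / 2) ltac:(lra).
have [u hu] := proj2 (proj2 (proj2 (proj2 ht))) b (eps / 2) ltac:(lra).
exists u; have := norm_minus_trans (i1 (i2 u)) (i1 b) x; have := ni1 (minus (i2 u) b).
rewrite (linear_minus _ _ _ li1); lran.
Qed.

(** Turns weak estimates into bounds of the derivative terms in the norm of [B1], by moving [D j] to
    the other side of the pairing. *)
Lemma norm_D_le j b M : 0 <= M -> (forall f, Rabs (p (i1 b) (Db j f)) <= M * norm (i1b f)) -> norm (D j b) <= M.
Proof.
move=> hM h; apply: (norm_by_dual hp hib hM) => f.
by rewrite hdual Rabs_Ropp; exact: h.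
Qed.

(** The bound of [hW] blows up as t tends to 0, but for x in the domain the increments of the orbit
    are small enough to be summed along t = 2^(-k). The result involves [i1b f] only, not
    [Db j f]. *)
Lemma domain_weak_bound : exists C1, 0 < C1 /\ forall x g, generator_at S x g ->
  forall j f, Rabs (p x (Db j f)) <= C1 * (norm x + norm g) * norm (i1b f).
Proof.
have [M [hM hMb]] := sg_bound hS0 1.
(* Ratio of the geometric series whose terms are h^(1-om) at h = 2^(-k). *)
set q := Rpower (/2) (1 - om).
have hq : 0 < q < 1.
  split; first exact: Rpower_pos.
  apply: (Rlt_le_trans _ (exp 0)); last by rewrite exp_0; lra.
  rewrite /q /Rpower; apply: exp_increasing.
  have hln : ln (/2) < 0 by rewrite -ln_1; apply: ln_increasing; lra.
  have := @Rmult_lt_0_compat (1 - om) (- ln (/2)) ltac:(lra) ltac:(lra); lra.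
exists (kap * (1 + M / (1 - q))).
have hMq : 0 < M / (1 - q) by apply: Rdiv_lt_0_compat; lra.
split; first by apply: Rmult_lt_0_compat; lra.
move=> x g hg j f.
set m := norm (i1b f); have hm : 0 <= m by exact: norm_ge_0.
have hxn := norm_ge_0 x; have hgn := norm_ge_0 g.
have hpow k : 0 < (/2)^k <= 1.
  split; first by apply: pow_lt; lra.
  by rewrite -(pow1 k); apply: pow_incr; lra.
(* [S h x = S (2h) x - S h (S h x - x)] with [|S h x - x| = O(h)], so each halving costs [O(h^(1 - om))]. *)
have main : forall N : nat, Rabs (p (S ((/2)^N) x) (Db j f)) <=
    kap * (norm x + M * norm g * ((q - q ^ N.+1) / (1 - q))) * m.
  elim=> [|N IH].
    have := @hW j 1 x f ltac:(lra).
    rewrite /Rpower ln_1 Rmult_0_r exp_0 pow_O pow_1 Rminus_diag_eq // -/m.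
    rewrite /Rdiv Rmult_0_l Rmult_0_r Rplus_0_r; lra.
  set h := (/2)^N.+1; have hh := hpow N.+1; rewrite -/h in hh.
  have eh : (/2)^N = h + h by rewrite /h /=; field.
  rewrite eh in IH.
  have hlh := sg_linear hS0 (Rlt_le _ _ (proj1 hh)).
  have e1 : p (S h x) (Db j f) = p (S (h + h) x) (Db j f) - p (S h (minus (S h x) x)) (Db j f).
    rewrite (linear_minus _ _ _ hlh) (dp_minus_l hp) (sg_plus hS0); [ring | lra | lra].
  have h1 := hW j (minus (S h x) x) f hh.
  have h2 := @generator_lipschitz B S hS0 M 1 x g h hMb ltac:(lra) hg ltac:(lra).
  have eq1 : Rpower h (- om) * h = q ^ N.+1.
    rewrite -{2}(Rpower_1 h); last lra.
    rewrite -Rpower_plus /h Rpower_pow_base; last lra.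
    by congr (Rpower _ _ ^ _); ring.
  have h3 : kap * Rpower h (- om) * norm (minus (S h x) x) * norm (i1b f) <= kap * (M * norm g * q ^ N.+1) * m.
    rewrite -/m; apply: Rmult_le_compat_r => //.
    rewrite Rmult_assoc; apply: Rmult_le_compat_l; first lra.
    apply: (Rle_trans _ (Rpower h (- om) * (M * h * norm g))).
      by apply: Rmult_le_compat_l => //; left; exact: Rpower_pos.
    right; rewrite -eq1; ring.
  have e2 : kap * (norm x + M * norm g * ((q - q ^ N.+2) / (1 - q))) * m =
     kap * (norm x + M * norm g * ((q - q ^ N.+1) / (1 - q))) * m + kap * (M * norm g * q ^ N.+1) * m.
    by rewrite /=; field; lra.
  rewrite e2 e1.
  have tri (u v : R) : Rabs (u - v) <= Rabs u + Rabs v by rewrite /Rabs; do 3 case: Rcase_abs; lra.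
  have := tri (p (S (h + h) x) (Db j f)) (p (S h (minus (S h x) x)) (Db j f)); lra.
(* Letting [N] grow: the error S (2^(-N)) x - x is paired with [Db j f] itself, but it vanishes in
   the limit and leaves the constant unchanged. *)
apply: Rle_plus_epsilon => eps he.
have hz := norm_ge_0 (Db j f).
have hMg : 0 <= M * norm g * norm (Db j f) by apply: Rmult_le_pos => //; apply: Rmult_le_pos; lra.
have [N hN] := pow_half_small hMg he.
have hNN := hN N (le_n _).
have h1 := main N; have hh := hpow N.
have h2 := dp_norm hp (minus (S ((/2)^N) x) x) (Db j f).
have h3 := @generator_lipschitz B S hS0 M 1 x g ((/2)^N) hMb ltac:(lra) hg ltac:(lra).
have h4 : norm (minus (S ((/2)^N) x) x) * norm (Db j f) <= M * (/2)^N * norm g * norm (Db j f).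
  by apply: Rmult_le_compat_r.
have h5 : kap * (norm x + M * norm g * ((q - q ^ N.+1) / (1 - q))) * m <= kap * (1 + M / (1 - q)) * (norm x + norm g) * m.
  apply: Rmult_le_compat_r => //; rewrite (Rmult_assoc kap); apply: Rmult_le_compat_l; first lra.
  have hqN : (q - q ^ N.+1) / (1 - q) <= / (1 - q).
    rewrite /Rdiv -{2}(Rmult_1_l (/ (1 - q))); apply: Rmult_le_compat_r.
      by left; apply: Rinv_0_lt_compat; lra.
    have := pow_lt q N.+1 (proj1 hq); lra.
  have : M * norm g * ((q - q ^ N.+1) / (1 - q)) <= M * norm g * / (1 - q).
    by apply: Rmult_le_compat_l => //; apply: Rmult_le_pos; lra.
  have : 0 <= M / (1 - q) * norm x by apply: Rmult_le_pos; lra.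
  rewrite /Rdiv; nra.
have e3 : p x (Db j f) = p (S ((/2)^N) x) (Db j f) - p (minus (S ((/2)^N) x) x) (Db j f).
  by rewrite (dp_minus_l hp); ring.
rewrite e3.
have tri (u v : R) : Rabs (u - v) <= Rabs u + Rabs v by rewrite /Rabs; do 3 case: Rcase_abs; lra.
have := tri (p (S ((/2)^N) x) (Db j f)) (p (minus (S ((/2)^N) x) x) (Db j f)); lran.
Qed.

(** On the image of [B2] the weak bound controls the [B1] norm by the graph norm of [A]. Since the
    generator is the closure of [A], any vector of its domain is a graph-norm limit of such images,
    and these are then Cauchy in [B1]. *)
Lemma domain_lift : exists C2, 0 < C2 /\ forall x g, generator_at S x g ->
  exists y, i1 y = x /\ norm y <= C2 * (norm x + norm g).
Proof.
have [C1 [hC1 h1]] := domain_weak_bound.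
have hn := pos_INR n.
have hnC : 0 <= INR n * C1 by apply: Rmult_le_pos; lra.
have hu u : norm (i2 u) <= (1 + INR n * C1) * (norm (i1 (i2 u)) + norm (A u)).
  have hx := norm_ge_0 (i1 (i2 u)); have hg := norm_ge_0 (A u).
  rewrite hnorm.
  have : sum_ord (fun j => norm (D j (i2 u))) <= INR n * (C1 * (norm (i1 (i2 u)) + norm (A u))).
    apply: sum_ord_const => j; apply: norm_D_le => [|f]; first by apply: Rmult_le_pos; lra.
    by apply: h1; exact: (proj1 (proj2 hS) u).
  nra.
set K := 1 + INR n * C1 in hu.
have hK : 0 < K by rewrite /K; lra.
exists K; split=> // x g hg.
have happ k : exists u, norm (minus (i1 (i2 u)) x) < (/2)^k /\ norm (minus (A u) g) < (/2)^k.
  by apply: (proj2 (proj2 hS) x g hg); apply: pow_lt; lra.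
pose u k := proj1_sig (constructive_indefinite_description _ (happ k)).
have hu1 k : norm (minus (i1 (i2 (u k))) x) < (/2)^k /\ norm (minus (A (u k)) g) < (/2)^k.
  exact: (proj2_sig (constructive_indefinite_description _ (happ k))).
have hp0 k : 0 < (/2)^k by apply: pow_lt; lra.
(* One constant for the three conditions: 4K for consecutive differences, 1 for convergence in [B],
   2K for the norms. *)
apply: (embedded_lim (ys := fun k => i2 (u k)) (d := 4 * K + 1)) => // k.
- rewrite -(linear_minus _ _ _ li2).
  apply: Rle_trans (hu _) _.
  rewrite (linear_minus _ _ _ li2) (linear_minus _ _ _ li1) (linear_minus _ _ _ hAl).
  have [a1 a2] := hu1 k; have [b1 b2] := hu1 k.+1; have := hp0 k.
  have e : (/2)^k.+1 = (/2)^k / 2 by rewrite /=; field.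
  rewrite e in b1 b2 => h0.
  have t1 := norm_minus_trans (i1 (i2 (u k.+1))) x (i1 (i2 (u k))); have t2 := norm_minusC x (i1 (i2 (u k))).
  have t3 := norm_minus_trans (A (u k.+1)) g (A (u k)); have t4 := norm_minusC g (A (u k)).
  apply: (Rle_trans _ (K * (4 * (/2)^k))); last by nra.
  apply: Rmult_le_compat_l; lran.
- have [a1 _] := hu1 k; have := hp0 k; have := Rmult_lt_0_compat _ _ hK (hp0 k); nra.
- apply: Rle_trans (hu _) _.
  have [a1 a2] := hu1 k; have h0 := hp0 k.
  have t1 := norm_le_minus (i1 (i2 (u k))) x; have t2 := norm_le_minus (A (u k)) g.
  apply: (Rle_trans _ (K * (norm x + norm g + 2 * (/2)^k))); last by nra.
  apply: Rmult_le_compat_l; lran.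
Qed.

(** Orbits from [B2] stay in the domain of the generator, hence in [B1] by [domain_lift]; [hW]
    bounds their [B1] norm by the norm of the initial value in [B], so density extends both facts to
    all of [B]. *)
Lemma smoothing_near_0 : exists K, 0 < K /\ forall t x, 0 < t <= 1 ->
  exists y, i1 y = S t x /\ norm y <= K * Rpower t (- om) * norm x.
Proof.
have [C2 [hC2 h2]] := domain_lift.
have [M [hM hMb]] := sg_bound hS0 1.
have hn := pos_INR n.
set K := M + INR n * kap.
have hK : 0 < K by have := Rmult_le_pos _ _ hn (Rlt_le _ _ hkap); rewrite /K; lra.
have hdom t y x : 0 < t <= 1 -> i1 y = S t x -> norm y <= K * Rpower t (- om) * norm x.
  move=> ht1 hy.
  rewrite hnorm.
  have hx := norm_ge_0 x; have h1 := Rpower_neg_ge1 ht1 (Rlt_le _ _ (proj1 hom)).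
  have : sum_ord (fun j => norm (D j y)) <= INR n * (kap * Rpower t (- om) * norm x).
    apply: sum_ord_const => j; apply: norm_D_le => [|f].
      by apply: Rmult_le_pos => //; apply: Rmult_le_pos; lra.
    by rewrite hy; exact: hW.
  have : norm (i1 y) <= M * norm x by rewrite hy; apply: hMb; lra.
  have : M * norm x <= M * norm x * Rpower t (- om).
    by rewrite -{1}(Rmult_1_r (M * norm x)); apply: Rmult_le_compat_l => //; apply: Rmult_le_pos; lra.
  rewrite /K; lra.
exists K; split=> // t x ht1.
have ht0 : 0 <= t by lra.
have happ k : exists u, norm (minus (i1 (i2 u)) x) < (/2)^k by apply: dense_core; apply: pow_lt; lra.
pose u k := proj1_sig (constructive_indefinite_description _ (happ k)).
have hu k : norm (minus (i1 (i2 (u k))) x) < (/2)^k.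
  exact: (proj2_sig (constructive_indefinite_description _ (happ k))).
have hp0 k : 0 < (/2)^k by apply: pow_lt; lra.
have hlift k : exists y, i1 y = S t (i1 (i2 (u k))).
  have [y [hy _]] := h2 _ _ (generator_orbit hS0 ht0 (proj1 (proj2 hS) (u k))).
  by exists y.
pose ys k := proj1_sig (constructive_indefinite_description _ (hlift k)).
have hys k : i1 (ys k) = S t (i1 (i2 (u k))).
  exact: (proj2_sig (constructive_indefinite_description _ (hlift k))).
have hr := Rpower_pos t (- om).
set Q := K * Rpower t (- om).
have hQ : 0 < Q by apply: Rmult_lt_0_compat.
have hlt := sg_linear hS0 ht0.
apply: (embedded_lim (ys := ys) (d := 2 * Q + M)) => // k.
- have hmin : i1 (minus (ys k.+1) (ys k)) = S t (minus (i1 (i2 (u k.+1))) (i1 (i2 (u k)))).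
    by rewrite (linear_minus _ _ _ li1) !hys (linear_minus _ _ _ hlt).
  apply: Rle_trans (hdom _ _ _ ht1 hmin) _; rewrite -/Q.
  have a1 := hu k; have b1 := hu k.+1; have h0 := hp0 k.
  have e : (/2)^k.+1 = (/2)^k / 2 by rewrite /=; field.
  rewrite e in b1.
  have t1 := norm_minus_trans (i1 (i2 (u k.+1))) x (i1 (i2 (u k))); have t2 := norm_minusC x (i1 (i2 (u k))).
  apply: (Rle_trans _ (Q * (2 * (/2)^k))); last by nra.
  apply: Rmult_le_compat_l; lran.
- rewrite hys -(linear_minus _ _ _ hlt).
  apply: Rle_trans (hMb _ _ _) _; first lra.
  have a1 := hu k; have h0 := hp0 k.
  apply: (Rle_trans _ (M * (/2)^k)); last by nra.
  apply: Rmult_le_compat_l; lran.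
- apply: Rle_trans (hdom _ _ _ ht1 (hys k)) _; rewrite -/Q.
  have a1 := hu k; have h0 := hp0 k; have t1 := norm_le_minus (i1 (i2 (u k))) x.
  apply: (Rle_trans _ (Q * (norm x + (/2)^k))); last by nra.
  apply: Rmult_le_compat_l; lran.
Qed.

Lemma smoothing_bound : exists K w, 0 < K /\ 0 <= w /\ forall t x, 0 < t ->
  exists y, i1 y = S t x /\ norm y <= K * Rpower t (- om) * exp (w * t) * norm x.
Proof.
have [K [hK h]] := smoothing_near_0.
have [M [w [hM [hw hg]]]] := sg_growth hS0.
(* For t > 1 the splitting S t = S 1 S (t-1) loses the factor t^(-om); the extra rate [om] restores
   it, because ln t <= t. *)
exists (K * M), (w + om); split; first by apply: Rmult_lt_0_compat; lra.
split; first lra.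
move=> t x ht0; have hx := norm_ge_0 x.
have hexp s : 0 <= s -> 1 <= exp s by move=> hs; rewrite -exp_0; apply: exp_le_compat.
have hr := Rpower_pos t (- om).
case: (Rle_dec t 1) => h1.
- have [y [hy hn]] := h t x (conj ht0 h1); exists y; split=> //.
  apply: Rle_trans hn _; apply: Rmult_le_compat_r => //.
  have he := hexp ((w + om) * t) ltac:(apply: Rmult_le_pos; lra).
  have : 1 <= M * exp ((w + om) * t) by nra.
  have : 0 < K * Rpower t (- om) by apply: Rmult_lt_0_compat.
  nra.
- have [y [hy hn]] := h 1 (S (t - 1) x) ltac:(lra).
  exists y; split; first by rewrite hy -(sg_plus hS0); [congr (S _ x); ring | lra | lra].
  have hone : Rpower 1 (- om) = 1 by rewrite /Rpower ln_1 Rmult_0_r exp_0.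
  rewrite hone Rmult_1_r in hn.
  have h2 := hg (t - 1) x ltac:(lra).
  apply: Rle_trans hn _.
  apply: (Rle_trans _ (K * (M * exp (w * (t - 1)) * norm x))).
    by apply: Rmult_le_compat_l; lra.
  have h3 : exp (w * (t - 1)) <= Rpower t (- om) * exp ((w + om) * t).
    rewrite /Rpower -exp_plus; apply: exp_le_compat.
    have : ln t <= t.
      have := exp_ineq1_le (ln t); rewrite exp_ln; lra.
    nra.
  have hKM : 0 <= K * M * norm x by apply: Rmult_le_pos => //; apply: Rmult_le_pos; lra.
  have := Rmult_le_compat_l _ _ _ hKM h3; lra.
Qed.

(** For t <= 1, [D j] is moved through [S t] at the cost of the bounded commutator. For t > 1
    smoothing suffices, since t^(-om) <= 1. *)
Lemma restriction_bound : exists K w, 0 < K /\ 0 <= w /\ forall t b, 0 <= t ->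
  exists y, i1 y = S t (i1 b) /\ norm y <= K * exp (w * t) * norm b.
Proof.
have [K [w [hK [hw h]]]] := smoothing_bound.
have [M [hM hMb]] := sg_bound hS0 1.
have hn := pos_INR n.
have hMC : 0 <= INR n * (M + C) by apply: Rmult_le_pos; lra.
exists (K + (M + INR n * (M + C))), w; split; first lra.
split=> // t b ht0.
have hb := norm_ge_0 b; have hib1 := ni1 b; have hib0 := norm_ge_0 (i1 b).
have hexp : 1 <= exp (w * t) by rewrite -exp_0; apply: exp_le_compat; apply: Rmult_le_pos.
have hlift : exists y, i1 y = S t (i1 b).
  case: (Req_dec t 0) => [->|h0]; first by exists b; rewrite (sg_0 hS0).
  by have [y [hy _]] := h t (i1 b) ltac:(lra); exists y.
case: (Rle_dec t 1) => h1.
- have [y hy] := hlift; exists y; split=> //.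
  have hDj j : norm (D j y) <= M * norm (D j b) + C * norm (i1 b).
    have hDb := norm_ge_0 (D j b).
    apply: norm_D_le => [|f].
      by apply: Rplus_le_le_0_compat; apply: Rmult_le_pos; lra.
    rewrite hy.
    have a1 := hWC j b f (conj ht0 h1).
    have a2 := dp_norm hp (S t (D j b)) (i1b f).
    have a3 := hMb t (D j b) (conj ht0 h1).
    have hf := norm_ge_0 (i1b f).
    have a4 : norm (S t (D j b)) * norm (i1b f) <= M * norm (D j b) * norm (i1b f) by apply: Rmult_le_compat_r.
    have tri (u v : R) : Rabs v <= Rabs (u + v) + Rabs u by rewrite /Rabs; do 3 case: Rcase_abs; lra.
    have := tri (p (S t (D j b)) (i1b f)) (p (S t (i1 b)) (Db j f)); lra.
  have hDjb j : norm (D j b) <= norm b.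
    rewrite (hnorm b).
    have := @sum_ord_elem n (fun j => norm (D j b)) j (fun j => norm_ge_0 _); lra.
  have hsum : sum_ord (fun j => norm (D j y)) <= INR n * ((M + C) * norm b).
    apply: sum_ord_const => j; apply: Rle_trans (hDj j) _.
    have := hDjb j; nra.
  have hi : norm (i1 y) <= M * norm b.
    rewrite hy; apply: Rle_trans (hMb t _ (conj ht0 h1)) _.
    by apply: Rmult_le_compat_l; lra.
  rewrite hnorm.
  have : 0 <= (M + INR n * (M + C)) * norm b by apply: Rmult_le_pos; lra.
  have : 0 <= K * norm b by apply: Rmult_le_pos; lra.
  nra.
- have [y [hy hyn]] := h t (i1 b) ltac:(lra).
  exists y; split=> //.
  apply: Rle_trans hyn _.
  have hr : Rpower t (- om) <= 1.
    rewrite -(Rpower_O t); last lra.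
    by apply: Rle_Rpower; lra.
  have hr0 := Rpower_pos t (- om).
  have : K * Rpower t (- om) * exp (w * t) * norm (i1 b) <= K * 1 * exp (w * t) * norm b.
    apply: Rmult_le_compat => //.
      by apply: Rmult_le_pos; [apply: Rmult_le_pos; lra | lra].
    apply: Rmult_le_compat_r; first lra.
    by apply: Rmult_le_compat_l; lra.
  have : 0 <= (M + INR n * (M + C)) * exp (w * t) * norm b.
    by apply: Rmult_le_pos => //; apply: Rmult_le_pos; lra.
  lra.
Qed.

(** The uniform bound reduces the claim to the dense image of [B2]. There S t x - x lies in the
    domain, with generator S t (A u) - A u, and [domain_lift] bounds its [B1] norm by two quantities
    that vanish by strong continuity in [B]. *)
Lemma restriction_cont0 b eps : 0 < eps -> exists delta, 0 < delta /\
  forall t y, 0 <= t < delta -> i1 y = S t (i1 b) -> norm (minus y b) < eps.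
Proof.
move=> he.
have [C2 [hC2 h2]] := domain_lift.
have [K [w [hK [hw h]]]] := restriction_bound.
set K1 := K * exp w.
have hK1 : 0 < K1 by apply: Rmult_lt_0_compat => //; exact: exp_pos.
have [u hu] := proj2 (proj2 (proj2 (proj2 ht))) b (eps / (2 * (K1 + 1))) ltac:(apply: Rdiv_lt_0_compat; lra).
have hg := proj1 (proj2 hS) u.
have [d1 [hd1 k1]] := @sg_right_cont B S hS0 (i1 (i2 u)) (eps / (4 * C2)) ltac:(apply: Rdiv_lt_0_compat; lra).
have [d2 [hd2 k2]] := @sg_right_cont B S hS0 (A u) (eps / (4 * C2)) ltac:(apply: Rdiv_lt_0_compat; lra).
exists (Rmin (Rmin d1 d2) 1); split; first by apply: Rmin_pos; [exact: Rmin_pos | lra].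
move=> t y ht1 hy.
have l1 := Rmin_l d1 d2; have l2 := Rmin_r d1 d2; have l3 := Rmin_l (Rmin d1 d2) 1; have l4 := Rmin_r (Rmin d1 d2) 1.
have ht0 : 0 <= t by lra.
have [z [hz hzn]] := h2 _ _ (generator_minus hS0 (generator_orbit hS0 ht0 hg) hg).
have [y' [hy' hyn']] := h t (minus b (i2 u)) ht0.
have e : minus y b = plus (plus y' z) (minus (i2 u) b).
  apply: inj1.
  rewrite (linear_plus _ li1 (plus y' z)) (linear_plus _ li1 y' z) !(linear_minus _ _ _ li1) hy hy' hz.
  rewrite (linear_minus _ _ _ li1) (linear_minus _ _ _ (sg_linear hS0 ht0)).
  rewrite /minus -!plus_assoc; congr plus.
  rewrite plus_assoc plus_opp_l plus_zero_l plus_assoc plus_opp_l plus_zero_l //.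
have t1 := norm_triangle (plus y' z) (minus (i2 u) b); have t2 := norm_triangle y' z.
have hE : exp (w * t) <= exp w by apply: exp_le_compat; nra.
have b1 : norm y' <= K1 * norm (minus b (i2 u)).
  apply: Rle_trans hyn' _; apply: Rmult_le_compat_r; first exact: norm_ge_0.
  by apply: Rmult_le_compat_l; lra.
rewrite norm_minusC in b1.
have b2 : (K1 + 1) * norm (minus (i2 u) b) < eps / 2.
  have -> : eps / 2 = (K1 + 1) * (eps / (2 * (K1 + 1))) by field; lra.
  by apply: Rmult_lt_compat_l; lra.
have b3 : norm z <= eps / 2.
  apply: Rle_trans hzn _.
  have := k1 t ltac:(lra); have := k2 t ltac:(lra) => q2 q1.
  have -> : eps / 2 = C2 * (eps / (4 * C2) + eps / (4 * C2)) by field; lra.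
  apply: Rmult_le_compat_l; lran.
rewrite e; lran.
Qed.

End Smoothing.

(** Outcome of the duality argument, in the same form for both triples. Lifts to [B1] are
    quantified, not chosen; injectivity of [i1] makes them unique later. *)
Record smoothing_semigroup (B B1 : Banach) (i1 : B1 -> B) (S : R -> B -> B) (K w om : R) : Prop := {
  ss_C0 : C0_semigroup S;
  ss_K : 0 < K;
  ss_w : 0 <= w;
  ss_om : 0 < om < 1;
  ss_smooth : forall t x, 0 < t -> exists y, i1 y = S t x /\
    norm y <= K * Rpower t (- om) * exp (w * t) * norm x;
  ss_restr : forall t b, 0 <= t -> exists y, i1 y = S t (i1 b) /\ norm y <= K * exp (w * t) * norm b;
  ss_cont0 : forall b eps, 0 < eps -> exists delta, 0 < delta /\
    forall t y, 0 <= t < delta -> i1 y = S t (i1 b) -> norm (minus y b) < eps }.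

Lemma smoothing_semigroup_of_weak (n : nat) (B B1 B2 Bb B1b : Banach)
    (i1 : B1 -> B) (i2 : B2 -> B1) (i1b : B1b -> Bb)
    (D : 'I_n -> B1 -> B) (Db : 'I_n -> B1b -> Bb) (p : B -> Bb -> R) (A : B2 -> B) (S : R -> B -> B)
    (kap om C : R) :
  banach_triple i1 i2 -> dense_embedding i1b ->
  (forall b, norm b = norm (i1 b) + sum_ord (fun j => norm (D j b))) ->
  dual_pair p -> (forall j b f, p (D j b) (i1b f) = - p (i1 b) (Db j f)) ->
  is_linear A -> generates (fun b => i1 (i2 b)) A S ->
  0 < kap -> 0 < om < 1 -> 0 <= C ->
  (forall j t x f, 0 < t <= 1 ->
    Rabs (p (S t x) (Db j f)) <= kap * Rpower t (- om) * norm x * norm (i1b f)) ->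
  (forall j t b f, 0 <= t <= 1 ->
    Rabs (p (S t (D j b)) (i1b f) + p (S t (i1 b)) (Db j f)) <= C * norm (i1 b) * norm (i1b f)) ->
  exists K w, smoothing_semigroup i1 S K w om.
Proof.
move=> ht hib hnorm hp hdual hAl hS hkap hom hC hW hWC.
have [K [w [hK [hw h1]]]] := smoothing_bound ht hib hnorm hp hdual hAl hS hkap hom hW.
have [K' [w' [hK' [hw' h2]]]] := restriction_bound ht hib hnorm hp hdual hAl hS hkap hom hC hW hWC.
have l1 := Rmax_l K K'; have l2 := Rmax_r K K'; have l3 := Rmax_l w w'; have l4 := Rmax_r w w'.
exists (Rmax K K'), (Rmax w w'); split => //.
- exact: (proj1 hS).
- lra.
- lra.
- move=> t x t0; have [y [hy hn]] := h1 t x t0; exists y; split=> //.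
  apply: Rle_trans hn _; apply: Rmult_le_compat_r; first exact: norm_ge_0.
  have hr := Rpower_pos t (- om).
  apply: Rmult_le_compat => //; try (left; exact: exp_pos).
  + by apply: Rmult_le_pos; lra.
  + by apply: Rmult_le_compat_r; lra.
  + by apply: exp_le_compat; apply: Rmult_le_compat_r; lra.
- move=> t b t0; have [y [hy hn]] := h2 t b t0; exists y; split=> //.
  apply: Rle_trans hn _; apply: Rmult_le_compat_r; first exact: norm_ge_0.
  apply: Rmult_le_compat => //; try (left; exact: exp_pos); try lra.
  by apply: exp_le_compat; apply: Rmult_le_compat_r; lra.
- exact: (restriction_cont0 ht hib hnorm hp hdual hAl hS hkap hom hC hW hWC).
Qed.

(** The Lipschitz constant serves only to pass to the limit: the bound obtained keeps the constant
    [c] valid on the dense subspace. *)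
Lemma dense_bound (B B1 : Banach) (i : B1 -> B) (phi : B -> R) (Lc c : R) (x : B) :
  dense_embedding i -> (forall y y', Rabs (phi y - phi y') <= Lc * norm (minus y y')) -> 0 <= c ->
  (forall b, Rabs (phi (i b)) <= c * norm (i b)) -> Rabs (phi x) <= c * norm x.
Proof.
move=> [_ [_ [_ hd]]] hL hc h.
apply: Rle_plus_epsilon => eps he.
have hLp := Rabs_pos Lc.
set q := Rabs Lc + c + 1.
have hq : 0 < q by rewrite /q; lra.
have [b hb] := hd x (eps / q) ltac:(exact: Rdiv_lt_0_compat).
have h1 := h b; have h2 := hL (i b) x; have h3 := norm_le_minus (i b) x.
have h4 : Rabs (phi x) <= Rabs (phi (i b)) + Rabs (phi (i b) - phi x).
  by rewrite /Rabs; do 3 case: Rcase_abs; lra.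
have h5 : Lc * norm (minus (i b) x) <= Rabs Lc * norm (minus (i b) x).
  by apply: Rmult_le_compat_r; [exact: norm_ge_0 | exact: Rle_abs].
have h6 : c * norm (i b) <= c * (norm (minus (i b) x) + norm x) by apply: Rmult_le_compat_l.
have h7 : q * norm (minus (i b) x) <= q * (eps / q) by apply: Rmult_le_compat_l; lran.
have h8 : q * (eps / q) = eps by field; lra.
have h9 := norm_ge_0 (minus (i b) x).
rewrite /q in h7 h8; rewrite h8 in h7; lran.
Qed.

(** Duality is given for [A] and [Ab] on the small spaces; approximating both vectors in graph norm
    carries it to the full domains of the generators. *)
Lemma generator_pairing (B B2 Bb B2b : Banach) (e : B2 -> B) (eb : B2b -> Bb)
    (A : B2 -> B) (Ab : B2b -> Bb) (S : R -> B -> B) (Sb : R -> Bb -> Bb) (p : B -> Bb -> R)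
    (x g : B) (y k : Bb) :
  dual_pair p -> generates e A S -> generates eb Ab Sb ->
  (forall b f, p (A b) (eb f) = p (e b) (Ab f)) ->
  generator_at S x g -> generator_at Sb y k -> p g y = p x k.
Proof.
move=> hp [_ [_ hS]] [_ [_ hSb]] hA hx hy.
apply: Rminus_diag_uniq; apply: NNPP => hn.
have h0 := Rabs_pos_lt _ hn.
set r := Rabs (p g y - p x k) in h0.
have nx := norm_ge_0 x; have ng := norm_ge_0 g; have ny := norm_ge_0 y; have nk := norm_ge_0 k.
set Q := norm x + norm g + norm y + norm k + 2.
have hQ : 0 < Q by rewrite /Q; lra.
have he : 0 < Rmin 1 (r / (4 * Q)) by apply: Rmin_pos; [lra | apply: Rdiv_lt_0_compat; lra].
set eps := Rmin 1 (r / (4 * Q)) in he.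
have he1 : eps <= 1 by exact: Rmin_l.
have heQ : eps * Q <= r / 4.
  have : eps * Q <= r / (4 * Q) * Q by apply: Rmult_le_compat_r; [lra | exact: Rmin_r].
  have -> : r / (4 * Q) * Q = r / 4 by field; lra.
  by [].
have [u [hu1 hu2]] := hS x g hx eps he; have [v [hv1 hv2]] := hSb y k hy eps he.
have E : p g y - p x k = - p (minus (A u) g) (eb v) - p g (minus (eb v) y) + p (minus (e u) x) (Ab v) + p x (minus (Ab v) k).
  by rewrite !(dp_minus_l hp) !(dp_minus_r hp) hA; ring.
have b1 := dp_norm hp (minus (A u) g) (eb v); have b2 := dp_norm hp g (minus (eb v) y).
have b3 := dp_norm hp (minus (e u) x) (Ab v); have b4 := dp_norm hp x (minus (Ab v) k).
have c1 := norm_le_minus (eb v) y; have c2 := norm_le_minus (Ab v) k.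
have P := fun (V : NormedModule R_AbsRing) (z : V) => norm_ge_0 z.
have d1 : norm (minus (A u) g) * norm (eb v) <= eps * (norm y + 1).
  by apply: Rmult_le_compat; try exact: P; lran.
have d2 : norm g * norm (minus (eb v) y) <= norm g * eps by apply: Rmult_le_compat_l; lran.
have d3 : norm (minus (e u) x) * norm (Ab v) <= eps * (norm k + 1).
  by apply: Rmult_le_compat; try exact: P; lran.
have d4 : norm x * norm (minus (Ab v) k) <= norm x * eps by apply: Rmult_le_compat_l; lran.
have tri (a b c d : R) : Rabs (- a - b + c + d) <= Rabs a + Rabs b + Rabs c + Rabs d.
  by rewrite /Rabs; do 5 case: Rcase_abs; lra.
have := tri (p (minus (A u) g) (eb v)) (p g (minus (eb v) y)) (p (minus (e u) x) (Ab v)) (p x (minus (Ab v) k)).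
rewrite -E -/r => h.
have : eps * Q = eps * (norm y + 1) + norm g * eps + eps * (norm k + 1) + norm x * eps by rewrite /Q; ring.
lra.
Qed.

(** Smoothing and commutator bounds are given for [S] alone. Written as bounds of bilinear forms
    they transfer to [Sb], and the same one-sided lemma applies twice. *)
Lemma dual_smoothing_semigroups (n : nat) (B B1 B2 Bb B1b B2b : Banach)
    (i1 : B1 -> B) (i2 : B2 -> B1) (i1b : B1b -> Bb) (i2b : B2b -> B1b)
    (D : 'I_n -> B1 -> B) (Db : 'I_n -> B1b -> Bb) (p : B -> Bb -> R)
    (A : B2 -> B) (Ab : B2b -> Bb) (S : R -> B -> B) (Sb : R -> Bb -> Bb) :
  banach_triple i1 i2 -> banach_triple i1b i2b ->
  generated_by i1 i2 D -> generated_by i1b i2b Db -> dual_triples i1 D i1b Db p ->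
  is_linear A -> is_linear Ab ->
  (forall b f, p (A b) (i1b (i2b f)) = p (i1 (i2 b)) (Ab f)) ->
  generates (fun b => i1 (i2 b)) A S -> generates (fun f => i1b (i2b f)) Ab Sb ->
  smoothing_right i1 S \/ smoothing_left i1 D S -> commutators_bounded i1 D S ->
  exists om K w Kb wb, smoothing_semigroup i1 S K w om /\ smoothing_semigroup i1b Sb Kb wb om.
Proof.
move=> ht htb hgen hgenb [hp hdual] hAl hAbl hAd hS hSb hsm [hpres hcomm].
have hDl := proj1 hgen; have hDbl := proj1 hgenb.
have [D' [_ [_ [hnorm _]]]] := proj2 hgen; have [Db' [_ [_ [hnormb _]]]] := proj2 hgenb.
have hS0 := proj1 hS; have hSb0 := proj1 hSb.
have hDn j b : norm (D j b) <= norm b.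
  rewrite (hnorm b); have := norm_ge_0 (i1 b).
  have := @sum_ord_elem n (fun j => norm (D j b)) j (fun j => norm_ge_0 _); lra.
have hSd t x y : 0 <= t -> p (S t x) y = p x (Sb t y).
  move=> t0; refine (semigroup_dual x y hp hS0 hSb0 _ _ _ t0).
  - by move=> x' g y' k; exact: (generator_pairing hp hS hSb hAd).
  - move=> x' eps he; have [u hu] := dense_core ht x' he.
    by exists (i1 (i2 u)), (A u); split=> //; exact: (proj1 (proj2 hS)).
  - move=> x' eps he; have [u hu] := dense_core htb x' he.
    by exists (i1b (i2b u)), (Ab u); split=> //; exact: (proj1 (proj2 hSb)).
have [C0 hC0] := hcomm 1.
set C := Rabs C0.
have hC : 0 <= C by exact: Rabs_pos.
(* This sum is the commutator paired with f: the term D_j S t b is moved to the dual side, which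
   produces the plus sign. *)
have hWC j t b f : 0 <= t <= 1 ->
   Rabs (p (S t (D j b)) (i1b f) + p (S t (i1 b)) (Db j f)) <= C * norm (i1 b) * norm (i1b f).
  move=> ht1; have [b' hb'] := hpres t b (proj1 ht1).
  have [Q [_ [hQ hQn]]] := hC0 j t ht1.
  have -> : p (S t (D j b)) (i1b f) + p (S t (i1 b)) (Db j f) = p (Q (i1 b)) (i1b f).
    have h := hdual j b' f; rewrite hb' in h.
    by rewrite (hQ b b' hb') (dp_minus_l hp) h; ring.
  apply: Rle_trans (dp_norm hp _ _) _; apply: Rmult_le_compat_r; first exact: norm_ge_0.
  apply: Rle_trans (hQn _) _; apply: Rmult_le_compat_r; [exact: norm_ge_0 | exact: Rle_abs].
have [M [hM hMb]] := sg_bound hS0 1.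
(* From the right, [D j] acts on S t x, which is in [B1]. From the left, S t D_j is bounded and the
   commutator accounts for the difference. *)
have [kap [om [hkap [hom hW]]]] : exists kap om, 0 < kap /\ 0 < om < 1 /\ forall j t x f, 0 < t <= 1 ->
    Rabs (p (S t x) (Db j f)) <= kap * Rpower t (- om) * norm x * norm (i1b f).
  case: hsm => -[kap [om [hkap [hom h]]]].
  - exists kap, om; split=> //; split=> // j t x f ht1.
    have [y hy] := proj1 h t x (proj1 ht1); have hyn := proj2 h t x y ht1 hy.
    have e : p (S t x) (Db j f) = - p (D j y) (i1b f) by rewrite hdual hy; ring.
    rewrite e Rabs_Ropp; apply: Rle_trans (dp_norm hp _ _) _.
    apply: Rmult_le_compat_r; first exact: norm_ge_0.
    exact: Rle_trans (hDn j y) hyn.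
  (* [C] is absorbed by the singular factor, because t^(-om) >= 1 for t <= 1. *)
  - exists (kap + C), om; split; first lra.
    split=> // j t x f ht1.
    have hr := Rpower_neg_ge1 ht1 (Rlt_le _ _ (proj1 hom)).
    have ht0 : 0 <= t <= 1 by lra.
    have hlt := sg_linear hS0 (proj1 ht0).
    have -> : (kap + C) * Rpower t (- om) * norm x * norm (i1b f) = ((kap + C) * Rpower t (- om) * norm (i1b f)) * norm x by ring.
    apply: (@dense_bound B B1 i1 (fun x => p (S t x) (Db j f)) (M * norm (Db j f)) _ x (proj1 ht)).
    + move=> y y'; rewrite -(dp_minus_l hp) -(linear_minus _ _ _ hlt).
      apply: Rle_trans (dp_norm hp _ _) _.
      have -> : M * norm (Db j f) * norm (minus y y') = M * norm (minus y y') * norm (Db j f) by ring.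
      apply: Rmult_le_compat_r; first exact: norm_ge_0.
      exact: hMb.
    + apply: Rmult_le_pos; last exact: norm_ge_0.
      by apply: Rmult_le_pos; lra.
    + move=> b.
      have [Q [_ [hQ hQn]]] := h j t (proj1 ht1).
      have h1 := hWC j t b f ht0.
      have h2 : Rabs (p (S t (D j b)) (i1b f)) <= kap * Rpower t (- om) * norm (i1 b) * norm (i1b f).
        rewrite -hQ; apply: Rle_trans (dp_norm hp _ _) _; apply: Rmult_le_compat_r; first exact: norm_ge_0.
        exact: hQn (proj2 ht1) _.
      have tri (u v : R) : Rabs v <= Rabs (u + v) + Rabs u by rewrite /Rabs; do 3 case: Rcase_abs; lra.
      have h3 := tri (p (S t (D j b)) (i1b f)) (p (S t (i1 b)) (Db j f)).
      have h4 : C * norm (i1 b) * norm (i1b f) <= C * Rpower t (- om) * norm (i1 b) * norm (i1b f).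
        apply: Rmult_le_compat_r; first exact: norm_ge_0.
        apply: Rmult_le_compat_r; first exact: norm_ge_0.
        nra.
      lra.
have hC' : 0 < kap + C by lra.
(* The estimate for the dual triple: transposing [Sb t] gives S t D_j b paired with y, which [hW]
   and the commutator bound control. *)
have hWb j t y b : 0 < t <= 1 ->
    Rabs (p (D j b) (Sb t y)) <= (kap + C) * Rpower t (- om) * norm y * norm (i1 b).
  move=> ht1.
  have hr := Rpower_neg_ge1 ht1 (Rlt_le _ _ (proj1 hom)).
  have ht0 : 0 <= t <= 1 by lra.
  rewrite -hSd; last lra.
  have -> : (kap + C) * Rpower t (- om) * norm y * norm (i1 b) = ((kap + C) * Rpower t (- om) * norm (i1 b)) * norm y by ring.
  apply: (@dense_bound Bb B1b i1b (fun y => p (S t (D j b)) y) (norm (S t (D j b))) _ y (proj1 htb)).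
  + by move=> z z'; rewrite -(dp_minus_r hp); exact: dp_norm.
  + apply: Rmult_le_pos; last exact: norm_ge_0.
    by apply: Rmult_le_pos; lra.
  + move=> f.
    have h1 := hWC j t b f ht0; have h2 := hW j t (i1 b) f ht1.
    have tri (u v : R) : Rabs u <= Rabs (u + v) + Rabs v by rewrite /Rabs; do 3 case: Rcase_abs; lra.
    have h3 := tri (p (S t (D j b)) (i1b f)) (p (S t (i1 b)) (Db j f)).
    have h4 : C * norm (i1 b) * norm (i1b f) <= C * Rpower t (- om) * norm (i1 b) * norm (i1b f).
      apply: Rmult_le_compat_r; first exact: norm_ge_0.
      apply: Rmult_le_compat_r; first exact: norm_ge_0.
      nra.
    lra.
have [K [w hK]] := smoothing_semigroup_of_weak ht (proj1 htb) hnorm hp hdual hAl hS hkap hom hC hW hWC.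
have [Kb [wb hKb]] := @smoothing_semigroup_of_weak n Bb B1b B2b B B1 i1b i2b i1 Db D (fun c b => p b c) Ab Sb
   (kap + C) om C htb (proj1 ht) hnormb (dual_pair_sym hp) ltac:(move=> j b f /=; rewrite hdual; ring)
   hAbl hSb hC' hom hC hWb
   ltac:(move=> j t f b ht1 /=; rewrite -!hSd; try lra;
      have := hWC j t b f ht1; rewrite Rplus_comm; lra).
by exists om, K, w, Kb, wb.
Qed.

(** * The semigroup as a kernel from B to B1 *)

Section Lift.
Context (B B1 : Banach) (i1 : B1 -> B) (S : R -> B -> B) (K w om : R).
Context (hi1 : is_linear i1) (hinj : forall x y, i1 x = i1 y -> x = y).
Context (hs : smoothing_semigroup i1 S K w om).

(* Unspecified where [S t x] is not in the range of [i1]. *)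
Definition lift (t : R) (x : B) : B1 := epsilon (inhabits zero) (fun y => i1 y = S t x).

Lemma lift_spec t x : 0 < t -> i1 (lift t x) = S t x /\
  norm (lift t x) <= K * Rpower t (- om) * exp (w * t) * norm x.
Proof.
move=> t0; have [y [hy hn]] := ss_smooth hs x t0.
have h : i1 (lift t x) = S t x by apply: (epsilon_spec (inhabits zero) (fun y => i1 y = S t x)); exists y.
by have -> : lift t x = y by apply: hinj; rewrite h hy.
Qed.

Lemma lift_restr_spec t b : 0 <= t -> i1 (lift t (i1 b)) = S t (i1 b) /\
  norm (lift t (i1 b)) <= K * exp (w * t) * norm b.
Proof.
move=> t0; have [y [hy hn]] := ss_restr hs b t0.
have h : i1 (lift t (i1 b)) = S t (i1 b).
  by apply: (epsilon_spec (inhabits zero) (fun y => i1 y = S t (i1 b))); exists y.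
by have -> : lift t (i1 b) = y by apply: hinj; rewrite h hy.
Qed.

Lemma lift_minus t x y : 0 < t -> lift t (minus x y) = minus (lift t x) (lift t y).
Proof.
move=> t0; apply: hinj.
rewrite (linear_minus _ _ _ hi1) !(proj1 (lift_spec _ t0)).
exact: (linear_minus _ _ _ (sg_linear (ss_C0 hs) (Rlt_le _ _ t0))).
Qed.

(* [S t = S (t0/2) S (t - t0/2)], and [S (t0/2)] is bounded from [B] to [B1]. *)
Lemma lift_continuous t x : 0 < t -> continuous (fun s => lift s x) t.
Proof.
move=> t0; apply/continuous_normP => eps he.
have th : 0 < t / 2 by lra.
set Q := K * Rpower (t / 2) (- om) * exp (w * (t / 2)).
have hQ : 0 < Q.
  apply: Rmult_lt_0_compat; last exact: exp_pos.
  by apply: Rmult_lt_0_compat; [exact: ss_K hs | exact: Rpower_pos].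
have [d [hd h]] := @sg_cont B S (ss_C0 hs) x (t / 2) (eps / Q) (Rlt_le _ _ th) ltac:(exact: Rdiv_lt_0_compat).
exists (Rmin d (t / 2)); split; first exact: Rmin_pos.
move=> t' ht'.
have l1 := Rmin_l d (t / 2); have l2 := Rmin_r d (t / 2).
have ht2 : t / 2 < t' by move: ht'; rewrite /Rabs; case: Rcase_abs; lra.
have e s : t / 2 < s -> lift s x = lift (t / 2) (S (s - t / 2) x).
  move=> hs2; apply: hinj; have hs0 : 0 < s by lra.
  rewrite (proj1 (lift_spec _ hs0)) (proj1 (lift_spec _ th)).
  by rewrite -(sg_plus (ss_C0 hs)); [congr (S _ x); ring | lra | lra].
rewrite (e t') // (e t); last lra.
rewrite -lift_minus //.
apply: Rle_lt_trans (proj2 (lift_spec _ th)) _; rewrite -/Q.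
have -> : eps = Q * (eps / Q) by field; lra.
apply: Rmult_lt_compat_l => //.
have -> : t - t / 2 = t / 2 by field.
apply: h; first lra.
have -> : t' - t / 2 - t / 2 = t' - t by field.
lra.
Qed.

Lemma lift_Ccurve (b : B1) (L : R) : Ccurve 0 L (fun t => lift t (i1 b)).
Proof.
apply/CcurveP => t ht eps he.
case: (Rlt_dec 0 t) => h0.
  have [d [hd h]] := proj1 (continuous_normP _ _) (lift_continuous (x := i1 b) h0) eps he.
  by exists d; split=> // t' _; exact: h.
have -> : t = 0 by lra.
have [d [hd h]] := ss_cont0 hs b he.
have -> : lift 0 (i1 b) = b.
  by apply: hinj; rewrite (proj1 (lift_restr_spec b (Rle_refl 0))) (sg_0 (ss_C0 hs)).
exists d; split=> // t' ht' hlt.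
rewrite Rminus_0_r Rabs_pos_eq in hlt; last lra.
by apply: (h t'); [lra | exact: (proj1 (lift_restr_spec b (proj1 ht')))].
Qed.

Lemma semigroup_kernel (L0 : R) : 0 < L0 -> smoothing_kernel i1 S lift (K * exp (w * L0)) om L0.
Proof.
move=> hL0; split.
- by apply: Rmult_lt_0_compat; [exact: ss_K hs | exact: exp_pos].
- by have := ss_om hs; lra.
- by move=> t x [t0 _]; exact: (proj1 (lift_spec x t0)).
- by move=> t x y [t0 _]; exact: lift_minus.
- move=> t x [t0 t1]; apply: Rle_trans (proj2 (lift_spec x t0)) _.
  apply: Rmult_le_compat_r; first exact: norm_ge_0.
  have -> : K * Rpower t (- om) * exp (w * t) = K * exp (w * t) * Rpower t (- om) by ring.
  apply: Rmult_le_compat_r; first by left; exact: Rpower_pos.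
  apply: Rmult_le_compat_l; first by left; exact: ss_K hs.
  by apply: exp_le_compat; apply: Rmult_le_compat_l; [exact: ss_w hs | lra].
- by move=> t x [t0 _]; exact: lift_continuous.
Qed.

End Lift.

(** * Integrals over the half line *)

(* For [0 < d <= 1] the majorant is bounded by the derivative of [hl_primitive d / d]. *)
Definition hl_primitive (d p : R) : R := Rpower (p / (1 + p)) d.
Definition hl_majorant (d p : R) : R := Rpower p (d - 1) / (1 + p) ^ 2.

Lemma Rpower_frac (p s : R) : 0 < p -> Rpower (p / (1 + p)) s = Rpower p s * Rpower (1 + p) (- s).
Proof.
move=> hp; rewrite /Rdiv -Rpower_mult_distr //; last by apply: Rinv_0_lt_compat; lra.
by congr (_ * _); rewrite /Rpower ln_Rinv; [congr exp; ring | lra].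
Qed.

Lemma hl_derive (d C p : R) : 0 < p ->
  is_derive (fun p => C / d * hl_primitive d p) p (C / d * (d * Rpower (p / (1 + p)) (d - 1) * / (1 + p) ^ 2)).
Proof.
move=> hp; rewrite /hl_primitive.
apply: is_derive_scal.
have hq : 0 < p / (1 + p) by apply: Rdiv_lt_0_compat; lra.
have h := is_derive_comp (fun t => Rpower t d) (fun p => p / (1 + p)) p _ (/ (1 + p) ^ 2) (is_derive_Rpower d hq).
have -> : d * Rpower (p / (1 + p)) (d - 1) * / (1 + p) ^ 2 = scal (/ (1 + p) ^ 2) (d * Rpower (p / (1 + p)) (d - 1)).
  by rewrite /scal /= /mult /=; field; lra.
apply: h; auto_derive; first lra.
by field; lra.
Qed.

Lemma hl_lim0 (d C : R) : 0 < d -> filterlim (fun p => C / d * hl_primitive d p) (at_right 0) (locally 0).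
Proof.
move=> hd; apply/(@filterlim_normP R R_NormedModule) => eps he.
have hC := Rabs_pos (C / d).
have [e [he0 h]] := @Rpower_small d (eps / (Rabs (C / d) + 1)) hd ltac:(apply: Rdiv_lt_0_compat; lra).
exists (mkposreal e he0) => p hp hp0.
have hp' : Rabs (p - 0) < e := hp.
have hp0' : 0 < p := hp0.
rewrite Rminus_0_r Rabs_pos_eq in hp'; last lra.
change (Rabs (C / d * hl_primitive d p - 0) < eps).
rewrite Rminus_0_r Rabs_mult (Rabs_pos_eq (hl_primitive _ _)); last by left; exact: Rpower_pos.
have hq : 0 < p / (1 + p) < e.
  split; first by apply: Rdiv_lt_0_compat; lra.
  apply: Rle_lt_trans hp'.
  apply: (Rmult_le_reg_r (1 + p)); first lra.
  have -> : p / (1 + p) * (1 + p) = p by field; lra.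
  nra.
have h1 := h _ hq; have h2 := Rpower_pos (p / (1 + p)) d.
apply: (Rle_lt_trans _ ((Rabs (C / d) + 1) * hl_primitive d p)); first by rewrite /hl_primitive; nra.
have -> : eps = (Rabs (C / d) + 1) * (eps / (Rabs (C / d) + 1)) by field; lra.
by apply: Rmult_lt_compat_l; [lra | exact: h1].
Qed.

Lemma hl_liminf (d C : R) : filterlim (fun p => C / d * hl_primitive d p) (Rbar_locally p_infty) (locally (C / d)).
Proof.
rewrite -{2}(Rmult_1_r (C / d)).
apply: (filterlim_comp _ _ _ (fun p => hl_primitive d p) (fun z => C / d * z) _ (locally 1));
  last exact: (@filterlim_scal_r R_AbsRing R_NormedModule).
have h1 : filterlim (fun p => p / (1 + p)) (Rbar_locally p_infty) (locally 1).
  apply/(@filterlim_normP R R_NormedModule) => eps he.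
  exists (/ eps) => p hp.
  have hi := Rinv_0_lt_compat _ he.
  change (Rabs (p / (1 + p) - 1) < eps).
  have -> : p / (1 + p) - 1 = - / (1 + p) by field; lra.
  rewrite Rabs_Ropp Rabs_pos_eq; last by left; apply: Rinv_0_lt_compat; lra.
  rewrite -(Rinv_inv eps); apply: Rinv_lt_contravar; last lra.
  by apply: Rmult_lt_0_compat; lra.
have -> : 1 = Rpower 1 d by rewrite /Rpower ln_1 Rmult_0_r exp_0.
apply: (filterlim_comp _ _ _ (fun p => p / (1 + p)) (fun t => Rpower t d) _ (locally 1) _ h1).
exact: (continuous_Rpower (s := d) Rlt_0_1).
Qed.

Lemma hl_majorant_le (d p : R) : d <= 1 -> 0 < p ->
  hl_majorant d p <= Rpower (p / (1 + p)) (d - 1) * / (1 + p) ^ 2.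
Proof.
move=> hd hp; rewrite /hl_majorant /Rdiv.
apply: Rmult_le_compat_r; first by left; apply: Rinv_0_lt_compat; apply: pow_lt; lra.
change (Rpower p (d - 1) <= Rpower (p / (1 + p)) (d - 1)).
rewrite Rpower_frac // -{1}(Rmult_1_r (Rpower p (d - 1))).
apply: Rmult_le_compat_l; first by left; exact: Rpower_pos.
apply: (Rle_trans _ (Rpower (1 + p) 0)); first by rewrite Rpower_O; lra.
by apply: Rle_Rpower; lra.
Qed.

Lemma hl_continuous (d C p : R) : 0 < p ->
  continuous (fun p => C / d * (d * Rpower (p / (1 + p)) (d - 1) * / (1 + p) ^ 2)) p.
Proof.
move=> hp; apply: (@ex_derive_continuous R_AbsRing R_NormedModule).
apply: ex_derive_scal; apply: ex_derive_mult.
- apply: ex_derive_scal.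
  apply: (ex_derive_comp (fun t => Rpower t (d - 1)) (fun p => p / (1 + p))).
  + have hq : 0 < p / (1 + p) by apply: Rdiv_lt_0_compat; lra.
    by eexists; exact: is_derive_Rpower.
  + by auto_derive; lra.
- by auto_derive; nra.
Qed.

Lemma hl_at_right : at_right 0 (fun p => 0 < p).
Proof. by exists (mkposreal 1 Rlt_0_1) => p _. Qed.

Lemma hl_at_infty : Rbar_locally p_infty (fun p => 0 < p).
Proof. by exists 0. Qed.

Lemma positive_convex : forall x y z : R, 0 < x -> 0 < z -> x <= y <= z -> 0 < y.
Proof. by move=> x y z *; lra. Qed.

Lemma hl_bound (V : Banach) (d C p : R) (v : V) : 0 < d <= 1 -> 0 <= C -> 0 < p ->
  norm v <= C * hl_majorant d p -> norm v <= C / d * (d * Rpower (p / (1 + p)) (d - 1) * / (1 + p) ^ 2).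
Proof.
move=> hd hC hp hn; apply: Rle_trans hn _.
have -> : C / d * (d * Rpower (p / (1 + p)) (d - 1) * / (1 + p) ^ 2) = C * (Rpower (p / (1 + p)) (d - 1) * / (1 + p) ^ 2).
  by field; lra.
by apply: Rmult_le_compat_l => //; apply: hl_majorant_le; lra.
Qed.

(** The variable s = p / (1 + p) maps the half line to (0,1), and the majorant to at most s^(d-1),
    of integral 1/d. *)
Lemma half_line_integral (V : Banach) (g : R -> V) (d C : R) : 0 < d <= 1 -> 0 <= C ->
  (forall p, 0 < p -> continuous g p) ->
  (forall p, 0 < p -> norm (g p) <= C * hl_majorant d p) ->
  exists v, is_RInt_gen g (at_right 0) (Rbar_locally p_infty) v /\ norm v <= C / d /\
    forall a b, 0 < a -> 0 < b -> norm (minus v (RInt g a b)) <=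
      Rabs (C / d * hl_primitive d a - 0) + Rabs (C / d * hl_primitive d b - C / d).
Proof.
move=> hd hC hg hdom.
have [v [h1 [h2 h3]]] := @singular_integral V (fun p => 0 < p) (at_right 0) (Rbar_locally p_infty) _ _ g
  (fun p => C / d * hl_primitive d p) (fun p => C / d * (d * Rpower (p / (1 + p)) (d - 1) * / (1 + p) ^ 2))
  0 (C / d) positive_convex hl_at_right hl_at_infty hg (hl_derive d C) (fun p hp => hl_continuous (d := d) (C := C) hp)
  (fun p hp => hl_bound hd hC hp (hdom p hp)) (@hl_lim0 d C (proj1 hd)) (@hl_liminf d C).
exists v; split=> //; split; last by move=> a b ha hb; exact: h3.
move: h2; rewrite Rminus_0_r Rabs_pos_eq //.
by apply: Rmult_le_pos => //; left; apply: Rinv_0_lt_compat; lra.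
Qed.

Lemma half_line_integral_lim (V : Banach) (T : Type) (FQ : (T -> Prop) -> Prop) {FFQ : Filter FQ}
    (gq : T -> R -> V) (g : R -> V) (d C : R) (vq : T -> V) (v : V) : 0 < d <= 1 -> 0 <= C ->
  (forall p, 0 < p -> continuous g p /\ norm (g p) <= C * hl_majorant d p) ->
  FQ (fun q => forall p, 0 < p -> continuous (gq q) p /\ norm (gq q p) <= C * hl_majorant d p) ->
  (forall a b eps, 0 < a -> 0 < b -> 0 < eps ->
     FQ (fun q => forall x, a <= x <= b -> norm (minus (gq q x) (g x)) <= eps)) ->
  FQ (fun q => is_RInt_gen (gq q) (at_right 0) (Rbar_locally p_infty) (vq q)) ->
  is_RInt_gen g (at_right 0) (Rbar_locally p_infty) v ->
  filterlim vq FQ (locally v).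
Proof.
move=> hd hC hg hgq hu hvq hv.
apply: (@singular_integral_lim V T FQ FFQ (fun p => 0 < p) (at_right 0) (Rbar_locally p_infty) _ _ gq g
  (fun p => C / d * hl_primitive d p) (fun p => C / d * (d * Rpower (p / (1 + p)) (d - 1) * / (1 + p) ^ 2))
  0 (C / d) vq v positive_convex hl_at_right hl_at_infty (fun p hp => proj1 (hg p hp)) _ (hl_derive d C)
  (fun p hp => hl_continuous (d := d) (C := C) hp) (fun p hp => hl_bound hd hC hp (proj2 (hg p hp)))
  (@hl_lim0 d C (proj1 hd)) (@hl_liminf d C) hu hvq hv).
refine (filter_mono _ hgq _) => q h p hp; have [h1 h2] := h p hp.
by split=> //; exact: hl_bound.
Qed.

Lemma half_line_RInt_gen_eq (V : Banach) (f g : R -> V) (v : V) :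
  is_RInt_gen f (at_right 0) (Rbar_locally p_infty) v -> (forall z, 0 < z -> f z = g z) ->
  RInt_gen g (at_right 0) (Rbar_locally p_infty) = v.
Proof.
move=> hf hfg.
have hg : is_RInt_gen g (at_right 0) (Rbar_locally p_infty) v.
  refine (is_RInt_gen_ext f g v _ hf).
  refine (Filter_prod _ _ _ _ _ hl_at_right hl_at_infty _) => a b ha hb z hz.
  by apply: hfg; apply: Rlt_trans (proj1 hz); exact: Rmin_pos.
exact (is_RInt_gen_unique g v hg).
Qed.

(** The graph of ln lies below its tangent at 1/e. *)
Lemma ln_le_lin (e z : R) : 0 < e -> 0 < z -> ln z <= e * z - 1 - ln e.
Proof.
move=> he hz.
have := exp_ineq1_le (ln (e * z)); rewrite exp_ln; last exact: Rmult_lt_0_compat.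
rewrite ln_mult //; lra.
Qed.

Lemma stretched_decay (be a s : R) : 0 < be -> 0 < a -> 0 < s ->
  exists C, 0 < C /\ forall p, 0 < p -> Rpower (1 + p) s * exp (- a * Rpower p be) <= C.
Proof.
move=> hbe ha hs.
(* The slope for which (s / be) e = a, so that s ln p is bounded by a p^be plus a constant. *)
set e := a * be / s.
have he : 0 < e by apply: Rdiv_lt_0_compat => //; exact: Rmult_lt_0_compat.
exists (exp (s * ln 2 + Rmax 0 (s / be * (- 1 - ln e)))); split; first exact: exp_pos.
move=> p hp; rewrite {1}/Rpower -exp_plus; apply: exp_le_compat.
have hpb := Rpower_pos p be.
have hl2 : 0 < ln 2 by rewrite -ln_1; apply: ln_increasing; lra.
have h1 : s * ln p <= a * Rpower p be + s / be * (- 1 - ln e).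
  have h2 := ln_le_lin he hpb.
  rewrite {1}/Rpower ln_exp in h2.
  have -> : s * ln p = s / be * (be * ln p) by field; lra.
  have -> : a * Rpower p be = s / be * (e * Rpower p be) by rewrite /e; field; lra.
  rewrite -Rmult_plus_distr_l; apply: Rmult_le_compat_l; last lra.
  by left; apply: Rdiv_lt_0_compat.
have m1 := Rmax_l 0 (s / be * (- 1 - ln e)); have m2 := Rmax_r 0 (s / be * (- 1 - ln e)).
case: (Rle_dec p 1) => hp1.
- have : ln (1 + p) <= ln 2 by apply: ln_le; lra.
  nra.
- have : ln (1 + p) <= ln 2 + ln p by rewrite -ln_mult; [apply: ln_le; lra | lra | lra].
  nra.
Qed.

(** * The stable density *)

Lemma Rpower_2 (x : R) : 0 < x -> Rpower x 2 = x ^ 2.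
Proof. by move=> hx; rewrite -(Rpower_pow 2 x hx). Qed.

Lemma stretched_majorant (be a s d : R) : 0 < be -> 0 < a -> 0 <= s ->
  exists C, 0 < C /\ forall p, 0 < p ->
    Rpower p (d - 1) * Rpower (1 + p) s * exp (- a * Rpower p be) <= C * hl_majorant d p.
Proof.
move=> hbe ha hs.
have [C [hC h]] := @stretched_decay be a (s + 2) hbe ha ltac:(lra).
exists C; split=> // p hp.
have h1 := h p hp; rewrite Rpower_plus Rpower_2 in h1; last lra.
have hr := Rpower_pos p (d - 1).
have h2 : 0 < (1 + p) ^ 2 by apply: pow_lt; lra.
rewrite /hl_majorant.
apply: (Rmult_le_reg_r ((1 + p) ^ 2)) => //.
have -> : C * (Rpower p (d - 1) / (1 + p) ^ 2) * (1 + p) ^ 2 = Rpower p (d - 1) * C by field; lra.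
have -> : Rpower p (d - 1) * Rpower (1 + p) s * exp (- a * Rpower p be) * (1 + p) ^ 2 =
  Rpower p (d - 1) * (Rpower (1 + p) s * (1 + p) ^ 2 * exp (- a * Rpower p be)) by ring.
by apply: Rmult_le_compat_l; lra.
Qed.

Lemma sin_le_abs (x : R) : Rabs (sin x) <= Rabs x.
Proof.
have := MVT_abs sin cos 0 x (fun c _ => derivable_pt_lim_sin c).
move=> [c [hc _]]; rewrite sin_0 !Rminus_0_r in hc; rewrite hc.
have := Rabs_pos x; have := COS_bound c => hb hx.
have : Rabs (cos c) <= 1 by apply: Rabs_le; lra.
nra.
Qed.

Lemma cos_lip (x y : R) : Rabs (cos x - cos y) <= Rabs (x - y).
Proof.
have := MVT_abs cos (fun x => - sin x) y x (fun c _ => derivable_pt_lim_cos c).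
move=> [c [hc _]]; rewrite hc.
have := Rabs_pos (x - y); have := SIN_bound c => hb hx.
have : Rabs (- sin c) <= 1 by apply: Rabs_le; lra.
nra.
Qed.

Section Stable.
Context (be : R) (hbe : 0 < be < 1).

Let k := cos (PI * be / 2).
Let m := sin (PI * be / 2).

Lemma stable_k_pos : 0 < k.
Proof. by have := PI_RGT_0 => hPI; apply: cos_gt_0; nra. Qed.

(** Together with [stable_im], the real and imaginary parts of the integrand of [G_beta] at t = 1.
    Since be < 1, [k] is positive and the modulus exp (-k p^be) is integrable. *)
Definition stable_re (y p : R) : R := exp (- k * Rpower p be) * cos (p * y - m * Rpower p be).
Definition stable_im (y p : R) : R := exp (- k * Rpower p be) * sin (p * y - m * Rpower p be).

Lemma Rabs_cos_le1 x : Rabs (cos x) <= 1.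
Proof. by apply: Rabs_le; have := COS_bound x; lra. Qed.
Lemma Rabs_sin_le1 x : Rabs (sin x) <= 1.
Proof. by apply: Rabs_le; have := SIN_bound x; lra. Qed.

Lemma stable_re_bound y p : Rabs (stable_re y p) <= exp (- k * Rpower p be).
Proof.
rewrite /stable_re Rabs_mult Rabs_pos_eq; last by left; exact: exp_pos.
have := Rabs_cos_le1 (p * y - m * Rpower p be); have := exp_pos (- k * Rpower p be); nra.
Qed.

Lemma stable_im_bound y p : Rabs (stable_im y p) <= exp (- k * Rpower p be).
Proof.
rewrite /stable_im Rabs_mult Rabs_pos_eq; last by left; exact: exp_pos.
have := Rabs_sin_le1 (p * y - m * Rpower p be); have := exp_pos (- k * Rpower p be); nra.
Qed.

Lemma stable_re_cont y p : 0 < p -> continuous (stable_re y) p.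
Proof.
move=> hp; apply: (@ex_derive_continuous R_AbsRing R_NormedModule).
have h : ex_derive (fun p => Rpower p be) p by eexists; exact: is_derive_Rpower.
rewrite /stable_re; auto_derive; repeat split => //.
Qed.

Lemma stable_im_cont y p : 0 < p -> continuous (stable_im y) p.
Proof.
move=> hp; apply: (@ex_derive_continuous R_AbsRing R_NormedModule).
have h : ex_derive (fun p => Rpower p be) p by eexists; exact: is_derive_Rpower.
rewrite /stable_im; auto_derive; repeat split => //.
Qed.

Lemma stable_majorant a : 0 < a -> exists C, 0 < C /\ forall p, 0 < p ->
  exp (- a * Rpower p be) <= C * hl_majorant 1 p.
Proof.
move=> ha.
have [C [hC h]] := @stretched_majorant be a 0 1 (proj1 hbe) ha (Rle_refl 0).
exists C; split=> // p hp; have := h p hp.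
have -> : 1 - 1 = 0 by ring.
by rewrite !Rpower_O ?Rmult_1_l //; lra.
Qed.

(** The integral in [G_beta] is complex; [Re], being linear, passes inside once absolute convergence
    is known. *)
Lemma G_beta_re y : exists J, is_RInt_gen (V := R_NormedModule) (stable_re y) (at_right 0) (Rbar_locally p_infty) J /\
  G_beta be 1 y = / PI * J.
Proof.
have [K [hK hmaj]] := stable_majorant stable_k_pos.
pose g (p : R) : C := (stable_re y p, stable_im y p).
have hgc p : 0 < p -> continuous (T := R_UniformSpace) (U := C_R_CompleteNormedModule) g p.
  move=> hp P [eps hP].
  have [d1 h1] := stable_re_cont (y := y) hp (locally_ball (stable_re y p) eps).
  have [d2 h2] := stable_im_cont (y := y) hp (locally_ball (stable_im y p) eps).
  exists (mkposreal _ (Rmin_pos _ _ (cond_pos d1) (cond_pos d2))) => q hq.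
  apply: hP; split; [apply: h1 | apply: h2]; apply: ball_le hq; [exact: Rmin_l | exact: Rmin_r].
have hgn p : 0 < p -> norm (V := C_R_CompleteNormedModule) (g p) <= 2 * K * hl_majorant 1 p.
  move=> hp.
  have hn := proj2 (@norm_prod R_AbsRing R_NormedModule R_NormedModule (stable_re y p) (stable_im y p)).
  change (norm (V := C_R_CompleteNormedModule) (g p) <= sqrt 2 * Rmax (Rabs (stable_re y p)) (Rabs (stable_im y p))) in hn.
  have hM : Rmax (Rabs (stable_re y p)) (Rabs (stable_im y p)) <= K * hl_majorant 1 p.
    by apply: Rmax_lub; apply: Rle_trans (hmaj p hp); [exact: stable_re_bound | exact: stable_im_bound].
  have hM0 : 0 <= Rmax (Rabs (stable_re y p)) (Rabs (stable_im y p)).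
    exact: Rle_trans (Rabs_pos _) (Rmax_l _ _).
  have h2 : sqrt 2 <= 2.
    rewrite -{2}(sqrt_square 2); last lra.
    by apply: sqrt_le_1_alt; lra.
  nra.
have [v [hv _]] := @half_line_integral C_R_CompleteNormedModule g 1 (2 * K) ltac:(lra) ltac:(lra) hgc hgn.
exists (Re v); split.
  exact: (@is_RInt_gen_linear C_R_NormedModule R_NormedModule Re _ _ _ _ g v
     (@is_linear_fst R_AbsRing R_NormedModule R_NormedModule) hv).
have e : (fun p => Cexp (Cminus (Cmult Ci (RtoC (p * y)))
       (Cmult (RtoC (1 * Rpower p be)) (Cexp (Cmult Ci (RtoC (PI * be / 2))))))) = g.
  apply: functional_extensionality => p.
  rewrite /g /stable_re /stable_im /Cexp /Cminus /Cplus /Copp /Cmult /Ci /RtoC /= /k /m.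
  have e1 : 0 * (PI * be / 2) - 1 * 0 = 0 by ring.
  have e2 : 0 * 0 + 1 * (PI * be / 2) = PI * be / 2 by ring.
  rewrite e1 e2 exp_0.
  by congr (exp _ * cos _, exp _ * sin _); ring.
have hu : RInt_gen (V := C_R_CompleteNormedModule) g (at_right 0) (Rbar_locally p_infty) = v.
  exact (is_RInt_gen_unique (V := C_R_CompleteNormedModule) g v hv).
by rewrite /G_beta e hu.
Qed.

Definition stable_int (y : R) : R :=
  RInt_gen (V := R_CompleteNormedModule) (stable_re y) (at_right 0) (Rbar_locally p_infty).

Lemma stable_int_correct y :
  is_RInt_gen (V := R_CompleteNormedModule) (stable_re y) (at_right 0) (Rbar_locally p_infty) (stable_int y).
Proof.
have [J [hJ _]] := G_beta_re y.
exact (RInt_gen_correct (V := R_CompleteNormedModule) (stable_re y) (ex_intro _ J hJ)).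
Qed.

Lemma G_beta_stable_int y : G_beta be 1 y = / PI * stable_int y.
Proof.
have [J [hJ ->]] := G_beta_re y.
congr (_ * _); symmetry.
exact (is_RInt_gen_unique (V := R_CompleteNormedModule) (stable_re y) J hJ).
Qed.

Lemma stable_int_cont y : continuous stable_int y.
Proof.
have [K [hK hmaj]] := stable_majorant stable_k_pos.
have hb y' p : 0 < p -> continuous (stable_re y') p /\ norm (V := R_NormedModule) (stable_re y' p) <= K * hl_majorant 1 p.
  by move=> hp; split; [exact: stable_re_cont | apply: Rle_trans (stable_re_bound _ _) (hmaj p hp)].
apply: (@half_line_integral_lim R_CompleteNormedModule R (locally y) _ stable_re (stable_re y) 1 K
   stable_int (stable_int y) ltac:(lra) ltac:(lra) (hb y)).
- by apply: filter_forall => y'; exact: hb.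
- move=> a b eps ha hb0 he.
  have hd : 0 < eps / (b + 1) by apply: Rdiv_lt_0_compat; lra.
  exists (mkposreal _ hd) => y' hy' x hx.
  have hy : Rabs (y' - y) < eps / (b + 1) := hy'.
  change (Rabs (stable_re y' x - stable_re y x) <= eps).
  rewrite /stable_re -Rmult_minus_distr_l Rabs_mult Rabs_pos_eq; last by left; exact: exp_pos.
  have h1 := cos_lip (x * y' - m * Rpower x be) (x * y - m * Rpower x be).
  have e : x * y' - m * Rpower x be - (x * y - m * Rpower x be) = x * (y' - y) by ring.
  rewrite e Rabs_mult (Rabs_pos_eq x) in h1; last lra.
  have h2 : exp (- k * Rpower x be) <= 1.
    rewrite -exp_0; apply: exp_le_compat; have := stable_k_pos; have := Rpower_pos x be; nra.
  have h3 : x * Rabs (y' - y) <= b * (eps / (b + 1)).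
    by apply: Rmult_le_compat; [lra | exact: Rabs_pos | lra | left].
  have h4 : b * (eps / (b + 1)) <= (b + 1) * (eps / (b + 1)) by nra.
  have h5 : (b + 1) * (eps / (b + 1)) = eps by field; lra.
  have h6 := exp_pos (- k * Rpower x be).
  have h7 := Rabs_pos (cos (x * y' - m * Rpower x be) - cos (x * y - m * Rpower x be)).
  nra.
- by apply: filter_forall => y'; exact: stable_int_correct.
- exact: stable_int_correct.
Qed.

(* Two integrations by parts in [int e^{ipy} psi(p) dp], [psi(p) = exp (- (k + i m) p^be)], with the
   antiderivatives [e^{ipy} / (iy)] and [(e^{ipy} - 1) / (iy)^2]: the second one vanishes at [p = 0], which
   compensates the singularity of [psi'']. *)
Let u1 (p : R) := be * Rpower p (be - 1).
Let u2 (p : R) := be * ((be - 1) * Rpower p (be - 1 - 1)).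
(** [c0 + i s0] is psi, and the indices 1 and 2 mark its first and second derivatives. [Prim] and
    [Rest] are the real parts of the boundary terms and of (e^{ipy} - 1) psi'' / y^2. *)
Let c0 (p : R) := exp (- k * Rpower p be) * cos (m * Rpower p be).
Let s0 (p : R) := - (exp (- k * Rpower p be) * sin (m * Rpower p be)).
Let c1 (p : R) := - u1 p * (k * c0 p - m * s0 p).
Let s1 (p : R) := - u1 p * (k * s0 p + m * c0 p).
Let c2 (p : R) := u1 p ^ 2 * ((k ^ 2 - m ^ 2) * c0 p - 2 * k * m * s0 p) - u2 p * (k * c0 p - m * s0 p).
Let s2 (p : R) := u1 p ^ 2 * ((k ^ 2 - m ^ 2) * s0 p + 2 * k * m * c0 p) - u2 p * (k * s0 p + m * c0 p).
Let Prim (y p : R) := / y * (sin (p * y) * c0 p + cos (p * y) * s0 p)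
   + / y ^ 2 * ((cos (p * y) - 1) * c1 p - sin (p * y) * s1 p).
Let Rest (y p : R) := / y ^ 2 * ((cos (p * y) - 1) * c2 p - sin (p * y) * s2 p).

Lemma stable_re_split y p : stable_re y p = cos (p * y) * c0 p - sin (p * y) * s0 p.
Proof. by rewrite /stable_re cos_minus /c0 /s0; ring. Qed.

Lemma derive_c0 p : 0 < p -> is_derive c0 p (c1 p).
Proof.
move=> hp; have h : is_derive (fun p => Rpower p be) p (u1 p) := is_derive_Rpower be hp.
have hex : ex_derive (fun p => Rpower p be) p by exists (u1 p).
rewrite /c0; auto_derive; first by repeat split.
rewrite (is_derive_unique _ _ _ h) /c1 /c0 /s0; ring.
Qed.

Lemma derive_s0 p : 0 < p -> is_derive s0 p (s1 p).
Proof.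
move=> hp; have h : is_derive (fun p => Rpower p be) p (u1 p) := is_derive_Rpower be hp.
have hex : ex_derive (fun p => Rpower p be) p by exists (u1 p).
rewrite /s0; auto_derive; first by repeat split.
rewrite (is_derive_unique _ _ _ h) /s1 /c0 /s0; ring.
Qed.

Lemma derive_u1 p : 0 < p -> is_derive u1 p (u2 p).
Proof. by move=> hp; apply: is_derive_scal; exact: is_derive_Rpower. Qed.

Lemma derive_c1 p : 0 < p -> is_derive c1 p (c2 p).
Proof.
move=> hp; have h0 := derive_c0 hp; have h1 := derive_s0 hp; have h2 := derive_u1 hp.
have x0 : ex_derive (fun x => c0 x) p by eexists; exact: h0.
have x1 : ex_derive (fun x => s0 x) p by eexists; exact: h1.
have x2 : ex_derive (fun x => u1 x) p by eexists; exact: h2.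
rewrite /c1; auto_derive; first by repeat split.
rewrite (is_derive_unique (fun x => c0 x) _ _ h0) (is_derive_unique (fun x => s0 x) _ _ h1) (is_derive_unique (fun x => u1 x) _ _ h2).
rewrite /c2 /c1 /s1; ring.
Qed.

Lemma derive_s1 p : 0 < p -> is_derive s1 p (s2 p).
Proof.
move=> hp; have h0 := derive_c0 hp; have h1 := derive_s0 hp; have h2 := derive_u1 hp.
have x0 : ex_derive (fun x => c0 x) p by eexists; exact: h0.
have x1 : ex_derive (fun x => s0 x) p by eexists; exact: h1.
have x2 : ex_derive (fun x => u1 x) p by eexists; exact: h2.
rewrite /s1; auto_derive; first by repeat split.
rewrite (is_derive_unique (fun x => c0 x) _ _ h0) (is_derive_unique (fun x => s0 x) _ _ h1) (is_derive_unique (fun x => u1 x) _ _ h2).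
rewrite /s2 /c1 /s1; ring.
Qed.

Lemma derive_Prim y p : y <> 0 -> 0 < p -> is_derive (Prim y) p (stable_re y p + Rest y p).
Proof.
move=> hy hp; have h0 := derive_c0 hp; have h1 := derive_s0 hp.
have h2 := derive_c1 hp; have h3 := derive_s1 hp.
have x0 : ex_derive (fun x => c0 x) p by eexists; exact: h0.
have x1 : ex_derive (fun x => s0 x) p by eexists; exact: h1.
have x2 : ex_derive (fun x => c1 x) p by eexists; exact: h2.
have x3 : ex_derive (fun x => s1 x) p by eexists; exact: h3.
rewrite /Prim; auto_derive; first by repeat split.
rewrite (is_derive_unique (fun x => c0 x) _ _ h0) (is_derive_unique (fun x => s0 x) _ _ h1)
  (is_derive_unique (fun x => c1 x) _ _ h2) (is_derive_unique (fun x => s1 x) _ _ h3).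
by rewrite stable_re_split /Rest; field.
Qed.

Lemma c0_bound p : Rabs (c0 p) <= exp (- k * Rpower p be).
Proof.
rewrite /c0 Rabs_mult Rabs_pos_eq; last by left; exact: exp_pos.
have := Rabs_cos_le1 (m * Rpower p be); have := exp_pos (- k * Rpower p be); nra.
Qed.

Lemma s0_bound p : Rabs (s0 p) <= exp (- k * Rpower p be).
Proof.
rewrite /s0 Rabs_Ropp Rabs_mult Rabs_pos_eq; last by left; exact: exp_pos.
have := Rabs_sin_le1 (m * Rpower p be); have := exp_pos (- k * Rpower p be); nra.
Qed.

Lemma lin_bound (x y X Y E a b : R) : Rabs x <= E -> Rabs y <= E -> X = a * x + b * y ->
  Rabs a <= Y -> Rabs b <= Y -> Rabs X <= 2 * Y * E.
Proof.
move=> hx hy -> ha hb.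
apply: Rle_trans (Rabs_triang _ _) _; rewrite !Rabs_mult.
have h1 : Rabs a * Rabs x <= Y * E by apply: Rmult_le_compat => //; exact: Rabs_pos.
have h2 : Rabs b * Rabs y <= Y * E by apply: Rmult_le_compat => //; exact: Rabs_pos.
lra.
Qed.

Lemma stable_angle_bounds : Rabs k <= 1 /\ Rabs m <= 1 /\ Rabs (k ^ 2 - m ^ 2) <= 2 /\ Rabs (2 * k * m) <= 2.
Proof.
have hk := COS_bound (PI * be / 2); have hm := SIN_bound (PI * be / 2).
rewrite -/k in hk; rewrite -/m in hm.
repeat split; apply: Rabs_le; nra.
Qed.

Lemma c1_bound p : 0 < p -> Rabs (c1 p) <= 2 * u1 p * exp (- k * Rpower p be) /\
   Rabs (s1 p) <= 2 * u1 p * exp (- k * Rpower p be).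
Proof.
move=> hp; have [hk [hm _]] := stable_angle_bounds.
have hu : 0 < u1 p by apply: Rmult_lt_0_compat; [lra | exact: Rpower_pos].
have hc := c0_bound p; have hs := s0_bound p.
have h (z : R) : Rabs z <= 1 -> Rabs (- u1 p * z) <= u1 p.
  by move=> hz; rewrite Rabs_mult Rabs_Ropp (Rabs_pos_eq (u1 p)); nra.
split.
- apply: (lin_bound (a := - u1 p * k) (b := - u1 p * - m) hc hs); [by rewrite /c1; ring | exact: h | apply: h; by rewrite Rabs_Ropp].
- apply: (lin_bound (a := - u1 p * m) (b := - u1 p * k) hc hs); [by rewrite /s1; ring | exact: h | exact: h].
Qed.

Lemma c2_bound p : 0 < p -> Rabs (c2 p) <= 2 * (2 * u1 p ^ 2 + Rabs (u2 p)) * exp (- k * Rpower p be) /\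
   Rabs (s2 p) <= 2 * (2 * u1 p ^ 2 + Rabs (u2 p)) * exp (- k * Rpower p be).
Proof.
move=> hp; have [hk [hm [hd hkm]]] := stable_angle_bounds.
have hc := c0_bound p; have hs := s0_bound p.
have hu0 : 0 <= u1 p ^ 2 by exact: pow2_ge_0.
have h (z w : R) : Rabs z <= 2 -> Rabs w <= 1 -> Rabs (u1 p ^ 2 * z - u2 p * w) <= 2 * u1 p ^ 2 + Rabs (u2 p).
  move=> hz hw; apply: Rle_trans (Rabs_triang _ _) _; rewrite Rabs_Ropp (Rabs_mult (u1 p ^ 2)) (Rabs_mult (u2 p)) (Rabs_pos_eq (u1 p ^ 2)) //.
  have := Rabs_pos (u2 p); have := Rabs_pos w; nra.
split.
- apply: (lin_bound (a := u1 p ^ 2 * (k ^ 2 - m ^ 2) - u2 p * k) (b := u1 p ^ 2 * (- (2 * k * m)) - u2 p * - m) hc hs).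
  + by rewrite /c2; ring.
  + exact: h.
  + by apply: h; rewrite Rabs_Ropp.
- apply: (lin_bound (a := u1 p ^ 2 * (2 * k * m) - u2 p * m) (b := u1 p ^ 2 * (k ^ 2 - m ^ 2) - u2 p * k) hc hs).
  + by rewrite /s2; ring.
  + exact: h.
  + exact: h.
Qed.

(** Interpolation between the bounds x and 2: it trades regularity at p = 0 against decay in y when
    applied to e^{ipy} - 1. *)
Lemma min_le_Rpower (x z s : R) : 0 < x -> 0 <= s <= 1 -> z <= x -> z <= 2 -> z <= 2 * Rpower x s.
Proof.
move=> hx hs h1 h2; have hr := Rpower_pos x s.
case: (Rle_dec x 1) => hx1.
- have : x <= Rpower x s.
    rewrite -{1}(Rpower_1 x) //; apply: exp_le_compat.
    have : ln x <= 0 by rewrite -ln_1; apply: ln_le; lra.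
    nra.
  lra.
- have : 1 <= Rpower x s.
    rewrite -(Rpower_O x) //; apply: Rle_Rpower; lra.
  lra.
Qed.

(** Near 0, psi'' is O(p^(be-2)) and e^{ipy} - 1 is O((py)^s). Convergence at 0 needs s > 1 - be,
    and integrability of the resulting weight at 0 needs s < 1; s = 1 - be/2 is the midpoint. *)
Lemma Rest_bound : exists C, 0 < C /\ forall y p, 0 < y -> 0 < p ->
  Rabs (Rest y p) <= C * Rpower y (- 1 - be / 2) * hl_majorant (be / 2) p.
Proof.
have [K [hK h]] := @stretched_majorant be k 1 (be / 2) (proj1 hbe) stable_k_pos ltac:(lra).
exists (32 * K); split; first lra.
move=> y p hy hp.
set E := exp (- k * Rpower p be).
have hE : 0 < E by exact: exp_pos.
have hpy : 0 < p * y by exact: Rmult_lt_0_compat.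
set w := Rpower (p * y) (1 - be / 2).
have hw : 0 < w by exact: Rpower_pos.
have hcos : Rabs (cos (p * y) - 1) <= 2 * w.
  apply: min_le_Rpower => //; first lra.
  - have := cos_lip (p * y) 0; rewrite cos_0 Rminus_0_r (Rabs_pos_eq (p * y)); lra.
  - by apply: Rabs_le; have := COS_bound (p * y); lra.
have hsin : Rabs (sin (p * y)) <= 2 * w.
  apply: min_le_Rpower => //; first lra.
  - have := sin_le_abs (p * y); rewrite (Rabs_pos_eq (p * y)); lra.
  - have := Rabs_sin_le1 (p * y); lra.
have [hc2 hs2] := c2_bound hp; rewrite -/E in hc2 hs2.
set G := 2 * u1 p ^ 2 + Rabs (u2 p) in hc2 hs2.
have hG0 : 0 <= G by have := pow2_ge_0 (u1 p); have := Rabs_pos (u2 p); rewrite /G; lra.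
have hR : Rabs (Rest y p) <= / y ^ 2 * (8 * w * G * E).
  have hy2 : 0 < / y ^ 2 by apply: Rinv_0_lt_compat; exact: pow_lt.
  rewrite /Rest Rabs_mult (Rabs_pos_eq (/ y ^ 2)); last lra.
  apply: Rmult_le_compat_l; first lra.
  apply: Rle_trans (Rabs_triang _ _) _; rewrite Rabs_Ropp !Rabs_mult.
  have q1 : Rabs (cos (p * y) - 1) * Rabs (c2 p) <= 2 * w * (2 * G * E).
    by apply: Rmult_le_compat => //; exact: Rabs_pos.
  have q2 : Rabs (sin (p * y)) * Rabs (s2 p) <= 2 * w * (2 * G * E).
    by apply: Rmult_le_compat => //; exact: Rabs_pos.
  lra.
have hp1 : 0 < 1 + p by lra.
have hG : G <= 4 * Rpower p (be - 2) * (1 + p).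
  have e1 : u1 p ^ 2 = be ^ 2 * (Rpower p (be - 2) * Rpower p be).
    rewrite /u1 -Rpower_plus Rpow_mult_distr; congr (_ * _).
    have -> : be - 2 + be = (be - 1) + (be - 1) by ring.
    by rewrite Rpower_plus; ring.
  have e2 : Rabs (u2 p) = be * (1 - be) * Rpower p (be - 2).
    rewrite /u2; have -> : be - 1 - 1 = be - 2 by ring.
    have -> : be * ((be - 1) * Rpower p (be - 2)) = - (be * (1 - be) * Rpower p (be - 2)) by ring.
    rewrite Rabs_Ropp Rabs_pos_eq //.
    by apply: Rmult_le_pos; [nra | left; exact: Rpower_pos].
  have hpb : Rpower p be <= 1 + p.
    apply: (Rle_trans _ (Rpower (1 + p) be)); first by apply: Rle_Rpower_l; lra.
    by rewrite -{2}(Rpower_1 (1 + p)) //; apply: Rle_Rpower; lra.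
  have hq := Rpower_pos p (be - 2); have hpb0 := Rpower_pos p be.
  rewrite /G e1 e2.
  have hb2 : be ^ 2 <= 1 by nra.
  have hb3 : be * (1 - be) <= 1 by nra.
  have t1 : be ^ 2 * (Rpower p (be - 2) * Rpower p be) <= 1 * (Rpower p (be - 2) * (1 + p)).
    by apply: Rmult_le_compat; [exact: pow2_ge_0 | nra | lra | apply: Rmult_le_compat_l; lra].
  have t2 : be * (1 - be) * Rpower p (be - 2) <= 1 * (Rpower p (be - 2) * (1 + p)).
    by apply: Rmult_le_compat; [nra | lra | lra | nra].
  nra.
have h0 := h p hp; rewrite Rpower_1 // -/E in h0.
have e3 : w = Rpower p (1 - be / 2) * Rpower y (1 - be / 2) by rewrite /w Rpower_mult_distr.
have e4 : Rpower p (1 - be / 2) * Rpower p (be - 2) = Rpower p (be / 2 - 1).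
  by rewrite -Rpower_plus; congr Rpower; field.
have e5 : / y ^ 2 * Rpower y (1 - be / 2) = Rpower y (- 1 - be / 2).
  rewrite -Rpower_2 // -Rpower_Ropp -Rpower_plus; congr Rpower; field.
have hyp := Rpower_pos y (- 1 - be / 2).
apply: Rle_trans hR _.
apply: (Rle_trans _ (/ y ^ 2 * (8 * w * (4 * Rpower p (be - 2) * (1 + p)) * E))).
  apply: Rmult_le_compat_l; first by left; apply: Rinv_0_lt_compat; exact: pow_lt.
  apply: Rmult_le_compat_r; first lra.
  by apply: Rmult_le_compat_l; lra.
have -> : / y ^ 2 * (8 * w * (4 * Rpower p (be - 2) * (1 + p)) * E) =
   32 * Rpower y (- 1 - be / 2) * (Rpower p (be / 2 - 1) * (1 + p) * E).
  by rewrite e3 -e4 -e5; ring.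
have -> : 32 * K * Rpower y (- 1 - be / 2) * hl_majorant (be / 2) p =
   32 * Rpower y (- 1 - be / 2) * (K * hl_majorant (be / 2) p) by ring.
by apply: Rmult_le_compat_l; lra.
Qed.

(** The factors vanishing at p = 0 are kept on the right: they make the first term small there and
    compensate the singularity of [u1] in the second. *)
Lemma Prim_bound y p : 0 < y -> 0 < p ->
  Rabs (Prim y p) <= / y * (Rabs (sin (p * y)) * exp (- k * Rpower p be) + Rabs (s0 p)) +
    / y ^ 2 * ((Rabs (cos (p * y) - 1) + Rabs (sin (p * y))) * (2 * u1 p * exp (- k * Rpower p be))).
Proof.
move=> hy hp; have [hc hs] := c1_bound hp; have h0 := c0_bound p.
have hyi := Rinv_0_lt_compat _ hy; have hy2 : 0 < / y ^ 2 by apply: Rinv_0_lt_compat; exact: pow_lt.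
rewrite /Prim; apply: Rle_trans (Rabs_triang _ _) _.
rewrite !(Rabs_mult (/ _)) (Rabs_pos_eq (/ y)) ?(Rabs_pos_eq (/ y ^ 2)); try lra.
apply: Rplus_le_compat; apply: Rmult_le_compat_l; try lra.
- apply: Rle_trans (Rabs_triang _ _) _; rewrite (Rabs_mult (sin (p * y))) (Rabs_mult (cos (p * y))); apply: Rplus_le_compat.
    by apply: Rmult_le_compat_l => //; exact: Rabs_pos.
  have := Rabs_cos_le1 (p * y); have := Rabs_pos (s0 p); nra.
- apply: Rle_trans (Rabs_triang _ _) _; rewrite Rabs_Ropp (Rabs_mult (cos (p * y) - 1)) (Rabs_mult (sin (p * y))) Rmult_plus_distr_r.
  by apply: Rplus_le_compat; apply: Rmult_le_compat_l => //; exact: Rabs_pos.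
Qed.

Lemma Prim_lim0 y : 0 < y -> filterlim (Prim y) (at_right 0) (locally 0).
Proof.
move=> hy; apply/(@filterlim_normP R R_NormedModule) => eps he.
have hyi := Rinv_0_lt_compat _ hy.
(* Near 0 the first part of [Prim_bound] is at most (1 + 1/y) p^be and the second at most (4/y)
   p^be, since p [u1 p] = be p^be. *)
have [d [hd h]] := @Rpower_small be (eps / (1 + 5 * / y)) (proj1 hbe) ltac:(apply: Rdiv_lt_0_compat; lra).
exists (mkposreal _ (Rmin_pos _ _ hd Rlt_0_1)) => p hp hp0'.
have hp0 : 0 < p := hp0'.
have hpd : Rabs (p - 0) < Rmin d 1 := hp.
rewrite Rminus_0_r Rabs_pos_eq in hpd; last lra.
have l1 := Rmin_l d 1; have l2 := Rmin_r d 1.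
change (Rabs (Prim y p - 0) < eps); rewrite Rminus_0_r.
apply: Rle_lt_trans (Prim_bound hy hp0) _.
have hE : exp (- k * Rpower p be) <= 1.
  rewrite -exp_0; apply: exp_le_compat; have := stable_k_pos; have := Rpower_pos p be; nra.
have hE0 := exp_pos (- k * Rpower p be).
set E := exp (- k * Rpower p be) in hE hE0 *.
have hpy : 0 < p * y by exact: Rmult_lt_0_compat.
have hsin : Rabs (sin (p * y)) <= p * y by have := sin_le_abs (p * y); rewrite (Rabs_pos_eq (p * y)); lra.
have hcos : Rabs (cos (p * y) - 1) <= p * y.
  have := cos_lip (p * y) 0; rewrite cos_0 Rminus_0_r (Rabs_pos_eq (p * y)); lra.
have hpb := Rpower_pos p be.
have hs : Rabs (s0 p) <= Rpower p be.
  rewrite /s0 -/E Rabs_Ropp Rabs_mult (Rabs_pos_eq E); last lra.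
  have h1 := sin_le_abs (m * Rpower p be).
  rewrite Rabs_mult (Rabs_pos_eq (Rpower p be)) in h1; last lra.
  have [_ [hm _]] := stable_angle_bounds; have hs0 := Rabs_pos (sin (m * Rpower p be)).
  have : Rabs m * Rpower p be <= 1 * Rpower p be by apply: Rmult_le_compat_r; lra.
  nra.
have hpp : p <= Rpower p be.
  rewrite -{1}(Rpower_1 p) //; apply: exp_le_compat.
  have : ln p <= 0 by rewrite -ln_1; apply: ln_le; lra.
  nra.
have hu : u1 p * p <= Rpower p be.
  have -> : u1 p * p = be * Rpower p be.
    rewrite /u1 -{2}(Rpower_1 p) // Rmult_assoc -Rpower_plus; congr (_ * Rpower _ _); ring.
  nra.
have hu0 : 0 < u1 p by apply: Rmult_lt_0_compat; [lra | exact: Rpower_pos].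
have t1 : / y * (Rabs (sin (p * y)) * E + Rabs (s0 p)) <= Rpower p be + / y * Rpower p be.
  apply: (Rle_trans _ (/ y * (p * y * 1 + Rpower p be))).
    apply: Rmult_le_compat_l; first lra.
    apply: Rplus_le_compat => //.
    by apply: Rmult_le_compat => //; [exact: Rabs_pos | lra].
  have -> : / y * (p * y * 1 + Rpower p be) = p + / y * Rpower p be by field; lra.
  lra.
have t2 : / y ^ 2 * ((Rabs (cos (p * y) - 1) + Rabs (sin (p * y))) * (2 * u1 p * E)) <= 4 * / y * Rpower p be.
  apply: (Rle_trans _ (/ y ^ 2 * ((p * y + p * y) * (2 * u1 p * 1)))).
    apply: Rmult_le_compat_l; first by left; apply: Rinv_0_lt_compat; exact: pow_lt.
    apply: Rmult_le_compat.
    - by apply: Rplus_le_le_0_compat; exact: Rabs_pos.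
    - by apply: Rmult_le_pos; lra.
    - lra.
    - by apply: Rmult_le_compat_l; lra.
  have -> : / y ^ 2 * ((p * y + p * y) * (2 * u1 p * 1)) = 4 * / y * (u1 p * p) by field; lra.
  by apply: Rmult_le_compat_l; lra.
have h1 := h p ltac:(lra).
have h2 : (1 + 5 * / y) * Rpower p be < eps.
  have -> : eps = (1 + 5 * / y) * (eps / (1 + 5 * / y)) by field; lra.
  by apply: Rmult_lt_compat_l; lra.
lra.
Qed.

Lemma Prim_liminf y : 0 < y -> filterlim (Prim y) (Rbar_locally p_infty) (locally 0).
Proof.
move=> hy; apply/(@filterlim_normP R R_NormedModule) => eps he.
have hyi := Rinv_0_lt_compat _ hy; have hy2 : 0 < / y ^ 2 by apply: Rinv_0_lt_compat; exact: pow_lt.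
have [K [hK hmaj]] := stable_majorant stable_k_pos.
set Q := / y * 2 + / y ^ 2 * 6.
have hQ : 0 < Q by rewrite /Q; lra.
exists (Rmax 1 (Q * K / eps)) => p hp.
have l1 := Rmax_l 1 (Q * K / eps); have l2 := Rmax_r 1 (Q * K / eps).
have hp0 : 0 < p by lra.
change (Rabs (Prim y p - 0) < eps); rewrite Rminus_0_r.
apply: Rle_lt_trans (Prim_bound hy hp0) _.
have hE0 := exp_pos (- k * Rpower p be); have hEm := hmaj p hp0; have hs := s0_bound p.
set E := exp (- k * Rpower p be) in hE0 hEm hs *.
have hsin := Rabs_sin_le1 (p * y).
have hcos : Rabs (cos (p * y) - 1) <= 2 by apply: Rabs_le; have := COS_bound (p * y); lra.
have hu : u1 p <= 1.
  have : Rpower p (be - 1) <= 1.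
    by apply: (Rle_trans _ (Rpower p 0)); [apply: Rle_Rpower; lra | rewrite Rpower_O; lra].
  have := Rpower_pos p (be - 1); rewrite /u1; nra.
have hu0 : 0 < u1 p by apply: Rmult_lt_0_compat; [lra | exact: Rpower_pos].
have t1 : / y * (Rabs (sin (p * y)) * E + Rabs (s0 p)) <= / y * 2 * E.
  rewrite (Rmult_assoc (/ y)); apply: Rmult_le_compat_l; first lra.
  nra.
have t2 : / y ^ 2 * ((Rabs (cos (p * y) - 1) + Rabs (sin (p * y))) * (2 * u1 p * E)) <= / y ^ 2 * 6 * E.
  rewrite (Rmult_assoc (/ y ^ 2) 6); apply: Rmult_le_compat_l; first lra.
  apply: (Rle_trans _ (3 * (2 * 1 * E))); last lra.
  apply: Rmult_le_compat.
  - by apply: Rplus_le_le_0_compat; exact: Rabs_pos.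
  - by apply: Rmult_le_pos; lra.
  - lra.
  - by apply: Rmult_le_compat_r; lra.
have hmp : hl_majorant 1 p < / p.
  rewrite /hl_majorant; have -> : 1 - 1 = 0 by ring.
  rewrite Rpower_O // /Rdiv Rmult_1_l; apply: Rinv_lt_contravar; last nra.
  by apply: Rmult_lt_0_compat => //; apply: pow_lt; lra.
have hfin : Q * K * / p < eps.
  apply: (Rmult_lt_reg_r p) => //.
  have -> : Q * K * / p * p = Q * K / eps * eps by field; lra.
  by rewrite (Rmult_comm eps); apply: Rmult_lt_compat_r; lra.
have hQK : 0 < Q * K by exact: Rmult_lt_0_compat.
have h1 : Q * E <= Q * K * hl_majorant 1 p by rewrite Rmult_assoc; apply: Rmult_le_compat_l; lra.
have h2 : Q * K * hl_majorant 1 p < Q * K * / p by exact: Rmult_lt_compat_l.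
have e : Q * E = / y * 2 * E + / y ^ 2 * 6 * E by rewrite /Q; ring.
lra.
Qed.

Lemma Rest_cont y p : 0 < p -> continuous (Rest y) p.
Proof.
move=> hp; apply: (@ex_derive_continuous R_AbsRing R_NormedModule).
have h0 := derive_c0 hp; have h1 := derive_s0 hp; have h2 := derive_u1 hp.
have x0 : ex_derive (fun x => c0 x) p by eexists; exact: h0.
have x1 : ex_derive (fun x => s0 x) p by eexists; exact: h1.
have x2 : ex_derive (fun x => u1 x) p by eexists; exact: h2.
have x3 : ex_derive (fun x => u2 x) p.
  by apply: ex_derive_scal; apply: ex_derive_scal; eexists; exact: is_derive_Rpower.
rewrite /Rest /c2 /s2; auto_derive; by repeat split.
Qed.

Lemma is_RInt_gen_primitive (F f : R -> R) (la lb : R) :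
  (forall p, 0 < p -> is_derive F p (f p)) -> (forall p, 0 < p -> continuous f p) ->
  filterlim F (at_right 0) (locally la) -> filterlim F (Rbar_locally p_infty) (locally lb) ->
  is_RInt_gen (V := R_CompleteNormedModule) f (at_right 0) (Rbar_locally p_infty) (lb - la).
Proof.
move=> hF hf hla hlb P [eps hP].
have e2 : 0 < eps / 2 by have := cond_pos eps; lra.
have h1 : at_right 0 (fun x => Rabs (F x - la) < eps / 2).
  by exact (proj1 (@filterlim_normP R R_NormedModule (at_right 0) _ F la) hla _ e2).
have h2 : Rbar_locally p_infty (fun x => Rabs (F x - lb) < eps / 2).
  by exact (proj1 (@filterlim_normP R R_NormedModule (Rbar_locally p_infty) _ F lb) hlb _ e2).
refine (Filter_prod _ _ _ _ _ (filter_and _ _ hl_at_right h1) (filter_and _ _ hl_at_infty h2) _).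
move=> a b [ha ha'] [hb hb'].
have hin x : Rmin a b <= x <= Rmax a b -> 0 < x.
  by move=> hx; apply: Rlt_le_trans (proj1 hx); exact: Rmin_pos.
exists (F b - F a); split.
- by apply: (@is_RInt_derive R_CompleteNormedModule F f) => x /hin; [exact: hF | exact: hf].
- apply: hP.
  change (Rabs (F b - F a - (lb - la)) < eps).
  by move: ha' hb'; rewrite /Rabs; do 3 case: Rcase_abs; lra.
Qed.

(** [Prim] vanishes at both ends, so the integral of [stable_re] is minus that of [Rest]. *)
Lemma stable_int_large : exists C, 0 < C /\ forall y, 0 < y ->
  Rabs (stable_int y) <= C * Rpower y (- 1 - be / 2).
Proof.
have [C [hC h]] := Rest_bound.
exists (C / (be / 2)); split; first by apply: Rdiv_lt_0_compat; lra.
move=> y hy; have hr := Rpower_pos y (- 1 - be / 2).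
have [v [hv [hn _]]] := @half_line_integral R_CompleteNormedModule (Rest y) (be / 2) (C * Rpower y (- 1 - be / 2))
  ltac:(lra) ltac:(apply: Rmult_le_pos; lra) (fun p hp => @Rest_cont y p hp) (fun p hp => h y p hy hp).
have h1 : is_RInt_gen (V := R_CompleteNormedModule) (fun p => plus (stable_re y p) (Rest y p)) (at_right 0) (Rbar_locally p_infty) (plus (stable_int y) v).
  exact (is_RInt_gen_plus (V := R_CompleteNormedModule) _ _ _ _ (@stable_int_correct y) hv).
have h2 : is_RInt_gen (V := R_CompleteNormedModule) (fun p => plus (stable_re y p) (Rest y p)) (at_right 0) (Rbar_locally p_infty) (0 - 0).
  apply: (is_RInt_gen_primitive (F := Prim y)).
  - by move=> p hp; apply: derive_Prim; lra.
  - by move=> p hp; apply: (@continuous_plus _ R_AbsRing R_NormedModule); [exact: stable_re_cont | exact: Rest_cont].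
  - exact: Prim_lim0.
  - exact: Prim_liminf.
have h3 : stable_int y + v = 0 - 0.
  have q1 := is_RInt_gen_unique (V := R_CompleteNormedModule) (fun p => plus (stable_re y p) (Rest y p)) _ h1.
  have q2 := is_RInt_gen_unique (V := R_CompleteNormedModule) (fun p => plus (stable_re y p) (Rest y p)) _ h2.
  by rewrite -q2 q1.
have -> : stable_int y = - v by lra.
rewrite Rabs_Ropp.
apply: Rle_trans hn _.
by right; field; lra.
Qed.

End Stable.

(* [stable_int y] is the integral of [Re (exp (z y - z^be))] along the half line [z = i t]; moving it to
   [z = u + i t] does not change it, since [exp (z y - z^be)] is real for [z > 0]. *)
Section Shift.
Context (be : R) (hbe : 0 < be < 1) (y : R) (hy : 0 < y).

Let k := cos (PI * be / 2).
(* With [z = u + i t]: [LN + i TH] is [log (z^be)], [cr + i ci] is [z^be], [cru + i ciu] its derivative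
   [be z^(be - 1)], [Fre + i Fim] is [exp (z y - z^be)] and [W] the real part of its derivative. *)
Let LN (u t : R) := be / 2 * ln (u ^ 2 + t ^ 2).
Let TH (u t : R) := be * (PI / 2 - atan (u / t)).
Let q (u t : R) := be / (u ^ 2 + t ^ 2).
Let cr (u t : R) := exp (LN u t) * cos (TH u t).
Let ci (u t : R) := exp (LN u t) * sin (TH u t).
Let cru (u t : R) := exp (LN u t) * q u t * (u * cos (TH u t) + t * sin (TH u t)).
Let ciu (u t : R) := exp (LN u t) * q u t * (u * sin (TH u t) - t * cos (TH u t)).
Let Fre (u t : R) := exp (u * y - cr u t) * cos (t * y - ci u t).
Let Fim (u t : R) := exp (u * y - cr u t) * sin (t * y - ci u t).
Let W (u t : R) := exp (u * y - cr u t) * ((y - cru u t) * cos (t * y - ci u t) + ciu u t * sin (t * y - ci u t)).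

Lemma sq_pos u t : 0 < t -> 0 < u ^ 2 + t ^ 2.
Proof. by move=> ht; have := pow_lt t 2 ht; have := pow2_ge_0 u; lra. Qed.

Lemma LN_u u t : 0 < t -> is_derive (fun u => LN u t) u (q u t * u).
Proof.
move=> ht; have h := sq_pos u ht; rewrite /LN /q; auto_derive; first by move: h; rewrite /=; lra.
by rewrite /=; field; move: h; rewrite /=; lra.
Qed.

Lemma LN_t u t : 0 < t -> is_derive (fun t => LN u t) t (q u t * t).
Proof.
move=> ht; have h := sq_pos u ht; rewrite /LN /q; auto_derive; first by move: h; rewrite /=; lra.
by rewrite /=; field; move: h; rewrite /=; lra.
Qed.

Lemma TH_u u t : 0 < t -> is_derive (fun u => TH u t) u (- (q u t * t)).
Proof.
move=> ht; have h := sq_pos u ht; rewrite /TH /q; auto_derive; first by [].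
by rewrite /Rsqr; field; move: h; rewrite /=; split; lra.
Qed.

Lemma TH_t u t : 0 < t -> is_derive (fun t => TH u t) t (q u t * u).
Proof.
move=> ht; have h := sq_pos u ht; rewrite /TH /q; auto_derive; first lra.
by rewrite /Rsqr; field; move: h; rewrite /=; split; lra.
Qed.

(** This and the next three lemmas contain the Cauchy-Riemann equations for z^be. *)
Lemma cr_u u t : 0 < t -> is_derive (fun u => cr u t) u (cru u t).
Proof.
move=> ht; have h1 := LN_u u ht; have h2 := TH_u u ht.
have x1 : ex_derive (fun u => LN u t) u by eexists; exact: h1.
have x2 : ex_derive (fun u => TH u t) u by eexists; exact: h2.
rewrite /cr; auto_derive; first by repeat split.
rewrite (is_derive_unique (fun u => LN u t) _ _ h1) (is_derive_unique (fun u => TH u t) _ _ h2) /cru; ring.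
Qed.

Lemma ci_u u t : 0 < t -> is_derive (fun u => ci u t) u (ciu u t).
Proof.
move=> ht; have h1 := LN_u u ht; have h2 := TH_u u ht.
have x1 : ex_derive (fun u => LN u t) u by eexists; exact: h1.
have x2 : ex_derive (fun u => TH u t) u by eexists; exact: h2.
rewrite /ci; auto_derive; first by repeat split.
rewrite (is_derive_unique (fun u => LN u t) _ _ h1) (is_derive_unique (fun u => TH u t) _ _ h2) /ciu; ring.
Qed.

Lemma cr_t u t : 0 < t -> is_derive (fun t => cr u t) t (- ciu u t).
Proof.
move=> ht; have h1 := LN_t u ht; have h2 := TH_t u ht.
have x1 : ex_derive (fun t => LN u t) t by eexists; exact: h1.
have x2 : ex_derive (fun t => TH u t) t by eexists; exact: h2.
rewrite /cr; auto_derive; first by repeat split.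
rewrite (is_derive_unique (fun t => LN u t) _ _ h1) (is_derive_unique (fun t => TH u t) _ _ h2) /ciu; ring.
Qed.

Lemma ci_t u t : 0 < t -> is_derive (fun t => ci u t) t (cru u t).
Proof.
move=> ht; have h1 := LN_t u ht; have h2 := TH_t u ht.
have x1 : ex_derive (fun t => LN u t) t by eexists; exact: h1.
have x2 : ex_derive (fun t => TH u t) t by eexists; exact: h2.
rewrite /ci; auto_derive; first by repeat split.
rewrite (is_derive_unique (fun t => LN u t) _ _ h1) (is_derive_unique (fun t => TH u t) _ _ h2) /cru; ring.
Qed.

(** The derivative of [Fre] in [u] and that of [Fim] in [t] are the same function [W]; this
    Cauchy-Riemann equation is the one the contour shift rests on. *)
Lemma Fre_u u t : 0 < t -> is_derive (fun u => Fre u t) u (W u t).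
Proof.
move=> ht; have h1 := cr_u u ht; have h2 := ci_u u ht.
have x1 : ex_derive (fun u => cr u t) u by eexists; exact: h1.
have x2 : ex_derive (fun u => ci u t) u by eexists; exact: h2.
rewrite /Fre; auto_derive; first by repeat split.
rewrite (is_derive_unique (fun u => cr u t) _ _ h1) (is_derive_unique (fun u => ci u t) _ _ h2) /W /Rminus; ring.
Qed.

Lemma Fim_t u t : 0 < t -> is_derive (fun t => Fim u t) t (W u t).
Proof.
move=> ht; have h1 := cr_t u ht; have h2 := ci_t u ht.
have x1 : ex_derive (fun t => cr u t) t by eexists; exact: h1.
have x2 : ex_derive (fun t => ci u t) t by eexists; exact: h2.
rewrite /Fim; auto_derive; first by repeat split.
rewrite (is_derive_unique (fun t => cr u t) _ _ h1) (is_derive_unique (fun t => ci u t) _ _ h2) /W /Rminus; ring.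
Qed.

Lemma Fre_t_ex u t : 0 < t -> ex_derive (fun t => Fre u t) t.
Proof.
move=> ht; have h1 := cr_t u ht; have h2 := ci_t u ht.
have x1 : ex_derive (fun t => cr u t) t by eexists; exact: h1.
have x2 : ex_derive (fun t => ci u t) t by eexists; exact: h2.
by rewrite /Fre; auto_derive; repeat split.
Qed.

Lemma cont2_sq u t : continuity_2d_pt (fun u t => u ^ 2 + t ^ 2) u t.
Proof.
have h1 := continuity_2d_pt_id1 u t; have h2 := continuity_2d_pt_id2 u t; have h3 := continuity_2d_pt_const u t 1.
by apply: continuity_2d_pt_plus; apply: continuity_2d_pt_mult => //; apply: continuity_2d_pt_mult.
Qed.

Lemma cont2_LN u t : 0 < t -> continuity_2d_pt LN u t.
Proof.
move=> ht; apply: continuity_2d_pt_mult; first exact: continuity_2d_pt_const.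
apply: (continuity_1d_2d_pt_comp ln); last exact: cont2_sq.
by apply: derivable_continuous_pt; eexists; exact: derivable_pt_lim_ln (sq_pos u ht).
Qed.

Lemma cont2_TH u t : 0 < t -> continuity_2d_pt TH u t.
Proof.
move=> ht; apply: continuity_2d_pt_mult; first exact: continuity_2d_pt_const.
apply: continuity_2d_pt_minus; first exact: continuity_2d_pt_const.
apply: (continuity_1d_2d_pt_comp atan).
  by apply: derivable_continuous_pt; exact: derivable_pt_atan.
apply: continuity_2d_pt_mult; first exact: continuity_2d_pt_id1.
apply: continuity_2d_pt_inv; [exact: continuity_2d_pt_id2 | lra].
Qed.

Lemma cont2_q u t : 0 < t -> continuity_2d_pt q u t.
Proof.
move=> ht; apply: continuity_2d_pt_mult; first exact: continuity_2d_pt_const.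
apply: continuity_2d_pt_inv; [exact: cont2_sq | by have := sq_pos u ht; lra].
Qed.

Lemma cont2_comp (f : R -> R) (g : R -> R -> R) u t : continuity f -> continuity_2d_pt g u t ->
  continuity_2d_pt (fun u t => f (g u t)) u t.
Proof. by move=> hf hg; apply: continuity_1d_2d_pt_comp => //; exact: hf. Qed.

Lemma continuity_exp : continuity exp.
Proof. by apply: derivable_continuous; exact: derivable_exp. Qed.

Lemma cont2_W u t : 0 < t -> continuity_2d_pt W u t.
Proof.
move=> ht.
have hLN := cont2_LN u ht; have hTH := cont2_TH u ht; have hq := cont2_q u ht.
have hu := continuity_2d_pt_id1 u t; have hv := continuity_2d_pt_id2 u t.
have hyc := continuity_2d_pt_const u t y.
have hE := cont2_comp continuity_exp hLN.
have hc := cont2_comp continuity_cos hTH; have hs := cont2_comp continuity_sin hTH.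
have hcr : continuity_2d_pt cr u t by exact: continuity_2d_pt_mult.
have hci : continuity_2d_pt ci u t by exact: continuity_2d_pt_mult.
have hcru : continuity_2d_pt cru u t.
  by apply: continuity_2d_pt_mult; [exact: continuity_2d_pt_mult | apply: continuity_2d_pt_plus; exact: continuity_2d_pt_mult].
have hciu : continuity_2d_pt ciu u t.
  by apply: continuity_2d_pt_mult; [exact: continuity_2d_pt_mult | apply: continuity_2d_pt_minus; exact: continuity_2d_pt_mult].
have hY : continuity_2d_pt (fun u t => t * y - ci u t) u t.
  by apply: continuity_2d_pt_minus => //; exact: continuity_2d_pt_mult.
apply: continuity_2d_pt_mult.
  by apply: (cont2_comp continuity_exp); apply: continuity_2d_pt_minus => //; exact: continuity_2d_pt_mult.
apply: continuity_2d_pt_plus; apply: continuity_2d_pt_mult => //.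
- exact: continuity_2d_pt_minus.
- exact: (cont2_comp continuity_cos).
- exact: (cont2_comp continuity_sin).
Qed.

Lemma W_cont_t u t : 0 < t -> continuous (fun t => W u t) t.
Proof.
move=> ht.
have h := proj1 (continuity_2d_pt_filterlim W u t) (cont2_W u ht).
apply: (filterlim_comp _ _ _ (fun t => (u, t)) (fun z => W z.1 z.2) _ (locally (u, t)) _ _ h).
move=> P [e he]; exists e => s hs; apply: he; split => //; exact: ball_center.
Qed.

(** Cauchy's theorem in infinitesimal form: differentiating under the integral gives [W], which is
    an exact derivative in [t], so only the two ends contribute. *)
Lemma strip_derive a b u : 0 < a -> 0 < b ->
  is_derive (fun u => RInt (fun t => Fre u t) a b) u (Fim u b - Fim u a).
Proof.
move=> ha hb.
have hmin : 0 < Rmin a b by exact: Rmin_pos.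
have hD t v : 0 < t -> Derive (fun u => Fre u t) v = W v t.
  by move=> ht; apply: is_derive_unique; exact: Fre_u.
have hex v : ex_RInt (fun t => Fre v t) a b.
  apply: (@ex_RInt_continuous R_CompleteNormedModule) => t ht.
  apply: (@ex_derive_continuous R_AbsRing R_NormedModule); apply: Fre_t_ex; lra.
have h := @is_derive_RInt_param (fun u t => Fre u t) a b u
  ltac:(apply: filter_forall => v t ht; eexists; apply: Fre_u; lra)
  ltac:(move=> t ht; apply: (continuity_2d_pt_ext_loc W);
    [have ht0 : 0 < t by [lra]; exists (mkposreal t ht0) => u' t' _ /= h2; symmetry; apply: hD;
     move: h2; rewrite /Rabs; case: Rcase_abs; lra
    | apply: cont2_W; lra])
  ltac:(by apply: filter_forall => v; exact: hex).
have e : RInt (fun t => Derive (fun u => Fre u t) u) a b = Fim u b - Fim u a.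
  rewrite (RInt_ext _ (fun t => W u t)); last by move=> t ht; apply: hD; lra.
  apply: is_RInt_unique.
  apply: (@is_RInt_derive R_CompleteNormedModule (fun t => Fim u t) (fun t => W u t)) => t ht.
  - apply: Fim_t; lra.
  - apply: W_cont_t; lra.
by rewrite -e.
Qed.

Lemma angle_bounds u t : 0 <= u -> 0 < t -> 0 <= PI / 2 - atan (u / t) <= PI / 2.
Proof.
move=> hu ht; have h := atan_bound (u / t).
have h0 : 0 <= atan (u / t).
  rewrite -atan_0; case: (Rle_lt_or_eq_dec _ _ hu) => [h0|<-]; last by rewrite /Rdiv Rmult_0_l; right.
  by left; apply: atan_increasing; exact: Rdiv_lt_0_compat.
lra.
Qed.

Lemma TH_bounds u t : 0 <= u -> 0 < t -> 0 <= TH u t <= PI * be / 2.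
Proof. by move=> hu ht; have h := angle_bounds hu ht; have hPI := PI_RGT_0; rewrite /TH; split; nra. Qed.

Lemma k_le_cos u t : 0 <= u -> 0 < t -> k <= cos (TH u t).
Proof.
move=> hu ht; have h := TH_bounds hu ht; have hPI := PI_RGT_0.
by apply: cos_decr_1; try nra; lra.
Qed.

Lemma exp_LN_ge s u t : 0 < t -> 0 < s -> s ^ 2 <= u ^ 2 + t ^ 2 -> Rpower s be <= exp (LN u t).
Proof.
move=> ht hs h; rewrite /Rpower; apply: exp_le_compat; rewrite /LN.
have : ln (s ^ 2) <= ln (u ^ 2 + t ^ 2) by apply: ln_le => //; exact: pow_lt.
have -> : ln (s ^ 2) = 2 * ln s.
  by rewrite /= Rmult_1_r ln_mult //; ring.
nra.
Qed.

Lemma exp_LN_le s u t : 0 < t -> 0 < s -> u ^ 2 + t ^ 2 <= 2 * s ^ 2 -> exp (LN u t) <= 2 * Rpower s be.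
Proof.
move=> ht hs h; have h0 := sq_pos u ht.
have -> : 2 * Rpower s be = exp (ln 2 + be * ln s) by rewrite exp_plus exp_ln //; lra.
apply: exp_le_compat; rewrite /LN.
have h2 : ln (u ^ 2 + t ^ 2) <= ln (2 * s ^ 2) by apply: ln_le.
have e : ln (2 * s ^ 2) = ln 2 + 2 * ln s.
  by rewrite ln_mult; [rewrite /= Rmult_1_r ln_mult //; ring | lra | exact: pow_lt].
have hl2 : 0 < ln 2 by rewrite -ln_1; apply: ln_increasing; lra.
rewrite e in h2; nra.
Qed.

Lemma atan_le_id z : 0 <= z -> atan z <= z.
Proof.
move=> hz; have [c [hc _]] := MVT_abs atan (fun x => / (1 + x ^ 2)) 0 z (fun c _ => derivable_pt_lim_atan c).
rewrite atan_0 !Rminus_0_r (Rabs_pos_eq z) // in hc.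
have h : Rabs (/ (1 + c ^ 2)) <= 1.
  have h1 := pow2_ge_0 c.
  rewrite Rabs_pos_eq; last by left; apply: Rinv_0_lt_compat; lra.
  by rewrite -Rinv_1; apply: Rinv_le_contravar; lra.
have := Rle_abs (atan z); nra.
Qed.

(** A bound uniform in [u]. If u <= t, the modulus of z^be is at most 2 t^be and its argument at
    most 2. If u > t, the argument is at most t/u, and u^be (t/u) <= t^be because be < 1. *)
Lemma ci_small u t : 0 <= u -> 0 < t -> Rabs (ci u t) <= 4 * Rpower t be.
Proof.
move=> hu ht; have [hT0 hT1] := TH_bounds hu ht; have hph := angle_bounds hu ht.
have hE := exp_pos (LN u t); have hr := Rpower_pos t be.
have hphi : TH u t <= PI / 2 - atan (u / t) by rewrite /TH; nra.
rewrite /ci Rabs_mult (Rabs_pos_eq (exp _)); last lra.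
have hs : Rabs (sin (TH u t)) <= TH u t by have := sin_le_abs (TH u t); rewrite (Rabs_pos_eq (TH u t)).
have hs0 := Rabs_pos (sin (TH u t)).
case: (Rle_dec u t) => hut.
- have h1 : exp (LN u t) <= 2 * Rpower t be by apply: exp_LN_le => //; nra.
  have := PI_4 => hPI.
  apply: (Rle_trans _ (2 * Rpower t be * 2)); last lra.
  by apply: Rmult_le_compat; lra.
- have hu0 : 0 < u by lra.
  have h1 : exp (LN u t) <= 2 * Rpower u be by apply: exp_LN_le => //; nra.
  have h2 : PI / 2 - atan (u / t) <= t / u.
    rewrite -atan_inv; last exact: Rdiv_lt_0_compat.
    have -> : / (u / t) = t / u by field; lra.
    by apply: atan_le_id; left; exact: Rdiv_lt_0_compat.
  apply: (Rle_trans _ (2 * Rpower u be * (t / u))).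
    by apply: Rmult_le_compat; lra.
  have e1 : Rpower u be * (t / u) = t * Rpower u (be - 1).
    have -> : Rpower u be = Rpower u (be - 1) * u.
      by rewrite -{3}(Rpower_1 u) // -Rpower_plus; congr Rpower; ring.
    by field; lra.
  have e2 : Rpower t be = t * Rpower t (be - 1).
    by rewrite -{2}(Rpower_1 t) // -Rpower_plus; congr Rpower; ring.
  have h3 : Rpower u (be - 1) <= Rpower t (be - 1).
    rewrite /Rpower; apply: exp_le_compat.
    have : ln t <= ln u by apply: ln_le; lra.
    nra.
  rewrite Rmult_assoc e1 e2.
  have := Rpower_pos u (be - 1); nra.
Qed.

Lemma exp_X_le u t s : 0 <= u -> 0 < t -> 0 < s -> s <= exp (LN u t) ->
  exp (u * y - cr u t) <= exp (u * y) * exp (- k * s).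
Proof.
move=> hu ht hs h; rewrite -exp_plus; apply: exp_le_compat.
have hk := stable_k_pos hbe; rewrite -/k in hk.
have hc := k_le_cos hu ht; have hE := exp_pos (LN u t).
have : k * s <= exp (LN u t) * cos (TH u t) by rewrite Rmult_comm; apply: Rmult_le_compat; lra.
rewrite /cr; lra.
Qed.

Lemma Rpower_le_LN u t : 0 < t -> Rpower t be <= exp (LN u t).
Proof. by move=> ht; apply: exp_LN_ge => //; have := pow2_ge_0 u; lra. Qed.

Lemma Fre_bound u t : 0 <= u -> 0 < t -> Rabs (Fre u t) <= exp (u * y) * exp (- k * Rpower t be).
Proof.
move=> hu ht; have hX := exp_X_le hu ht (Rpower_pos t be) (Rpower_le_LN u ht).
rewrite /Fre Rabs_mult (Rabs_pos_eq (exp _)); last by left; exact: exp_pos.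
have := Rabs_cos_le1 (t * y - ci u t); have := exp_pos (u * y - cr u t); nra.
Qed.

(** |z|^be is at least the mean of u^be and t^be: one half yields the decay in [u], the other keeps
    the integral over [t] convergent. *)
Lemma Fre_bound2 u t : 0 < u -> 0 < t ->
  Rabs (Fre u t) <= exp (u * y) * exp (- (k / 2) * Rpower u be) * exp (- (k / 2) * Rpower t be).
Proof.
move=> hu ht.
have hu0 := Rlt_le _ _ hu.
have h1 := Rpower_le_LN u ht.
have h2 : Rpower u be <= exp (LN u t) by apply: exp_LN_ge => //; have := pow2_ge_0 t; lra.
have hs : 0 < (Rpower u be + Rpower t be) / 2 by have := Rpower_pos u be; have := Rpower_pos t be; lra.
have hX := exp_X_le hu0 ht hs ltac:(lra).
rewrite Rmult_assoc -exp_plus.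
have <- : - k * ((Rpower u be + Rpower t be) / 2) = - (k / 2) * Rpower u be + - (k / 2) * Rpower t be by field.
rewrite /Fre Rabs_mult (Rabs_pos_eq (exp _)); last by left; exact: exp_pos.
have := Rabs_cos_le1 (t * y - ci u t); have := exp_pos (u * y - cr u t); nra.
Qed.

Lemma Fim_bound u t : 0 <= u -> 0 < t -> Rabs (Fim u t) <= exp (u * y) * exp (- k * Rpower t be).
Proof.
move=> hu ht; have hX := exp_X_le hu ht (Rpower_pos t be) (Rpower_le_LN u ht).
rewrite /Fim Rabs_mult (Rabs_pos_eq (exp _)); last by left; exact: exp_pos.
have := Rabs_sin_le1 (t * y - ci u t); have := exp_pos (u * y - cr u t); nra.
Qed.

Lemma Fim_small u t : 0 <= u -> 0 < t -> Rabs (Fim u t) <= exp (u * y) * (t * y + 4 * Rpower t be).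
Proof.
move=> hu ht; have hX := exp_X_le hu ht (Rpower_pos t be) (Rpower_le_LN u ht).
rewrite /Fim Rabs_mult (Rabs_pos_eq (exp _)); last by left; exact: exp_pos.
have hs := sin_le_abs (t * y - ci u t); have hc := ci_small hu ht.
have hty : 0 < t * y by exact: Rmult_lt_0_compat.
have h1 : Rabs (t * y - ci u t) <= t * y + 4 * Rpower t be.
  apply: Rle_trans (Rabs_triang _ _) _; rewrite Rabs_Ropp (Rabs_pos_eq (t * y)); lra.
have hk := stable_k_pos hbe; rewrite -/k in hk.
have hE : exp (- k * Rpower t be) <= 1.
  rewrite -exp_0; apply: exp_le_compat; have := Rpower_pos t be; nra.
have hE1 := exp_pos (u * y); have hE2 := exp_pos (u * y - cr u t); have h0 := Rabs_pos (sin (t * y - ci u t)).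
by apply: Rmult_le_compat; nra.
Qed.

Lemma Fre_0 t : 0 < t -> Fre 0 t = stable_re be y t.
Proof.
move=> ht; rewrite /Fre /stable_re /cr /ci.
have e1 : TH 0 t = PI * be / 2 by rewrite /TH /Rdiv Rmult_0_l atan_0; field.
have e2 : exp (LN 0 t) = Rpower t be.
  rewrite /LN /Rpower; congr exp.
  have -> : 0 ^ 2 + t ^ 2 = t * t by ring.
  by rewrite ln_mult //; field.
rewrite e1 e2 -/k; congr (exp _ * cos _); ring.
Qed.

(** On a finite segment [a,b] the mean value theorem in [u] bounds the change of the integral by
    [Fim] at the two ends, which is small for a near 0 and b large. *)
Lemma stable_int_shift u : 0 < u ->
  is_RInt_gen (V := R_CompleteNormedModule) (fun t => Fre u t) (at_right 0) (Rbar_locally p_infty) (stable_int be y).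
Proof.
move=> hu; have hu0 := Rlt_le _ _ hu.
have [K [hK hmaj]] := stable_majorant hbe (stable_k_pos hbe).
set C := exp (u * y) * K.
have hC : 0 <= C by left; apply: Rmult_lt_0_compat => //; exact: exp_pos.
have hcont v t : 0 < t -> continuous (fun t => Fre v t) t.
  by move=> ht; apply: (@ex_derive_continuous R_AbsRing R_NormedModule); exact: Fre_t_ex.
have hexp v : 0 <= v <= u -> exp (v * y) <= exp (u * y).
  by move=> hv; apply: exp_le_compat; nra.
have hdom v t : 0 <= v <= u -> 0 < t -> Rabs (Fre v t) <= C * hl_majorant 1 t.
  move=> hv ht; apply: Rle_trans (Fre_bound (proj1 hv) ht) _.
  rewrite /C Rmult_assoc; apply: Rmult_le_compat; try (left; exact: exp_pos); [exact: hexp | exact: hmaj].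
have [J [hJ [_ hJt]]] := @half_line_integral R_CompleteNormedModule (fun t => Fre u t) 1 C ltac:(lra) hC
  (fun t ht => @hcont u t ht) (fun t ht => hdom u t ltac:(lra) ht).
have [I0 [hI [_ hIt]]] := @half_line_integral R_CompleteNormedModule (fun t => Fre 0 t) 1 C ltac:(lra) hC
  (fun t ht => @hcont 0 t ht) (fun t ht => hdom 0 t ltac:(lra) ht).
have hI0 : is_RInt_gen (V := R_CompleteNormedModule) (fun t => Fre 0 t) (at_right 0) (Rbar_locally p_infty) (stable_int be y).
  refine (is_RInt_gen_ext (V := R_CompleteNormedModule) _ _ _ _ (@stable_int_correct be hbe y)).
  refine (Filter_prod _ _ _ _ _ hl_at_right hl_at_infty _) => a b ha hb x hx.
  rewrite Fre_0 //; apply: Rlt_trans (proj1 hx); exact: Rmin_pos.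
have eI : I0 = stable_int be y.
  have q1 := is_RInt_gen_unique (V := R_CompleteNormedModule) (fun t => Fre 0 t) _ hI.
  have q2 := is_RInt_gen_unique (V := R_CompleteNormedModule) (fun t => Fre 0 t) _ hI0.
  by rewrite -q1 q2.
suff e : J = stable_int be y by rewrite -e.
rewrite -eI.
set Q := exp (u * y).
have hQ : 0 < Q by exact: exp_pos.
(* Each of the two truncations to [a,b] costs 2 eta, and the shift by [u] costs 2 u eta. *)
suff h : forall eta, 0 < eta -> Rabs (J - I0) <= (4 + 2 * u) * eta.
  apply: Rminus_diag_uniq; apply: NNPP => hn.
  have h0 := Rabs_pos_lt _ hn.
  have := h (Rabs (J - I0) / (2 * (4 + 2 * u))) ltac:(apply: Rdiv_lt_0_compat; lra).
  have -> : (4 + 2 * u) * (Rabs (J - I0) / (2 * (4 + 2 * u))) = Rabs (J - I0) / 2 by field; lra.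
  lra.
move=> eta heta.
have near0 : at_right 0 (fun a => 0 < a /\ Rabs (C / 1 * hl_primitive 1 a - 0) < eta /\ Q * (a * y + 4 * Rpower a be) < eta).
  have n1 : at_right 0 (fun a => Rabs (C / 1 * hl_primitive 1 a - 0) < eta).
    by exact (proj1 (@filterlim_normP R R_NormedModule (at_right 0) _ _ 0) (@hl_lim0 1 C Rlt_0_1) eta heta).
  have [d [hd h]] := @Rpower_small be (eta / (2 * (4 * Q))) (proj1 hbe) ltac:(apply: Rdiv_lt_0_compat; lra).
  have hQy : 0 < Q * y by exact: Rmult_lt_0_compat.
  have hd2 : 0 < eta / (2 * (Q * y)) by apply: Rdiv_lt_0_compat; lra.
  have n2 : at_right 0 (fun a => Q * (a * y + 4 * Rpower a be) < eta).
    exists (mkposreal _ (Rmin_pos _ _ hd hd2)) => a ha ha0'.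
    have ha0 : 0 < a := ha0'.
    have ha' : Rabs (a - 0) < Rmin d (eta / (2 * (Q * y))) := ha.
    rewrite Rminus_0_r Rabs_pos_eq in ha'; last lra.
    have l1 := Rmin_l d (eta / (2 * (Q * y))); have l2 := Rmin_r d (eta / (2 * (Q * y))).
    have h1 := h a ltac:(lra).
    have h2 : 4 * Q * Rpower a be < 4 * Q * (eta / (2 * (4 * Q))) by apply: Rmult_lt_compat_l; lra.
    have h3 : Q * y * a < Q * y * (eta / (2 * (Q * y))) by apply: Rmult_lt_compat_l; lra.
    have e1 : 4 * Q * (eta / (2 * (4 * Q))) = eta / 2 by field; lra.
    have e2 : Q * y * (eta / (2 * (Q * y))) = eta / 2 by field; lra.
    rewrite e1 in h2; rewrite e2 in h3; lra.
  refine (filter_and _ _ hl_at_right (filter_and _ _ n1 n2)).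
have [a [ha [ha1 ha2]]] := filter_ex _ near0.
have nearI : Rbar_locally p_infty (fun b => 0 < b /\ Rabs (C / 1 * hl_primitive 1 b - C / 1) < eta /\ Q * exp (- k * Rpower b be) < eta).
  have n1 : Rbar_locally p_infty (fun b => Rabs (C / 1 * hl_primitive 1 b - C / 1) < eta).
    by exact (proj1 (@filterlim_normP R R_NormedModule (Rbar_locally p_infty) _ _ (C / 1)) (@hl_liminf 1 C) eta heta).
  have n2 : Rbar_locally p_infty (fun b => Q * exp (- k * Rpower b be) < eta).
    exists (Rmax 1 (Q * K / eta)) => b hb.
    have l1 := Rmax_l 1 (Q * K / eta); have l2 := Rmax_r 1 (Q * K / eta).
    have hb0 : 0 < b by lra.
    have h1 := hmaj b hb0; rewrite -/k in h1.
    have hmp : hl_majorant 1 b < / b.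
      rewrite /hl_majorant; have -> : 1 - 1 = 0 by ring.
      rewrite Rpower_O // /Rdiv Rmult_1_l; apply: Rinv_lt_contravar; last nra.
      by apply: Rmult_lt_0_compat => //; apply: pow_lt; lra.
    have hQK : 0 < Q * K by exact: Rmult_lt_0_compat.
    have h2 : Q * K * / b < eta.
      apply: (Rmult_lt_reg_r b) => //.
      have -> : Q * K * / b * b = Q * K / eta * eta by field; lra.
      by rewrite (Rmult_comm eta); apply: Rmult_lt_compat_r; lra.
    have h3 : Q * exp (- k * Rpower b be) <= Q * K * hl_majorant 1 b by rewrite Rmult_assoc; apply: Rmult_le_compat_l; lra.
    have h4 : Q * K * hl_majorant 1 b < Q * K * / b by exact: Rmult_lt_compat_l.
    lra.
  refine (filter_and _ _ hl_at_infty (filter_and _ _ n1 n2)).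
have [b [hb [hb1 hb2]]] := filter_ex _ nearI.
have hJab := hJt a b ha hb; have hIab := hIt a b ha hb.
change (Rabs (J - RInt (fun t => Fre u t) a b) <= Rabs (C / 1 * hl_primitive 1 a - 0) + Rabs (C / 1 * hl_primitive 1 b - C / 1)) in hJab.
change (Rabs (I0 - RInt (fun t => Fre 0 t) a b) <= Rabs (C / 1 * hl_primitive 1 a - 0) + Rabs (C / 1 * hl_primitive 1 b - C / 1)) in hIab.
have [c [hc hcu]] := MVT_abs (fun u => RInt (fun t => Fre u t) a b) (fun u => Fim u b - Fim u a) 0 u
  (fun c _ => proj1 (is_derive_Reals _ _ _) (strip_derive c ha hb)).
rewrite Rmin_left ?Rmax_right in hcu; try lra.
rewrite Rminus_0_r (Rabs_pos_eq u) // in hc.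
have hFb := Fim_bound (proj1 hcu) hb; have hFa := Fim_small (proj1 hcu) ha.
have hcQ := hexp c hcu; rewrite -/Q in hcQ.
have hEb := exp_pos (- k * Rpower b be); have hay : 0 < a * y by exact: Rmult_lt_0_compat.
have har := Rpower_pos a be.
have hFb2 : Rabs (Fim c b) <= eta by nra.
have hFa2 : Rabs (Fim c a) <= eta by nra.
have hdiff : Rabs (Fim c b - Fim c a) <= 2 * eta.
  by move: hFb2 hFa2; rewrite /Rabs; do 3 case: Rcase_abs; lra.
have hd : Rabs (RInt (fun t => Fre u t) a b - RInt (fun t => Fre 0 t) a b) <= 2 * eta * u.
  by rewrite hc; apply: Rmult_le_compat_r.
have tri (x1 x2 x3 x4 : R) : Rabs (x1 - x4) <= Rabs (x1 - x2) + Rabs (x2 - x3) + Rabs (x4 - x3).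
  by rewrite /Rabs; do 4 case: Rcase_abs; lra.
have := tri J (RInt (fun t => Fre u t) a b) (RInt (fun t => Fre 0 t) a b) I0.
lra.
Qed.

Lemma stable_int_shift_bound u K : 0 < u -> 0 < K ->
  (forall p, 0 < p -> exp (- (k / 2) * Rpower p be) <= K * hl_majorant 1 p) ->
  Rabs (stable_int be y) <= exp (u * y) * exp (- (k / 2) * Rpower u be) * K.
Proof.
move=> hu hK hmaj.
set C := exp (u * y) * exp (- (k / 2) * Rpower u be).
have hC : 0 < C by apply: Rmult_lt_0_compat; exact: exp_pos.
have [J [hJ [hn _]]] := @half_line_integral R_CompleteNormedModule (fun t => Fre u t) 1 (C * K) ltac:(lra)
  ltac:(left; exact: Rmult_lt_0_compat)
  ltac:(move=> t ht; apply: (@ex_derive_continuous R_AbsRing R_NormedModule); exact: Fre_t_ex)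
  ltac:(move=> t ht; apply: Rle_trans (Fre_bound2 hu ht) _; rewrite -/C Rmult_assoc;
    apply: Rmult_le_compat_l; [lra | exact: hmaj]).
have q1 := is_RInt_gen_unique (V := R_CompleteNormedModule) (fun t => Fre u t) _ hJ.
have q2 := is_RInt_gen_unique (V := R_CompleteNormedModule) (fun t => Fre u t) _ (@stable_int_shift u hu).
rewrite -q2 q1; apply: Rle_trans hn _; right; field.
Qed.

End Shift.

(** The shift u = 1/y keeps e^{uy} constant, while u^be = y^(-be) grows as y tends to 0; at y =
    x^(-1/be) this is exactly x. *)
Lemma stable_int_decay (be : R) : 0 < be < 1 -> exists C c, 0 < C /\ 0 < c /\ forall y, 0 < y ->
  Rabs (stable_int be y) <= C * exp (- c * Rpower y (- be)).
Proof.
move=> hbe.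
have hk := stable_k_pos hbe.
set k := cos (PI * be / 2) in hk.
have [K [hK hmaj]] := @stable_majorant be hbe (k / 2) ltac:(lra).
exists (exp 1 * K), (k / 2); split; first by apply: Rmult_lt_0_compat => //; exact: exp_pos.
split; first lra.
move=> y hy.
have hu : 0 < / y by exact: Rinv_0_lt_compat.
have h := stable_int_shift_bound hbe hy hu hK hmaj; rewrite -/k in h.
have e1 : / y * y = 1 by field; lra.
have e2 : Rpower (/ y) be = Rpower y (- be).
  by rewrite /Rpower ln_Rinv //; congr exp; ring.
rewrite e1 e2 in h; lra.
Qed.

(** Divided by [be], the density at time 1 of the inverse of a stable subordinator, also known as
    the M-Wright function. *)
Definition ml_weight (be x : R) : R := Rpower x (- 1 - / be) * G_beta be 1 (Rpower x (- / be)).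

Lemma ml_weight_bound (be : R) : 0 < be < 1 -> exists C c, 0 < C /\ 0 < c /\ forall x, 0 < x ->
  Rabs (ml_weight be x) <= C * Rpower x (- / 2) * exp (- c * x).
Proof.
move=> hbe.
have [C1 [hC1 h1]] := stable_int_large hbe.
have [C2 [c [hC2 [hc h2]]]] := stable_int_decay hbe.
have hPI := PI_RGT_0; have hPi := Rinv_0_lt_compat _ hPI.
have hbi : 1 < / be by rewrite -Rinv_1; apply: Rinv_lt_contravar; lra.
exists (/ PI * (C1 * exp c + C2)), c; split.
  apply: Rmult_lt_0_compat => //; apply: Rplus_lt_0_compat => //; apply: Rmult_lt_0_compat => //; exact: exp_pos.
split=> // x hx.
set y := Rpower x (- / be).
have hy : 0 < y by exact: Rpower_pos.
have hr := Rpower_pos x (- 1 - / be); have hr2 := Rpower_pos x (- / 2).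
have hE := exp_pos (- c * x); have hEc := exp_pos c.
have e0 : Rabs (ml_weight be x) = / PI * (Rpower x (- 1 - / be) * Rabs (stable_int be y)).
  rewrite /ml_weight (G_beta_stable_int hbe) -/y !Rabs_mult (Rabs_pos_eq (/ PI)) ?(Rabs_pos_eq (Rpower _ _)); try lra.
rewrite e0.
have -> : / PI * (C1 * exp c + C2) * Rpower x (- / 2) * exp (- c * x) =
  / PI * ((C1 * exp c + C2) * Rpower x (- / 2) * exp (- c * x)) by ring.
apply: Rmult_le_compat_l; first lra.
(* For x <= 1 the bound at large y applies, and the exponents of x add up to -1/2; the constant exp
   c compensates the missing exponential. For x > 1 the decay of [stable_int] at small y is used. *)
case: (Rle_dec x 1) => hx1.
- have e1 : Rpower x (- 1 - / be) * Rpower y (- 1 - be / 2) = Rpower x (- / 2).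
    rewrite /y Rpower_mult -Rpower_plus; congr Rpower; field; lra.
  have h3 : Rpower x (- 1 - / be) * Rabs (stable_int be y) <= C1 * Rpower x (- / 2).
    rewrite -e1; have := Rmult_le_compat_l _ _ _ (Rlt_le _ _ hr) (h1 y hy); lra.
  have h4 : 1 <= exp c * exp (- c * x) by rewrite -exp_plus -exp_0; apply: exp_le_compat; nra.
  have h5 : C1 * Rpower x (- / 2) * 1 <= C1 * Rpower x (- / 2) * (exp c * exp (- c * x)).
    by apply: Rmult_le_compat_l => //; apply: Rmult_le_pos; lra.
  have h6 : 0 <= C2 * Rpower x (- / 2) * exp (- c * x).
    by apply: Rmult_le_pos; [apply: Rmult_le_pos; lra | lra].
  lra.
- have e1 : Rpower y (- be) = x.
    rewrite /y Rpower_mult; have -> : - / be * - be = 1 by field; lra.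
    exact: Rpower_1.
  have h3 := h2 y hy; rewrite e1 in h3.
  have h4 : Rpower x (- 1 - / be) <= Rpower x (- / 2) by apply: Rle_Rpower; lra.
  have h5 : Rpower x (- 1 - / be) * Rabs (stable_int be y) <= Rpower x (- / 2) * (C2 * exp (- c * x)).
    by apply: Rmult_le_compat; [lra | exact: Rabs_pos | lra | lra].
  have h6 : 0 <= C1 * exp c * Rpower x (- / 2) * exp (- c * x).
    by do 3 (apply: Rmult_le_pos; last lra); lra.
  lra.
Qed.

Lemma ml_weight_cont (be x : R) : 0 < be < 1 -> 0 < x -> continuous (ml_weight be) x.
Proof.
move=> hbe hx.
apply: (continuous_ext (fun x => mult (Rpower x (- 1 - / be)) (mult (/ PI) (stable_int be (Rpower x (- / be)))))).
  by move=> z; rewrite /ml_weight (G_beta_stable_int hbe).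
apply: (@continuous_mult R_UniformSpace R_AbsRing); first exact: continuous_Rpower.
apply: (@continuous_mult R_UniformSpace R_AbsRing); first exact: continuous_const.
apply: (continuous_comp (fun z => Rpower z (- / be)) (stable_int be)); first exact: continuous_Rpower.
exact: stable_int_cont.
Qed.

(** * Mittag-Leffler operators *)

Lemma smoothing_kernel_restrict (B B1 : Banach) (i1 : B1 -> B) (U : R -> B -> B) (U1 : R -> B -> B1) (K om L0 L0' : R) :
  L0' <= L0 -> smoothing_kernel i1 U U1 K om L0 -> smoothing_kernel i1 U U1 K om L0'.
Proof.
move=> hL hk; split.
- exact: sk_K hk.
- exact: sk_om hk.
- by move=> t x ht; apply: (sk_lift hk); lra.
- by move=> t x y ht; apply: (sk_minus hk); lra.
- by move=> t x ht; apply: (sk_bound hk); lra.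
- by move=> t x ht; apply: (sk_cont hk); lra.
Qed.

Lemma continuous_scal2 (V : NormedModule R_AbsRing) (f : R -> R) (g : R -> V) (x : R) :
  continuous f x -> continuous g x -> continuous (fun x => scal (f x) (g x)) x.
Proof. by move=> hf hg; exact: (@continuous_scal R_UniformSpace R_AbsRing V f g x hf hg). Qed.

Lemma pow0_gt0 (x r : R) : 0 < x -> pow0 x r = Rpower x r.
Proof. by move=> hx; rewrite /pow0; case: Rlt_dec. Qed.

Definition ml_weight' (be x : R) : R := Rpower x (- / be) * G_beta be 1 (Rpower x (- / be)).

Lemma ml_weight'E (be x : R) : 0 < x -> ml_weight' be x = x * ml_weight be x.
Proof.
move=> hx; rewrite /ml_weight' /ml_weight -Rmult_assoc; congr (_ * _).
by rewrite -{2}(Rpower_1 x) // -Rpower_plus; congr Rpower; ring.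
Qed.

Section Fractional.
Context (be : R) (hbe : 0 < be < 1).
Context (B B1 : Banach) (i1 : B1 -> B) (S : R -> B -> B) (K w om : R).
Context (hi1 : is_linear i1) (hinj : forall x y, i1 x = i1 y -> x = y).
Context (hs : smoothing_semigroup i1 S K w om).

Let lft := lift i1 S.

Lemma ml_weight'_cont (x : R) : 0 < x -> continuous (ml_weight' be) x.
Proof.
move=> hx; apply/continuous_normP => eps he.
have hc : continuous (T := R_UniformSpace) (U := R_UniformSpace) (fun z : R => z * ml_weight be z) x.
  exact (@continuous_scal2 R_NormedModule (fun z => z) (ml_weight be) x (continuous_id x) (ml_weight_cont hbe hx)).
have [d [hd h]] := proj1 (@continuous_normP R_NormedModule _ _) hc eps he.
exists (Rmin d x); split; first exact: Rmin_pos.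
move=> x' hx'; have l1 := Rmin_l d x; have l2 := Rmin_r d x.
have hx0 : 0 < x' by move: hx'; rewrite /Rabs; case: Rcase_abs; lra.
rewrite !ml_weight'E //; apply: h; lra.
Qed.

(* The exponential growth of the semigroup is absorbed by the decay of the weight when [tau] is small. *)
Lemma ml_majorants : exists taum Q, 0 < taum /\ 0 < Q /\ forall tau x, 0 <= tau <= taum -> 0 < x ->
  Rabs (ml_weight be x) * exp (w * (tau * x)) <= Q * hl_majorant (/ 2) x /\
  Rabs (ml_weight' be x) * Rpower x (- om) * exp (w * (tau * x)) <= Q * hl_majorant (/ 2) x.
Proof.
have [C [c [hC [hc h]]]] := ml_weight_bound hbe.
have hw := ss_w hs; have hom := ss_om hs.
have [Kq [hKq hq]] := @stretched_majorant 1 (c / 2) 1 (/ 2) Rlt_0_1 ltac:(lra) ltac:(lra).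
(* For these [tau] one has w tau <= c/2, which leaves half of the decay rate; the [+ 1] allows w =
   0. *)
have htm : 0 < c / (2 * (w + 1)) by apply: Rdiv_lt_0_compat; lra.
exists (c / (2 * (w + 1))), (C * Kq); split=> //; split; first exact: Rmult_lt_0_compat.
move=> tau x ht hx.
have h0 := h x hx; have h1 := hq x hx.
rewrite !Rpower_1 in h1; try lra.
have e12 : / 2 - 1 = - / 2 by field.
rewrite e12 in h1.
have hwt : w * tau <= c / 2.
  apply: (Rle_trans _ (w * (c / (2 * (w + 1))))); first by apply: Rmult_le_compat_l; lra.
  have -> : c / 2 = (w + 1) * (c / (2 * (w + 1))) by field; lra.
  by apply: Rmult_le_compat_r; lra.
have hE : exp (- c * x) * exp (w * (tau * x)) <= exp (- (c / 2) * x).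
  by rewrite -exp_plus; apply: exp_le_compat; nra.
have hr := Rpower_pos x (- / 2); have hE0 := exp_pos (- (c / 2) * x); have hE1 := exp_pos (w * (tau * x)).
have hb : Rabs (ml_weight be x) * exp (w * (tau * x)) <= C * (Rpower x (- / 2) * exp (- (c / 2) * x)).
  apply: (Rle_trans _ (C * Rpower x (- / 2) * exp (- c * x) * exp (w * (tau * x)))).
    by apply: Rmult_le_compat_r; lra.
  have := Rmult_le_compat_l _ _ _ (Rmult_le_pos _ _ (Rlt_le _ _ hC) (Rlt_le _ _ hr)) hE; lra.
have hm : Rpower x (- / 2) * (1 + x) * exp (- (c / 2) * x) = Rpower x (- / 2) * exp (- (c / 2) * x) * (1 + x) by ring.
have hRE : 0 < Rpower x (- / 2) * exp (- (c / 2) * x) by exact: Rmult_lt_0_compat.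
have hfin : C * (Rpower x (- / 2) * exp (- (c / 2) * x)) * (1 + x) <= C * Kq * hl_majorant (/ 2) x.
  have := Rmult_le_compat_l _ _ _ (Rlt_le _ _ hC) h1; rewrite hm; lra.
split.
- apply: Rle_trans hb _; apply: Rle_trans hfin.
  have := Rmult_lt_0_compat _ _ hC hRE; nra.
- rewrite ml_weight'E // Rabs_mult (Rabs_pos_eq x); last lra.
  have -> : x * Rabs (ml_weight be x) * Rpower x (- om) * exp (w * (tau * x)) =
     (Rabs (ml_weight be x) * exp (w * (tau * x))) * (x * Rpower x (- om)) by ring.
  apply: Rle_trans hfin; apply: Rmult_le_compat => //.
  + by apply: Rmult_le_pos; [exact: Rabs_pos | lra].
  + by apply: Rmult_le_pos; [lra | left; exact: Rpower_pos].
  + have -> : x * Rpower x (- om) = Rpower x (1 - om).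
      by rewrite -{1}(Rpower_1 x) // -Rpower_plus.
    apply: (Rle_trans _ (Rpower (1 + x) (1 - om))); first by apply: Rle_Rpower_l; lra.
    have hx1 : 0 < 1 + x by lra.
    by rewrite -{2}(Rpower_1 (1 + x)) //; apply: Rle_Rpower; lra.
Qed.

(** Integrated in [B1] from the start: the singularity (tau z)^(-om) of the lift splits into the
    bound tau^(-om) and a factor z^(-om), integrable against the weight. *)
Definition ml_lift' (tau : R) (x : B) : B1 :=
  RInt_gen (fun z => scal (ml_weight' be z) (lft (tau * z) x)) (at_right 0) (Rbar_locally p_infty).

Context (taum Q : R) (htaum : 0 < taum) (hQ : 0 < Q).
Context (hmaj : forall tau x, 0 <= tau <= taum -> 0 < x ->
  Rabs (ml_weight be x) * exp (w * (tau * x)) <= Q * hl_majorant (/ 2) x /\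
  Rabs (ml_weight' be x) * Rpower x (- om) * exp (w * (tau * x)) <= Q * hl_majorant (/ 2) x).

Lemma lift_mul_cont tau x z : 0 < tau -> 0 < z -> continuous (fun z => lft (tau * z) x) z.
Proof.
move=> ht hz; apply: (continuous_comp (fun z => tau * z) (fun t => lft t x)).
- exact: (@continuous_scal_r _ R_AbsRing R_NormedModule tau (fun z => z) z (continuous_id z)).
- by apply: (lift_continuous hi1 hinj hs); exact: Rmult_lt_0_compat.
Qed.

Lemma ml_integrand'_bound tau x z : 0 < tau <= taum -> 0 < z ->
  norm (scal (ml_weight' be z) (lft (tau * z) x)) <= K * Rpower tau (- om) * norm x * Q * hl_majorant (/ 2) z.
Proof.
move=> ht hz; rewrite norm_scal_R.
have htz : 0 < tau * z by apply: Rmult_lt_0_compat; lra.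
have [_ h1] := lift_spec hinj hs x htz.
have [_ h2] := hmaj (tau := tau) (x := z) ltac:(lra) hz.
have hx := norm_ge_0 x; have hK := ss_K hs; have hr := Rpower_pos tau (- om).
apply: (Rle_trans _ (Rabs (ml_weight' be z) * (K * Rpower (tau * z) (- om) * exp (w * (tau * z)) * norm x))).
  by apply: Rmult_le_compat_l; [exact: Rabs_pos | exact: h1].
rewrite -Rpower_mult_distr //; last lra.
have -> : Rabs (ml_weight' be z) * (K * (Rpower tau (- om) * Rpower z (- om)) * exp (w * (tau * z)) * norm x) =
  K * Rpower tau (- om) * norm x * (Rabs (ml_weight' be z) * Rpower z (- om) * exp (w * (tau * z))) by ring.
rewrite (Rmult_assoc _ Q); apply: Rmult_le_compat_l => //.
by apply: Rmult_le_pos => //; apply: Rmult_le_pos; lra.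
Qed.

Lemma ml_integrand'_cont tau x z : 0 < tau -> 0 < z -> continuous (fun z => scal (ml_weight' be z) (lft (tau * z) x)) z.
Proof. by move=> ht hz; apply: continuous_scal2; [exact: ml_weight'_cont | exact: lift_mul_cont]. Qed.

Lemma KQ_ge0 tau (x : B) : 0 <= K * Rpower tau (- om) * norm x * Q.
Proof.
have hx := norm_ge_0 x; have hK := ss_K hs; have hr := Rpower_pos tau (- om).
by apply: Rmult_le_pos; [apply: Rmult_le_pos => //; apply: Rmult_le_pos; lra | lra].
Qed.

Lemma ml_lift'_spec tau x : 0 < tau <= taum ->
  is_RInt_gen (fun z => scal (ml_weight' be z) (lft (tau * z) x)) (at_right 0) (Rbar_locally p_infty) (ml_lift' tau x) /\
  norm (ml_lift' tau x) <= 2 * K * Q * Rpower tau (- om) * norm x.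
Proof.
move=> ht.
have [v [hv [hn _]]] := @half_line_integral B1 (fun z => scal (ml_weight' be z) (lft (tau * z) x)) (/ 2)
  (K * Rpower tau (- om) * norm x * Q) ltac:(lra) (KQ_ge0 tau x)
  (fun z hz => @ml_integrand'_cont tau x z (proj1 ht) hz) (fun z hz => @ml_integrand'_bound tau x z ht hz).
have e : ml_lift' tau x = v by exact (is_RInt_gen_unique _ _ hv).
rewrite e; split=> //; apply: Rle_trans hn _; right; field.
Qed.

Lemma ml_lift'_i1 tau x : 0 < tau <= taum -> i1 (scal (/ be) (ml_lift' tau x)) = ML' be S tau x.
Proof.
move=> ht; rewrite (linear_scal _ hi1) /ML'; congr scal; symmetry.
have [h _] := ml_lift'_spec x ht.
apply: (half_line_RInt_gen_eq (is_RInt_gen_linear hi1 h)) => z hz.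
rewrite (linear_scal _ hi1); congr scal.
by apply: (proj1 (lift_spec hinj hs x _)); apply: Rmult_lt_0_compat; lra.
Qed.

Lemma ml_lift'_minus tau x y : 0 < tau <= taum ->
  ml_lift' tau (minus x y) = minus (ml_lift' tau x) (ml_lift' tau y).
Proof.
move=> ht; have [h1 _] := ml_lift'_spec x ht; have [h2 _] := ml_lift'_spec y ht.
apply: (half_line_RInt_gen_eq (is_RInt_gen_minus _ _ _ _ h1 h2)) => z hz.
rewrite /lft (lift_minus hi1 hinj hs); last by apply: Rmult_lt_0_compat; lra.
by rewrite scal_minus.
Qed.

Lemma ml_lift'_cont tau x : 0 < tau < taum -> continuous (fun t => ml_lift' t x) tau.
Proof.
move=> ht.
(* On times above tau/2 the singular bound is uniform, which gives a common majorant near [tau]. *)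
set C := K * Rpower (tau / 2) (- om) * norm x * Q.
have hC : 0 <= C by exact: KQ_ge0.
have hd : 0 < Rmin (tau / 2) (taum - tau) by apply: Rmin_pos; lra.
have l1 := Rmin_l (tau / 2) (taum - tau); have l2 := Rmin_r (tau / 2) (taum - tau).
have hnear : locally tau (fun t => tau / 2 < t <= taum).
  exists (mkposreal _ hd) => t ht'.
  have h : Rabs (t - tau) < Rmin (tau / 2) (taum - tau) := ht'.
  by move: h; rewrite /Rabs; case: Rcase_abs; lra.
have hdom t z : tau / 2 <= t <= taum -> 0 < z -> continuous (fun z => scal (ml_weight' be z) (lft (t * z) x)) z /\
    norm (scal (ml_weight' be z) (lft (t * z) x)) <= C * hl_majorant (/ 2) z.
  move=> ht' hz; split; first by apply: ml_integrand'_cont => //; lra.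
  apply: Rle_trans (@ml_integrand'_bound t x z ltac:(lra) hz) _.
  apply: Rmult_le_compat_r.
    rewrite /hl_majorant; apply: Rmult_le_pos; first by left; exact: Rpower_pos.
    by left; apply: Rinv_0_lt_compat; apply: pow_lt; lra.
  rewrite /C; apply: Rmult_le_compat_r; first lra.
  apply: Rmult_le_compat_r; first exact: norm_ge_0.
  apply: Rmult_le_compat_l; first by left; exact: ss_K hs.
  rewrite /Rpower; apply: exp_le_compat.
  have : ln (tau / 2) <= ln t by apply: ln_le; lra.
  have := ss_om hs; nra.
apply: (@half_line_integral_lim B1 R (locally tau) _ (fun t z => scal (ml_weight' be z) (lft (t * z) x))
  (fun z => scal (ml_weight' be z) (lft (tau * z) x)) (/ 2) C (fun t => ml_lift' t x) (ml_lift' tau x)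
  ltac:(lra) hC).
- by move=> z hz; apply: hdom => //; lra.
- refine (filter_mono _ hnear _) => t ht' z hz; apply: hdom => //; lra.
- move=> a b eps ha hb he.
  set lo := tau / 2 * a; set hi := taum * b.
  have hlo : 0 < lo by apply: Rmult_lt_0_compat; lra.
  case: (Rle_dec a b) => hab; last by apply: filter_forall => t z hz; lra.
  have hlh : lo <= hi by rewrite /lo /hi; nra.
  have hCu : Ccurve lo hi (fun t => lft t x).
    by apply: Ccurve_of_continuous => t ht'; apply: (lift_continuous hi1 hinj hs); lra.
  have hWc : Ccurve (B := R_CompleteNormedModule) a b (ml_weight' be).
    by apply: Ccurve_of_continuous => z hz; apply: ml_weight'_cont; lra.
  have [mx [_ hmx]] := Ccurve_max hab hWc.
  set M := norm (V := R_NormedModule) (ml_weight' be mx).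
  have hM : 0 <= M by exact: norm_ge_0.
  have [d [hd0 hu]] := Ccurve_unif hlh hCu (eps := eps / (M + 1)) ltac:(apply: Rdiv_lt_0_compat; lra).
  have hdb : 0 < d / b by exact: Rdiv_lt_0_compat.
  have hn2 : locally tau (fun t => Rabs (t - tau) < d / b) by exists (mkposreal _ hdb).
  refine (filter_mono _ (filter_and _ _ hnear hn2) _) => t [ht1 ht2] z hz.
  rewrite -scal_minus norm_scal_R.
  have h1 : norm (minus (lft (t * z) x) (lft (tau * z) x)) <= eps / (M + 1).
    apply: hu.
    - by rewrite /lo /hi; split; apply: Rmult_le_compat; lra.
    - by rewrite /lo /hi; split; apply: Rmult_le_compat; lra.
    - have -> : t * z - tau * z = (t - tau) * z by ring.
      rewrite Rabs_mult (Rabs_pos_eq z); last lra.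
      apply: (Rle_lt_trans _ (Rabs (t - tau) * b)).
        by apply: Rmult_le_compat_l; [exact: Rabs_pos | lra].
      have -> : d = d / b * b by field; lra.
      by apply: Rmult_lt_compat_r.
  have h2 : Rabs (ml_weight' be z) <= M := hmx z hz.
  apply: (Rle_trans _ (M * (eps / (M + 1)))).
    by apply: Rmult_le_compat => //; [exact: Rabs_pos | exact: norm_ge_0].
  have h3 : 0 < eps / (M + 1) by apply: Rdiv_lt_0_compat; lra.
  have h4 : (M + 1) * (eps / (M + 1)) = eps by field; lra.
  lra.
- refine (filter_mono _ hnear _) => t ht'; apply: (proj1 (ml_lift'_spec x _)); lra.
- by apply: (proj1 (ml_lift'_spec x _)); lra.
Qed.

(** [frac_U] copies the integrand in the definition of a fractional mild solution, so that the two
    agree by conversion; for r > 0, [pow0] is the power used in [frac_U1]. *)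
Definition frac_U (r : R) (x : B) : B := scal (Rpower r (be - 1)) (ML' be S (pow0 r be) x).
Definition frac_U1 (r : R) (x : B) : B1 := scal (Rpower r (be - 1)) (scal (/ be) (ml_lift' (Rpower r be) x)).

Let Lm := Rpower taum (/ be).

Lemma frac_range r : 0 < r < Lm -> 0 < Rpower r be < taum.
Proof.
move=> hr; split; first exact: Rpower_pos.
have -> : taum = Rpower Lm be by rewrite /Lm Rpower_mult Rinv_l ?Rpower_1 //; lra.
by apply: Rlt_Rpower_l; lra.
Qed.

(** The exponent is that of r^(be-1) (r^be)^(-om), and 1 - be + be om < 1 precisely because om <
    1. *)
Lemma frac_kernel : smoothing_kernel i1 frac_U frac_U1 (/ be * (2 * K * Q)) (1 - be + be * om) Lm.
Proof.
have hK := ss_K hs; have hom := ss_om hs.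
have hbi : 0 < / be by apply: Rinv_0_lt_compat; lra.
split.
- by apply: Rmult_lt_0_compat => //; apply: Rmult_lt_0_compat; lra.
- split; nra.
- move=> t x ht; have hr := frac_range ht.
  rewrite /frac_U1 (linear_scal _ hi1) ml_lift'_i1; last lra.
  by rewrite /frac_U pow0_gt0 //; lra.
- move=> t x y ht; have hr := frac_range ht.
  by rewrite /frac_U1 ml_lift'_minus ?scal_minus //; lra.
- move=> t x ht; have hr := frac_range ht.
  have [_ hn] := ml_lift'_spec x (tau := Rpower t be) ltac:(lra).
  rewrite /frac_U1 !norm_scal_R (Rabs_pos_eq (/ be)) ?(Rabs_pos_eq (Rpower _ _)); try lra; last by left; exact: Rpower_pos.
  have e : Rpower t (- (1 - be + be * om)) = Rpower t (be - 1) * Rpower (Rpower t be) (- om).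
    by rewrite Rpower_mult -Rpower_plus; congr Rpower; ring.
  rewrite e.
  have hr1 := Rpower_pos t (be - 1).
  apply: (Rle_trans _ (Rpower t (be - 1) * (/ be * (2 * K * Q * Rpower (Rpower t be) (- om) * norm x)))).
    apply: Rmult_le_compat_l; first lra.
    by apply: Rmult_le_compat_l; lra.
  by right; ring.
- move=> t x ht; have hr := frac_range ht.
  apply: continuous_scal2; first by apply: continuous_Rpower; lra.
  apply: continuous_scal2; first exact: continuous_const.
  apply: (continuous_comp (fun r => Rpower r be) (fun s => ml_lift' s x)).
  + by apply: continuous_Rpower; lra.
  + exact: ml_lift'_cont.
Qed.

(** Acting on [B1], where the semigroup is bounded near 0, this integral makes sense up to and
    including [tau = 0]. *)
Definition ml_lift (tau : R) (b : B1) : B1 :=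
  RInt_gen (fun z => scal (ml_weight be z) (lft (tau * z) (i1 b))) (at_right 0) (Rbar_locally p_infty).

Lemma ml_integrand_dom tau b z : 0 <= tau <= taum -> 0 < z ->
  continuous (fun z => scal (ml_weight be z) (lft (tau * z) (i1 b))) z /\
  norm (scal (ml_weight be z) (lft (tau * z) (i1 b))) <= K * norm b * Q * hl_majorant (/ 2) z.
Proof.
move=> ht hz; split.
  apply: continuous_scal2; first exact: ml_weight_cont.
  case: (Req_dec tau 0) => h0; last by apply: lift_mul_cont; lra.
  apply: (continuous_ext (fun _ => lft 0 (i1 b))); last exact: continuous_const.
  by move=> z'; rewrite h0 Rmult_0_l.
rewrite norm_scal_R.
have htz : 0 <= tau * z by apply: Rmult_le_pos; lra.
have [_ h1] := lift_restr_spec hinj hs b htz.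
have [h2 _] := hmaj ht hz.
have hb := norm_ge_0 b; have hK := ss_K hs.
apply: (Rle_trans _ (Rabs (ml_weight be z) * (K * exp (w * (tau * z)) * norm b))).
  by apply: Rmult_le_compat_l; [exact: Rabs_pos | exact: h1].
have -> : Rabs (ml_weight be z) * (K * exp (w * (tau * z)) * norm b) =
  K * norm b * (Rabs (ml_weight be z) * exp (w * (tau * z))) by ring.
rewrite (Rmult_assoc _ Q); apply: Rmult_le_compat_l => //.
by apply: Rmult_le_pos; lra.
Qed.

Lemma KbQ_ge0 (b : B1) : 0 <= K * norm b * Q.
Proof.
have hb := norm_ge_0 b; have hK := ss_K hs.
by apply: Rmult_le_pos; [apply: Rmult_le_pos; lra | lra].
Qed.

Lemma ml_lift_spec tau b : 0 <= tau <= taum ->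
  is_RInt_gen (fun z => scal (ml_weight be z) (lft (tau * z) (i1 b))) (at_right 0) (Rbar_locally p_infty) (ml_lift tau b).
Proof.
move=> ht.
have [v [hv _]] := @half_line_integral B1 (fun z => scal (ml_weight be z) (lft (tau * z) (i1 b))) (/ 2)
  (K * norm b * Q) ltac:(lra) (KbQ_ge0 b) (fun z hz => proj1 (ml_integrand_dom b ht hz))
  (fun z hz => proj2 (ml_integrand_dom b ht hz)).
have e : ml_lift tau b = v by exact (is_RInt_gen_unique _ _ hv).
by rewrite e.
Qed.

Lemma ml_lift_i1 tau b : 0 <= tau <= taum -> i1 (scal (/ be) (ml_lift tau b)) = ML be S tau (i1 b).
Proof.
move=> ht; rewrite (linear_scal _ hi1) /ML; congr scal; symmetry.
have h := @ml_lift_spec tau b ht.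
apply: (half_line_RInt_gen_eq (is_RInt_gen_linear hi1 h)) => z hz.
rewrite (linear_scal _ hi1); congr scal.
by apply: (proj1 (lift_restr_spec hinj hs b _)); apply: Rmult_le_pos; lra.
Qed.

Lemma ml_lift_Ccurve b : Ccurve 0 taum (fun tau => ml_lift tau b).
Proof.
move=> tau ht.
have hin : within (fun t => 0 <= t <= taum) (locally tau) (fun t => 0 <= t <= taum).
  by exists (mkposreal 1 Rlt_0_1) => t _ h.
apply: (@half_line_integral_lim B1 R (within (fun t => 0 <= t <= taum) (locally tau)) _
  (fun t z => scal (ml_weight be z) (lft (t * z) (i1 b)))
  (fun z => scal (ml_weight be z) (lft (tau * z) (i1 b))) (/ 2) (K * norm b * Q) (fun t => ml_lift t b) (ml_lift tau b)
  ltac:(lra) (KbQ_ge0 b)).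
- by move=> z hz; exact: ml_integrand_dom.
- by refine (filter_mono _ hin _) => t ht' z hz; exact: ml_integrand_dom.
- move=> a c eps ha hc he.
  case: (Rle_dec a c) => hac; last by apply: filter_forall => t z hz; lra.
  have hWc : Ccurve (B := R_CompleteNormedModule) a c (ml_weight be).
    by apply: Ccurve_of_continuous => z hz; apply: ml_weight_cont => //; lra.
  have [mx [_ hmx]] := Ccurve_max hac hWc.
  set M := norm (V := R_NormedModule) (ml_weight be mx).
  have hM : 0 <= M by exact: norm_ge_0.
  have hhi : 0 <= taum * c by apply: Rmult_le_pos; lra.
  have [d [hd0 hu]] := Ccurve_unif hhi (@lift_Ccurve B B1 i1 S K w om hi1 hinj hs b (taum * c)) (eps := eps / (M + 1)) ltac:(apply: Rdiv_lt_0_compat; lra).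
  have hdb : 0 < d / c by exact: Rdiv_lt_0_compat.
  exists (mkposreal _ hdb) => t htb ht1 z hz.
  have ht2 : Rabs (t - tau) < d / c := htb.
  rewrite -scal_minus norm_scal_R.
  have h1 : norm (minus (lft (t * z) (i1 b)) (lft (tau * z) (i1 b))) <= eps / (M + 1).
    apply: hu.
    - by split; [apply: Rmult_le_pos; lra | apply: Rmult_le_compat; lra].
    - by split; [apply: Rmult_le_pos; lra | apply: Rmult_le_compat; lra].
    - have -> : t * z - tau * z = (t - tau) * z by ring.
      rewrite Rabs_mult (Rabs_pos_eq z); last lra.
      apply: (Rle_lt_trans _ (Rabs (t - tau) * c)).
        by apply: Rmult_le_compat_l; [exact: Rabs_pos | lra].
      have -> : d = d / c * c by field; lra.
      by apply: Rmult_lt_compat_r.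
  have h2 : Rabs (ml_weight be z) <= M := hmx z hz.
  apply: (Rle_trans _ (M * (eps / (M + 1)))).
    by apply: Rmult_le_compat => //; [exact: Rabs_pos | exact: norm_ge_0].
  have h3 : 0 < eps / (M + 1) by apply: Rdiv_lt_0_compat; lra.
  have h4 : (M + 1) * (eps / (M + 1)) = eps by field; lra.
  lra.
- by refine (filter_mono _ hin _) => t ht'; exact: ml_lift_spec.
- exact: ml_lift_spec.
Qed.

Lemma pow0_range t : 0 <= t <= Lm -> 0 <= pow0 t be <= taum.
Proof.
move=> ht; rewrite /pow0; case: Rlt_dec => h0 /=; last lra.
split; first by left; exact: Rpower_pos.
have -> : taum = Rpower Lm be by rewrite /Lm Rpower_mult Rinv_l ?Rpower_1 //; lra.
by apply: Rle_Rpower_l; lra.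
Qed.

Lemma frac_curve b L : 0 <= L <= Lm ->
  Ccurve 0 L (fun t => scal (/ be) (ml_lift (pow0 t be) b)).
Proof.
move=> hL; apply/CcurveP => t ht eps he.
have hbi : 0 < / be by apply: Rinv_0_lt_compat; lra.
have [d [hd h]] := proj1 (CcurveP _ _ _) (@ml_lift_Ccurve b) (pow0 t be) (@pow0_range t ltac:(lra)) (eps * be) ltac:(apply: Rmult_lt_0_compat; lra).
have [d' [hd' h']] : exists d', 0 < d' /\ forall t', 0 <= t' <= L -> Rabs (t' - t) < d' -> Rabs (pow0 t' be - pow0 t be) < d.
  case: (Rlt_dec 0 t) => h0.
  - have [e [he0 hc]] := proj1 (@continuous_normP R_NormedModule _ _) (continuous_Rpower (s := be) h0) d hd.
    exists (Rmin e t); split; first exact: Rmin_pos.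
    move=> t' ht' hlt; have l1 := Rmin_l e t; have l2 := Rmin_r e t.
    have h1 : 0 < t' by move: hlt; rewrite /Rabs; case: Rcase_abs; lra.
    by rewrite !pow0_gt0 //; apply: hc; lra.
  - have t0 : t = 0 by lra.
    have [e [he0 hc]] := @Rpower_small be d (proj1 hbe) hd.
    exists e; split=> // t' ht' hlt.
    rewrite t0 Rminus_0_r Rabs_pos_eq in hlt; last lra.
    have -> : pow0 t be = 0 by rewrite /pow0; case: Rlt_dec.
    rewrite Rminus_0_r /pow0; case: Rlt_dec => h1 /=; last by rewrite Rabs_R0.
    rewrite Rabs_pos_eq; last by left; exact: Rpower_pos.
    by apply: hc.
exists d'; split=> // t' ht' hlt.
rewrite -scal_minus norm_scal_R Rabs_pos_eq; last lra.
have := h _ (pow0_range (t := t') ltac:(lra)) (h' t' ht' hlt) => h1.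
have -> : eps = / be * (eps * be) by field; lra.
by apply: Rmult_lt_compat_l.
Qed.

End Fractional.

(** * The nonlinear system *)

Lemma is_RInt_gen_at_left (V : Banach) (g : R -> V) (a t : R) : a < t ->
  (forall s, a <= s <= t -> continuous g s) -> is_RInt_gen g (at_point a) (at_left t) (RInt g a t).
Proof.
move=> hat hg.
have hC : Ccurve a t g by exact: Ccurve_of_continuous.
have [m [_ hm]] := Ccurve_max (Rlt_le _ _ hat) hC.
set M := norm (g m) in hm.
have hd : 0 < t - a by lra.
have hder x : a <= x <= t -> is_derive (fun x => M * x) x M.
  by move=> _; auto_derive => //; ring.
have hlim x (P : R -> Prop) : locally (M * x) P -> locally x (fun y => P (M * y)).
  by move=> hP; apply: (@continuous_scal_r _ R_AbsRing R_NormedModule M (fun z => z) x (continuous_id x)).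
have [v [hv [_ hvn]]] := @singular_integral V (fun s => a <= s <= t) (at_point a) (at_left t) _ _ g
  (fun x => M * x) (fun _ => M) (M * a) (M * t)
  ltac:(move=> x y z ? ? ?; lra) ltac:(rewrite /at_point; lra)
  ltac:(exists (mkposreal _ hd) => x hx hxt; have h1 : Rabs (x - t) < t - a := hx; have h2 : x < t := hxt;
    move: h1; rewrite Rabs_left; lra)
  hg hder (fun x _ => continuous_const M x) hm
  ltac:(move=> P hP; exact: (locally_singleton _ _ (hlim a P hP)))
  ltac:(move=> P hP; have [e he] := hlim t P hP; exists e => x hx _; exact: he).
have e : v = RInt g a t.
  apply: norm_minus_eq0; have := hvn a t ltac:(lra) ltac:(lra).
  by rewrite !Rminus_diag_eq // Rabs_R0 Rplus_0_r.
by rewrite -e.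
Qed.

Lemma is_RInt_gen_at_right (V : Banach) (g : R -> V) (t T : R) : t < T ->
  (forall s, t <= s <= T -> continuous g s) -> is_RInt_gen g (at_right t) (at_point T) (RInt g t T).
Proof.
move=> htT hg.
have h := @is_RInt_gen_at_left V (fun s => g (t + T - s)) t T htT
  ltac:(move=> s hs; apply: (continuous_comp (fun s => t + T - s) g);
    [apply: (@continuous_minus _ R_AbsRing R_NormedModule); [exact: continuous_const | exact: continuous_id]
    | apply: hg; lra]).
apply/is_RInt_gen_shift.
move/is_RInt_gen_reflect: h.
have -> : RInt (fun s => g (t + T - s)) t T = RInt g t T.
  apply: is_RInt_unique.
  have hex : ex_RInt g t T.
    by apply: ex_RInt_continuous => s; rewrite Rmin_left ?Rmax_right; try lra; exact: hg.
  have := proj1 (is_RInt_reflect g (t + T) t T _) (RInt_correct _ _ _ hex).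
  have -> : t + T - T = t by ring.
  by have -> : t + T - t = T by ring.
by have -> : (fun r => g (t + T - (T - r))) = (fun r => g (t + r)) by
  apply: functional_extensionality => r; congr g; ring.
Qed.

Lemma sing_right_iff (V : Banach) (g gc : R -> V) (a t : R) (v : V) : a <= t ->
  (forall s, a <= s <= t -> g s = gc s) -> (forall s, continuous gc s) ->
  (is_RInt g a t v <-> is_RInt_sing_right g a t v).
Proof.
move=> hat hg hc.
have ext : forall w, is_RInt gc a t w <-> is_RInt g a t w.
  move=> w; split; apply: is_RInt_ext => s; rewrite Rmin_left ?Rmax_right // => hs; [symmetry|]; apply: hg; lra.
have hex : ex_RInt gc a t by apply: ex_RInt_continuous => s _; exact: hc.
case: (Rle_lt_or_eq_dec _ _ hat) => h0; last first.
  rewrite -h0; split.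
  - move=> h; left; split=> //.
    by rewrite -(is_RInt_unique _ _ _ _ h) RInt_point.
  - by move=> [[_ ->]|[h1 _]]; [exact: is_RInt_point | lra].
have hgen : is_RInt_gen g (at_point a) (at_left t) (RInt gc a t).
  refine (is_RInt_gen_ext gc g _ _ (@is_RInt_gen_at_left V gc a t h0 (fun s _ => hc s))).
  apply: (Filter_prod _ _ _ (fun x => x = a) (fun x => a < x < t)) => //.
  - have hd : 0 < t - a by lra.
    exists (mkposreal _ hd) => x hx hxt; have h1 : Rabs (x - t) < t - a := hx; have h2 : x < t := hxt.
    by move: h1; rewrite Rabs_left; lra.
  - move=> x y -> hy s /=; rewrite Rmin_left ?Rmax_right; try lra.
    by move=> hs; symmetry; apply: hg; lra.
split.
- move=> h; right; split=> //.
  by have <- : RInt gc a t = v by apply: is_RInt_unique; apply/ext.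
- move=> [[h1 _]|[_ h]]; first lra.
  have <- : RInt gc a t = v.
    by rewrite -(is_RInt_gen_unique _ _ hgen); exact (is_RInt_gen_unique g v h).
  by apply/ext; exact: RInt_correct.
Qed.

Lemma sing_left_iff (V : Banach) (g gc : R -> V) (t T : R) (v : V) : t <= T ->
  (forall s, t <= s <= T -> g s = gc s) -> (forall s, continuous gc s) ->
  (is_RInt g t T v <-> is_RInt_sing_left g t T v).
Proof.
move=> hat hg hc.
have ext : forall w, is_RInt gc t T w <-> is_RInt g t T w.
  move=> w; split; apply: is_RInt_ext => s; rewrite Rmin_left ?Rmax_right // => hs; [symmetry|]; apply: hg; lra.
have hex : ex_RInt gc t T by apply: ex_RInt_continuous => s _; exact: hc.
case: (Rle_lt_or_eq_dec _ _ hat) => h0; last first.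
  rewrite -h0; split.
  - move=> h; left; split=> //.
    by rewrite -(is_RInt_unique _ _ _ _ h) RInt_point.
  - by move=> [[_ ->]|[h1 _]]; [exact: is_RInt_point | lra].
have hgen : is_RInt_gen g (at_right t) (at_point T) (RInt gc t T).
  refine (is_RInt_gen_ext gc g _ _ (@is_RInt_gen_at_right V gc t T h0 (fun s _ => hc s))).
  apply: (Filter_prod _ _ _ (fun x => t < x < T) (fun x => x = T)) => //.
  - have hd : 0 < T - t by lra.
    exists (mkposreal _ hd) => x hx hxt; have h1 : Rabs (x - t) < T - t := hx; have h2 : t < x := hxt.
    by move: h1; rewrite Rabs_pos_eq; lra.
  - move=> x y hy -> s /=; rewrite Rmin_left ?Rmax_right; try lra.
    by move=> hs; symmetry; apply: hg; lra.
split.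
- move=> h; right; split=> //.
  by have <- : RInt gc t T = v by apply: is_RInt_unique; apply/ext.
- move=> [[h1 _]|[_ h]]; first lra.
  have <- : RInt gc t T = v.
    by rewrite -(is_RInt_gen_unique _ _ hgen); exact (is_RInt_gen_unique g v h).
  by apply/ext; exact: RInt_correct.
Qed.

(** [phi] will be a time truncated at 0. Joint continuity comes from strong continuity and the bound
    of the semigroup on bounded intervals. *)
Lemma semigroup_comp_continuous (B : Banach) (S : R -> B -> B) (phi : R -> R) (c : R -> B) (s : R) :
  C0_semigroup S -> (forall s, 0 <= phi s) -> (forall s s', Rabs (phi s - phi s') <= Rabs (s - s')) ->
  (forall s, continuous c s) -> continuous (fun s => S (phi s) (c s)) s.
Proof.
move=> hS h0 hlip hc; apply/continuous_normP => eps he.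
have [M [hM hMb]] := sg_bound hS (phi s + 1).
have [d1 [hd1 h1]] := sg_cont hS (c s) (h0 s) (eps := eps / 2) ltac:(lra).
have [d2 [hd2 h2]] := proj1 (continuous_normP _ _) (hc s) (eps / (2 * M)) ltac:(apply: Rdiv_lt_0_compat; lra).
exists (Rmin (Rmin d1 d2) 1); split; first by apply: Rmin_pos; [exact: Rmin_pos | lra].
move=> s' hs'.
have l1 := Rmin_l d1 d2; have l2 := Rmin_r d1 d2; have l3 := Rmin_l (Rmin d1 d2) 1; have l4 := Rmin_r (Rmin d1 d2) 1.
have hp := hlip s' s.
have hps : phi s' <= phi s + 1 by have := Rle_abs (phi s' - phi s); lra.
have t1 := norm_minus_trans (S (phi s') (c s')) (S (phi s') (c s)) (S (phi s) (c s)).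
have t2 := h1 (phi s') (h0 s') ltac:(lra).
have t3 : norm (minus (S (phi s') (c s')) (S (phi s') (c s))) <= M * (eps / (2 * M)).
  rewrite -(linear_minus _ _ _ (sg_linear hS (h0 s'))).
  apply: Rle_trans (hMb _ _ (conj (h0 s') hps)) _.
  apply: Rmult_le_compat_l; first lra.
  by left; apply: h2; lra.
have e : M * (eps / (2 * M)) = eps / 2 by field; lra.
rewrite e in t3; lran.
Qed.

Lemma mild_iff_kernel (B B1 Bb B1b : Banach) (i1 : B1 -> B) (i1b : B1b -> Bb)
    (S : R -> B -> B) (Sb : R -> Bb -> Bb)
    (h : (R -> B1) -> (R -> B1b) -> R -> B) (hb : (R -> B1) -> (R -> B1b) -> R -> Bb)
    (a T : R) (Y : B1) (Z : B1b) (b : R -> B1) (f : R -> B1b) :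
  C0_semigroup S -> C0_semigroup Sb -> a < T ->
  (forall b f, Ccurve a T b -> Ccurve a T f -> Ccurve a T (h b f) /\ Ccurve a T (hb b f)) ->
  (mild_solution i1 i1b S Sb h hb a T Y Z b f <->
   kernel_solution i1 i1b (fun t => S t (i1 Y)) S (fun t => Sb t (i1b Z)) Sb 1 h hb a T b f).
Proof.
move=> hS hSb haT hh.
have hmax (x y : R) : Rabs (Rmax 0 x - Rmax 0 y) <= Rabs (x - y).
  by rewrite /Rmax /Rabs; do 4 (try case: Rle_dec; try case: Rcase_abs); lra.
have key t : Ccurve a T b -> Ccurve a T f -> a <= t <= T ->
   (forall v, is_RInt (fun s => S (t - s) (h b f s)) a t v <-> is_RInt_sing_right (fun s => S (t - s) (h b f s)) a t v) /\
   (forall v, is_RInt (fun s => Sb (s - t) (hb b f s)) t T v <-> is_RInt_sing_left (fun s => Sb (s - t) (hb b f s)) t T v).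
  move=> hb1 hf1 ht; have [c1 c2] := hh b f hb1 hf1.
  have k1 := Ccurve_clamp (Rlt_le _ _ haT) c1; have k2 := Ccurve_clamp (Rlt_le _ _ haT) c2.
  split=> v.
  - apply: (sing_right_iff (gc := fun s => S (Rmax 0 (t - s)) (h b f (clamp a T s)))); first lra.
    + by move=> s hs; rewrite clamp_id ?Rmax_right //; lra.
    + move=> s; apply: (semigroup_comp_continuous (phi := fun s => Rmax 0 (t - s)) hS) => //.
      * by move=> s'; exact: Rmax_l.
      * move=> s1 s2; apply: Rle_trans (hmax _ _) _; right.
        by have -> : t - s1 - (t - s2) = - (s1 - s2) by [ring]; rewrite Rabs_Ropp.
  - apply: (sing_left_iff (gc := fun s => Sb (Rmax 0 (s - t)) (hb b f (clamp a T s)))); first lra.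
    + by move=> s hs; rewrite clamp_id ?Rmax_right //; lra.
    + move=> s; apply: (semigroup_comp_continuous (phi := fun s => Rmax 0 (s - t)) hSb) => //.
      * by move=> s'; exact: Rmax_l.
      * move=> s1 s2; apply: Rle_trans (hmax _ _) _; right.
        by have -> : s1 - t - (s2 - t) = s1 - s2 by ring.
have one (V : NormedModule R_AbsRing) (v : V) : scal (1 : R) v = v by exact: scal_one.
split=> -[hb1 [hf1 hsol]]; split=> //; split=> // t ht; have [k1 k2] := key t hb1 hf1 ht;
  have [[v [hv e1]] [v' [hv' e2]]] := hsol t ht; split.
- by exists v; split; [apply/k1 | rewrite one].
- by exists v'; split; [apply/k2 | rewrite one].
- by exists v; split; [apply/k1 | rewrite one in e1].
- by exists v'; split; [apply/k2 | rewrite one in e2].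
Qed.

Lemma unique_on_iff (B1 B1b : Banach) (a T : R) (P Q : (R -> B1) -> (R -> B1b) -> Prop) :
  (forall b f, P b f <-> Q b f) -> unique_on a T Q -> unique_on a T P.
Proof.
move=> h [[b [f hbf]] hu]; split; first by exists b, f; apply/h.
by move=> b1 f1 b2 f2 /h h1 /h h2; exact: hu.
Qed.

(** Since [a,T] is nonempty the least upper bound is finite, so [real] does not return its default
    value 0. *)
Lemma Cdist_le (B : Banach) (a T d : R) (c c' : R -> B) : a <= T ->
  (forall s, a <= s <= T -> norm (minus (c s) (c' s)) <= d) -> Cdist a T c c' <= d.
Proof.
move=> haT h; rewrite /Cdist.
set E := fun r => _.
have [h1 h2] := Lub_Rbar_correct E.
have hle : Rbar_le (Lub_Rbar E) d by apply: h2 => r [s [hs ->]]; exact: h.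
have hge : Rbar_le (norm (minus (c a) (c' a))) (Lub_Rbar E) by apply: h1; exists a; split=> //; lra.
by move: hle hge; case: (Lub_Rbar E).
Qed.

Lemma continuous_metric (U : UniformSpace) (V : NormedModule R_AbsRing) (f : U -> V) (x : U) :
  continuous f x -> forall eps, 0 < eps -> exists delta : posreal,
    forall x', ball x delta x' -> norm (minus (f x') (f x)) < eps.
Proof.
move=> hf eps he.
have [d hd] : locally x (fun x' => norm (minus (f x') (f x)) < eps).
  by exact (proj1 (@filterlim_normP U V (locally x) _ f (f x)) hf eps he).
by exists d.
Qed.

Lemma linear_Ccurve (B C : Banach) (l : B -> C) (a T : R) (b : R -> B) :
  is_linear l -> Ccurve a T b -> Ccurve a T (fun r => l (b r)).
Proof. by move=> hl hb t ht; apply: filterlim_comp (hb t ht) _; exact: linear_cont. Qed.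

(** * The nonlinear terms in the graph norm *)

Section GraphNorm.
Context (n : nat) (B B1 : Banach) (i1 : B1 -> B) (D : 'I_n -> B1 -> B).
Context (hi1 : is_linear i1) (hD : forall j, is_linear (D j)).
Context (hnorm : forall b, norm b = norm (i1 b) + sum_ord (fun j => norm (D j b))).

Lemma graph_norm_minus (b b' : B1) :
  norm (minus (i1 b) (i1 b')) + sum_ord (fun j => norm (minus (D j b) (D j b'))) = norm (minus b b').
Proof.
rewrite (hnorm (minus b b')) (linear_minus _ _ _ hi1); congr (_ + _).
by congr sum_ord; apply: functional_extensionality => j; rewrite (linear_minus _ _ _ (hD j)).
Qed.

Lemma graph_component_le (b b' : B1) : norm (minus (i1 b) (i1 b')) <= norm (minus b b') /\
  forall j, norm (minus (D j b) (D j b')) <= norm (minus b b').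
Proof.
have e := graph_norm_minus b b'; have h1 := norm_ge_0 (minus (i1 b) (i1 b')).
have h2 j := @sum_ord_elem n (fun j => norm (minus (D j b) (D j b'))) j (fun j => norm_ge_0 _).
have h3 := @sum_ord_ge0 n (fun j => norm (minus (D j b) (D j b'))) (fun j => norm_ge_0 _).
by split=> [|j]; [lran | have := h2 j; lran].
Qed.

Lemma graph_sum_le b : 0 <= sum_ord (fun j => norm (D j b)) <= norm b.
Proof.
rewrite (hnorm b); have := norm_ge_0 (i1 b).
have := @sum_ord_ge0 n (fun j => norm (D j b)) (fun j => norm_ge_0 _); lra.
Qed.

End GraphNorm.

Section Nonlinear.
Context (n : nat) (B B1 Bb B1b Bcon : Banach) (i1 : B1 -> B) (i1b : B1b -> Bb).
Context (D : 'I_n -> B1 -> B) (Db : 'I_n -> B1b -> Bb).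
Context (hi1 : is_linear i1) (hi1b : is_linear i1b).
Context (hD : forall j, is_linear (D j)) (hDb : forall j, is_linear (Db j)).
Context (hnorm : forall b, norm b = norm (i1 b) + sum_ord (fun j => norm (D j b))).
Context (hnormb : forall f, norm f = norm (i1b f) + sum_ord (fun j => norm (Db j f))).
Context (H : R -> B -> ('I_n -> B) -> Bcon -> B) (L_H L_H' L_par : R).
Context (H_cont : forall z : R * B * ('I_n -> B) * Bcon,
     continuous (fun w : R * B * ('I_n -> B) * Bcon => H w.1.1.1 w.1.1.2 w.1.2 w.2) z).
Context (H_lip : forall t b0 bs b0' bs' v,
     norm (minus (H t b0 bs v) (H t b0' bs' v)) <=
       L_H * (norm (minus b0 b0') + sum_ord (fun j => norm (minus (bs j) (bs' j))))
           * (1 + L_H' * sum_ord (fun j => norm (bs j)))).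
Context (H_par : forall t b0 bs v v',
     norm (minus (H t b0 bs v) (H t b0 bs v')) <=
       L_par * norm (minus v v') * (1 + sum_ord (fun j => norm (bs j)))).
Context (H_bound : forall t b0 bs v,
     norm (H t b0 bs v) <= L_H * sum_ord (fun j => norm (bs j))).
Context (Hb : forall T : R, R -> Bb -> ('I_n -> Bb) -> (R -> B) -> Bb) (L_Hb L_Hb' a : R).
Context (Hb_cont : forall T, a < T -> continuous_with_curve a T (Hb T)).
Context (Hb_lip : forall T t f0 fs f0' fs' c, a < T -> Ccurve a T c ->
     norm (minus (Hb T t f0 fs c) (Hb T t f0' fs' c)) <=
       L_Hb * (norm (minus f0 f0') + sum_ord (fun j => norm (minus (fs j) (fs' j))))
            * (1 + L_Hb' * sum_ord (fun j => norm (fs j)))).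
Context (Hb_par : forall T t f0 fs c c', a < T -> Ccurve a T c -> Ccurve a T c' ->
     norm (minus (Hb T t f0 fs c) (Hb T t f0 fs c')) <=
       L_Hb * Cdist a T c c' * (1 + (norm f0 + sum_ord (fun j => norm (fs j))))).
Context (Hb_bound : forall T t f0 fs c, a < T -> Ccurve a T c ->
     norm (Hb T t f0 fs c) <= L_Hb * sum_ord (fun j => norm (fs j))).
Context (u : R -> Bb -> ('I_n -> Bb) -> Bcon) (L_u : R).
Context (u_cont : forall z : R * Bb * ('I_n -> Bb),
     continuous (fun w : R * Bb * ('I_n -> Bb) => u w.1.1 w.1.2 w.2) z).
Context (u_lip : forall t f0 fs f0' fs',
     norm (minus (u t f0 fs) (u t f0' fs')) <=
       L_u * (norm (minus f0 f0') + sum_ord (fun j => norm (minus (fs j) (fs' j))))).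

Let h := H_along i1 D i1b Db H u.
Let hb T := Hb_along i1 i1b Db (Hb T).

Let norm_minus_split := graph_norm_minus hi1 hD hnorm.
Let norm_minus_splitb := graph_norm_minus hi1b hDb hnormb.
Let component_le := graph_component_le hi1 hD hnorm.
Let component_leb := graph_component_le hi1b hDb hnormb.
Let sum_D_le := graph_sum_le hnorm.
Let sum_Db_le := graph_sum_le hnormb.

Lemma control_Ccurve T f : Ccurve a T f -> Ccurve a T (fun s => u s (i1b (f s)) (fun j => Db j (f s))).
Proof.
move=> hf; apply/CcurveP => t ht eps he.
have [d hd] := continuous_metric (@u_cont (t, i1b (f t), fun j => Db j (f t))) he.
have [e [he0 hfe]] := proj1 (CcurveP _ _ _) hf t ht d (cond_pos d).
exists (Rmin d e); split; first by apply: Rmin_pos => //; exact: cond_pos.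
move=> t' ht' hlt.
have l1 := Rmin_l d e; have l2 := Rmin_r d e.
have h1 := hfe t' ht' ltac:(lra).
have [c1 c2] := component_leb (f t') (f t).
apply: (hd (t', i1b (f t'), fun j => Db j (f t'))).
split; [split |] => /=.
- by change (Rabs (t' - t) < d); lra.
- by apply: norm_compat1; lran.
- by move=> j; apply: norm_compat1; have := c2 j; lran.
Qed.

Lemma nonlinear_Ccurve T b f : a < T -> Ccurve a T b -> Ccurve a T f ->
  Ccurve a T (h b f) /\ Ccurve a T (hb T b f).
Proof.
move=> haT hb1 hf1; split; apply/CcurveP => t ht eps he.
- have hu1 := control_Ccurve hf1.
  have [d hd] := continuous_metric (@H_cont (t, i1 (b t), (fun j => D j (b t)), u t (i1b (f t)) (fun j => Db j (f t)))) he.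
  have [e1 [he1 hbe]] := proj1 (CcurveP _ _ _) hb1 t ht d (cond_pos d).
  have [e2 [he2 hue]] := proj1 (CcurveP _ _ _) hu1 t ht d (cond_pos d).
  exists (Rmin d (Rmin e1 e2)); split; first by apply: Rmin_pos; [exact: cond_pos | exact: Rmin_pos].
  move=> t' ht' hlt.
  have l1 := Rmin_l d (Rmin e1 e2); have l2 := Rmin_r d (Rmin e1 e2).
  have l3 := Rmin_l e1 e2; have l4 := Rmin_r e1 e2.
  have k1 := hbe t' ht' ltac:(lra); have k2 := hue t' ht' ltac:(lra).
  have [c1 c2] := component_le (b t') (b t).
  apply: (hd (t', i1 (b t'), (fun j => D j (b t')), u t' (i1b (f t')) (fun j => Db j (f t')))).
  split; [split; [split |] |] => /=.
  + by change (Rabs (t' - t) < d); lra.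
  + by apply: norm_compat1; lran.
  + by move=> j; apply: norm_compat1; have := c2 j; lran.
  + by apply: norm_compat1.
- have hib := linear_Ccurve hi1 hb1.
  have [d [hd0 hd]] := @Hb_cont T haT t (i1b (f t)) (fun j => Db j (f t)) (fun r => i1 (b r)) hib eps he.
  have [e [he0 hfe]] := proj1 (CcurveP _ _ _) hf1 t ht d hd0.
  exists (Rmin d e); split; first exact: Rmin_pos.
  move=> t' ht' hlt.
  have l1 := Rmin_l d e; have l2 := Rmin_r d e.
  have h1 := hfe t' ht' ltac:(lra).
  have [c1 c2] := component_leb (f t') (f t).
  apply: hd => //.
  + lra.
  + lran.
  + by move=> j; have := c2 j; lran.
  (* Only the time and the value of [f] vary along the curve; the functional argument stays the
     whole of [b], at distance 0 from itself. *)
  + apply: (Rle_lt_trans _ 0) => //.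
    by apply: Cdist_le => [|s hs]; [lra | rewrite minus_eq_zero norm_zero; lra].
Qed.

Lemma nonlinear_growth T b f s : a < T -> Ccurve a T b -> Ccurve a T f -> a <= s <= T ->
  norm (h b f s) <= (Rabs L_H + Rabs L_Hb) * norm (b s) /\
  norm (hb T b f s) <= (Rabs L_H + Rabs L_Hb) * norm (f s).
Proof.
move=> haT hb1 hf1 hs.
have p1 := Rabs_pos L_H; have p2 := Rabs_pos L_Hb; have q1 := Rle_abs L_H; have q2 := Rle_abs L_Hb.
split.
- apply: Rle_trans (@H_bound _ _ _ _) _; have := sum_D_le (b s); nra.
- apply: Rle_trans (@Hb_bound _ _ _ _ _ haT (linear_Ccurve hi1 hb1)) _; have := sum_Db_le (f s); nra.
Qed.

(** The Lipschitz factors grow with the arguments and are bounded only once the radius is fixed.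
    [C1] adds the direct dependence on [b] and the dependence on [f] through the control [u]; [C2]
    adds those on [f] and on the curve [b]. Neither involves [T]. *)
Lemma nonlinear_lipschitz Rad : exists LamR, 0 <= LamR /\ forall T b f b' f' d, a < T ->
  ball_curves a T Rad b f -> ball_curves a T Rad b' f' ->
  (forall t, a <= t <= T -> norm (minus (b t) (b' t)) <= d /\ norm (minus (f t) (f' t)) <= d) ->
  forall s, a <= s <= T -> norm (minus (h b f s) (h b' f' s)) <= LamR * d /\
                           norm (minus (hb T b f s) (hb T b' f' s)) <= LamR * d.
Proof.
pose C1 := Rabs L_H * (1 + Rabs L_H' * Rabs Rad) + Rabs L_par * Rabs L_u * (1 + Rabs Rad).
pose C2 := Rabs L_Hb * (1 + Rabs L_Hb' * Rabs Rad) + Rabs L_Hb * (1 + Rabs Rad).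
have aR := Rabs_pos Rad.
have a1 := Rabs_pos L_H; have a2 := Rabs_pos L_H'; have a3 := Rabs_pos L_par; have a4 := Rabs_pos L_u.
have a5 := Rabs_pos L_Hb; have a6 := Rabs_pos L_Hb'.
have b1 := Rmult_le_pos _ _ a2 aR; have b2 := Rmult_le_pos _ _ a6 aR.
have hC1 : 0 <= C1.
  by apply: Rplus_le_le_0_compat; apply: Rmult_le_pos; try lra; exact: Rmult_le_pos.
have hC2 : 0 <= C2 by apply: Rplus_le_le_0_compat; apply: Rmult_le_pos; lra.
(* The Lipschitz constants may be negative. *)
have prod (L L' x z X Z : R) : 0 <= x <= X -> 0 <= z <= Z -> L * x * (1 + L' * z) <= Rabs L * X * (1 + Rabs L' * Z).
  move=> hx hz; have := Rabs_pos L; have := Rabs_pos L' => p1 p2.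
  apply: Rle_trans (Rle_abs _) _; rewrite !Rabs_mult (Rabs_pos_eq x); last lra.
  apply: Rmult_le_compat; [apply: Rmult_le_pos; lra | exact: Rabs_pos | apply: Rmult_le_compat_l; lra |].
  apply: Rle_trans (Rabs_triang _ _) _; rewrite Rabs_R1 Rabs_mult (Rabs_pos_eq z); last lra.
  have := Rmult_le_compat_l _ _ _ p1 (proj2 hz); lra.
exists (C1 + C2); split; first lra.
move=> T b f b' f' d haT [cb [cf hbf]] [cb' [cf' hbf']] hd s hs.
have [d1 d2] := hd s hs; have [r1 r2] := hbf s hs; have [r1' r2'] := hbf' s hs.
have hRad := Rle_abs Rad.
have hd0 : 0 <= d by apply: Rle_trans (norm_ge_0 _) d1.
have nb := norm_ge_0 (minus (b s) (b' s)); have nf := norm_ge_0 (minus (f s) (f' s)).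
split.
- rewrite /h /H_along.
  set us := u s (i1b (f s)) _; set us' := u s (i1b (f' s)) _.
  have t1 := norm_minus_trans (H s (i1 (b s)) (fun j => D j (b s)) us) (H s (i1 (b' s)) (fun j => D j (b' s)) us)
    (H s (i1 (b' s)) (fun j => D j (b' s)) us').
  have t2 := @H_lip s (i1 (b s)) (fun j => D j (b s)) (i1 (b' s)) (fun j => D j (b' s)) us.
  have t3 := @H_par s (i1 (b' s)) (fun j => D j (b' s)) us us'.
  have t4 := @u_lip s (i1b (f s)) (fun j => Db j (f s)) (i1b (f' s)) (fun j => Db j (f' s)).
  rewrite norm_minus_split in t2; rewrite norm_minus_splitb -/us -/us' in t4.
  have s1 := sum_D_le (b s); have s2 := sum_D_le (b' s).
  have p1 : norm (minus (H s (i1 (b s)) (fun j => D j (b s)) us) (H s (i1 (b' s)) (fun j => D j (b' s)) us))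
      <= Rabs L_H * d * (1 + Rabs L_H' * Rabs Rad).
    by apply: Rle_trans t2 (prod _ _ _ _ _ _ _ _); lra.
  have nu := norm_ge_0 (minus us us').
  have p2 : norm (minus us us') <= Rabs L_u * d.
    apply: Rle_trans t4 _; apply: (Rle_trans _ (Rabs L_u * norm (minus (f s) (f' s)))).
      by apply: Rmult_le_compat_r => //; exact: Rle_abs.
    by apply: Rmult_le_compat_l.
  have p3 : norm (minus (H s (i1 (b' s)) (fun j => D j (b' s)) us) (H s (i1 (b' s)) (fun j => D j (b' s)) us'))
      <= Rabs L_par * (Rabs L_u * d) * (1 + Rabs Rad).
    apply: Rle_trans t3 _.
    have := @prod L_par 1 (norm (minus us us')) (sum_ord (fun j => norm (D j (b' s)))) (Rabs L_u * d) (Rabs Rad)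
      ltac:(lra) ltac:(lra).
    by rewrite Rabs_R1 !Rmult_1_l.
  have : 0 <= C2 * d by exact: Rmult_le_pos.
  rewrite /C1; lran.
- rewrite /hb /Hb_along.
  set c := fun r => i1 (b r); set c' := fun r => i1 (b' r).
  have hc : Ccurve a T c := linear_Ccurve hi1 cb; have hc' : Ccurve a T c' := linear_Ccurve hi1 cb'.
  have t1 := norm_minus_trans (Hb T s (i1b (f s)) (fun j => Db j (f s)) c) (Hb T s (i1b (f' s)) (fun j => Db j (f' s)) c)
    (Hb T s (i1b (f' s)) (fun j => Db j (f' s)) c').
  have t2 := @Hb_lip T s (i1b (f s)) (fun j => Db j (f s)) (i1b (f' s)) (fun j => Db j (f' s)) c haT hc.
  have t3 := @Hb_par T s (i1b (f' s)) (fun j => Db j (f' s)) c c' haT hc hc'.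
  rewrite norm_minus_splitb in t2; rewrite -hnormb in t3.
  have s1 := sum_Db_le (f s).
  have p1 : norm (minus (Hb T s (i1b (f s)) (fun j => Db j (f s)) c) (Hb T s (i1b (f' s)) (fun j => Db j (f' s)) c))
      <= Rabs L_Hb * d * (1 + Rabs L_Hb' * Rabs Rad).
    by apply: Rle_trans t2 (prod _ _ _ _ _ _ _ _); lra.
  have cd : Cdist a T c c' <= d.
    apply: Cdist_le => [|r hr]; first lra.
    apply: Rle_trans (proj1 (component_le (b r) (b' r))) _; exact: (proj1 (hd r hr)).
  have cd0 : 0 <= Cdist a T c c'.
    have hE := @Cdist_le B a T d c c' ltac:(lra) ltac:(move=> r hr;
      apply: Rle_trans (proj1 (component_le (b r) (b' r))) _; exact: (proj1 (hd r hr))).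
    rewrite /Cdist; set E := fun r => _.
    have [u1 u2] := Lub_Rbar_correct E.
    have hle : Rbar_le (Lub_Rbar E) d.
      apply: u2 => r [r0 [hr0 ->]].
      apply: Rle_trans (proj1 (component_le (b r0) (b' r0))) _; exact: (proj1 (hd r0 hr0)).
    have hge : Rbar_le (norm (minus (c a) (c' a))) (Lub_Rbar E) by apply: u1; exists a; split=> //; lra.
    have := norm_ge_0 (minus (c a) (c' a)).
    by move: hle hge; case: (Lub_Rbar E) => //= r h1 h2 h3; exact: Rle_trans h3 h2.
  have p3 : norm (minus (Hb T s (i1b (f' s)) (fun j => Db j (f' s)) c) (Hb T s (i1b (f' s)) (fun j => Db j (f' s)) c'))
      <= Rabs L_Hb * d * (1 + Rabs Rad).
    apply: Rle_trans t3 _.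
    have nf' := norm_ge_0 (f' s).
    have := @prod L_Hb 1 (Cdist a T c c') (norm (f' s)) d (Rabs Rad) ltac:(lra) ltac:(lra).
    by rewrite Rabs_R1 !Rmult_1_l.
  have : 0 <= C1 * d by exact: Rmult_le_pos.
  rewrite /C2; lran.
Qed.

End Nonlinear.

(** [Lm] is chosen before the initial value, so one interval serves the kernel and the free
    evolution alike. *)
Lemma fractional_propagators (be : R) (B B1 : Banach) (i1 : B1 -> B) (S : R -> B -> B) (K w om : R) :
  0 < be < 1 -> is_linear i1 -> (forall x y, i1 x = i1 y -> x = y) -> smoothing_semigroup i1 S K w om ->
  exists U1 K' om' Lm, 0 < Lm /\ smoothing_kernel i1 (frac_U be S) U1 K' om' Lm /\
    forall b, exists V1, (forall L, 0 <= L <= Lm -> Ccurve 0 L V1) /\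
      forall t, 0 <= t <= Lm -> i1 (V1 t) = ML be S (pow0 t be) (i1 b).
Proof.
move=> hbe hi1 hinj hs.
have [taum [Q [htaum [hQ hmaj]]]] := ml_majorants hbe hs.
exists (frac_U1 be i1 S), (/ be * (2 * K * Q)), (1 - be + be * om), (Rpower taum (/ be)).
split; first exact: Rpower_pos.
split; first exact (frac_kernel hbe hi1 hinj hs htaum hQ hmaj).
move=> b; exists (fun t => scal (/ be) (ml_lift be i1 S (pow0 t be) b)); split.
- by move=> L hL; exact (frac_curve hbe hi1 hinj hs htaum hQ hmaj (b := b) hL).
- by move=> t ht; exact (ml_lift_i1 hbe hi1 hinj hs hQ hmaj b (pow0_range hbe htaum ht)).
Qed.

Theorem theorem8p2
  (beta a : R) (hbeta : 0 < beta < 1)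
  (n : nat)
  (B B1 B2 Bb B1b B2b Bcon : Banach)
  (i1 : B1 -> B) (i2 : B2 -> B1) (i1b : B1b -> Bb) (i2b : B2b -> B1b)
  (D : 'I_n -> B1 -> B) (Db : 'I_n -> B1b -> Bb)
  (p : B -> Bb -> R)
  (htriple : banach_triple i1 i2) (htripleb : banach_triple i1b i2b)
  (hgen : generated_by i1 i2 D) (hgenb : generated_by i1b i2b Db)
  (hdual : dual_triples i1 D i1b Db p)
  (A : B2 -> B) (Ab : B2b -> Bb)
  (hA : is_linear A) (hAb : is_linear Ab)
  (hAdual : forall b f, p (A b) (i1b (i2b f)) = p (i1 (i2 b)) (Ab f))
  (S : R -> B -> B) (Sb : R -> Bb -> Bb)
  (hS : generates (fun b => i1 (i2 b)) A S)
  (hSb : generates (fun f => i1b (i2b f)) Ab Sb)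
  (hcore : core_in i1 S) (hcoreb : core_in i1b Sb)
  (hsmooth : smoothing_right i1 S \/ smoothing_left i1 D S)
  (hcomm : commutators_bounded i1 D S)
  (H : R -> B -> ('I_n -> B) -> Bcon -> B)
  (L_H L_H' L_par : R)
  (H_cont : forall z : R * B * ('I_n -> B) * Bcon,
     continuous (fun w : R * B * ('I_n -> B) * Bcon =>
       H w.1.1.1 w.1.1.2 w.1.2 w.2) z)
  (H_lip : forall t b0 bs b0' bs' v,
     norm (minus (H t b0 bs v) (H t b0' bs' v)) <=
       L_H * (norm (minus b0 b0') + sum_ord (fun j => norm (minus (bs j) (bs' j))))
           * (1 + L_H' * sum_ord (fun j => norm (bs j))))
  (H_par : forall t b0 bs v v',
     norm (minus (H t b0 bs v) (H t b0 bs v')) <=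
       L_par * norm (minus v v') * (1 + sum_ord (fun j => norm (bs j))))
  (H_bound : forall t b0 bs v,
     norm (H t b0 bs v) <= L_H * sum_ord (fun j => norm (bs j)))
  (Hb : forall T : R, R -> Bb -> ('I_n -> Bb) -> (R -> B) -> Bb)
  (L_Hb L_Hb' : R)
  (Hb_cont : forall T, a < T -> continuous_with_curve a T (Hb T))
  (Hb_future : forall T t f0 fs c c', a < T -> Ccurve a T c -> Ccurve a T c' ->
     (forall s, a <= s <= T -> t <= s -> c s = c' s) ->
     Hb T t f0 fs c = Hb T t f0 fs c')
  (Hb_lip : forall T t f0 fs f0' fs' c, a < T -> Ccurve a T c ->
     norm (minus (Hb T t f0 fs c) (Hb T t f0' fs' c)) <=
       L_Hb * (norm (minus f0 f0') + sum_ord (fun j => norm (minus (fs j) (fs' j))))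
            * (1 + L_Hb' * sum_ord (fun j => norm (fs j))))
  (Hb_par : forall T t f0 fs c c', a < T -> Ccurve a T c -> Ccurve a T c' ->
     norm (minus (Hb T t f0 fs c) (Hb T t f0 fs c')) <=
       L_Hb * Cdist a T c c' * (1 + (norm f0 + sum_ord (fun j => norm (fs j)))))
  (Hb_bound : forall T t f0 fs c, a < T -> Ccurve a T c ->
     norm (Hb T t f0 fs c) <= L_Hb * sum_ord (fun j => norm (fs j)))
  (u : R -> Bb -> ('I_n -> Bb) -> Bcon)
  (L_u : R)
  (u_cont : forall z : R * Bb * ('I_n -> Bb),
     continuous (fun w : R * Bb * ('I_n -> Bb) => u w.1.1 w.1.2 w.2) z)
  (u_lip : forall t f0 fs f0' fs',
     norm (minus (u t f0 fs) (u t f0' fs')) <=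
       L_u * (norm (minus f0 f0') + sum_ord (fun j => norm (minus (fs j) (fs' j))))) :
  forall (Y : B1) (Z : B1b),
  exists T0 : R, a < T0 /\
    forall T : R, a < T < T0 ->
      unique_on a T
        (mild_solution i1 i1b S Sb (H_along i1 D i1b Db H u)
           (Hb_along i1 i1b Db (Hb T)) a T Y Z) /\
      unique_on a T
        (fractional_mild_solution beta i1 i1b S Sb (H_along i1 D i1b Db H u)
           (Hb_along i1 i1b Db (Hb T)) a T Y Z).

Proof.
move=> Y Z.
have [om [K [w [Kb [wb [hs hsb]]]]]] :=
  dual_smoothing_semigroups htriple htripleb hgen hgenb hdual hA hAb hAdual hS hSb hsmooth hcomm.
have [hi1 [hinj _]] := proj1 htriple; have [hi1b [hinjb _]] := proj1 htripleb.
have hD := proj1 hgen; have hDb := proj1 hgenb.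
have [D' [_ [_ [hnorm _]]]] := proj2 hgen; have [Db' [_ [_ [hnormb _]]]] := proj2 hgenb.
pose h := fun _ : R => H_along i1 D i1b Db H u; pose hb := fun T : R => Hb_along i1 i1b Db (Hb T).
(* The estimates for H, H^b and u are fed in once; the two systems differ only in kernels, free
   evolutions and [gam]. *)
have wellposed := fun U U1 Ub U1b K1 om1 K1b om1b L0 L2 V V1 Vb V1b gam => fun hk hkb hL2 hL20 hV hVc hVb hVcb =>
  @kernel_wellposed B B1 Bb B1b i1 i1b U U1 K1 om1 Ub U1b K1b om1b L0 L2 hi1 hinj hi1b hinjb hk hkb V V1 Vb V1b gam
    hL2 hL20 hV hVc hVb hVcb a (Rabs L_H + Rabs L_Hb) h hb
    (fun T b f => @nonlinear_Ccurve n B B1 Bb B1b Bcon i1 i1b D Db hi1 hi1b hD hDb hnorm hnormb H H_cont Hb a Hb_cont u u_cont T b f)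
    (Rplus_le_le_0_compat _ _ (Rabs_pos L_H) (Rabs_pos L_Hb))
    (fun T b f s => @nonlinear_growth n B B1 Bb B1b Bcon i1 i1b D Db hi1 hnorm hnormb H L_H H_bound Hb L_Hb a Hb_bound u T b f s)
    (@nonlinear_lipschitz n B B1 Bb B1b Bcon i1 i1b D Db hi1 hi1b hD hDb hnorm hnormb H L_H L_H' L_par H_lip H_par
       Hb L_Hb L_Hb' a Hb_lip Hb_par u L_u u_lip).
(* The semigroup kernel is available on every bounded interval; 1 and 1/2 are arbitrary. *)
have [T1 [hT1 sol1]] := wellposed _ _ _ _ _ _ _ _ 1 (/ 2)
  (fun t => S t (i1 Y)) (fun t => lift i1 S t (i1 Y)) (fun t => Sb t (i1b Z)) (fun t => lift i1b Sb t (i1b Z)) 1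
  (semigroup_kernel hi1 hinj hs Rlt_0_1) (semigroup_kernel hi1b hinjb hsb Rlt_0_1) ltac:(lra) ltac:(lra)
  (fun t ht => proj1 (lift_restr_spec hinj hs Y (proj1 ht))) (@lift_Ccurve _ _ _ _ _ _ _ hi1 hinj hs Y (/ 2))
  (fun t ht => proj1 (lift_restr_spec hinjb hsb Z (proj1 ht))) (@lift_Ccurve _ _ _ _ _ _ _ hi1b hinjb hsb Z (/ 2)).
have [U1 [K1 [om1 [L [hL [hk hV]]]]]] := fractional_propagators hbeta hi1 hinj hs.
have [U1b [K1b [om1b [Lb [hLb [hkb hVb]]]]]] := fractional_propagators hbeta hi1b hinjb hsb.
have [V1 [hV1c hV1]] := hV Y; have [V1b [hV1bc hV1b]] := hVb Z.
have hL0 : 0 < Rmin L Lb by exact: Rmin_pos.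
have l1 := Rmin_l L Lb; have l2 := Rmin_r L Lb.
(* The two fractional kernels live on different intervals and are restricted to the shorter one. *)
have [T2 [hT2 sol2]] := wellposed _ _ _ _ _ _ _ _ (Rmin L Lb) (Rmin L Lb / 2)
  (fun t => ML beta S (pow0 t beta) (i1 Y)) V1 (fun t => ML beta Sb (pow0 t beta) (i1b Z)) V1b beta
  (smoothing_kernel_restrict l1 hk) (smoothing_kernel_restrict l2 hkb) ltac:(lra) ltac:(lra)
  (fun t ht => hV1 t ltac:(lra)) (hV1c (Rmin L Lb / 2) ltac:(lra))
  (fun t ht => hV1b t ltac:(lra)) (hV1bc (Rmin L Lb / 2) ltac:(lra)).
exists (Rmin T1 T2); split; first exact: Rmin_glb_lt.
move=> T hT; have m1 := Rmin_l T1 T2; have m2 := Rmin_r T1 T2.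
split.
- refine (unique_on_iff _ (sol1 T ltac:(lra))) => b f.
  apply: mild_iff_kernel; [exact: (proj1 hS) | exact: (proj1 hSb) | lra |] => b0 f0 hb0 hf0.
  exact (@nonlinear_Ccurve n B B1 Bb B1b Bcon i1 i1b D Db hi1 hi1b hD hDb hnorm hnormb H H_cont Hb a Hb_cont u u_cont T b0 f0
    ltac:(lra) hb0 hf0).
- exact (sol2 T ltac:(lra)).
Qed.
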